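(* Fix $\kappa_0>2$, $0<\delta<2$ and $0<\varepsilon\le\alpha<1$. Let $z_0=(x_0,t_0)\in\Gamma(u)\cap Q'_{1/2}$ and let $u\in\mathcal F_{z_0}$ satisfy the weighted almost parabolic Signorini property at $z_0$. For $0<\kappa<\kappa_0$ set $$W_{\kappa,\alpha,\varepsilon,\delta}(r,u,z_0):=\frac{e^{ar^\alpha}}{r^{2\kappa+2}}\left(\int_{S_r(t_0)}\left(2(t_0-t)|\nabla u|^2-\kappa(1-br^\varepsilon)u^2\right)G_{z_0}\,dx\,dt+\|u\|_{\mathcal F_{z_0}}^2e^{-\frac1r}r^{-\delta}\right),$$ where $a=\frac{8(\kappa+1)}{\alpha}$ and $b=\frac{128(\kappa_0+1)}{\varepsilon}$. Then there is $r_0=r_0(\kappa_0,\varepsilon)>0$ such that $W_{\kappa,\alpha,\varepsilon,\delta}(r,u,z_0)$ is nondecreasing in $r$ for $0<r<r_0$.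
   Context: Notation: $n\ge2$, $x=(x',x_n)\in\mathbb R^{n-1}\times\mathbb R$, $z_0=(x_0,t_0)$. $B_r(x_0)$ is the open ball in $\mathbb R^n$; $Q_r(z_0)=B_r(x_0)\times(t_0-r^2,t_0]$; $S_r(t_0)=\mathbb R^n\times(t_0-r^2,t_0]$, $S_0(t_0)=\emptyset$; a center equal to $0$ is omitted. A prime denotes intersection with the thin space: $\Omega'=\Omega\cap\{x_n=0\}$. $\nabla$ is the spatial gradient. The free boundary is $\Gamma(u)=\partial_{Q_1'}\{(x',t)\in Q_1':u(x',0,t)=0\}$ (boundary relative to $Q_1'$). Backward heat kernel: $G(x,t)=(-4\pi t)^{-n/2}e^{|x|^2/(4t)}$ for $t<0$, $G=0$ for $t\ge0$; $G_{z_0}=G(\cdot-x_0,\cdot-t_0)$. Function space: $u\in\mathcal F_{z_0}$ if the norm $$\|u\|_{\mathcal F_{z_0}}=\|u\|_{W^{1,1}_2(\mathbb R^n\times(-1,t_0),G_{z_0})}+\|u\|_{W^{1,1}_2(B_1\times(-1,t_0))}+\|u\|_{L^\infty(\mathbb R^n\times(-1,t_0))}$$ is finite, where $\|u\|^2_{W^{1,1}_2(D,G_{z_0})}=\int_D\left(u^2+(t_0-t)(|\nabla u|^2+(\partial_tu)^2)\right)G_{z_0}\,dx\,dt$ and $W^{1,1}_2(D)$ is the parabolic Sobolev space of $u$ with $u,\nabla u,\partial_tu\in L^2(D)$. Weighted almost parabolic Signorini property at $z_0\in Q_1'$ (zero thin obstacle, gauge function $\eta(r)=r^\alpha$, $0<\alpha<1$):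 $u\in\mathcal F_{z_0}$, $u\ge0$ on the thin space $\{x_n=0\}$, and for all $0\le\rho<r<1$ with $-1<t_0-r^2$, $$\int_{S_r(t_0)\setminus S_\rho(t_0)}\Big[(1-r^\alpha)(t_0-t)|\nabla u|^2+\big(-(x-x_0)\cdot\nabla u-2(t-t_0)\partial_tu\big)(u-w)\Big]G_{z_0}$$ $$\le(1+r^\alpha)\int_{S_r(t_0)\setminus S_\rho(t_0)}(t_0-t)|\nabla w|^2G_{z_0}+r^\alpha\int_{S_r(t_0)\setminus S_\rho(t_0)}(u-w)^2G_{z_0}+\|u\|^2_{\mathcal F_{z_0}}e^{-1/r}$$ for every $w\in L^2(t_0-r^2,t_0-\rho^2;W^{1,2}(\mathbb R^n,G_{z_0}))$ with $w\ge0$ on $S_r'(t_0)\setminus S'_\rho(t_0)$ and $u-w\in L^2(t_0-r^2,t_0-\rho^2;W^{1,2}_0(\mathbb R^n,G_{z_0}))$ (Sobolev spaces in $x$ with weight $G_{z_0}(\cdot,t)$). *)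

(* Defs.v *)
From HB Require Import structures.
From mathcomp Require Import all_boot all_order all_algebra.
From mathcomp Require Import all_classical all_reals all_analysis.

Set Implicit Arguments.
Unset Strict Implicit.
Unset Printing Implicit Defensive.

Import Order.TTheory GRing.Theory Num.Theory.
Import numFieldNormedType.Exports.
Local Open Scope classical_set_scope.
Local Open Scope ring_scope.

Definition rV_display : measure_display -> measure_display.
Proof. exact. Qed.

Section rV_measurable.
Context {d} {T : sigmaRingType d} (n : nat).

Let coord (i : 'I_n) (x : 'rV[T]_n) : T := x ord0 i.

Let rV_set0 : g_sigma_preimage coord set0.
Proof. exact: sigma_algebra0. Qed.

Let rV_setC A : g_sigma_preimage coord A -> g_sigma_preimage coord (~` A).
Proof. exact: sigma_algebraC. Qed.

Let rV_bigcup (F : _^nat) : (forall i, g_sigma_preimage coord (F i)) ->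
  g_sigma_preimage coord (\bigcup_i (F i)).
Proof. exact: sigma_algebra_bigcup. Qed.

HB.instance Definition _ := @isMeasurable.Build (rV_display d)
  'rV[T]_n (g_sigma_preimage coord) rV_set0 rV_setC rV_bigcup.

End rV_measurable.

Lemma measurable_coord d (T : sigmaRingType d) n (i : 'I_n) :
  measurable_fun [set: 'rV[T]_n] (fun x => x ord0 i).
Proof.
move=> _ Y mY; rewrite setTI; apply: sub_sigma_algebra => /=.
rewrite -bigcup_seq/=; exists i => /=; first by rewrite mem_index_enum.
by exists Y => //; rewrite setTI.
Qed.

Lemma measurable_fun_coord d1 d2 (T1 : measurableType d1)
    (T2 : measurableType d2) n (f : T1 -> 'rV[T2]_n) :
  (forall i, measurable_fun [set: T1] (fun x => f x ord0 i)) ->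
  measurable_fun [set: T1] f.
Proof.
move=> mf.
have sub : g_sigma_preimage (fun i x => f x ord0 i) `<=` measurable.
  apply: smallest_sub; first exact: sigma_algebra_measurable.
  case: n => [|n] in f mf *; first by rewrite big_ord0.
  rewrite -bigcup_mkord_ord; apply: bigcup_sub => i Ii.
  by move=> A [B mB <-]; exact: mf.
move=> _ A mA; apply: sub.
by rewrite (@g_sigma_preimage_comp _ _ _ _ (fun i (x : 'rV[T2]_n) => x ord0 i)); exists A.
Qed.

Section lebesgue_rV.
Variable R : realType.

(* the point (x', x_n) *)
Definition rsnoc n (p : 'rV[R]_n * R) : 'rV[R]_n.+1 :=
  \row_i (if unlift ord_max i is Some j then p.1 ord0 j else p.2).

Let rbelast n (x : 'rV[R]_n.+1) : 'rV[R]_n * R :=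
  (\row_j x ord0 (lift ord_max j), x ord0 ord_max).

Let rbelastK n (p : 'rV[R]_n * R) : rbelast (rsnoc p) = p.
Proof.
case: p => x a; rewrite /rbelast /rsnoc !mxE unlift_none; congr pair.
by apply/rowP => j; rewrite !mxE liftK.
Qed.

Lemma measurable_rsnoc n :
  measurable_fun [set: 'rV[R]_n * measurableTypeR R] (@rsnoc n).
Proof.
apply: measurable_fun_coord => i.
rewrite /rsnoc; under eq_fun do rewrite mxE.
case: unliftP => [j _|_]; last exact: measurable_snd.
exact: (measurableT_comp (measurable_coord j) measurable_fst).
Qed.

Let measurable_rbelast n :
  measurable_fun setT (@rbelast n : _ -> 'rV[R]_n * measurableTypeR R).
Proof.
apply: measurable_fun_pair; last exact: measurable_coord.
apply: measurable_fun_coord => i.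
under eq_fun do rewrite mxE; exact: measurable_coord.
Qed.

Section step.
Variables (n : nat) (mu : {sigma_finite_measure set 'rV[R]_n -> \bar R}).

Definition snoc_measure : set 'rV[R]_n.+1 -> \bar R :=
  pushforward (mu \x @lebesgue_measure R)%E (@rsnoc n).

Let mpre A : measurable A -> measurable (@rsnoc n @^-1` A).
Proof.
by move=> mA; rewrite -[X in measurable X]setTI; exact: measurable_rsnoc.
Qed.

Let snoc0 : snoc_measure set0 = 0%E.
Proof. by rewrite /snoc_measure /pushforward preimage_set0 measure0. Qed.

Let snoc_ge0 A : (0 <= snoc_measure A)%E.
Proof. by rewrite /snoc_measure /pushforward measure_ge0. Qed.

Let snoc_sigma_additive : semi_sigma_additive snoc_measure.
Proof.
move=> F mF tF mUF; rewrite /snoc_measure /pushforward preimage_bigcup.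
apply: measure_semi_sigma_additive.
- by move=> k; exact: mpre.
- apply/trivIsetP => /= i j _ _ ij; rewrite -preimage_setI.
  by move/trivIsetP : tF => /(_ _ _ _ _ ij) ->//; rewrite preimage_set0.
- by rewrite -preimage_bigcup; exact: mpre.
Qed.

HB.instance Definition _ := isMeasure.Build _ _ _ snoc_measure
  snoc0 snoc_ge0 snoc_sigma_additive.

Let snoc_sigma_finite : sigma_finite setT snoc_measure.
Proof.
have /sigma_finiteP[F [TF ndF Foo]] := sigma_finiteT mu.
have /sigma_finiteP[G [TG ndG Goo]] := sigma_finiteT (@lebesgue_measure R).
exists (fun k => @rbelast n @^-1` (F k `*` G k)).
  apply/esym; rewrite -subTset => x _.
  have [k _ Fx] : (\bigcup_k F k) (rbelast x).1 by rewrite -TF.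
  have [l _ Gx] : (\bigcup_k G k) (rbelast x).2 by rewrite -TG.
  exists (maxn k l) => //; split.
    by move: Fx; exact/subsetPset/ndF/leq_maxl.
  by move: Gx; exact/subsetPset/ndG/leq_maxr.
move=> k; have [mF Fk] := Foo k; have [mG Gk] := Goo k; split.
  by rewrite -[X in measurable X]setTI; apply: measurable_rbelast => //;
    exact: measurableX.
rewrite /snoc_measure /pushforward.
rewrite (_ : _ @^-1` _ = F k `*` G k); last first.
  by rewrite -comp_preimage (_ : _ \o _ = id)//; apply/funext => p;
    exact: rbelastK.
by rewrite product_measure1E// lte_mul_pinfty// ge0_fin_numE.
Qed.

HB.instance Definition _ := Measure_isSigmaFinite.Build _ _ _ snoc_measure
  snoc_sigma_finite.

End step.

(* Lebesgue measure on R^n; each step adds the last coordinate. *)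
Fixpoint leb n : {sigma_finite_measure set 'rV[R]_n -> \bar R} :=
  if n is m.+1 then snoc_measure (leb m) else \d_ (0 : 'rV[R]_0).

End lebesgue_rV.

(* In finite dimension, C^k in terms of iterated directional derivatives. *)
Fixpoint Ck (R : realType) (V : normedModType R) (k : nat) (f : V -> R) : Prop :=
  if k is j.+1 then (forall x v, derivable f x v) /\
                    (forall v, Ck j (fun x => 'D_v f x))
  else continuous f.

(* phi \in C_c^\infty(D) *)
Definition test_fun (R : realType) (V : normedModType R) (D : set V)
    (phi : V -> R) : Prop :=
  let supp := closure [set x | phi x != 0] in
  [/\ forall k, Ck k phi, compact supp & supp `<=` D].

Section space.
Context {R : realType} {m : nat}.
Local Notation Rm := 'rV[R]_m.

Definition dotv (v w : Rm) : R := \sum_i v ord0 i * w ord0 i.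

Definition sqnorm (v : Rm) : R := dotv v v.

Definition basis_vec (i : 'I_m) : Rm := delta_mx ord0 i.

Definition locally_integrable_rV (f : Rm -> R) : Prop :=
  measurable_fun setT f /\
  forall K : set Rm, compact K -> (leb R m).-integrable K (EFin \o f).

Definition is_weak_partial (i : 'I_m) (f g : Rm -> R) : Prop :=
  [/\ locally_integrable_rV f, locally_integrable_rV g &
   forall phi, test_fun setT phi ->
     \int[leb R m]_x (f x * 'D_(basis_vec i) phi x) =
     - \int[leb R m]_x (g x * phi x)].

(* a chosen representative, unique up to null sets *)
Definition weak_partial (i : 'I_m) (f : Rm -> R) : Rm -> R :=
  xget (fun=> 0) [set g | is_weak_partial i f g].

Definition weak_grad (f : Rm -> R) (x : Rm) : Rm :=
  \row_i weak_partial i f x.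

Definition grad (f : Rm -> R) (x : Rm) : Rm := \row_i 'D_(basis_vec i) f x.

Definition weakly_differentiable (f : Rm -> R) : Prop :=
  forall i, is_weak_partial i f (weak_partial i f).

(* f \in W^{1,2}(R^m, p) for a weight p *)
Definition W12 (p f : Rm -> R) : Prop :=
  weakly_differentiable f /\
  (\int[leb R m]_x ((f x ^+ 2 + sqnorm (weak_grad f x)) * p x)%:E < +oo)%E.

(* phi_k --> f in W^{1,2}(R^m, p), with classical gradients of the smooth phi_k *)
Definition cvg_W12 (p : Rm -> R) (phi : nat -> Rm -> R) (f : Rm -> R) : Prop :=
  (fun k => \int[leb R m]_x
     (((f x - phi k x) ^+ 2 + sqnorm (weak_grad f x - grad (phi k) x)) * p x)%:E)%E
    @ \oo --> 0%E.

(* f \in W^{1,2}_0(R^m, p), the closure of C_c^\infty(R^m) in W^{1,2}(R^m, p) *)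
Definition W12_0 (p f : Rm -> R) : Prop :=
  W12 p f /\
  exists2 phi : nat -> Rm -> R, (forall k, test_fun setT (phi k)) &
    cvg_W12 p phi f.

End space.

(* g is the trace of f \in W^{1,2}(R^{n+1}, p) on R^n x {0}: the L^2_loc limit
   of the restrictions of smooth functions converging to f. *)
Definition is_thin_trace (R : realType) (n : nat) (p f : 'rV[R]_n.+1 -> R)
    (g : 'rV[R]_n -> R) : Prop :=
  [/\ W12 p f, measurable_fun setT g &
   exists phi : nat -> 'rV[R]_n.+1 -> R,
   [/\ forall k, test_fun setT (phi k), cvg_W12 p phi f &
    forall K : set 'rV[R]_n, compact K ->
      (fun k => \int[leb R n]_(x' in K)
         ((phi k (rsnoc (x', 0)) - g x') ^+ 2)%:E)%E @ \oo --> 0%E]].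

Section spacetime.
Context {R : realType} {n : nat}.
(* space-time R^{n+1} x R; the dimension of space is n + 1 *)
Local Notation Rx := 'rV[R]_n.+1.
Local Notation Rxt := (Rx * R)%type.
Local Notation mu := (leb R n.+1 \x @lebesgue_measure R)%E.
Implicit Types (u w : Rxt -> R) (z : Rxt) (D : set Rxt).

Definition ball_e (r : R) (x0 : Rx) : set Rx :=
  [set x | Num.sqrt (sqnorm (x - x0)) < r].

Definition cylinder (r : R) z0 : set Rxt :=
  [set z | ball_e r z0.1 z.1 /\ z0.2 - r ^+ 2 < z.2 <= z0.2].

Definition strip (r t0 : R) : set Rxt := [set z | t0 - r ^+ 2 < z.2 <= t0].

Definition slab (a b : R) : set Rxt := [set z | a < z.2 < b].

Definition thin_space : set Rxt := [set z : Rxt | z.1 ord0 ord_max = 0].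

(* Gamma(u): boundary, relative to Q_1', of the coincidence set *)
Definition free_boundary u : set Rxt :=
  let Q1' := cylinder 1 0 `&` thin_space in
  let Lambda := Q1' `&` [set z | u z = 0] in
  Q1' `&` closure Lambda `&` closure (Q1' `\` Lambda).

Definition heat_kernel (x : Rx) (t : R) : R :=
  if t < 0 then
    (- (4 * pi * t)) `^ (- (n.+1%:R / 2)) * expR (sqnorm x / (4 * t))
  else 0.

Definition heat_kernel_at z0 (z : Rxt) : R :=
  heat_kernel (z.1 - z0.1) (z.2 - z0.2).

Definition locally_integrable_on D u : Prop :=
  measurable_fun (D : set (Rx * measurableTypeR R)) u /\
  forall K : set Rxt, compact K -> K `<=` D -> mu.-integrable K (EFin \o u).

Definition is_weak_deriv D (v : Rxt) (u g : Rxt -> R) : Prop :=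
  [/\ locally_integrable_on D u, locally_integrable_on D g &
   forall phi, test_fun D phi ->
     \int[mu]_(z in D) (u z * 'D_v phi z) =
     - \int[mu]_(z in D) (g z * phi z)].

(* A chosen representative of the weak derivative on the open set D, extended
   by 0; it is unique up to null sets. *)
Definition weak_deriv D (v : Rxt) u : Rxt -> R :=
  xget (fun=> 0) [set g | is_weak_deriv D v u g] \_ D.

Definition nabla D u (z : Rxt) : Rx :=
  \row_i weak_deriv D (basis_vec i, 0) u z.

Definition partial_t D u : Rxt -> R := weak_deriv D (0, 1) u.

Definition W11_differentiable D u : Prop :=
  (forall i, is_weak_deriv D (basis_vec i, 0) u
               (weak_deriv D (basis_vec i, 0) u)) /\
  is_weak_deriv D (0, 1) u (partial_t D u).

Definition normF z0 u : \bar R :=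
  let t0 := z0.2 in
  let D := slab (-1) t0 in
  let Du := nabla D u in
  let ut := partial_t D u in
  ((\int[mu]_(z in D)
      ((u z ^+ 2 + (t0 - z.2) * (sqnorm (Du z) + ut z ^+ 2))
         * heat_kernel_at z0 z)%:E) `^ 2^-1
   + (\int[mu]_(z in D `&` [set z | ball_e 1 0 z.1])
        (u z ^+ 2 + sqnorm (Du z) + ut z ^+ 2)%:E) `^ 2^-1
   + 'N[mu]_+oo [EFin \o (u \_ D)])%E.

Definition F_space z0 u : Prop :=
  W11_differentiable (slab (-1) z0.2) u /\ (normF z0 u < +oo)%E.

Definition slice u (t : R) : Rx -> R := fun x => u (x, t).

(* w \in L^2(a, b; W^{1,2}(R^{n+1}, G_{z0})) *)
Definition L2W12 z0 (a b : R) w : Prop :=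
  [/\ measurable_fun (slab a b : set (Rx * measurableTypeR R)) w,
   {ae @lebesgue_measure R, forall t, a < t < b ->
      W12 (slice (heat_kernel_at z0) t) (slice w t)} &
   (\int[@lebesgue_measure R]_(t in `]a, b[)
      \int[leb R n.+1]_x ((slice w t x ^+ 2 + sqnorm (weak_grad (slice w t) x))
                          * slice (heat_kernel_at z0) t x)%:E < +oo)%E].

(* w \in L^2(a, b; W^{1,2}_0(R^{n+1}, G_{z0})) *)
Definition L2W12_0 z0 (a b : R) w : Prop :=
  L2W12 z0 a b w /\
  {ae @lebesgue_measure R, forall t, a < t < b ->
     W12_0 (slice (heat_kernel_at z0) t) (slice w t)}.

(* w >= 0 on the thin space for times in (a, b), in the sense of traces *)
Definition thin_ge0 z0 (a b : R) w : Prop :=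
  {ae @lebesgue_measure R, forall t, a < t < b ->
     exists2 g, is_thin_trace (slice (heat_kernel_at z0) t) (slice w t) g &
       {ae leb R n, forall x', 0 <= g x'}}.

(* Elements of F_{z0} are classes modulo null sets, while the free boundary uses
   the values u(x', 0, t): this fixes the representative on the thin space, for
   -1 < t < t0, by requiring these values to be the trace of u. *)
Definition thin_values_trace z0 u : Prop :=
  {ae @lebesgue_measure R, forall t, -1 < t < z0.2 ->
     is_thin_trace (slice (heat_kernel_at z0) t) (slice u t)
       (fun x' => u (rsnoc (x', 0), t))}.

Definition weighted_almost_signorini (alpha : R) z0 u : Prop :=
  let t0 := z0.2 in
  let G := heat_kernel_at z0 in
  let Du := nabla (slab (-1) t0) u in
  let ut := partial_t (slab (-1) t0) u in
  [/\ (cylinder 1 0 `&` thin_space) z0, F_space z0 u, thin_ge0 z0 (-1) t0 u &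
   forall rho r : R, 0 <= rho -> rho < r -> r < 1 -> -1 < t0 - r ^+ 2 ->
   forall w : Rxt -> R,
     let a := t0 - r ^+ 2 in
     let b := t0 - rho ^+ 2 in
     let A := strip r t0 `\` strip rho t0 in
     let Dw := nabla (slab a b) w in
     L2W12 z0 a b w -> thin_ge0 z0 a b w -> L2W12_0 z0 a b (u \- w) ->
     \int[mu]_(z in A)
        (((1 - r `^ alpha) * (t0 - z.2) * sqnorm (Du z)
          + (- dotv (z.1 - z0.1) (Du z) - 2 * (z.2 - t0) * ut z) * (u z - w z))
         * G z)
     <= (1 + r `^ alpha)
          * \int[mu]_(z in A) ((t0 - z.2) * sqnorm (Dw z) * G z)
        + r `^ alpha * \int[mu]_(z in A) ((u z - w z) ^+ 2 * G z)
        + fine (normF z0 u) ^+ 2 * expR (- r^-1)].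

Definition weiss (kappa0 kappa alpha eps delta r : R) u z0 : R :=
  let t0 := z0.2 in
  let Du := nabla (slab (-1) t0) u in
  let a := 8 * (kappa + 1) / alpha in
  let b := 128 * (kappa0 + 1) / eps in
  expR (a * r `^ alpha) / r `^ (2 * kappa + 2)
  * (\int[mu]_(z in strip r t0)
       ((2 * (t0 - z.2) * sqnorm (Du z)
         - kappa * (1 - b * r `^ eps) * u z ^+ 2) * heat_kernel_at z0 z)
     + fine (normF z0 u) ^+ 2 * expR (- r^-1) * r `^ (- delta)).

End spacetime.

(* Main.v *)
Require Import Defs.
From HB Require Import structures.
From mathcomp Require Import all_boot all_order all_algebra.
From mathcomp Require Import all_classical all_reals all_analysis.
From mathcomp Require Import measurable_realfun.
From mathcomp Require Import ring lra.
Set Implicit Arguments.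
Unset Strict Implicit.
Unset Printing Implicit Defensive.
Import Order.TTheory GRing.Theory Num.Theory.
Import numFieldNormedType.Exports.
Local Open Scope classical_set_scope.
Local Open Scope ring_scope.

(* In the variables (y, t) with y = (x - x0) / sqrt (t0 - t) the Gaussian weight
   does not depend on t, and (x - x0) . grad u + 2 (t - t0) u_t is the derivative
   of u along the curves y = const, up to the factor - 2 (t0 - t). Fix a slice
   t = t0 - r^2 and let w be the parabolically kappa-homogeneous extension, about
   z0, of the values of u on that slice. Integrating along the curves from the
   slice, where u = w, the drift term of the almost minimality bounds
   int (u - w)^2 from above. As w is homogeneous, its energy is a multiple of the
   energy of u on the slice, that is, of the derivative in r of the energy
   integral of u. Hence testing with w gives a differential inequality for the
   energy and height integrals, for almost every r; together with the bound
   int w^2 >= (1 - theta) int u^2 - theta^-1 int (u - w)^2 it says that the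
   derivative of W is nonnegative: b r^eps absorbs the errors in the height, and
   e^(-1/r) r^-delta absorbs the error e^(-1/r) of the almost minimality.

   The competitor w has finite energy only up to times b < t0, and b tends to t0
   at the end. That a function with weak derivatives is absolutely continuous
   along almost every curve y = const is obtained with the lemma of
   du Bois-Reymond in y and t, tested with countably many products of
   one-dimensional bumps. *)

(** * Measurability and integration on row vectors *)

(** No derivative in [r] is taken. In the variable [t = t0 - r^2] the energy and height integrals
    are primitives of integrable functions, so the difference of two values of W is the integral of
    a product-rule expression, which Fubini provides; its sign matters only for almost every slice.
    The drift term is controlled through [(t0 - t) (u - w)^2]: along a curve this vanishes on the
    slice and is nonnegative afterwards, and its derivative contains exactly the drift times
    [u - w]. Up to [t0] the drift is only shown to be integrable for the Gaussian weight, so its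
    product with [u - w] is integrable because [u] is bounded: this is the role of the supremum in
    the norm of F. Constants: the height is recovered from the competitor with
    [theta = eps / (4 (kappa0 + 1))]. Then [b theta = 32], so that the loss [theta int u^2] is paid
    by the derivative of [b r^eps], while [b r^eps <= theta / 2] lets the remaining distance term
    pay the loss [theta^-1 int (u - w)^2]. Weak derivatives are choices, unique up to null sets, and
    a real integral has a default value where integrability fails; hence the attention to joint
    measurability and to common null sets. *)

Lemma measurable_funT_comp d1 d2 d3 (T1 : measurableType d1) (T2 : measurableType d2)
    (T3 : measurableType d3) (f : T2 -> T3) (g : T1 -> T2) :
  measurable_fun setT f -> measurable_fun setT g ->
  measurable_fun setT (fun x => f (g x)).
Proof. by move=> mf mg; exact: (measurableT_comp mf mg). Qed.

(** The integral of a nonnegative function is a supremum over the simple functions below it, and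
    those below [f] are also below [g]. This serves where measurability of an integrand is not at
    hand. *)
Lemma ge0_le_integral_nonmeas d (T : measurableType d) (R : realType)
    (mu : {measure set T -> \bar R}) (D : set T) (f g : T -> \bar R) :
  (forall x, D x -> 0 <= f x)%E -> (forall x, D x -> f x <= g x)%E ->
  (\int[mu]_(x in D) f x <= \int[mu]_(x in D) g x)%E.
Proof.
move=> f0 fg; rewrite integral_mkcond [leRHS]integral_mkcond.
have f0' x : (0 <= (f \_ D) x)%E.
  by rewrite patchE; case: ifPn => // /set_mem /f0.
have fg' x : ((f \_ D) x <= (g \_ D) x)%E.
  by rewrite !patchE; case: ifPn => // /set_mem /fg.
rewrite ge0_integralTE// ge0_integralTE//; last by move=> x; exact: le_trans (fg' x).
by apply: ereal_sup_le => _ [h hf <-]; exists h => // x; exact: le_trans (hf x) (fg' x).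
Qed.

Lemma bigcup_base_open (T : topologicalType) (I : Type) (B : I -> set T) (A : set T) :
  (forall x U, nbhs x U -> exists2 i, B i x & B i `<=` U) -> open A ->
  A = \bigcup_i (if `[< B i `<=` A >] then B i else set0).
Proof.
move=> base oA; apply/seteqP; split=> [x Ax|x [i _]].
  have [i Bix BiA] := base x A (open_nbhs_nbhs (conj oA Ax)).
  by exists i => //; rewrite asboolT.
by case: asboolP => // + Bix; exact.
Qed.

(** Link between topology and sigma-algebra: an open set is a countable union of members of the
    base, so it is enough to know that these have measurable preimages. On row vectors the
    sigma-algebra is generated by the coordinates, not by the open sets. *)
Lemma open_measurable_base d (T : measurableType d) (S : topologicalType)
    (phi : T -> S) (I : countType) (B : I -> set S) (A : set S) :
  (forall x U, nbhs x U -> exists2 i, B i x & B i `<=` U) ->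
  (forall i, measurable (phi @^-1` B i)) -> open A -> measurable (phi @^-1` A).
Proof.
move=> base mB oA; rewrite (bigcup_base_open base oA) preimage_bigcup.
apply: countable_bigcupT_measurable => [|i]; first exact: countableP.
by case: asboolP => // _; rewrite preimage_set0.
Qed.

Section base.
Context {R : realType}.

(** Balls of the sup norm with rational centre and radius [1 / (k + 1)]: a countable base of the
    topology. *)
Definition rat_box n (q : 'rV[rat]_n * nat) : set 'rV[R]_n :=
  [set x | forall i, `|x ord0 i - ratr (q.1 ord0 i)| < q.2.+1%:R^-1].

Lemma rat_box_base n (x : 'rV[R]_n) (U : set 'rV[R]_n) : nbhs x U ->
  exists2 q, rat_box q x & rat_box q `<=` U.
Proof.
move=> /nbhs_ballP[e /= e0 eU].
have [k ke] : exists k : nat, k.+1%:R^-1 < e / 2.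
  have [k] := near_infty_natSinv_lt (PosNum (divr_gt0 e0 (ltr0n _ 2))).
  by move=> _ /(_ k (leqnn k)) /= ?; exists k.
have /(_ _)/cid2 qP (i : 'I_n) : exists2 q : rat, true & `|x ord0 i - ratr q| < k.+1%:R^-1.
  have k0 : 0 < k.+1%:R^-1 :> R by rewrite invr_gt0.
  have [|q] := @rat_in_itvoo R (x ord0 i - k.+1%:R^-1) (x ord0 i + k.+1%:R^-1).
    by rewrite ltrD2l; apply: lt_trans k0; rewrite oppr_lt0.
  rewrite in_itv/= => /andP[q1 q2]; exists q => //.
  by rewrite ltr_distlC q1 q2.
exists (\row_i sval (qP i), k).
  by move=> i; rewrite mxE; case: (qP i).
move=> y yq; apply: eU; rewrite /ball/= /mx_ball; split => // i j.
rewrite (ord1 i) /ball/=.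
have := yq j; rewrite /= mxE; case: (qP j) => q /= _ h1 h2.
rewrite (_ : x ord0 j - y ord0 j = (x ord0 j - ratr q) - (y ord0 j - ratr q)); last by ring.
apply: le_lt_trans (ler_normB _ _) _; rewrite (splitr e); apply: ltrD.
  exact: lt_trans ke.
exact: lt_trans ke.
Qed.

Lemma measurable_rat_box n (q : 'rV[rat]_n * nat) : measurable (@rat_box n q).
Proof.
rewrite (_ : rat_box q = \bigcap_(i in setT)
   [set x : 'rV[R]_n | `|x ord0 i - ratr (q.1 ord0 i)| < q.2.+1%:R^-1]).
  apply: fin_bigcap_measurable => [|i _]; first exact: finite_finset.
  rewrite -[X in measurable X]setTI.
  rewrite (_ : [set x | _] = (fun x : 'rV[R]_n => x ord0 i) @^-1`
     [set r | `|r - ratr (q.1 ord0 i)| < q.2.+1%:R^-1])//.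
  apply: measurable_coord => //.
  apply: open_measurable.
  rewrite (_ : [set r | _] = ball (ratr (q.1 ord0 i) : R) q.2.+1%:R^-1).
    exact: ball_open.
  by apply/seteqP; split=> r; rewrite /ball/= distrC.
by apply/seteqP; split=> x h; [move=> i _ /=|move=> i]; exact: h.
Qed.

Lemma rat_base_R (x : R) (U : set R) : nbhs x U ->
  exists2 q : rat * nat, `|x - ratr q.1| < q.2.+1%:R^-1 &
     [set y : R | `|y - ratr q.1| < q.2.+1%:R^-1] `<=` U.
Proof.
move=> /nbhs_ballP[e /= e0 eU].
have [k ke] : exists k : nat, k.+1%:R^-1 < e / 2.
  have [k] := near_infty_natSinv_lt (PosNum (divr_gt0 e0 (ltr0n _ 2))).
  by move=> _ /(_ k (leqnn k)) /= ?; exists k.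
have k0 : 0 < k.+1%:R^-1 :> R by rewrite invr_gt0.
have [|q] := @rat_in_itvoo R (x - k.+1%:R^-1) (x + k.+1%:R^-1).
  by rewrite ltrD2l; apply: lt_trans k0; rewrite oppr_lt0.
rewrite in_itv/= => /andP[q1 q2]; exists (q, k) => /=.
  by rewrite ltr_distlC q1 q2.
move=> y /= h2; apply: eU; rewrite /ball/=.
rewrite (_ : x - y = (x - ratr q) - (y - ratr q)); last by ring.
apply: le_lt_trans (ler_normB _ _) _; rewrite (splitr e); apply: ltrD.
  by apply: lt_trans ke; rewrite ltr_distlC q1 q2.
exact: lt_trans ke.
Qed.

Lemma continuous_measurable_base d (T : measurableType d) (S : topologicalType)
    (phi : T -> S) (I : countType) (B : I -> set S) (f : S -> R) :
  (forall x U, nbhs x U -> exists2 i, B i x & B i `<=` U) ->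
  (forall i, measurable (phi @^-1` B i)) -> continuous f ->
  measurable_fun setT (f \o phi : T -> measurableTypeR R).
Proof.
move=> base mB cf; apply: (measurability _ (RGenOpens.measurableE R)).
move=> _ [_ [a [b ->] <-]]; rewrite setTI comp_preimage.
apply: (open_measurable_base base mB).
by apply: open_comp.
Qed.

Lemma continuous_measurable_rV n (f : 'rV[R]_n -> R) :
  continuous f -> measurable_fun setT f.
Proof.
move=> cf; have := @continuous_measurable_base _ 'rV[R]_n 'rV[R]_n id _ (@rat_box n) f.
by apply => //; [exact: rat_box_base | exact: measurable_rat_box].
Qed.

Lemma continuous_measurable_rVR n (f : 'rV[R]_n * R -> R) :
  continuous f -> measurable_fun setT (f : 'rV[R]_n * measurableTypeR R -> R).
Proof.
move=> cf.
pose B (q : ('rV[rat]_n * nat) * (rat * nat)) : set ('rV[R]_n * R) :=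
  @rat_box n q.1 `*` [set y : R | `|y - ratr q.2.1| < q.2.2.+1%:R^-1].
have := @continuous_measurable_base _ ('rV[R]_n * measurableTypeR R)%type ('rV[R]_n * R)%type id _ B f.
apply => //.
- move=> [x t] U [[U1 U2] /= [/rat_box_base[q1 q1x q1U] /rat_base_R[q2 q2t q2U]] UU].
  exists (q1, q2); first by split.
  by move=> [y s] /= [? ?]; apply: UU; split => /=; [exact: q1U|exact: q2U].
- move=> i; rewrite preimage_id; apply: measurableX; first exact: measurable_rat_box.
  apply: open_measurable.
  rewrite (_ : [set r | _] = ball (ratr i.2.1 : R) i.2.2.+1%:R^-1).
    exact: ball_open.
  by apply/seteqP; split=> r; rewrite /ball/= distrC.
Qed.

End base.

Section transfer.
Context d1 d2 (X : measurableType d1) (Y : measurableType d2) (R : realType).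
Variables (mu : {measure set X -> \bar R}) (nu : {measure set Y -> \bar R}).
Variables (phi : Y -> X) (L : X -> R) (K : Y -> R).
Hypothesis mphi : measurable_fun setT phi.
Hypotheses (L0 : forall x, 0 <= L x) (K0 : forall y, 0 <= K y).
Hypotheses (mL : measurable_fun setT L) (mK : measurable_fun setT K).
Hypothesis tr : forall f : X -> R, measurable_fun setT f -> (forall x, 0 <= f x) ->
  (\int[mu]_x (f x * L x)%:E = \int[nu]_y (f (phi y) * K y)%:E)%E.

Let maxM (a b : R) : 0 <= b -> Num.max (a * b) 0 = Num.max a 0 * b.
Proof. by move=> b0; rewrite maxr_pMl// mul0r. Qed.

(** Positive and negative parts are treated separately, since a nonnegative density commutes with
    [max _ 0]; thus the identity holds for non-integrable [f] as well. *)
Lemma integral_transfer (f : X -> R) : measurable_fun setT f ->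
  (\int[mu]_x (f x * L x)%:E = \int[nu]_y (f (phi y) * K y)%:E)%E.
Proof.
move=> mf; rewrite integralE [RHS]integralE.
have mp : measurable_fun setT (fun x => Num.max (f x) 0).
  by apply: measurable_maxr => //.
have mn : measurable_fun setT (fun x => Num.max (- f x) 0).
  by apply: measurable_maxr => //; exact: measurableT_comp.
congr (_ - _)%E.
- transitivity (\int[mu]_x (Num.max (f x) 0 * L x)%:E)%E.
    by apply: eq_integral => x _; rewrite funeposE -EFin_max maxM.
  rewrite tr => [|//|x]; last by rewrite le_max lexx orbT.
  by apply: eq_integral => y _; rewrite funeposE -EFin_max maxM.
- transitivity (\int[mu]_x (Num.max (- f x) 0 * L x)%:E)%E.
    by apply: eq_integral => x _; rewrite funenegE -EFinN -EFin_max -mulNr maxM.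
  rewrite tr => [|//|x]; last by rewrite le_max lexx orbT.
  by apply: eq_integral => y _; rewrite funenegE -EFinN -EFin_max -mulNr maxM.
Qed.

Lemma integrable_transfer (f : X -> R) : measurable_fun setT f ->
  mu.-integrable setT (fun x => (f x * L x)%:E) <->
  nu.-integrable setT (fun y => (f (phi y) * K y)%:E).
Proof.
move=> mf.
have E : (\int[mu]_x `|(f x * L x)%:E| = \int[nu]_y `|(f (phi y) * K y)%:E|)%E.
  transitivity (\int[mu]_x (`|f x| * L x)%:E)%E.
    by apply: eq_integral => x _; rewrite abse_EFin normrM (ger0_norm (L0 _)).
  rewrite tr => [|//|//]; last exact: measurableT_comp.
  by apply: eq_integral => x _; rewrite abse_EFin normrM (ger0_norm (K0 _)).
split=> /integrableP[_ h]; apply/integrableP; split.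
- apply/measurable_EFinP; apply: measurable_funM => //; exact: measurableT_comp mf mphi.
- by rewrite -E.
- by apply/measurable_EFinP; apply: measurable_funM.
- by rewrite E.
Qed.

End transfer.

Section affine.
Context {R : realType}.
Local Notation lam := (@lebesgue_measure R).

(** The pushforward under [x |-> a + c x], multiplied by [c], agrees with Lebesgue measure on
    half-open intervals, and these determine it. *)
Lemma lebesgue_measure_affine (a c : R) (A : set R) : 0 < c -> measurable A ->
  lam A = (c%:E * lam ((fun x => a + c * x)%R @^-1` A))%E.
Proof.
move=> c0 mA.
have mf : measurable_fun setT (fun x : measurableTypeR R => (a + c * x)%R : measurableTypeR R).
  by apply: measurable_funD => //; exact: measurable_funM.
pose k : {nonneg R} := NngNum (ltW c0).
pose nu : {measure set (measurableTypeR R) -> \bar R} :=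
  mscale k [the measure _ _ of pushforward lam (fun x : measurableTypeR R => (a + c * x)%R : measurableTypeR R)].
suff : lam A = nu mf A by [].
apply: lebesgue_measure_unique => // _ [[x y]] _ <- /=.
rewrite /= /mscale /= /pushforward.
rewrite (_ : _ @^-1` _ = `](x - a) / c, (y - a) / c]%classic); last first.
  apply/seteqP; split=> z; rewrite /= !in_itv/= ltr_pdivrMr// ler_pdivlMr// => /andP[h1 h2];
    by apply/andP; split; lra.
rewrite !lebesgue_measure_itv/= !lte_fin ltr_pM2r ?invr_gt0// ltrD2r.
case: ifPn => _; last by rewrite mule0.
rewrite -EFinM; congr EFin; field; exact: lt0r_neq0.
Qed.

Lemma ge0_integral_affine (a c : R) (f : measurableTypeR R -> \bar R) : 0 < c ->
  measurable_fun setT f -> (forall x, 0 <= f x)%E ->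
  (\int[lam]_x f x = c%:E * \int[lam]_x f (a + c * x)%R)%E.
Proof.
move=> c0 mf f0.
have mg : measurable_fun setT (fun x : measurableTypeR R => (a + c * x)%R : measurableTypeR R).
  by apply: measurable_funD => //; exact: measurable_funM.
pose k : {nonneg R} := NngNum (ltW c0).
pose nu : {measure set (measurableTypeR R) -> \bar R} :=
  mscale k [the measure _ _ of pushforward lam (fun x : measurableTypeR R => (a + c * x)%R : measurableTypeR R)].
transitivity (\int[nu mg]_x f x)%E.
  by apply: eq_measure_integral => A mA _; exact: lebesgue_measure_affine.
rewrite ge0_integral_mscale//=; congr (_ * _)%E.
by rewrite ge0_integral_pushforward.
Qed.

Lemma ge0_integral_rsnoc n (f : 'rV[R]_n.+1 -> \bar R) :
  measurable_fun setT f -> (forall x, 0 <= f x)%E ->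
  (\int[leb R n.+1]_x f x = \int[leb R n]_x \int[lam]_s f (rsnoc (x, s)))%E.
Proof.
move=> mf f0.
transitivity (\int[pushforward (leb R n \x lam) (@rsnoc R n)]_x f x)%E; first by [].
rewrite ge0_integral_pushforward//; last exact: measurable_rsnoc.
rewrite preimage_setT fubini_tonelli1//; last by move=> ?; exact: f0.
apply: measurableT_comp => //; exact: measurable_rsnoc.
Qed.

Lemma rsnoc_affine n (x0 : 'rV[R]_n.+1) (c : R) (x : 'rV[R]_n) (s : R) :
  rsnoc (\row_j x0 ord0 (lift ord_max j) + c *: x, x0 ord0 ord_max + c * s) =
  x0 + c *: rsnoc (x, s).
Proof.
apply/rowP => i; rewrite !mxE; case: unliftP => [j ->|->]/=; last by [].
by rewrite !mxE.
Qed.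

Lemma measurable_affine n (x0 : 'rV[R]_n) (c : R) :
  measurable_fun setT (fun x : 'rV[R]_n => x0 + c *: x).
Proof.
apply: measurable_fun_coord => i; under eq_fun do rewrite !mxE.
apply: measurable_funD => //; apply: measurable_funM => //; exact: measurable_coord.
Qed.

(** Induction on the dimension along the definition of [leb]: the last coordinate contributes one
    factor [c] and Tonelli reduces to the remaining ones. *)
Lemma ge0_integral_leb_affine n (x0 : 'rV[R]_n) (c : R) (f : 'rV[R]_n -> \bar R) :
  0 < c -> measurable_fun setT f -> (forall x, 0 <= f x)%E ->
  (\int[leb R n]_x f x = (c ^+ n)%:E * \int[leb R n]_x f (x0 + c *: x)%R)%E.
Proof.
move=> c0; elim: n x0 f => [|n IH] x0 f mf f0.
  rewrite expr0 mul1e; apply: eq_integral => x _; congr f.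
  by apply/rowP; case.
rewrite [in RHS]ge0_integral_rsnoc//; last first.
  exact: measurableT_comp mf (measurable_affine _ _).
rewrite ge0_integral_rsnoc//.
have mfr : measurable_fun setT
    (fun z : 'rV[R]_n * measurableTypeR R => f (rsnoc z)).
  exact: measurableT_comp mf (@measurable_rsnoc _ _).
have mF (g : R -> R) : measurable_fun setT (g : measurableTypeR R -> measurableTypeR R) ->
    measurable_fun setT (fun x => \int[lam]_s f (rsnoc (x, g s)))%E.
  move=> mg.
  apply: (measurable_fun_fubini_tonelli_F (fun z : 'rV[R]_n * measurableTypeR R => f (rsnoc (z.1, g z.2)))) => //=.
  apply: (@measurable_funT_comp _ _ _ _ ('rV[R]_n * measurableTypeR R)%type _
    (fun z => f (rsnoc z)) (fun z => (z.1, g z.2))) => //.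
  apply: measurable_fun_pair => //; exact: measurableT_comp.
have ma : measurable_fun setT (fun s : measurableTypeR R => x0 ord0 ord_max + c * s : measurableTypeR R).
  by apply: measurable_funD => //; exact: measurable_funM.
transitivity (c%:E * \int[leb R n]_x \int[lam]_s f (rsnoc (x, (x0 ord0 ord_max + c * s)%R)))%E.
  rewrite -ge0_integralZl//; [|exact: mF|by move=> *; exact: integral_ge0|by rewrite lee_fin ltW].
  apply: eq_integral => x _; apply: ge0_integral_affine => //.
  exact: (measurableT_comp mfr (pair1_measurable _)).
rewrite (IH (\row_j x0 ord0 (lift ord_max j)))//; [|exact: mF|by move=> *; exact: integral_ge0].
rewrite muleA -EFinM -exprS; congr (_ * _)%E.
apply: eq_integral => x _; apply: eq_integral => s _.
by rewrite rsnoc_affine.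
Qed.

Let tr_affine n (x0 : 'rV[R]_n) (c : R) (c0 : 0 < c) (h : 'rV[R]_n -> R) :
  measurable_fun setT h -> (forall x, 0 <= h x) ->
  (\int[leb R n]_x (h x * 1)%:E =
   \int[leb R n]_x (h (x0 + c *: x)%R * c ^+ n)%:E)%E.
Proof.
move=> mh h0; under eq_integral do rewrite mulr1.
under [RHS]eq_integral do rewrite mulrC EFinM.
rewrite ge0_integralZl//.
- by rewrite (ge0_integral_leb_affine x0 c0)//; exact/measurable_EFinP.
- apply/measurable_EFinP; exact: measurableT_comp mh (measurable_affine _ _).
- by move=> x _; rewrite lee_fin.
- by rewrite lee_fin exprn_ge0// ltW.
Qed.

Lemma integrable_leb_affine n (x0 : 'rV[R]_n) (c : R) (f : 'rV[R]_n -> R) :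
  0 < c -> measurable_fun setT f ->
  (leb R n).-integrable setT (EFin \o f) <->
  (leb R n).-integrable setT (fun x => (f (x0 + c *: x)%R)%:E).
Proof.
move=> c0 mf.
have cn0 : 0 < c ^+ n by rewrite exprn_gt0.
have := integrable_transfer (L:=cst 1) (K:=cst (c ^+ n))
  (measurable_affine x0 c) (fun=> ler01) (fun=> ltW cn0)
  (measurable_cst _) (measurable_cst _) (tr_affine x0 c0) mf.
under eq_fun do rewrite /= mulr1.
move=> H; split.
  move=> /H /(integrableZl measurableT (c ^- n)).
  by apply: eq_integrable => // x _; rewrite /= -EFinM mulrCA mulVf ?mulr1// gt_eqF.
move=> h; apply/H; move: h => /(integrableZl measurableT (c ^+ n)).
by apply: eq_integrable => // x _; rewrite /= -EFinM mulrC.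
Qed.

Lemma Rintegral_leb_affine n (x0 : 'rV[R]_n) (c : R) (f : 'rV[R]_n -> R) :
  0 < c -> (leb R n).-integrable setT (EFin \o f) ->
  \int[leb R n]_x f x = c ^+ n * \int[leb R n]_x f (x0 + c *: x).
Proof.
move=> c0 intf.
have mf : measurable_fun setT f by apply/measurable_EFinP; exact: measurable_int intf.
have cn0 : 0 < c ^+ n by rewrite exprn_gt0.
rewrite -RintegralZl//; last exact/(integrable_leb_affine _ c0 mf).
rewrite /Rintegral; congr fine.
have := integral_transfer (L:=cst 1) (K:=cst (c ^+ n))
  (fun=> ler01) (fun=> ltW cn0)
  (tr_affine x0 c0) mf.
under eq_integral do rewrite /= mulr1.
by move=> ->; apply: eq_integral => x _; rewrite mulrC.
Qed.

End affine.

(** * Absolutely continuous functions *)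

Lemma lee_abs_fine (R : realType) (x : \bar R) : (`|fine x|%:E <= `|x|)%E.
Proof. by case: x => [r||]/=; rewrite ?normr0 ?leey. Qed.

Section Rfubini.
Context d1 d2 (T1 : measurableType d1) (T2 : measurableType d2) (R : realType).
Variable m1 : {sigma_finite_measure set T1 -> \bar R}.
Variable m2 : {sigma_finite_measure set T2 -> \bar R}.
Variable f : T1 * T2 -> R.
Hypothesis intf : (m1 \x m2)%E.-integrable setT (EFin \o f).

Lemma integrable_Rfubini1 :
  m1.-integrable setT (EFin \o (fun x => \int[m2]_y f (x, y))).
Proof.
apply: le_integrable (integrable_fubini_F intf) => //.
  apply/measurable_EFinP; apply: measurable_funT_comp (measurable_fubini_F intf).
  exact: fine_measurable.
by move=> x _; exact: lee_abs_fine.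
Qed.

Lemma integrable_Rfubini2 :
  m2.-integrable setT (EFin \o (fun y => \int[m1]_x f (x, y))).
Proof.
have mf := measurable_int _ intf.
apply/integrableP; split.
  apply/measurable_EFinP; apply: measurable_funT_comp (measurable_fubini_G intf).
  exact: fine_measurable.
have /integrable21ltyP : (m1 \x m2)%E.-integrable setT (EFin \o f) by [].
move=> /(_ mf); apply: le_lt_trans; apply: ge0_le_integral_nonmeas => //= y _.
apply: le_trans (lee_abs_fine _) _; apply: le_abse_integral => //.
exact: measurableT_comp mf (pair2_measurable y).
Qed.

(** The sections are integrable for almost every [x] only. Elsewhere the inner real integral is a
    default value, on a null set that the outer integral ignores. *)
Lemma Rintegral12_prod :
  \int[(m1 \x m2)%E]_z f z = \int[m1]_x \int[m2]_y f (x, y).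
Proof.
rewrite {1}/Rintegral -integral12_prod_meas1//; congr fine.
apply: ae_eq_integral => //.
- exact: (measurable_fubini_F intf).
- exact: measurable_int integrable_Rfubini1.
apply: filterS (ae_integrable1 intf) => x h _ /=.
rewrite /fubini_F /Rintegral fineK//.
exact: (integrable_fin_num measurableT h).
Qed.

Lemma Rintegral21_prod :
  \int[(m1 \x m2)%E]_z f z = \int[m2]_y \int[m1]_x f (x, y).
Proof.
rewrite {1}/Rintegral -integral21_prod_meas1//; congr fine.
apply: ae_eq_integral => //.
- exact: (measurable_fubini_G intf).
- exact: measurable_int integrable_Rfubini2.
apply: filterS (ae_integrable2 intf) => x h _ /=.
rewrite /fubini_G /Rintegral fineK//.
exact: (integrable_fin_num measurableT h).
Qed.

End Rfubini.

Section indicator.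
Context d (T : measurableType d) (R : realType) (mu : {measure set T -> \bar R}).

Lemma integrable_mulind (p : pred T) (f : T -> R) :
  measurable [set x | p x] -> mu.-integrable setT (EFin \o f) ->
  mu.-integrable setT (EFin \o (fun x => f x * (p x)%:R)).
Proof.
move=> mp intf; have mf := measurable_int _ intf.
apply: le_integrable intf => //.
  apply/measurable_EFinP; apply: measurable_funM; first exact/measurable_EFinP.
  rewrite (_ : (fun _ => _) = \1_[set x | p x]) ?measurable_indicP//.
  by apply/funext => x; rewrite indicE mem_setE.
move=> x _ /=; rewrite lee_fin normrM; case: (p x); rewrite ?normr1 ?normr0 ?mulr1//.
by rewrite mulr0.
Qed.

Lemma Rintegral_mulind (p : pred T) (f : T -> R) :
  \int[mu]_(x in [set x | p x]) f x = \int[mu]_x (f x * (p x)%:R).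
Proof.
rewrite Rintegral_mkcond; apply: eq_Rintegral => x _; rewrite patchE mem_setE -topredE /=.
by case: (p x); rewrite ?mulr1 ?mulr0.
Qed.

Lemma integrable_mulindP (p : pred T) (f : T -> R) : measurable [set x | p x] ->
  mu.-integrable [set x | p x] (EFin \o f) <->
  mu.-integrable setT (EFin \o (fun x => f x * (p x)%:R)).
Proof.
move=> mp; rewrite integrable_mkcond//.
suff -> : (EFin \o f) \_ [set x | p x] = EFin \o (fun x => f x * (p x)%:R) by [].
apply/funext => x; rewrite patchE mem_setE -topredE /=.
by case: (p x); rewrite ?mulr1 ?mulr0.
Qed.

End indicator.

Lemma integrable_tensor d1 d2 (T1 : measurableType d1) (T2 : measurableType d2) (R : realType)
    (m1 : {sigma_finite_measure set T1 -> \bar R}) (m2 : {sigma_finite_measure set T2 -> \bar R})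
    (f : T1 -> R) (g : T2 -> R) :
  m1.-integrable setT (EFin \o f) -> m2.-integrable setT (EFin \o g) ->
  (m1 \x m2)%E.-integrable setT (EFin \o (fun z => f z.1 * g z.2)).
Proof.
move=> intf intg; have mf : measurable_fun setT f by apply/measurable_EFinP; exact: measurable_int intf.
have mg : measurable_fun setT g by apply/measurable_EFinP; exact: measurable_int intg.
have mfg : measurable_fun setT (fun z : T1 * T2 => f z.1 * g z.2).
  apply: measurable_funM; first exact: (measurable_funT_comp mf measurable_fst).
  exact: (measurable_funT_comp mg measurable_snd).
apply/integrableP; split; first exact/measurable_EFinP.
rewrite fubini_tonelli1//; last by apply: measurableT_comp => //; exact/measurable_EFinP.
have E x : fubini_F m2 (abse \o (EFin \o (fun z => f z.1 * g z.2))) x =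
    (`|f x|%:E * \int[m2]_y `|(EFin \o g) y|)%E.
  rewrite /fubini_F -ge0_integralZl//; last by apply: measurableT_comp => //; exact/measurable_EFinP.
  by apply: eq_integral => y _; rewrite /= normrM EFinM.
under eq_integral do rewrite E.
have /integrableP[_ fy] := intf; have /integrableP[_ gy] := intg.
rewrite ge0_integralZr//; first last.
- by apply: integral_ge0.
- by apply: measurableT_comp => //; exact: measurableT_comp.
rewrite lte_mul_pinfty//; first by apply: integral_ge0.
by rewrite ge0_fin_numE//; apply: integral_ge0.
Qed.

Section ac.
Context {R : realType}.
Local Notation lam := (@lebesgue_measure R).
Implicit Types (f g : R -> R).

Definition ltind (s t : R) : R := (s < t)%R%:R.

Lemma measurable_ltr d (T : measurableType d) (f g : T -> R) :
  measurable_fun setT f -> measurable_fun setT g ->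
  measurable [set x | f x < g x].
Proof.
move=> mf mg.
rewrite (_ : [set x | _] = setT `&` (fun x => g x - f x) @^-1` `]0, +oo[).
  by apply: (measurable_funB mg mf).
by rewrite setTI; apply/seteqP; split=> x; rewrite /= in_itv/= andbT subr_gt0.
Qed.

Lemma measurable_ltfst : measurable [set z : measurableTypeR R * measurableTypeR R | (z.2 : R) < z.1].
Proof. by apply: measurable_ltr; [exact: measurable_snd|exact: measurable_fst]. Qed.

Lemma measurable_ltsnd : measurable [set z : measurableTypeR R * measurableTypeR R | (z.1 : R) < z.2].
Proof. by apply: measurable_ltr; [exact: measurable_fst|exact: measurable_snd]. Qed.

(** The product of the integrals is the integral of [f t * g s] over the plane. The diagonal is
    null, and the half planes on its two sides give the two iterated integrals. *)
Lemma triangle_mul f g : lam.-integrable setT (EFin \o f) ->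
  lam.-integrable setT (EFin \o g) ->
  [/\ lam.-integrable setT (EFin \o (fun t : R => f t * \int[lam]_s (g s * ltind s t))),
      lam.-integrable setT (EFin \o (fun t : R => (\int[lam]_s (f s * ltind s t)) * g t)) &
  \int[lam]_t f t * \int[lam]_t g t =
  \int[lam]_t (f t * \int[lam]_s (g s * ltind s t)) +
  \int[lam]_t ((\int[lam]_s (f s * ltind s t)) * g t)].
Proof.
move=> intf intg; have int2 := @integrable_tensor _ _ _ _ R lam lam _ _ intf intg.
have intb (p : R -> R -> bool) (h : R -> R) t : lam.-integrable setT (EFin \o h) ->
    (measurable [set s : measurableTypeR R | p s t]) ->
    lam.-integrable setT (EFin \o (fun s : R => h s * (p s t)%:R)).
  by move=> inth mp; exact: (@integrable_mulind _ (measurableTypeR R) R lam (fun s : R => p s t) h mp inth).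
have mlt t : measurable [set s : measurableTypeR R | s < t].
  by rewrite -set_itvE; exact: measurable_itv.
have mgt t : measurable [set s : measurableTypeR R | t < s].
  by rewrite -set_itvE; exact: measurable_itv.
have i1 := @integrable_mulind _ (measurableTypeR R * measurableTypeR R)%type R (lam \x lam)%E (fun z : R * R => z.2 < z.1) (fun z => f z.1 * g z.2) measurable_ltfst int2.
have i2 := @integrable_mulind _ (measurableTypeR R * measurableTypeR R)%type R (lam \x lam)%E (fun z : R * R => z.1 < z.2) (fun z => f z.1 * g z.2) measurable_ltsnd int2.
have E1 t : \int[lam]_y (f t * g y * ltind y t) = f t * \int[lam]_s (g s * ltind s t).
  rewrite -RintegralZl//; last exact: intb.
  by apply: eq_Rintegral => s _; rewrite mulrA.
have E2 t : \int[lam]_s (f s * g t * ltind s t) = (\int[lam]_s (f s * ltind s t)) * g t.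
  rewrite -RintegralZr//; last exact: intb.
  by apply: eq_Rintegral => s _; rewrite mulrAC.
split.
- have := integrable_Rfubini1 i1; apply: eq_integrable => // t _.
  by rewrite /= E1.
- have := integrable_Rfubini2 i2; apply: eq_integrable => // t _.
  by rewrite /= E2.
transitivity (\int[(lam \x lam)%E]_z (f z.1 * g z.2)).
  rewrite Rintegral12_prod//= -RintegralZr//; apply: eq_Rintegral => t _.
  by rewrite RintegralZl.
transitivity (\int[(lam \x lam)%E]_z (f z.1 * g z.2 * ltind z.2 z.1 +
    f z.1 * g z.2 * ltind z.1 z.2)); last first.
  rewrite RintegralD//; congr (_ + _).
    rewrite Rintegral12_prod//=; apply: eq_Rintegral => t _; exact: E1.
  rewrite Rintegral21_prod//=; apply: eq_Rintegral => t _; exact: E2.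
have i12 : (lam \x lam)%E.-integrable setT (EFin \o (fun z : R * R =>
    f z.1 * g z.2 * ltind z.2 z.1 + f z.1 * g z.2 * ltind z.1 z.2)).
  by have := integrableD measurableT i1 i2; apply: eq_integrable.
rewrite (Rintegral12_prod int2) (Rintegral12_prod i12)/=; apply: eq_Rintegral => t _.
rewrite /Rintegral; congr fine; apply: ae_eq_integral => //=.
- by apply/measurable_EFinP; apply: measurable_funM => //; apply/measurable_EFinP; exact: measurable_int intg.
- apply/measurable_EFinP; have := measurable_int _ i12 => /measurable_EFinP h.
  exact: (measurableT_comp h (pair1_measurable t)).
exists [set t]; split => //; first exact: lebesgue_measure_set1.
move=> s /= /not_implyP[_ ne]; apply: contrapT => /eqP st; apply: ne; congr EFin.
by rewrite /ltind; case: (ltgtP s t) st => //= _; rewrite ?mulr1 ?mulr0 ?addr0 ?add0r.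
Qed.

(** Product rule for absolutely continuous functions in integrated form. It comes from Fubini by
    [triangle_mul], so that no almost everywhere derivative of a primitive enters; the constants [A]
    and [B] add linear terms only. *)
Lemma ac_mul (a b A B : R) f g : a <= b ->
  lam.-integrable `]a, b[ (EFin \o f) -> lam.-integrable `]a, b[ (EFin \o g) ->
  let F t := A + \int[lam]_(s in `]a, t[) f s in
  let G t := B + \int[lam]_(s in `]a, t[) g s in
  lam.-integrable `]a, b[ (EFin \o (fun t : R => f t * G t + F t * g t)) /\
  F b * G b = A * B + \int[lam]_(t in `]a, b[) (f t * G t + F t * g t).
Proof.
move=> ab intf intg F G.
pose p s := s \in `]a, b[.
pose f' s := f s * (p s)%:R; pose g' s := g s * (p s)%:R.
have mp : measurable [set s : measurableTypeR R | p s] by exact: measurable_itv.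
have intf' : lam.-integrable setT (EFin \o f') by exact/(integrable_mulindP _ _ mp).
have intg' : lam.-integrable setT (EFin \o g') by exact/(integrable_mulindP _ _ mp).
have P (h : R -> R) t : p t -> \int[lam]_(s in `]a, t[) h s =
    \int[lam]_s (h s * (p s)%:R * ltind s t).
  rewrite /p in_itv/= => /andP[at_ tb].
  pose q (s : R) := s \in `]a, t[.
  transitivity (\int[lam]_s (h s * (q s)%:R)).
    exact: (@Rintegral_mulind _ (measurableTypeR R) R lam q h).
  apply: eq_Rintegral => s _; rewrite /q !in_itv/= -mulrA; congr (_ * _).
  rewrite /ltind; case: (ltP s t) => st; rewrite ?andbF ?mulr0// ?mulr1.
  by rewrite (lt_trans st tb).
have Pb (h : R -> R) : \int[lam]_(s in `]a, b[) h s = \int[lam]_s (h s * (p s)%:R).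
  exact: (@Rintegral_mulind _ (measurableTypeR R) R lam p h).
have [i1 i2 E] := triangle_mul intf' intg'.
have key : EFin \o (fun t : R => (f t * G t + F t * g t) * (p t)%:R) =
    EFin \o (fun t : R => B * f' t + A * g' t +
     (f' t * \int[lam]_s (g' s * ltind s t) + (\int[lam]_s (f' s * ltind s t)) * g' t)).
  apply/funext => t /=; congr EFin; rewrite /f' /g'.
  case: (boolP (p t)) => pt; last by rewrite !(mulr0, mul0r, addr0).
  by rewrite /G /F !P//=; ring.
have j1 : lam.-integrable setT (EFin \o (fun t : R => B * f' t + A * g' t)).
  have := integrableD measurableT (integrableZl measurableT B intf') (integrableZl measurableT A intg').
  by apply: eq_integrable.
have j2 := integrableD measurableT i1 i2.
split.
  apply/(integrable_mulindP _ _ mp); rewrite key.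
  by have := integrableD measurableT j1 j2; apply: eq_integrable.
rewrite {1}/F {1}/G !Pb -/f' -/g'.
rewrite [X in _ = _ + X](_ : _ = \int[lam]_t (B * f' t + A * g' t +
     (f' t * \int[lam]_s (g' s * ltind s t) + (\int[lam]_s (f' s * ltind s t)) * g' t))); last first.
  rewrite /Rintegral; congr fine; apply: eq_integral => t _.
  exact: (congr1 (fun h : R -> \bar R => h t) key).
rewrite RintegralD// RintegralD//; last 2 first.
  exact: (integrableZl measurableT B intf').
  exact: (integrableZl measurableT A intg').
rewrite RintegralD// RintegralZl// RintegralZl// -E; ring.
Qed.

End ac.

(** * Smooth functions and bumps *)

Section smooth.
Context {R : realType}.

(** Smoothness relative to a set, since the similarity variables are smooth only before [t0].
    Directional derivability does not give continuity, so continuity is asked at every order; this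
    makes the class stable under products and compositions. *)
Fixpoint Cs (V : normedModType R) (U : set V) (k : nat) (f : V -> R) : Prop :=
  {in U, continuous f} /\
  if k is j.+1 then (forall x v, U x -> derivable f x v) /\
                    (forall v, Cs U j (fun x => 'D_v f x))
  else True.

Definition smooth (V : normedModType R) (U : set V) f := forall k, Cs U k f.

Section general.
Context {V : normedModType R}.
Implicit Types (U : set V) (f g : V -> R).

Lemma Cs_continuous U k f : Cs U k f -> {in U, continuous f}.
Proof. by case: k => [|k] []. Qed.

Lemma CsW U k f : Cs U k.+1 f -> Cs U k f.
Proof.
elim: k f => [|k IH] f [cf [df Df]]; first by [].
by split=> //; split=> // v; apply: IH; exact: Df.
Qed.

Lemma Cs_sub U U' k f : U `<=` U' -> Cs U' k f -> Cs U k f.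
Proof.
move=> UU; elim: k f => [|k IH] f [cf /=].
  by split=> // x; rewrite inE => /UU Ux; apply: cf; rewrite inE.
case=> df Df; split; first by move=> x; rewrite inE => /UU Ux; apply: cf; rewrite inE.
by split=> [x v /UU Ux|v]; [exact: df|apply: IH; exact: Df].
Qed.

Lemma eq_near_open U f g x : open U -> {in U, f =1 g} -> U x -> \near x, f x = g x.
Proof.
move=> oU fg Ux; have : nbhs x U by exact: open_nbhs_nbhs.
by apply: filterS => y Uy; apply: fg; rewrite inE.
Qed.

Lemma Cs_ext U k f g : open U -> {in U, f =1 g} -> Cs U k f -> Cs U k g.
Proof.
move=> oU; elim: k f g => [|k IH] f g fg [cf /=].
  move=> _; split=> // x xU; have := cf x xU; rewrite /continuous_at (fg _ xU).
  by apply: cvg_trans; apply: near_eq_cvg; apply: (eq_near_open oU fg); exact/set_mem.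
case=> df Df; split; [|split] => [x xU|x v Ux|v].
- have := cf x xU; rewrite /continuous_at (fg _ xU).
  by apply: cvg_trans; apply: near_eq_cvg; apply: (eq_near_open oU fg); exact/set_mem.
- by apply: near_eq_derivable (df x v Ux); exact: (eq_near_open oU fg Ux).
- apply: IH (Df v) => x; rewrite inE => Ux; apply: near_eq_derive.
  by apply: (eq_near_open oU _ Ux) => y /fg.
Qed.

Lemma Cs_cst U k (c : R) : Cs U k (cst c).
Proof.
elim: k c => [|k IH] c /=.
  by split=> // x _; exact: cst_continuous.
split; first by move=> x _; exact: cst_continuous.
split=> // v; rewrite (_ : (fun x => _) = cst 0); first exact: IH.
by apply/funext => x; rewrite derive_cst.
Qed.

Lemma CsD U k f g : open U -> Cs U k f -> Cs U k g -> Cs U k (fun x => f x + g x).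
Proof.
move=> oU; elim: k f g => [|k IH] f g [cf /= hf] [cg /= hg].
  by split=> // x xU; apply: continuousD; [exact: cf|exact: cg].
case: hf hg => df Df [dg Dg].
split; first by move=> x xU; apply: continuousD; [exact: cf|exact: cg].
split=> [x v Ux|v]; first by apply: derivableD; [exact: df|exact: dg].
apply: (Cs_ext oU _ (IH _ _ (Df v) (Dg v))) => x; rewrite inE => Ux.
by rewrite -[LHS](deriveD (df x v Ux) (dg x v Ux)).
Qed.

Lemma CsM U k f g : open U -> Cs U k f -> Cs U k g -> Cs U k (fun x => f x * g x).
Proof.
move=> oU; elim: k f g => [|k IH] f g hf0 hg0.
  case: hf0 hg0 => [cf _] [cg _].
  by split=> // x xU; apply: continuousM; [exact: cf|exact: cg].
case: (hf0) (hg0) => [cf [df Df]] [cg [dg Dg]].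
split; first by move=> x xU; apply: continuousM; [exact: cf|exact: cg].
split=> [x v Ux|v]; first by apply: derivableM; [exact: df|exact: dg].
apply: (Cs_ext oU _ (CsD oU (IH _ _ (CsW hf0) (Dg v)) (IH _ _ (CsW hg0) (Df v)))).
move=> x; rewrite inE => Ux.
by rewrite -[LHS](deriveM (df x v Ux) (dg x v Ux)).
Qed.

Lemma Cs_prod U k (I : Type) (r : seq I) (F : I -> V -> R) : open U ->
  (forall i, Cs U k (F i)) -> Cs U k (fun x => \prod_(i <- r) F i x).
Proof.
move=> oU h; elim: r => [|i r IH].
  rewrite (_ : (fun x => _) = cst 1); first exact: Cs_cst.
  by apply/funext => x; rewrite big_nil.
rewrite (_ : (fun x => _) = (fun x => F i x * \prod_(j <- r) F j x)); first exact: CsM.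
by apply/funext => x; rewrite big_cons.
Qed.

(** Smoothness is local, and [U] and the complement of [K] are open sets that cover the space; on
    the second one [f] is 0. *)
Lemma Cs_glue U (K : set V) k f : open U -> closed K -> K `<=` U ->
  (forall x, ~ K x -> f x = 0) -> Cs U k f -> Cs setT k f.
Proof.
move=> oU cK KU; elim: k f => [|k IH] f f0 [cf /=].
  move=> _; split=> // x _; have [Kx|nKx] := pselect (K x).
    by apply: cf; rewrite inE; exact: KU.
  rewrite /continuous_at f0//; apply: (@cvg_trans _ (cst 0 @ x)); last exact: cvg_cst.
  apply: near_eq_cvg; apply: (@eq_near_open (~` K)) => //; first exact: closed_openC.
  by move=> y; rewrite inE => /f0.
move=> [df Df].
have n0 x : ~ K x -> \near x, cst 0 x = f x.
  move=> nKx; apply: (@eq_near_open (~` K)) => //; first exact: closed_openC.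
  by move=> y; rewrite inE => /f0.
split; [|split].
- move=> x _; have [Kx|nKx] := pselect (K x).
    by apply: cf; rewrite inE; exact: KU.
  rewrite /continuous_at f0//; apply: (@cvg_trans _ (cst 0 @ x)); last exact: cvg_cst.
  by apply: near_eq_cvg; exact: n0.
- move=> x v _; have [Kx|nKx] := pselect (K x); first by apply: df; exact: KU.
  by apply: near_eq_derivable (derivable_cst 0 x v); exact: n0.
- move=> v; apply: IH (Df v) => x nKx.
  by rewrite -(near_eq_derive v (n0 x nKx)) derive_cst.
Qed.

Lemma CsCk k f : Cs setT k f -> Ck k f.
Proof.
elim: k f => [|k IH] f [cf /=]; first by move=> _ x; apply: cf; rewrite inE.
by case=> df Df; split=> [x v|v]; [exact: df|apply: IH; exact: Df].
Qed.

(** [Ck k] asks for continuity of the derivatives of order [k] only; known for every [k], it gives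
    continuity at all orders. *)
Lemma Ck_smooth f : (forall k, Ck k f) -> smooth setT f.
Proof.
move=> h k; elim: k f h => [|k IH] f h.
  by split=> // x _; exact: (h 0%N).
split; first by move=> x _; exact: (h 0%N).
have [df _] := h 1%N; split=> [x v _|v]; first exact: df.
by apply: IH => j; have [_] := h j.+1; exact.
Qed.

Lemma smooth_D U f v : smooth U f -> smooth U (fun x => 'D_v f x).
Proof. by move=> h k; have [_ [_]] := h k.+1; exact. Qed.

Lemma smooth_derivable U f x v : smooth U f -> U x -> derivable f x v.
Proof. by move=> h; have [_ [+ _]] := h 1%N; exact. Qed.

End general.

(** Both difference quotients are the same function of [h]. *)
Lemma derivable_line (V W : normedModType R) (f : W -> R) (A : V -> W) (x v : V) (w : W) :
  (forall h : R, A (x + h *: v) = A x + h *: w) -> derivable f (A x) w ->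
  derivable (f \o A) x v /\ 'D_v (f \o A) x = 'D_w f (A x).
Proof.
move=> HA df.
have E : (fun h : R => h^-1 *: (((f \o A) \o shift x) (h *: v) - (f \o A) x)) =
         (fun h : R => h^-1 *: ((f \o shift (A x)) (h *: w) - f (A x))).
  by apply/funext => h /=; rewrite [h *: v + x]addrC HA [h *: w + _]addrC.
by split; rewrite /derivable /derive E.
Qed.

Lemma Cs_affine (V W : normedModType R) (f : W -> R) (A : V -> W) (L : V -> W)
    (U : set W) k :
  open U -> continuous A ->
  (forall x v (h : R), A (x + h *: v) = A x + h *: L v) -> Cs U k f ->
  Cs (A @^-1` U) k (f \o A).
Proof.
move=> oU cA HA; have oAU : open (A @^-1` U) by apply: open_comp.
elim: k f => [|k IH] f [cf /=].
  move=> _; split=> // x; rewrite inE => xU; apply: continuous_comp; first exact: cA.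
  by apply: cf; rewrite inE.
move=> [df Df]; split; [|split].
- move=> x; rewrite inE => xU; apply: continuous_comp; first exact: cA.
  by apply: cf; rewrite inE.
- by move=> x v Ux; have [] := derivable_line (HA x v) (df _ _ Ux).
- move=> v; apply: Cs_ext oAU _ (IH _ (Df (L v))) => x; rewrite inE => Ux.
  by have [_ ->] := derivable_line (HA x v) (df _ _ Ux).
Qed.

(** Restriction to the line through [x] with direction [v] reduces this to the chain rule in one
    variable. *)
Lemma derivable_comp1 (V : normedModType R) (g : R -> R) (f : V -> R) (x v : V) :
  derivable f x v -> derivable g (f x) 1 ->
  derivable (g \o f) x v /\ 'D_v (g \o f) x = 'D_1 g (f x) * 'D_v f x.
Proof.
move=> df dg.
pose l (h : R) : V := x + h *: v.
have l0 : l 0 = x by rewrite /l scale0r addr0.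
have Hl (y w h : R) : l (y + h *: w) = l y + h *: (w *: v).
  by rewrite /l scalerDl addrA scalerA.
have df' : derivable f (l 0) (1 *: v) by rewrite scale1r l0.
have [d1 D1] := derivable_line (Hl 0 1) df'.
have i1 : is_derive (0:R) 1 (f \o l) ('D_v f x).
  by apply: DeriveDef => //; rewrite D1 scale1r l0.
have i2 : is_derive ((f \o l) 0) 1 g ('D_1 g (f x)).
  have -> : (f \o l) 0 = f x by rewrite /= l0.
  by split.
have i3 := is_derive1_comp i2 i1.
have E : (fun h : R => h^-1 *: (((g \o (f \o l)) \o shift 0) (h *: (1:R)) - (g \o (f \o l)) 0)) =
         (fun h : R => h^-1 *: (((g \o f) \o shift x) (h *: v) - (g \o f) x)).
  apply/funext => h /=; rewrite l0 addr0 /l /= [_ + x]addrC.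
  by rewrite [h *: 1]mulr1.
have [d3 e3] := i3.
by split; [move: d3|rewrite -e3]; rewrite /derivable /derive E.
Qed.

Lemma Cs_comp1 (V : normedModType R) (g : R -> R) (f : V -> R) (U : set V) (W : set R) k :
  open U -> (forall x, U x -> W (f x)) -> Cs W k g -> Cs U k f -> Cs U k (g \o f).
Proof.
move=> oU UW; elim: k g f UW => [|k IH] g f UW hg hf.
  split=> // x xU; apply: continuous_comp; first exact: (Cs_continuous hf).
  by apply: (Cs_continuous hg); rewrite inE; apply: UW; exact/set_mem.
split.
  move=> x xU; apply: continuous_comp; first exact: (Cs_continuous hf).
  by apply: (Cs_continuous hg); rewrite inE; apply: UW; exact/set_mem.
case: (hg) (hf) => cg [dg Dg] [cf [df Df]].
split=> [x v Ux|v].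
  by have [] := derivable_comp1 (df x v Ux) (dg _ 1 (UW _ Ux)).
apply: Cs_ext oU _ (CsM oU (IH _ _ UW (Dg 1) (CsW hf)) (Df v)) => x; rewrite inE => Ux /=.
by have [_ ->] := derivable_comp1 (df x v Ux) (dg _ 1 (UW _ Ux)).
Qed.

(** Smoothness is asked only on an open set containing the support: test functions built from the
    similarity variables are products that are known to be smooth only before [t0]. *)
Lemma test_funI (V : normedModType R) (D U K : set V) (phi : V -> R) :
  open U -> compact K -> K `<=` D -> K `<=` U ->
  (forall x, ~ K x -> phi x = 0) -> smooth U phi -> test_fun D phi.
Proof.
move=> oU cK KD KU p0 sp.
have clK : closed K by apply: compact_closed => //; exact: norm_hausdorff.
have sK : closure [set x | phi x != 0] `<=` K.
  rewrite (closure_id K).1//; apply: closureS => x /= /eqP px.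
  by apply: contrapT => /p0.
split.
- by move=> k; apply: CsCk; exact: (Cs_glue oU clK KU p0).
- by apply: (subclosed_compact _ cK sK); exact: closed_closure.
- exact: subset_trans KD.
Qed.

End smooth.

Section hat.
Context {R : realType}.

Lemma derive1D (f : R -> R) (x v : R) : derivable f x 1 ->
  derivable f x v /\ 'D_v f x = v * 'D_1 f x.
Proof.
move=> /derivable1_diffP df; split; first exact: diff_derivable.
rewrite !deriveE// -[in LHS](mulr1 v).
have -> : v * 1 = v *: (1 : R) by [].
by rewrite linearZ.
Qed.

Lemma Cs1D (U : set R) k (f : R -> R) : open U -> {in U, continuous f} ->
  (forall x, U x -> derivable f x 1) -> Cs U k (fun x => 'D_1 f x) -> Cs U k.+1 f.
Proof.
move=> oU cf df Df; split=> //; split=> [x v Ux|v].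
  by have [] := derive1D v (df x Ux).
apply: (Cs_ext oU _ (CsM oU (Cs_cst U k v) Df)) => x; rewrite inE => Ux.
by have [_ ->] := derive1D v (df x Ux).
Qed.

(** The powers of [x^-1] are included so that the family is closed under differentiation; the case
    [n = 0] is the usual flat function [exp (- 1 / x)]. *)
Definition flat (n : nat) (x : R) : R :=
  if 0 < x then x^-1 ^+ n * expR (- x^-1) else 0.

Lemma flat_ge0 n x : 0 <= flat n x.
Proof.
rewrite /flat; case: ifPn => // x0.
by rewrite mulr_ge0 ?expR_ge0// exprn_ge0// invr_ge0 ltW.
Qed.

(** From [expR y >= 1 + y] at [y = x^-1 / n.+1], raised to the power [n.+1]. The bound gives the
    limit 0 at the origin. *)
Lemma flat_le n x : flat n x <= n.+1%:R ^+ n.+1 * `|x|.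
Proof.
rewrite /flat; case: ifPn => [x0|_]; last by rewrite mulr_ge0.
have y0 : 0 < x^-1 by rewrite invr_gt0.
have n0 : 0 < n.+1%:R :> R by [].
have h : (x^-1 / n.+1%:R) ^+ n.+1 <= expR x^-1.
  have -> : expR x^-1 = expR (n.+1%:R * (x^-1 / n.+1%:R)) by rewrite mulrC divfK// gt_eqF.
  rewrite expRM_natl.
  apply: lerXn2r; rewrite ?nnegrE ?expR_ge0// ?divr_ge0// ?ltW//.
  by apply: lt_le_trans (expR_ge1Dx _); rewrite ltrDr.
rewrite gtr0_norm// expRN ler_pdivrMr ?expR_gt0//.
rewrite -[leLHS]mul1r; apply: le_trans (_ : n.+1%:R ^+ n.+1 * x * (x^-1 / n.+1%:R) ^+ n.+1 <= _).
  rewrite expr_div_n [X in _ * (X / _)]exprS mul1r.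
  rewrite (_ : _ * _ = x^-1 ^+ n)//.
  have := expf_neq0 n.+1 (lt0r_neq0 n0); have := lt0r_neq0 x0.
  by move: (n.+1%:R ^+ n.+1) (x^-1 ^+ n) => A B x1 A1; field; rewrite ?x1 ?A1.
by apply: ler_wpM2l => //; rewrite mulr_ge0 ?exprn_ge0// ltW.
Qed.

Lemma flat_cvg0 n : flat n x @[x --> 0^'] --> (0 : R).
Proof.
apply: (@squeeze_cvgr _ _ _ _ (cst 0) (fun x => n.+1%:R ^+ n.+1 * `|x|)).
- by near=> x; rewrite flat_ge0 flat_le.
- exact: cvg_cst.
- rewrite -[X in _ --> X](mulr0 (n.+1%:R ^+ n.+1)); apply: cvgMr.
  have h : `|x| @[x --> (0 : R)] --> (`|0 : R| : R) by exact: (@norm_continuous R R 0).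
  by rewrite normr0 in h; apply: cvg_trans h; apply: cvg_app; exact: cvg_within.
Unshelve. all: by end_near. Qed.

Lemma is_derive_flat (n : nat) (x : R) : is_derive x 1 (flat n) (flat n.+2 x - n%:R * flat n.+1 x).
Proof.
have [x0|x0|x0] := ltgtP 0 x.
- pose g (y : R) := y^-1 ^+ n * expR (- y^-1).
  have gx : \near x, g x = flat n x.
    apply: (@eq_near_open R R `]0, +oo[%classic g (flat n) x) => //=.
      by move=> y; rewrite inE/= in_itv/= andbT /flat /g => ->.
    by rewrite in_itv/= andbT.
  have hV : is_derive x 1 (fun y : R => y^-1) (- x ^- 2).
    have := @is_deriveV R id x 1 1 (lt0r_neq0 x0) (is_derive_id _ _).
    by rewrite /GRing.scale/= mulr1.
  have hX : is_derive x 1 (fun y : R => y^-1 ^+ n) (n%:R * x^-1 ^+ n.-1 * (- x ^- 2)).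
    case: n {g gx} => [|n].
      by rewrite !mul0r; exact: (is_derive_cst (1 : R) x 1).
    have -> : (fun y : R => y^-1 ^+ n.+1) = (fun y : R => y^-1) ^+ n.+1.
      elim: (n.+1) => [|m IH]; first by [].
      by rewrite exprS -IH; apply/funext => y; rewrite exprS.
    exact: is_deriveX.
  have hE : is_derive x 1 (fun y : R => expR (- y^-1)) (expR (- x^-1) * (x ^- 2)).
    have hN : is_derive x 1 (fun y : R => - y^-1) (x ^- 2).
      by rewrite -[x ^- 2]opprK; exact: is_deriveN.
    exact: (is_derive1_comp (is_derive_expR _) hN).
  have [dg eg] := is_deriveM hX hE.
  apply: DeriveDef; first exact: near_eq_derivable gx dg.
  rewrite -(near_eq_derive _ gx) -[LHS]/('D_1 ((fun y : R => y^-1 ^+ n) * (fun y : R => expR (- y^-1))) x) eg.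
  rewrite /flat x0 /GRing.scale/= !exprVn.
  have xn0 := lt0r_neq0 x0.
  case: n {g gx hX dg eg} => [|n] /=.
    by rewrite !mul0r mulr0 addr0 subr0 expr0 invr1 mul1r mulrC.
  by rewrite -!exprVn !exprS; ring.
- have h0 : \near x, cst 0 x = flat n x.
    apply: (@eq_near_open R R `]-oo, 0[%classic (cst 0) (flat n) x) => //=.
      by move=> y; rewrite inE/= in_itv/= /flat => y0; rewrite ltNge ltW.
  apply: DeriveDef; first exact: near_eq_derivable h0 (derivable_cst _ _ _).
  rewrite -(near_eq_derive _ h0) derive_cst /flat ltNge ltW//=.
  by rewrite mulr0 subr0.
- rewrite -x0 {x x0}.
  (* The difference quotient of [flat n] at 0 is [flat n.+1] itself, which tends to 0. *)
  have E : \forall h \near (0:R)^', flat n.+1 h = h^-1 *: ((flat n \o shift 0) (h *: (1 : R)) - flat n 0).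
    near=> h; have h0 : h != 0 by near: h; exact: nbhs_dnbhs_neq.
    rewrite /= addr0 /GRing.scale/= mulr1 {3}/flat ltxx subr0 /flat.
    by case: ifPn => _; rewrite ?mulr0// exprS mulrA.
  have c : h^-1 *: ((flat n \o shift 0) (h *: (1 : R)) - flat n 0) @[h --> (0:R)^'] --> (0 : R).
    by apply: cvg_trans (flat_cvg0 n.+1); exact: near_eq_cvg.
  apply: DeriveDef; first by apply/cvg_ex; exists 0.
  rewrite /derive; apply: etrans (cvg_lim _ c) _ => //.
  by rewrite /flat ltxx mulr0 subr0.
Unshelve. all: by end_near. Qed.

Lemma Cs_flat k n : Cs setT k (flat n).
Proof.
have c m : {in [set: R], continuous (flat m)}.
  move=> x _; apply: differentiable_continuous; apply/derivable1_diffP.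
  by have [] := is_derive_flat m x.
elim: k n => [|k IH] n; first by split.
apply: Cs1D => //; first exact: openT.
  by move=> x _; have [] := is_derive_flat n x.
apply: (Cs_ext openT (f := fun x => flat n.+2 x + (- n%:R) * flat n.+1 x)).
  by move=> x _; have [_ ->] := is_derive_flat n x; rewrite mulNr.
by apply: CsD openT _ _ => //; apply: CsM openT _ _ => //; exact: Cs_cst.
Qed.

(** The parameter [k] steepens the bump: its values stay between 0 and 1 and tend to the indicator
    of []a, b[]. With rational end points these bumps form a countable family. *)
Definition hat (k : nat) (a b x : R) : R :=
  flat 0 (k.+1%:R * (x - a)) * flat 0 (k.+1%:R * (b - x)).

Lemma Cs_lin j (c d : R) : Cs [set: R] j (fun x : R => c * x + d).
Proof.
have := @Cs_affine R R R id (fun x => c * x + d) (fun v => c * v) setT j openT.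
apply.
- move=> x; apply: cvgD; last exact: cvg_cst.
  by apply: cvgMr; exact: cvg_id.
- by move=> x v h; rewrite /GRing.scale/=; ring.
- elim: j => [|j IH]; first by split=> // x _; exact: cvg_id.
  split; first by move=> x _; exact: cvg_id.
  split=> [x v _|v]; first exact: derivable_id.
  rewrite (_ : (fun x => _) = cst v); first exact: Cs_cst.
  by apply/funext => x; rewrite derive_id.
Qed.

Lemma smooth_hat k a b : smooth setT (hat k a b).
Proof.
move=> j; apply: CsM openT _ _.
  apply: (Cs_comp1 (W := setT) openT _ (Cs_flat j 0)) => //.
  apply: (Cs_ext openT _ (Cs_lin j k.+1%:R (- (k.+1%:R * a)))) => x _; ring.
apply: (Cs_comp1 (W := setT) openT _ (Cs_flat j 0)) => //.
apply: (Cs_ext openT _ (Cs_lin j (- k.+1%:R) (k.+1%:R * b))) => x _; ring.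
Qed.

Lemma flat0_le1 x : flat 0 x <= 1.
Proof.
rewrite /flat; case: ifPn => // x0; rewrite expr0 mul1r -[leRHS]expR0 ler_expR.
by rewrite oppr_le0 invr_ge0 ltW.
Qed.

Lemma hat_ge0 k a b x : 0 <= hat k a b x.
Proof. by rewrite mulr_ge0// flat_ge0. Qed.

Lemma hat_le1 k a b x : hat k a b x <= 1.
Proof. by rewrite mulr_ile1 ?flat_ge0 ?flat0_le1. Qed.

Lemma hat_out k a b x : x \notin `]a, b[ -> hat k a b x = 0.
Proof.
rewrite in_itv/= negb_and -!leNgt /hat /flat => /orP[h|h].
  by rewrite ltNge pmulr_rle0// subr_le0 h mul0r.
by rewrite [X in _ * (if X then _ else _)]ltNge pmulr_rle0// subr_le0 h mulr0.
Qed.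

Lemma flat0_cvg1 (y : R) : 0 < y -> (fun k => flat 0 (k.+1%:R * y)) @ \oo --> (1 : R).
Proof.
move=> y0.
rewrite (_ : (fun k => _) = (fun k => expR (- (k.+1%:R^-1 * y^-1)))); last first.
  by apply/funext => k; rewrite /flat mulr_gt0// expr0 mul1r invfM.
rewrite -[X in _ --> X]expR0; apply: continuous_cvg; first exact: continuous_expR.
rewrite -oppr0 -[X in - X](mul0r y^-1); apply: cvgN; apply: cvgMl.
exact: cvg_harmonic.
Qed.

Lemma hat_cvg a b x : (fun k => hat k a b x) @ \oo --> (\1_(`]a, b[) x : R).
Proof.
rewrite indicE; case: (boolP (x \in _)) => [|].
  rewrite inE/= in_itv/= => /andP[ax xb].
  rewrite -[X in _ --> X](mulr1 (1 : R)); apply: cvgM; apply: flat0_cvg1.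
    by rewrite subr_gt0.
  by rewrite subr_gt0.
rewrite notin_setE => /negP h.
rewrite (_ : (fun k => _) = cst 0); first exact: cvg_cst.
by apply/funext => k; rewrite hat_out.
Qed.

Lemma measurable_hat k a b : measurable_fun setT (hat k a b).
Proof.
apply: continuous_measurable_fun => x.
by apply: (Cs_continuous (smooth_hat k a b 0)); rewrite inE.
Qed.

End hat.

Section patch.
Context d (T : measurableType d) (R : realType) (mu : {measure set T -> \bar R}).

Lemma integrable_patch (D : set T) (f : T -> R) : measurable D ->
  mu.-integrable D (EFin \o f) <-> mu.-integrable setT (EFin \o (f \_ D)).
Proof.
move=> mD; rewrite integrable_mkcond//.
suff -> : (EFin \o f) \_ D = EFin \o (f \_ D) by [].
by apply/funext => x; rewrite /= !patchE; case: ifPn.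
Qed.

Lemma ae_eq_Rintegral (D : set T) (f g : T -> R) : measurable D ->
  measurable_fun D f -> measurable_fun D g ->
  {ae mu, forall x, D x -> f x = g x} ->
  \int[mu]_(x in D) f x = \int[mu]_(x in D) g x.
Proof.
move=> mD mf mg fg; rewrite /Rintegral; congr fine; apply: ae_eq_integral => //.
- exact/measurable_EFinP.
- exact/measurable_EFinP.
- by apply: filterS fg => x + Dx => ->.
Qed.

Lemma measurable_fun_int (D : set T) (f : T -> R) :
  mu.-integrable D (EFin \o f) -> measurable_fun D f.
Proof. by move=> intf; apply/measurable_EFinP; exact: measurable_int intf. Qed.

End patch.

(** * The fundamental lemma of the calculus of variations in one dimension *)

Section fundamental_lemma_1d.
Context {R : realType}.
Local Notation lam := (@lebesgue_measure R).

Lemma ae_and d (T : measurableType d) (mu : {measure set T -> \bar R}) (P Q : T -> Prop) :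
  {ae mu, forall x, P x} -> {ae mu, forall x, Q x} -> {ae mu, forall x, P x /\ Q x}.
Proof. by move=> aP aQ; apply: filterS2 aP aQ => x. Qed.

Lemma ae_neq (c : R) : {ae lam, forall t : measurableTypeR R, (t : R) != c}.
Proof.
exists [set c]; split=> //; first exact: lebesgue_measure_set1.
by move=> t /= /negP; rewrite negbK => /eqP.
Qed.

Lemma ae_countable d (T : measurableType d) (mu : {measure set T -> \bar R})
    (I : countType) (P : I -> T -> Prop) :
  (forall i, {ae mu, forall x, P i x}) -> {ae mu, forall x, forall i, P i x}.
Proof.
move=> h.
have : {ae mu, forall x, forall n, forall i : I, pickle_inv n = Some i -> P i x}.
  apply: ae_foralln => n; case E : (pickle_inv n) => [i|]; last exact: aeW.
  by apply: filterS (h i) => x Px j [<-].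
by apply: filterS => x Px i; apply: (Px (pickle i)); exact: pickleK_inv.
Qed.

Lemma eq_const_of_rat (c d K : R) (F : R -> R) : {in `]c, d[, continuous F} ->
  (forall p : rat, (ratr p : R) \in `]c, d[ -> F (ratr p) = K) ->
  forall x, x \in `]c, d[ -> F x = K.
Proof.
move=> cF FK x xcd; apply/eqP; apply: contrapT => /negP neq.
have oN : open [set y : R | y != K] by exact: open_neq.
have : nbhs x (F @^-1` [set y | y != K] `&` `]c, d[%classic).
  apply: filterI; last by apply: open_nbhs_nbhs; split => //; exact: interval_open.
  by apply: cF => //; exact: open_nbhs_nbhs.
move=> /rat_base_R[[q k] /= _ sub].
have /sub[/= /eqP + qcd] : `|ratr q - ratr q| < k.+1%:R^-1 :> R.
  by rewrite subrr normr0 invr_gt0.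
by apply; apply: FK.
Qed.

(** As [k] grows, dominated convergence replaces the bumps by indicators of rational intervals.
    Hence the primitive of [h] takes a single value at rational points, and is constant by
    continuity. *)
Lemma ae0_of_bumps (c d : R) (h : R -> R) : c < d ->
  lam.-integrable `[c, d] (EFin \o h) ->
  (forall k (p q : rat), c < ratr p -> ratr p < ratr q :> R -> ratr q < d ->
    \int[lam]_t (h t * hat k (ratr p) (ratr q) t) = 0) ->
  {ae lam, forall t : measurableTypeR R, (t : R) \in `[c, d] -> h t = 0}.
Proof.
move=> cd inth h0; pose f := h \_ `[c, d].
have intf : lam.-integrable setT (EFin \o f).
  exact: (@integrable_patch _ (measurableTypeR R) R lam `[c, d]%classic h (measurable_itv _)).1 inth.
have mf : measurable_fun setT f by apply/measurable_EFinP; exact: measurable_int intf.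
have intfD (i : interval R) : lam.-integrable [set` i] (EFin \o f).
  exact: integrableS intf.
have S1 (p q : rat) : c < ratr p -> ratr p < ratr q :> R -> ratr q < d ->
    \int[lam]_(t in `]ratr p, ratr q[) f t = 0.
  move=> cp pq qd.
  have fb k t : f t * hat k (ratr p) (ratr q) t = h t * hat k (ratr p) (ratr q) t.
    rewrite /f patchE; case: ifPn => //; rewrite notin_setE => /negP tcd.
    rewrite hat_out ?mulr0//; apply: contra tcd; rewrite !in_itv/= => /andP[pt tq].
    by rewrite (ltW (lt_trans cp pt)) (ltW (lt_trans tq qd)).
  have := @dominated_cvg _ _ _ lam setT measurableT
    (fun k t => (f t * hat k (ratr p) (ratr q) t)%:E)
    (fun t => (f t * \1_(`]ratr p, ratr q[) t)%:E) (fun t => `|f t|%:E).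
  move=> /(_ _ _ _ _ _)/cvg_lim H.
  rewrite Rintegral_mkcond /Rintegral.
  rewrite (_ : (fun x => _) = (fun t => (f t * \1_(`]ratr p, ratr q[) t)%:E)); last first.
    apply/funext => t; rewrite patchE indicE; case: ifPn => _; rewrite ?mulr1// mulr0//.
  rewrite -H//.
  - rewrite (_ : (fun k => _) = cst 0%E); first by rewrite lim_cst.
    apply/funext => k.
    have : \int[lam]_t (f t * hat k (ratr p) (ratr q) t) = 0.
      by rewrite -(h0 k p q cp pq qd); apply: eq_Rintegral => t _; exact: fb.
    rewrite /Rintegral => /eqP; rewrite fine_eq0; first by move/eqP.
    apply: integrable_fin_num => //.
    apply: le_integrable intf => //.
      by apply/measurable_EFinP; apply: measurable_funM => //; exact: measurable_hat.
    move=> t _ /=; rewrite lee_fin normrM ler_piMr// ger0_norm ?hat_ge0//.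
    exact: hat_le1.
  - by move=> k; apply/measurable_EFinP; apply: measurable_funM => //; exact: measurable_hat.
  - move=> t _; apply: cvg_EFin; first exact: nearW.
    by apply: cvgMr; exact: hat_cvg.
  - exact: (integrable_norm intf).
  - move=> k t _; rewrite /= lee_fin normrM ler_piMr// ger0_norm ?hat_ge0//.
    exact: hat_le1.
pose F x := \int[lam]_(t in `[c, x]) f t.
have S2 (p q : rat) : c < ratr p -> ratr p < ratr q :> R -> ratr q < d ->
    F (ratr p) = F (ratr q).
  move=> cp pq qd; apply/esym/eqP; rewrite -subr_eq0 /F; apply/eqP.
  rewrite Rintegral_itvB//= ?bnd_simp//; [|exact: ltW|exact: ltW].
  by rewrite -Rintegral_itv_bndo_bndc// S1.
have cF : {in `]c, d[, continuous F}.
  move=> x xcd; apply: (within_continuous_continuous cd _ xcd).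
  by apply: parameterized_integral_continuous => //; exact: ltW.
have [q0] : exists q0 : rat, (ratr q0 : R) \in `]c, d[.
  by have [q qi] := rat_in_itvoo cd; exists q.
rewrite in_itv/= => /andP[cq0 q0d].
have FK := @eq_const_of_rat c d (F (ratr q0)) F cF.
have {}FK x : x \in `]c, d[ -> F x = F (ratr q0).
  apply: FK => p; rewrite in_itv/= => /andP[cp pd].
  by have [pq|qp|->//] := ltgtP (ratr p : R) (ratr q0); [exact: S2|apply/esym; exact: S2].
have locf : locally_integrable [set: R] f.
  by have := integrable_locally (measurable_itv _) inth.
(* Lebesgue differentiation: almost everywhere [f] is the derivative of its primitive, which is
   constant inside. The two end points are discarded as null. *)
have := @FTC1 R f (BLeft c) (fun y => intfD _) locf.
move=> /ae_and /(_ (ae_and (ae_neq c) (ae_neq d))).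
apply: filterS => t [/= Ft [tc td]] tcd.
have tcd' : t \in `]c, d[.
  by move: tcd; rewrite !in_itv/= !le_eqVlt (negbTE td) (eq_sym c) (negbTE tc).
have ct : (c < t)%R by move: tcd'; rewrite in_itv/= => /andP[].
have := Ft; rewrite lte_fin => /(_ ct)[_ Ft'].
have ft : f t = h t by rewrite /f patchE mem_set.
rewrite -ft -Ft' derive1E.
rewrite (@near_eq_derive _ _ _ F (cst (F (ratr q0)))) ?derive_cst//.
apply: (@eq_near_open R R `]c, d[%classic F (cst (F (ratr q0))) t) => //.
by move=> y; rewrite inE/= => ycd; rewrite FK.
Qed.

End fundamental_lemma_1d.

(** * Countable families of bumps that separate functions *)

Section separating.
Context {R : realType}.

(** The sets [Q N] form an exhaustion on which [h] is integrable. Only the members of the family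
    supported in some [Q N] are tested, so that the pairings are integrals of integrable functions
    when the members are bounded and measurable. *)
Definition separating d (T : measurableType d) (mu : {measure set T -> \bar R})
    (I : Type) (B : I -> T -> R) (Q : nat -> set T) : Prop :=
  forall h : T -> R, (forall N, mu.-integrable (Q N) (EFin \o h)) ->
    (forall i, (exists N, forall x, B i x != 0 -> Q N x) ->
       \int[mu]_x (h x * B i x) = 0) ->
    {ae mu, forall x, (exists N, Q N x) -> h x = 0}.

Lemma Rintegral_supp d (T : measurableType d) (mu : {measure set T -> \bar R})
    (D : set T) (h B : T -> R) : (forall x, B x != 0 -> D x) ->
  \int[mu]_x (h x * B x) = \int[mu]_(x in D) (h x * B x).
Proof.
move=> BD; rewrite [RHS]Rintegral_mkcond; apply: eq_Rintegral => x _.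
rewrite patchE; case: ifPn => //; rewrite notin_setE => nD.
have [->|/BD//] := eqVneq (B x) 0; by rewrite mulr0.
Qed.

Lemma integrable_bounded_mul d (T : measurableType d) (mu : {measure set T -> \bar R})
    (D : set T) (h B : T -> R) (M : R) : measurable D -> measurable_fun D B ->
  (forall x, D x -> `|B x| <= M) -> mu.-integrable D (EFin \o h) ->
  mu.-integrable D (EFin \o (fun x => h x * B x)).
Proof.
move=> mD mB BM inth; apply: le_integrable (integrableZl mD M inth) => //.
  apply/measurable_EFinP; apply: measurable_funM => //; apply/measurable_EFinP.
  exact: measurable_int inth.
move=> x Dx /=; rewrite lee_fin !normrM mulrC ler_wpM2r//.
by apply: le_trans (BM x Dx) _; exact: ler_norm.
Qed.

(** For a fixed [i] the pairing of the slices with [B1 i] is a function of the second variable that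
    is orthogonal to the second family, hence zero almost everywhere. As [I1] is countable, one null
    set serves for all [i], and the first family then applies on each remaining slice. *)
Lemma separating_prod d1 d2 (T1 : measurableType d1) (T2 : measurableType d2)
    (m1 : {sigma_finite_measure set T1 -> \bar R})
    (m2 : {sigma_finite_measure set T2 -> \bar R})
    (I1 I2 : countType) (B1 : I1 -> T1 -> R) (B2 : I2 -> T2 -> R)
    (Q1 : nat -> set T1) (Q2 : nat -> set T2) :
  (forall N, measurable (Q1 N)) -> (forall N, measurable (Q2 N)) ->
  (forall N M, (N <= M)%N -> Q1 N `<=` Q1 M) ->
  (forall N M, (N <= M)%N -> Q2 N `<=` Q2 M) ->
  (forall i, measurable_fun setT (B1 i)) -> (forall i, measurable_fun setT (B2 i)) ->
  (forall i x, `|B1 i x| <= 1) -> (forall i x, `|B2 i x| <= 1) ->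
  separating m1 B1 Q1 -> separating m2 B2 Q2 ->
  separating (m1 \x m2)%E (fun i z => B1 i.1 z.1 * B2 i.2 z.2)
    (fun N => Q1 N `*` Q2 N).
Proof.
move=> mQ1 mQ2 ndQ1 ndQ2 mB1 mB2 B11 B21 sep1 sep2 h inth hB.
have mQ N : measurable (Q1 N `*` Q2 N) by exact: measurableX.
pose hN N := h \_ (Q1 N `*` Q2 N).
have ihN N : (m1 \x m2)%E.-integrable setT (EFin \o hN N).
  exact: (@integrable_patch _ _ _ _ _ h (mQ N)).1 (inth N).
have hNE N t : Q2 N t -> forall y, Q1 N y -> hN N (y, t) = h (y, t).
  by move=> Qt y Qy; rewrite /hN patchE mem_set.
have mfst (f : T1 -> R) : measurable_fun setT f ->
    measurable_fun setT (fun z : T1 * T2 => f z.1).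
  by move=> mf; exact: (measurable_funT_comp mf measurable_fst).
have msnd (f : T2 -> R) : measurable_fun setT f ->
    measurable_fun setT (fun z : T1 * T2 => f z.2).
  by move=> mf; exact: (measurable_funT_comp mf measurable_snd).
have aeH (i : I1) : {ae m2, forall t, (exists N, Q2 N t) ->
    (exists N, forall x, B1 i x != 0 -> Q1 N x) -> \int[m1]_x (h (x, t) * B1 i x) = 0}.
  have [[N0 BN0]|nN0] := pselect (exists N, forall x, B1 i x != 0 -> Q1 N x); last first.
    by apply: aeW => t _ /nN0.
  have ihB N : (m1 \x m2)%E.-integrable setT (EFin \o (fun z => hN N z * B1 i z.1)).
    apply: (@integrable_bounded_mul _ _ _ _ _ _ 1) => //; exact: mfst.
  have HE N t : (N0 <= N)%N -> Q2 N t ->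
      \int[m1]_x (h (x, t) * B1 i x) = \int[m1]_x (hN N (x, t) * B1 i x).
    move=> NN Qt; apply: eq_Rintegral => x _.
    have [->|/BN0 Qx] := eqVneq (B1 i x) 0; first by rewrite !mulr0.
    by rewrite (hNE N t Qt)//; exact: ndQ1 Qx.
  suff : {ae m2, forall t, (exists N, Q2 N t) -> \int[m1]_x (h (x, t) * B1 i x) = 0}.
    by apply: filterS => t + Qt _; exact.
  apply: sep2.
    move=> N; pose M := maxn N N0.
    apply: (@integrableS _ _ _ _ (Q2 M)) => //; first by apply: ndQ2; exact: leq_maxl.
    apply: (@eq_integrable _ _ _ m2 _ (mQ2 M) (EFin \o (fun t => \int[m1]_x (hN M (x, t) * B1 i x)))) => //.
      by move=> t; rewrite inE => Qt /=; rewrite (HE M t)//; exact: leq_maxr.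
    by apply: integrableS (integrable_Rfubini2 (ihB M)).
  move=> j [N1 BN1]; pose M := maxn N0 N1.
  have := hB (i, j) _; rewrite /=.
  have supp z : B1 i z.1 * B2 j z.2 != 0 -> (Q1 M `*` Q2 M) z.
    rewrite mulf_eq0 negb_or => /andP[/BN0 b1 /BN1 b2]; split.
      by apply: ndQ1 b1; exact: leq_maxl.
    by apply: ndQ2 b2; exact: leq_maxr.
  move=> /(_ (ex_intro _ M supp)) <-.
  transitivity (\int[(m1 \x m2)%E]_z (hN M z * B1 i z.1 * B2 j z.2)); last first.
    apply: eq_Rintegral => z _; rewrite -mulrA.
    have [->|/supp Qz] := eqVneq (B1 i z.1 * B2 j z.2) 0; first by rewrite !mulr0.
    by rewrite /hN patchE mem_set.
  rewrite Rintegral21_prod/=; last first.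
    apply: (@integrable_bounded_mul _ _ _ _ _ _ 1) => //; exact: msnd.
  have ihBB : (m1 \x m2)%E.-integrable setT
      (EFin \o (fun z => hN M z * B1 i z.1 * B2 j z.2)).
    by apply: (@integrable_bounded_mul _ _ _ _ _ _ 1) => //; exact: msnd.
  have E t : m1.-integrable setT (fun x => (hN M (x, t) * B1 i x)%:E) ->
      \int[m1]_x (h (x, t) * B1 i x) * B2 j t =
      \int[m1]_x (hN M (x, t) * B1 i x * B2 j t).
    move=> it; rewrite RintegralZr//.
    have [->|/BN1 Qt] := eqVneq (B2 j t) 0; first by rewrite !mulr0.
    congr (_ * _); apply: HE; first exact: leq_maxl.
    by apply: ndQ2 Qt; exact: leq_maxr.
  have mR := measurable_fun_int (integrable_Rfubini2 ihBB).
  have suppH t : B2 j t != 0 -> Q2 M t.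
    by move=> /BN1; apply: ndQ2; exact: leq_maxr.
  rewrite (@Rintegral_supp _ _ m2 (Q2 M) _ _ suppH) [RHS](_ : _ = \int[m2]_(t in Q2 M) \int[m1]_x (hN M (x, t) * B1 i x * B2 j t)); last first.
    rewrite [RHS]Rintegral_mkcond; apply: eq_Rintegral => t _.
    rewrite patchE; case: ifPn => //; rewrite notin_setE => nQ.
    have -> : B2 j t = 0 by apply/eqP; apply: contrapT => /negP /suppH.
    by rewrite /Rintegral integral0_eq// => x _; rewrite mulr0.
  apply: ae_eq_Rintegral => //.
  - apply: measurable_funM; last exact: measurable_funS (mB2 j).
    apply: (eq_measurable_fun (fun t => \int[m1]_x (hN M (x, t) * B1 i x))).
      by move=> t; rewrite inE => Qt; rewrite (HE M t)//; exact: leq_maxl.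
    exact: measurable_funS (measurable_fun_int (integrable_Rfubini2 (ihB M))).
  - exact: measurable_funS mR.
  - by apply: filterS (ae_integrable2 (ihB M)) => t it _; exact: E.
have aeI : {ae m2, forall t, forall N, m1.-integrable setT (fun x => (hN N (x, t))%:E)}.
  by apply: ae_foralln => N; exact: ae_integrable2 (ihN N).
have {aeH aeI} ae0 : {ae m2, forall t, (exists N, Q2 N t) ->
    {ae m1, forall x, (exists N, Q1 N x) -> h (x, t) = 0}}.
  apply: filterS2 (ae_countable aeH) aeI => t Ht It [M QM].
  apply: sep1 => [N|i Bi]; last by apply: Ht => //; exists M.
  pose K := maxn N M.
  have QK : Q2 K t by apply: ndQ2 QM; exact: leq_maxr.
  apply: (@integrableS _ _ _ _ (Q1 K)) => //; first by apply: ndQ1; exact: leq_maxl.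
  apply: (@eq_integrable _ _ _ m1 _ (mQ1 K) (fun x => (hN K (x, t))%:E)) => //.
    by move=> x; rewrite inE => Qx /=; rewrite (hNE K t QK).
  exact: integrableS (It K).
(* The slices of [h] vanish almost everywhere, for almost every [t]. The set where [h] is nonzero is
   measurable on each [Q1 N * Q2 N], so Tonelli makes it null in the product. *)
have mbad N : measurable ((Q1 N `*` Q2 N) `&` [set z | h z != 0]).
  have mh := measurable_fun_int (inth N).
  have := mh (mQ N) [set~ 0] (measurableC (measurable_set1 0)).
  rewrite (_ : h @^-1` _ = [set z | h z != 0])//.
  by apply/seteqP; split=> z /= /eqP.
have bad0 N : (m1 \x m2)%E ((Q1 N `*` Q2 N) `&` [set z | h z != 0]) = 0%E.
  set A := _ `&` _.
  rewrite -(setIT A) -integral_indic//; last exact: mbad.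
  rewrite fubini_tonelli2//=; last first.
    by apply/measurable_EFinP; exact: measurable_indic (mbad N).
  rewrite /fubini_G /=; apply/eqP.
  rewrite (ae_eq_integral (cst 0%E)) ?integral0//.
    apply: (measurable_fun_fubini_tonelli_G (fun z => (\1_A z)%:E)) => //=.
    by apply/measurable_EFinP; exact: measurable_indic (mbad N).
  apply: filterS ae0 => t ht _ /=.
  have [Qt|nQt] := pselect (Q2 N t); last first.
    apply: integral0_eq => x _; rewrite indicE /A; case: (boolP (_ \in _)) => //.
    by rewrite inE => -[[/= _ /nQt]].
  rewrite (ae_eq_integral (cst 0%E)) ?integral0//.
    apply/measurable_EFinP; apply: (measurable_funT_comp (measurable_indic (mbad N))).
    exact: pair2_measurable.
  apply: filterS (ht (ex_intro _ N Qt)) => x hx _ /=.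
  rewrite indicE /A; case: (boolP (_ \in _)) => //.
  by rewrite inE => -[[/= Qx _] /eqP]; rewrite hx//; exists N.
have : {ae (m1 \x m2)%E, forall z, forall N, (Q1 N `*` Q2 N) z -> h z = 0}.
  apply: ae_foralln => N; exists ((Q1 N `*` Q2 N) `&` [set z | h z != 0]).
  split; [exact: mbad|exact: bad0|].
  by move=> z /= /not_implyP[Qz /eqP hz].
by apply: filterS => z hz [N]; exact: hz.
Qed.

End separating.

Section rV.
Context {R : realType}.
Local Notation lam := (@lebesgue_measure R).

Definition bump_index := (nat * rat * rat)%type.

Definition bumpI (i : bump_index) : R -> R := hat i.1.1 (ratr i.1.2) (ratr i.2).

Lemma separating_R (c d : nat -> R) : (forall N, c N < d N) ->
  separating lam bumpI (fun N => `[c N, d N]%classic : set (measurableTypeR R)).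
Proof.
move=> cd h inth hB.
have : {ae lam, forall t : measurableTypeR R, forall N, (t : R) \in `[c N, d N] -> h t = 0}.
  apply: ae_foralln => N; apply: ae0_of_bumps => // k p q cp pq qd.
  apply: (hB (k, p, q)); exists N => x /=.
  apply: contraNP => xN; apply/eqP; rewrite /bumpI hat_out//; apply/negP.
  rewrite in_itv/= => /andP[px xq]; apply: xN; rewrite /= in_itv/=.
  by rewrite (ltW (lt_trans cp px)) (ltW (lt_trans xq qd)).
by apply: filterS => t ht [N]; exact: ht.
Qed.

Definition rV_unsnoc n (x : 'rV[R]_n.+1) : 'rV[R]_n * R :=
  (\row_j x ord0 (lift ord_max j), x ord0 ord_max).

Lemma rV_unsnocK n (x : 'rV[R]_n.+1) : rsnoc (rV_unsnoc x) = x.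
Proof.
apply/rowP => i; rewrite mxE; case: unliftP => [j ->|->] //=.
by rewrite mxE.
Qed.

Lemma rsnocK n (p : 'rV[R]_n * R) : rV_unsnoc (rsnoc p) = p.
Proof.
case: p => x a; rewrite /rV_unsnoc /rsnoc !mxE unlift_none; congr pair.
by apply/rowP => j; rewrite !mxE liftK.
Qed.

Lemma measurable_rV_unsnoc n :
  measurable_fun setT (@rV_unsnoc n : _ -> 'rV[R]_n * measurableTypeR R).
Proof.
apply: measurable_fun_pair; last exact: measurable_coord.
apply: measurable_fun_coord => i.
under eq_fun do rewrite mxE; exact: measurable_coord.
Qed.

Lemma integrable_rsnoc n (D : set 'rV[R]_n.+1) (f : 'rV[R]_n.+1 -> R) :
  measurable D -> (leb R n.+1).-integrable D (EFin \o f) ->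
  (leb R n \x lam)%E.-integrable (@rsnoc R n @^-1` D) (EFin \o (f \o @rsnoc R n)).
Proof.
move=> mD /integrableP[mf foo]; apply/integrableP; split.
  move=> _ Y mY; have := @measurable_rsnoc R n measurableT _ (mf mD Y mY).
  by rewrite setTI preimage_setI.
rewrite (_ : integral _ _ _ = \int[leb R n.+1]_(x in D) `|(EFin \o f) x|)%E//.
transitivity (\int[pushforward (leb R n \x lam) (@rsnoc R n)]_(x in D) `|(EFin \o f) x|)%E; last by [].
rewrite ge0_integral_pushforward//; first exact: measurable_rsnoc.
exact: measurableT_comp.
Qed.

Lemma Rintegral_rsnoc n (f : 'rV[R]_n.+1 -> R) :
  (leb R n.+1).-integrable setT (EFin \o f) ->
  \int[leb R n.+1]_x f x = \int[(leb R n \x lam)%E]_z f (rsnoc z).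
Proof.
move=> intf; rewrite /Rintegral; congr fine.
have := @integral_pushforward _ _ _ _ R _ (@measurable_rsnoc R n)
  (leb R n \x lam)%E setT (EFin \o f) (measurable_int _ intf).
rewrite preimage_setT; apply=> //.
by have := integrable_rsnoc measurableT intf.
Qed.

Lemma ae_rsnoc n (P : 'rV[R]_n.+1 -> Prop) :
  {ae (leb R n \x lam)%E, forall z, P (rsnoc z)} -> {ae leb R n.+1, forall x, P x}.
Proof.
move=> [A [mA A0 sub]]; exists (@rV_unsnoc n @^-1` A); split.
- by rewrite -[X in measurable X]setTI; exact: measurable_rV_unsnoc.
- rewrite -A0 -[LHS]/((leb R n \x lam)%E (@rsnoc R n @^-1` (@rV_unsnoc n @^-1` A))).
  congr (_ _); apply/seteqP; split=> z; by rewrite /= rsnocK.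
- by move=> x /= nP; apply: sub => /=; rewrite rV_unsnocK.
Qed.

Definition rV_index n := {ffun 'I_n -> bump_index}.

Definition rV_bump n (I : rV_index n) (x : 'rV[R]_n) : R :=
  \prod_(i < n) bumpI (I i) (x ord0 i).

Definition rV_box n (N : nat) : set 'rV[R]_n :=
  [set x | forall i, x ord0 i \in `[- N.+1%:R, N.+1%:R]].

Lemma measurable_rV_box n N : measurable (@rV_box n N).
Proof.
rewrite (_ : rV_box N = \bigcap_(i in setT)
   [set x : 'rV[R]_n | x ord0 i \in `[- N.+1%:R, N.+1%:R]]).
  apply: fin_bigcap_measurable => [|i _]; first exact: finite_finset.
  rewrite -[X in measurable X]setTI.
  rewrite (_ : [set x | _] = (fun x : 'rV[R]_n => x ord0 i) @^-1`
     `[- N.+1%:R, N.+1%:R]%classic)//.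
  by apply: measurable_coord => //; exact: measurable_itv.
by apply/seteqP; split=> x h; [move=> i _ /=|move=> i]; exact: h.
Qed.

Lemma measurable_rV_bump n (I : rV_index n) : measurable_fun setT (rV_bump I).
Proof.
apply: measurable_prod => i _.
exact: (measurable_funT_comp (measurable_hat _ _ _) (measurable_coord i)).
Qed.

Lemma rV_bump_le1 n (I : rV_index n) x : `|rV_bump I x| <= 1.
Proof.
suff /andP[b0 b1] : 0 <= rV_bump I x <= 1 by rewrite ger0_norm.
apply: (big_ind (fun y : R => 0 <= y <= 1)) => [|y z /andP[y0 y1] /andP[z0 z1]|i _].
- by rewrite ler01 lexx.
- by rewrite mulr_ge0// mulr_ile1.
- by rewrite hat_ge0 hat_le1.
Qed.

Lemma itv_nd (N M : nat) (x : R) : (N <= M)%N ->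
  x \in `[- N.+1%:R, N.+1%:R] -> x \in `[- M.+1%:R, M.+1%:R].
Proof.
move=> NM; rewrite !in_itv/= => /andP[h1 h2].
have h : N.+1%:R <= M.+1%:R :> R by rewrite ler_nat.
by rewrite (le_trans _ h1) ?lerN2//= (le_trans h2).
Qed.

Lemma rV_box_nd n N M : (N <= M)%N -> @rV_box n N `<=` @rV_box n M.
Proof. by move=> NM x h i; exact: itv_nd (h i). Qed.

Lemma rV_box_exhaust n (x : 'rV[R]_n) : exists N, rV_box N x.
Proof.
exists (Num.truncn (\sum_i `|x ord0 i|)) => i.
rewrite in_itv/= -ler_norml; apply: le_trans (_ : \sum_i `|x ord0 i| <= _).
  by rewrite (bigD1 i)//= lerDl sumr_ge0.
exact/ltW/truncnS_gt.
Qed.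

Lemma separating_step n (c d : nat -> R) :
  (forall N, c N < d N) ->
  (forall N M, (N <= M)%N -> c M <= c N) -> (forall N M, (N <= M)%N -> d N <= d M) ->
  separating (leb R n) (@rV_bump n) (@rV_box n) ->
  separating (leb R n \x lam)%E
    (fun (i : rV_index n * bump_index) z => rV_bump i.1 z.1 * bumpI i.2 z.2)
    (fun N => @rV_box n N `*` `[c N, d N]%classic).
Proof.
move=> cd cnd dnd sepn; apply: separating_prod => //.
- exact: measurable_rV_box.
- exact: rV_box_nd.
- move=> N M NM x /=; rewrite !in_itv/= => /andP[cx xd].
  by rewrite (le_trans (cnd _ _ NM) cx) (le_trans xd (dnd _ _ NM)).
- exact: measurable_rV_bump.
- by move=> i; exact: measurable_hat.
- exact: rV_bump_le1.
- by move=> i x; rewrite ger0_norm ?hat_ge0 ?hat_le1.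
- exact: separating_R.
Qed.

Lemma separating_rV n : separating (leb R n) (@rV_bump n) (@rV_box n).
Proof.
elim: n => [|n IH].
  (* In dimension 0 the measure is a point mass and the bump, an empty product, is 1: the single
     pairing is the value of [h]. *)
  move=> h inth hB.
  have intT : (leb R 0).-integrable setT (EFin \o h).
    by have := inth 0%N; rewrite (_ : rV_box 0 = setT)//; apply/seteqP; split=> // x _ [].
  have := hB [ffun=> (0%N, 0, 0)] (ex_intro _ 0%N _).
  rewrite /Rintegral integral_dirac//; last first.
    apply/measurable_EFinP/measurable_funM; last exact: measurable_rV_bump.
    exact: measurable_fun_int intT.
  rewrite diracT mul1e /= /rV_bump big_ord0 mulr1 => h0.
  apply: aeW => x _; rewrite -h0; last by move=> y _ [].
  by congr h; apply/rowP; case.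
have sepn : separating (leb R n \x lam)%E
    (fun (i : rV_index n * bump_index) z => rV_bump i.1 z.1 * bumpI i.2 z.2)
    (fun N => @rV_box n N `*` `[- N.+1%:R, N.+1%:R]%classic).
  apply: separating_step => //.
  - by move=> N; rewrite -subr_gt0 opprK addr_gt0.
  - by move=> N M NM; rewrite lerN2 ler_nat.
  - by move=> N M NM; rewrite ler_nat.
move=> h inth hB.
have rB N (z : 'rV[R]_n * R) : rV_box N (rsnoc z) <->
    (rV_box N `*` `[- N.+1%:R, N.+1%:R]%classic) z.
  split=> [H|[H1 H2] i].
    split; last by have := H ord_max; rewrite mxE unlift_none.
    by move=> i; have := H (lift ord_max i); rewrite mxE liftK.
  by rewrite mxE; case: unliftP => [j _|_]; [exact: H1|exact: H2].
have : {ae (leb R n \x lam)%E, forall z : 'rV[R]_n * measurableTypeR R,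
    (exists N, (rV_box N `*` `[- N.+1%:R, N.+1%:R]%classic) z) -> h (rsnoc z) = 0}.
  apply: sepn.
    move=> N; have := integrable_rsnoc (@measurable_rV_box _ N) (inth N).
    rewrite (_ : _ @^-1` _ = rV_box N `*` `[- N.+1%:R, N.+1%:R]%classic)//.
    by apply/seteqP; split=> z /= /rB.
  move=> [I1 i2] [N supp] /=.
  pose I : rV_index n.+1 := [ffun j => if unlift ord_max j is Some k then I1 k else i2].
  have BE z : rV_bump I (rsnoc z) = rV_bump I1 z.1 * bumpI i2 z.2.
    rewrite /rV_bump big_ord_recr/=; congr (_ * _); last first.
      by rewrite ffunE mxE unlift_none.
    apply: eq_bigr => j _.
    have -> : widen_ord (leqnSn n) j = lift ord_max j.
      by apply: ord_inj; rewrite lift_max.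
    by rewrite ffunE mxE liftK.
  have suppI x : rV_bump I x != 0 -> rV_box N x.
    by rewrite -[x]rV_unsnocK BE => /supp /rB.
  rewrite -(hB I (ex_intro _ N suppI)).
  pose f := (h \_ (rV_box N)) \* rV_bump I.
  have fE x : f x = h x * rV_bump I x.
    rewrite /f /= patchE; case: ifPn => //; rewrite notin_setE => nB.
    have [->|/suppI//] := eqVneq (rV_bump I x) 0; by rewrite !mulr0.
  have intf : (leb R n.+1).-integrable setT (EFin \o f).
    apply: (@integrable_bounded_mul _ _ _ _ _ _ _ 1) => //.
    - exact: measurable_rV_bump.
    - by move=> x _; exact: rV_bump_le1.
    - by apply: (@integrable_patch _ _ _ _ _ h (measurable_rV_box _)).1.
  transitivity (\int[leb R n.+1]_x f x); last by apply: eq_Rintegral => x _; rewrite fE.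
  rewrite Rintegral_rsnoc//; apply: eq_Rintegral => z _.
  by rewrite fE BE.
move=> H; apply: ae_rsnoc; apply: filterS H => z hz [N Bz].
by apply: hz; exists N; exact/rB.
Qed.

End rV.

(** * Weak derivatives *)

Section test_functions.
Context {R : realType}.

Lemma integrable_mul_supp d (T : measurableType d) (mu : {measure set T -> \bar R})
    (K : set T) (f B : T -> R) (M : R) : measurable K -> measurable_fun setT B ->
  (forall x, `|B x| <= M) -> (forall x, B x != 0 -> K x) ->
  mu.-integrable K (EFin \o f) -> mu.-integrable setT (EFin \o (fun x => f x * B x)).
Proof.
move=> mK mB BM BK intf.
have := (@integrable_patch _ _ _ mu K f mK).1 intf.
move=> /(@integrable_bounded_mul _ _ _ _ _ _ B M measurableT mB (fun x _ => BM x)).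
apply: eq_integrable => // x _ /=; congr EFin.
rewrite patchE; case: ifPn => //; rewrite notin_setE => nK.
have [->|/BK//] := eqVneq (B x) 0; by rewrite !mulr0.
Qed.

Section topological.
Context {V : normedModType R}.
Implicit Types (D K : set V) (phi : V -> R).

Lemma test_fun_smooth D phi : test_fun D phi -> smooth setT phi.
Proof. by case=> h _ _; exact: Ck_smooth. Qed.

Lemma smooth_continuous phi : smooth setT phi -> continuous phi.
Proof. by move=> h x; apply: (Cs_continuous (h 0%N)); rewrite inE. Qed.

Lemma derive_out K phi (v x : V) : closed K -> (forall y, ~ K y -> phi y = 0) ->
  ~ K x -> 'D_v phi x = 0.
Proof.
move=> cK p0 nKx.
rewrite (@near_eq_derive _ _ _ phi (cst 0)) ?derive_cst//.
apply: (@eq_near_open _ _ (~` K)) => //; first exact: closed_openC.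
by move=> y; rewrite inE => /p0.
Qed.

Lemma test_fun_supp D phi : test_fun D phi -> exists K, [/\ compact K, K `<=` D,
  forall x, phi x != 0 -> K x & forall v x, 'D_v phi x != 0 -> K x].
Proof.
move=> [_ cK KD]; exists (closure [set x | phi x != 0]); split => //.
  by move=> x px; exact: subset_closure.
move=> v x; apply: contraNP => nK; apply/eqP; apply: (@derive_out _ phi v x _ _ nK).
  exact: closed_closure.
move=> y nKy; apply/eqP; apply: contrapT => /negP ny; apply: nKy.
exact: subset_closure.
Qed.

Lemma continuous_supp_bounded K phi : compact K -> continuous phi ->
  (forall x, phi x != 0 -> K x) -> exists2 M, 0 <= M & forall x, `|phi x| <= M.
Proof.
move=> cK cphi pK.
have : compact (phi @` K).
  by apply: continuous_compact => //; exact: continuous_subspaceT.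
move=> /compact_bounded[M [Mr MM]]; exists (`|M| + 1); first by rewrite addr_ge0.
move=> x; have [->|/pK Kx] := eqVneq (phi x) 0; first by rewrite normr0 addr_ge0.
apply: (MM (`|M| + 1)); last by exists x.
by rewrite (le_lt_trans (ler_norm _))// ltrDl.
Qed.

Lemma smooth_test D phi v : test_fun D phi -> continuous (fun x => 'D_v phi x).
Proof. by move=> /test_fun_smooth sp; exact: smooth_continuous (smooth_D v sp). Qed.

End topological.

Lemma open_measurable_rV n (A : set 'rV[R]_n) : open A -> measurable A.
Proof.
have := @open_measurable_base _ 'rV[R]_n 'rV[R]_n id _ (@rat_box R n) A.
by apply => //; [exact: rat_box_base | exact: measurable_rat_box].
Qed.

Lemma closed_measurable_rV n (A : set 'rV[R]_n) : closed A -> measurable A.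
Proof.
move=> /closed_openC/open_measurable_rV/measurableC; by rewrite setCK.
Qed.

Lemma open_measurable_rVR n (A : set ('rV[R]_n * R)) :
  open A -> measurable (A : set ('rV[R]_n * measurableTypeR R)).
Proof.
pose B (q : ('rV[rat]_n * nat) * (rat * nat)) : set ('rV[R]_n * R) :=
  @rat_box R n q.1 `*` [set y : R | `|y - ratr q.2.1| < q.2.2.+1%:R^-1].
have := @open_measurable_base _ ('rV[R]_n * measurableTypeR R)%type ('rV[R]_n * R)%type id _ B A.
apply => //.
- move=> [x t] U [[U1 U2] /= [/rat_box_base[q1 q1x q1U] /rat_base_R[q2 q2t q2U]] UU].
  exists (q1, q2); first by split.
  by move=> [y s] /= [? ?]; apply: UU; split => /=; [exact: q1U|exact: q2U].
- move=> i; rewrite preimage_id; apply: measurableX; first exact: measurable_rat_box.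
  apply: open_measurable.
  rewrite (_ : [set r | _] = ball (ratr i.2.1 : R) i.2.2.+1%:R^-1).
    exact: ball_open.
  by apply/seteqP; split=> r; rewrite /ball/= distrC.
Qed.

Lemma compact_measurable_rV n (A : set 'rV[R]_n) : compact A -> measurable A.
Proof.
move=> cA; apply: closed_measurable_rV; exact: compact_closed.
Qed.

Lemma compact_measurable_rVR n (A : set ('rV[R]_n * R)) :
  compact A -> measurable (A : set ('rV[R]_n * measurableTypeR R)).
Proof.
move=> cA; rewrite -[A]setCK; apply: measurableC; apply: open_measurable_rVR.
by apply: closed_openC; exact: compact_closed.
Qed.

Lemma compact_rV_box n N : compact (@rV_box R n N).
Proof.
apply: (@rV_compact R n (fun=> [set` `[- N.+1%:R, N.+1%:R]])) => i.
exact: segment_compact.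
Qed.

Lemma Cs_coord n (i : 'I_n) k (U : set 'rV[R]_n) : Cs U k (fun x => x ord0 i).
Proof.
apply: (Cs_sub (U' := setT)) => //.
apply: (@Cs_affine R _ R (fun x => x) (fun x : 'rV[R]_n => x ord0 i) (fun v => v ord0 i) setT k openT).
- exact: coord_continuous.
- by move=> x v h; rewrite !mxE.
- apply: Cs_ext openT _ (Cs_lin k 1 0) => x _; by rewrite mul1r addr0.
Qed.

Lemma smooth_rV_bump n (I : rV_index n) : smooth setT (@rV_bump R n I).
Proof.
move=> k; apply: Cs_prod openT _ => i.
apply: (Cs_comp1 (W := setT) openT _ (smooth_hat _ _ _ k)) => //.
exact: Cs_coord.
Qed.

Lemma test_fun_rV_bump n (I : rV_index n) N : (forall x : 'rV[R]_n, rV_bump I x != 0 -> rV_box N x) ->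
  test_fun setT (@rV_bump R n I).
Proof.
move=> supp; apply: (@test_funI _ _ setT setT (rV_box N)) => //.
- exact: openT.
- exact: compact_rV_box.
- by move=> x nx; apply/eqP; apply: contrapT => /negP /supp.
- exact: smooth_rV_bump.
Qed.

Lemma locally_integrable_rVB n (f g : 'rV[R]_n -> R) :
  locally_integrable_rV f -> locally_integrable_rV g ->
  locally_integrable_rV (fun x => f x - g x).
Proof.
move=> [mf lf] [mg lg]; split; first exact: measurable_funB.
move=> K cK; have := integrableB (compact_measurable_rV cK) (lf K cK) (lg K cK).
by apply: eq_integrable => //; exact: compact_measurable_rV.
Qed.

Lemma integrable_test_rV n (f phi : 'rV[R]_n -> R) (D : set 'rV[R]_n) :
  locally_integrable_rV f -> test_fun D phi ->
  (leb R n).-integrable setT (EFin \o (fun x => f x * phi x)) /\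
  forall v, (leb R n).-integrable setT (EFin \o (fun x => f x * 'D_v phi x)).
Proof.
move=> [mf lf] tphi; have [K [cK _ pK dK]] := test_fun_supp tphi.
have cp := smooth_continuous (test_fun_smooth tphi).
split=> [|v].
  have [M _ hM] := continuous_supp_bounded cK cp pK.
  apply: (integrable_mul_supp (compact_measurable_rV cK) _ hM pK (lf K cK)).
  exact: continuous_measurable_rV.
have [M _ hM] := continuous_supp_bounded cK (smooth_test (v := v) tphi) (dK v).
apply: (integrable_mul_supp (compact_measurable_rV cK) _ hM (dK v) (lf K cK)).
exact: continuous_measurable_rV (smooth_test tphi).
Qed.

Lemma ae0_rV n (h : 'rV[R]_n -> R) : locally_integrable_rV h ->
  (forall I, test_fun setT (@rV_bump R n I) -> \int[leb R n]_x (h x * rV_bump I x) = 0) ->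
  {ae leb R n, forall x, h x = 0}.
Proof.
move=> [mh lh] h0; have := @separating_rV R n h (fun N => lh _ (@compact_rV_box n N)).
move=> /(_ _)/wrap[].
  by move=> I [N supp]; apply: h0; exact: test_fun_rV_bump supp.
by apply: filterS => x; apply; exact: rV_box_exhaust.
Qed.

Lemma weak_partial_unique n (i : 'I_n) (f g1 g2 : 'rV[R]_n -> R) :
  is_weak_partial i f g1 -> is_weak_partial i f g2 ->
  {ae leb R n, forall x, g1 x = g2 x}.
Proof.
move=> [_ l1 h1] [_ l2 h2].
have := @ae0_rV n (fun x => g1 x - g2 x) (locally_integrable_rVB l1 l2).
move=> /(_ _)/wrap[].
  move=> I tI; under eq_Rintegral do rewrite mulrBl.
  rewrite RintegralB//; [|exact: (integrable_test_rV l1 tI).1|exact: (integrable_test_rV l2 tI).1].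
  by apply/eqP; rewrite subr_eq0 -eqr_opp -h1// -h2.
by apply: filterS => x /eqP; rewrite subr_eq0 => /eqP.
Qed.

(** [weak_partial] is a choice: the existence of one weak derivative makes the choice a weak
    derivative, and uniqueness identifies the two up to a null set. *)
Lemma weak_partialP n (i : 'I_n) (f g : 'rV[R]_n -> R) : is_weak_partial i f g ->
  is_weak_partial i f (weak_partial i f) /\
  {ae leb R n, forall x, weak_partial i f x = g x}.
Proof.
move=> h; have h' : is_weak_partial i f (weak_partial i f).
  exact: (@xgetPex _ (fun=> 0) [set g | is_weak_partial i f g] (ex_intro _ g h)).
by split=> //; exact: weak_partial_unique h' h.
Qed.

Lemma is_weak_partialB n (i : 'I_n) (f f' g g' : 'rV[R]_n -> R) :
  is_weak_partial i f g -> is_weak_partial i f' g' ->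
  is_weak_partial i (fun x => f x - f' x) (fun x => g x - g' x).
Proof.
move=> [lf lg h] [lf' lg' h']; split; [exact: locally_integrable_rVB..|].
move=> phi tphi; under eq_Rintegral do rewrite mulrBl.
under [X in _ = - X]eq_Rintegral do rewrite mulrBl.
rewrite RintegralB//; [|exact: (integrable_test_rV lf tphi).2|exact: (integrable_test_rV lf' tphi).2].
rewrite RintegralB//; [|exact: (integrable_test_rV lg tphi).1|exact: (integrable_test_rV lg' tphi).1].
by rewrite h// h'// opprB opprK addrC.
Qed.

Lemma continuous_affine_fun (V : normedModType R) (a : V) (c : R) :
  continuous (fun x : V => a + c *: x).
Proof.
move=> x; apply: (@continuousD R V V (cst a) (fun x => c *: x)).
  exact: cst_continuous.
exact: scaler_continuous.
Qed.

Lemma continuous_affine n (a : 'rV[R]_n) (c : R) :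
  continuous (fun x : 'rV[R]_n => a + c *: x).
Proof. exact: (@continuous_affine_fun 'rV[R]_n a c). Qed.

Lemma test_fun_affine n (a : 'rV[R]_n) (c : R) (phi : 'rV[R]_n -> R) : c != 0 ->
  test_fun setT phi -> test_fun setT (fun x => phi (a + c *: x)) /\
  forall v x, 'D_v (fun x => phi (a + c *: x)) x = c * 'D_v phi (a + c *: x).
Proof.
move=> c0 tphi; have sp := test_fun_smooth tphi.
have HA (x v : 'rV[R]_n) (h : R) : a + c *: (x + h *: v) = (a + c *: x) + h *: (c *: v).
  by rewrite scalerDr addrA scalerA mulrC -scalerA.
split.
  have [K [cK _ pK _]] := test_fun_supp tphi.
  apply: (@test_funI _ _ setT setT ((fun y : 'rV[R]_n => c^-1 *: (- a) + c^-1 *: y) @` K)) => //.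
  - exact: openT.
  - apply: continuous_compact => //; apply: continuous_subspaceT.
    exact: continuous_affine.
  - move=> x nx; apply/eqP; apply: contrapT => /negP /pK Kx; apply: nx.
    exists (a + c *: x) => //.
    by rewrite -scalerDr addrA addNr add0r scalerA mulVf// scale1r.
  - by move=> k; apply: (Cs_affine openT (@continuous_affine n a c) HA (sp k)).
move=> v x; have := @derivable_line R 'rV[R]_n 'rV[R]_n phi (fun x => a + c *: x) x v (c *: v) (HA x v) (@smooth_derivable R _ setT phi (a + c *: x) (c *: v) sp I).
move=> [_]; rewrite /comp => ->.
have d1 : derivable phi (a + c *: x) v by exact: (smooth_derivable sp).
pose l (h : R) := (a + c *: x) + h *: v.
have l0 : l 0 = a + c *: x by rewrite /l scale0r addr0.
have Hl (y w h : R) : l (y + h *: w) = l y + h *: (w *: v).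
  by rewrite /l scalerDl addrA scalerA.
have dl w : derivable phi (l 0) (w *: v) by rewrite l0; exact: (smooth_derivable sp).
have [_ e1] := @derivable_line R R 'rV[R]_n phi l 0 1 (1 *: v) (Hl 0 1) (dl 1).
have [dd ec] := @derivable_line R R 'rV[R]_n phi l 0 c (c *: v) (Hl 0 c) (dl c).
rewrite l0 in e1 ec; rewrite -ec scale1r in e1 *; rewrite -e1.
have [d11 _] := @derivable_line R R 'rV[R]_n phi l 0 1 (1 *: v) (Hl 0 1) (dl 1).
by have [_ ->] := derive1D c d11.
Qed.

Lemma locally_integrable_affine n (a : 'rV[R]_n) (c d : R) (f : 'rV[R]_n -> R) : 0 < c ->
  locally_integrable_rV f -> locally_integrable_rV (fun x => d * f (a + c *: x)).
Proof.
move=> c0 [mf lf]; have mA := measurable_affine a c.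
split; first by apply: measurable_funM => //; exact: (measurable_funT_comp mf mA).
move=> K cK; have mK := compact_measurable_rV cK.
apply: (@eq_integrable _ _ _ _ _ mK (fun x => d%:E * (f (a + c *: x)%R)%:E)%E) => //.
apply: integrableZl => //.
pose K' := (fun x : 'rV[R]_n => a + c *: x) @` K.
have cK' : compact K'.
  by apply: continuous_compact => //; apply: continuous_subspaceT; exact: continuous_affine.
have mK' := compact_measurable_rV cK'.
apply/(@integrable_patch _ _ _ _ K (fun x => f (a + c *: x)) mK).
have h := (@integrable_patch _ _ _ _ K' f mK').1 (lf K' cK').
have := (@integrable_leb_affine R n a c _ c0 (measurable_fun_int h)).1 h.
apply: eq_integrable => // x _ /=; rewrite !patchE.
have -> // : (a + c *: x \in K') = (x \in K).
apply/idP/idP; last by rewrite !inE => Kx; exists x.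
by rewrite !inE => -[y Ky /addrI/(scalerI (lt0r_neq0 c0)) <-].
Qed.

(** The weak derivative of [f] is tested with [psi], the pullback of [phi] under the inverse affine
    map; the derivative of [psi] brings the factor [c^-1], and the Jacobian is the same on both
    sides. *)
Lemma is_weak_partial_affine n (i : 'I_n) (a : 'rV[R]_n) (c d : R) (f g : 'rV[R]_n -> R) :
  0 < c -> is_weak_partial i f g ->
  is_weak_partial i (fun x => d * f (a + c *: x)) (fun x => (d * c) * g (a + c *: x)).
Proof.
move=> c0 [lf lg h]; have cn0 := lt0r_neq0 c0.
split; [exact: locally_integrable_affine..|] => phi tphi.
pose psi y := phi (c^-1 *: (- a) + c^-1 *: y).
have [tpsi Dpsi] := @test_fun_affine n (c^-1 *: (- a)) c^-1 phi (invr_neq0 cn0) tphi.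
have E x : c^-1 *: (- a) + c^-1 *: (a + c *: x) = x.
  by rewrite -scalerDr addrA addNr add0r scalerA mulVf// scale1r.
have := h psi tpsi.
have [i1 i2] := integrable_test_rV lg tpsi.
have [i3 /(_ (basis_vec i)) i4] := integrable_test_rV lf tpsi.
rewrite (Rintegral_leb_affine a c0 i4) (Rintegral_leb_affine a c0 i1) -mulrN.
move=> /(mulfI (expf_neq0 n cn0)).
under eq_Rintegral do rewrite Dpsi E mulrCA.
under [X in _ = - X]eq_Rintegral do rewrite /psi E.
have [j1 j2] := integrable_test_rV (locally_integrable_affine a 1 c0 lg) tphi.
have [j3 j4] := integrable_test_rV (locally_integrable_affine a 1 c0 lf) tphi.
have j4' : (leb R n).-integrable setT (EFin \o (fun x => f (a + c *: x) * 'D_(basis_vec i) phi x)).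
  by have := j4 (basis_vec i); apply: eq_integrable => // x _ /=; rewrite mul1r.
have j1' : (leb R n).-integrable setT (EFin \o (fun x => g (a + c *: x) * phi x)).
  by have := j1; apply: eq_integrable => // x _ /=; rewrite mul1r.
rewrite RintegralZl// => H.
under eq_Rintegral do rewrite -mulrA.
under [X in _ = - X]eq_Rintegral do rewrite -!mulrA.
rewrite RintegralZl// RintegralZl//; last first.
  by have := integrableZl measurableT c j1'; apply: eq_integrable.
rewrite RintegralZl// -mulrN; congr (_ * _).
by rewrite -mulrN -H mulrA divff// mul1r.
Qed.

End test_functions.

Arguments leb : simpl never.

Section spacetime_test.
Context {R : realType} {n : nat}.
Local Notation lam := (@lebesgue_measure R).
Local Notation Rx := 'rV[R]_n.+1.
Local Notation Rxt := (Rx * R)%type.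
Local Notation mu := (leb R n.+1 \x @lebesgue_measure R)%E.

Lemma Cs_fst k (f : Rx -> R) : Cs setT k f -> Cs [set: Rxt] k (fun z => f z.1).
Proof.
move=> sf; apply: (@Cs_affine R Rxt Rx f fst fst setT k openT) sf => //.
by move=> x; exact: cvg_fst.
Qed.

Lemma Cs_snd k (U : set R) (f : R -> R) : open U -> Cs U k f ->
  Cs [set z : Rxt | U z.2] k (fun z => f z.2).
Proof.
move=> oU sf; apply: (@Cs_affine R Rxt R f snd snd U k oU) sf => //.
by move=> x; exact: cvg_snd.
Qed.

Lemma measurable_slab (a b : R) :
  measurable (@slab R n a b : set (Rx * measurableTypeR R)).
Proof.
rewrite (_ : slab a b = setT `*` `]a, b[%classic); first exact: measurableX.
by apply/seteqP; split=> z; [|case=> _]; rewrite /slab /= in_itv.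
Qed.

(** With the denominator [N.+3] the margins at the two ends add up to less than the length, already
    for [N = 0]; the closed intervals are therefore nondegenerate and increase to the open one. *)
Definition inner_left (a b : R) (N : nat) : R := a + (b - a) / N.+3%:R.
Definition inner_right (a b : R) (N : nat) : R := b - (b - a) / N.+3%:R.

Lemma inner_lt (a b : R) N : a < b -> [/\ a < inner_left a b N,
  inner_left a b N < inner_right a b N & inner_right a b N < b].
Proof.
rewrite -subr_gt0 => ab; have k0 : 0 < (b - a) / N.+3%:R by rewrite divr_gt0.
have k1 : (b - a) / N.+3%:R * 2 < b - a.
  rewrite mulrAC ltr_pdivrMr// ltr_pM2l// ltr_nat//.
rewrite /inner_left /inner_right; move: ((b - a) / _) k0 k1 => k k0 k1.
by split; lra.
Qed.

Lemma inner_left_nd (a b : R) N M : a < b -> (N <= M)%N -> inner_left a b M <= inner_left a b N.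
Proof.
move=> ab NM; rewrite lerD2l ler_pM2l ?subr_gt0// lef_pV2 ?posrE//.
by rewrite ler_nat.
Qed.

Lemma inner_right_nd (a b : R) N M : a < b -> (N <= M)%N -> inner_right a b N <= inner_right a b M.
Proof.
move=> ab NM; rewrite lerD2l lerN2 ler_pM2l ?subr_gt0// lef_pV2 ?posrE//.
by rewrite ler_nat.
Qed.

Lemma inner_exhaust (a b t : R) : a < t < b ->
  exists N, t \in `[inner_left a b N, inner_right a b N].
Proof.
move=> /andP[at_ tb]; have ab : 0 < b - a by rewrite subr_gt0 (lt_trans at_ tb).
pose e := Num.min (t - a) (b - t).
have e0 : 0 < e by rewrite lt_min !subr_gt0 at_ tb.
exists (Num.truncn ((b - a) / e)).
have h : (b - a) / (Num.truncn ((b - a) / e)).+3%:R <= e.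
  rewrite ler_pdivrMr// mulrC -ler_pdivrMr//; apply: ltW; apply: lt_le_trans (truncnS_gt _) _.
  by rewrite ler_nat (leq_trans (leqnSn _)).
have [h1 h2] : (b - a) / (Num.truncn ((b - a) / e)).+3%:R <= t - a /\
    (b - a) / (Num.truncn ((b - a) / e)).+3%:R <= b - t.
  by move: h; rewrite le_min => /andP.
rewrite in_itv/= /inner_left /inner_right; move: ((b - a) / _) h1 h2 => k h1 h2.
by apply/andP; split; lra.
Qed.

Definition slab_box (a b : R) (N : nat) : set Rxt :=
  @rV_box R n.+1 N `*` `[inner_left a b N, inner_right a b N]%classic.

Lemma slab_box_sub (a b : R) N : a < b -> slab_box a b N `<=` slab a b.
Proof.
move=> /(inner_lt N)[h1 _ h2] z [_ /=]; rewrite in_itv/= => /andP[h3 h4].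
by rewrite /slab/= (lt_le_trans h1 h3) (le_lt_trans h4 h2).
Qed.

Lemma compact_slab_box (a b : R) N : compact (slab_box a b N).
Proof. by apply: compact_setX; [exact: compact_rV_box|exact: segment_compact]. Qed.

Lemma separating_slab (a b : R) : a < b -> separating mu
    (fun (i : rV_index n.+1 * bump_index) z => rV_bump i.1 z.1 * bumpI i.2 z.2)
    (slab_box a b).
Proof.
move=> ab; apply: separating_step.
- by move=> N; have [] := inner_lt N ab.
- by move=> N M; exact: inner_left_nd.
- by move=> N M; exact: inner_right_nd.
- exact: separating_rV.
Qed.

Lemma test_fun_tensor (D : set Rxt) (psi : Rx -> R) (eta : R -> R) (K1 : set Rx) (K2 : set R) :
  smooth setT psi -> smooth setT eta -> compact K1 -> compact K2 ->
  (forall x, psi x != 0 -> K1 x) -> (forall t, eta t != 0 -> K2 t) ->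
  K1 `*` K2 `<=` D -> test_fun D (fun z => psi z.1 * eta z.2).
Proof.
move=> sp se cK1 cK2 pK eK KD.
apply: (@test_funI _ _ D setT (K1 `*` K2)) => //.
- exact: openT.
- exact: compact_setX.
- move=> z nz; apply/eqP; apply: contrapT => /negP.
  by rewrite mulf_eq0 negb_or => /andP[/pK h1 /eK h2]; apply: nz.
- by move=> k; apply: CsM openT _ _; [exact: Cs_fst|exact: (Cs_snd openT)].
Qed.

Lemma derive_tensor (psi : Rx -> R) (eta : R -> R) (v : Rx) (z : Rxt) : smooth setT psi ->
  'D_(v, 0) (fun z => psi z.1 * eta z.2) z = 'D_v psi z.1 * eta z.2.
Proof.
move=> sp; case: z => x t /=.
have E : (fun h : R => h^-1 *: (((fun z : Rxt => psi z.1 * eta z.2) \o shift (x, t)) (h *: (v, 0))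
    - (fun z : Rxt => psi z.1 * eta z.2) (x, t))) =
  (fun h : R => eta t * (h^-1 *: ((psi \o shift x) (h *: v) - psi x))).
  apply/funext => h /=; rewrite scaler0 add0r -mulrBl /GRing.scale/=.
  by rewrite mulrA mulrC.
rewrite /derive E mulrC.
have d : derivable psi x v by exact: (smooth_derivable sp).
apply: cvg_lim => //; apply: cvgMr; exact: d.
Qed.

Lemma integrable_test_rVR (f phi : Rxt -> R) (D : set Rxt) :
  locally_integrable_on D f -> test_fun D phi ->
  [/\ mu.-integrable setT (EFin \o (fun z => f z * phi z)),
    forall v, mu.-integrable setT (EFin \o (fun z => f z * 'D_v phi z)),
    \int[mu]_(z in D) (f z * phi z) = \int[mu]_z (f z * phi z) &
    forall v, \int[mu]_(z in D) (f z * 'D_v phi z) = \int[mu]_z (f z * 'D_v phi z)].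
Proof.
move=> [mf lf] tphi; have [K [cK KD pK dK]] := test_fun_supp tphi.
have cp := smooth_continuous (test_fun_smooth tphi).
have mK := compact_measurable_rVR cK.
split=> [|v||v].
- have [M _ hM] := continuous_supp_bounded cK cp pK.
  apply: (integrable_mul_supp mK _ hM pK (lf K cK KD)).
  exact: continuous_measurable_rVR.
- have [M _ hM] := continuous_supp_bounded cK (smooth_test (v := v) tphi) (dK v).
  apply: (integrable_mul_supp mK _ hM (dK v) (lf K cK KD)).
  exact: continuous_measurable_rVR (smooth_test tphi).
- by apply/esym/Rintegral_supp => z /pK /KD.
- by apply/esym/Rintegral_supp => z /dK /KD.
Qed.

Lemma locally_integrable_onB (D : set Rxt) (f g : Rxt -> R) :
  locally_integrable_on D f -> locally_integrable_on D g ->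
  locally_integrable_on D (fun x => f x - g x).
Proof.
move=> [mf lf] [mg lg]; split; first exact: measurable_funB.
move=> K cK KD; have mK := compact_measurable_rVR cK.
have := integrableB mK (lf K cK KD) (lg K cK KD).
by apply: eq_integrable.
Qed.

Lemma test_fun_slab_bump (a b : R) (I : rV_index n.+1) (j : bump_index) N : a < b ->
  (forall z : Rxt, rV_bump I z.1 * bumpI j z.2 != 0 -> slab_box a b N z) ->
  test_fun (slab a b) (fun z => rV_bump I z.1 * bumpI j z.2).
Proof.
move=> ab supp; apply: (@test_funI _ _ _ setT (slab_box a b N)) => //.
- exact: openT.
- exact: compact_slab_box.
- exact: slab_box_sub.
- by move=> z nz; apply/eqP; apply: contrapT => /negP /supp.
- move=> k; apply: CsM openT _ _; first exact: Cs_fst (smooth_rV_bump I k).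
  exact: (Cs_snd openT (smooth_hat _ _ _ k)).
Qed.

Lemma ae0_slab (a b : R) (h : Rxt -> R) : locally_integrable_on (slab a b) h ->
  (forall phi, test_fun (slab a b) phi -> \int[mu]_z (h z * phi z) = 0) ->
  {ae mu, forall z : Rx * measurableTypeR R, slab a b z -> h z = 0}.
Proof.
move=> [mh lh] h0; have [ab|ba] := ltP a b; last first.
  by apply: aeW => z /andP[h1 h2]; have := lt_trans h1 h2; rewrite ltNge ba.
have := @separating_slab a b ab h
  (fun N => lh _ (@compact_slab_box a b N) (@slab_box_sub a b N ab)).
move=> /(_ _)/wrap[].
  by move=> [I j] [N supp]; apply: h0; exact: test_fun_slab_bump supp.
apply: filterS => z hz zD; apply: hz.
have [N1 h1] := rV_box_exhaust z.1; have [N2 h2] := inner_exhaust zD.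
exists (maxn N1 N2); split; first by apply: rV_box_nd h1; exact: leq_maxl.
move: h2; rewrite /= !in_itv/= => /andP[h2 h3].
rewrite (le_trans (inner_left_nd ab (leq_maxr _ _)) h2).
by rewrite (le_trans h3 (inner_right_nd ab (leq_maxr _ _))).
Qed.

Lemma weak_deriv_unique (a b : R) (v : Rxt) (f g1 g2 : Rxt -> R) :
  is_weak_deriv (slab a b) v f g1 -> is_weak_deriv (slab a b) v f g2 ->
  {ae mu, forall z : Rx * measurableTypeR R, slab a b z -> g1 z = g2 z}.
Proof.
move=> [_ l1 h1] [_ l2 h2].
have := @ae0_slab a b (fun x => g1 x - g2 x) (locally_integrable_onB l1 l2).
move=> /(_ _)/wrap[].
  move=> phi tphi; under eq_Rintegral do rewrite mulrBl.
  have [i1 _ e1 _] := integrable_test_rVR l1 tphi.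
  have [i2 _ e2 _] := integrable_test_rVR l2 tphi.
  rewrite RintegralB// -e1 -e2.
  by apply/eqP; rewrite subr_eq0 -eqr_opp -h1// -h2.
by apply: filterS => x hx /hx /eqP; rewrite subr_eq0 => /eqP.
Qed.

Lemma locally_integrable_on_patch (D : set Rxt) (g : Rxt -> R) :
  measurable (D : set (Rx * measurableTypeR R)) ->
  locally_integrable_on D g -> locally_integrable_on D (g \_ D).
Proof.
move=> mD [mg lg]; split.
  by apply: eq_measurable_fun mg => z zD; rewrite patchE zD.
move=> K cK KD; apply: eq_integrable (lg K cK KD); first exact: compact_measurable_rVR.
by move=> z; rewrite inE => /KD zD /=; rewrite patchE mem_set.
Qed.

Lemma weak_derivP (a b : R) (v : Rxt) (f g : Rxt -> R) :
  is_weak_deriv (slab a b) v f g ->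
  is_weak_deriv (slab a b) v f (weak_deriv (slab a b) v f) /\
  {ae mu, forall z : Rx * measurableTypeR R, slab a b z -> weak_deriv (slab a b) v f z = g z}.
Proof.
move=> h.
have h' : is_weak_deriv (slab a b) v f (weak_deriv (slab a b) v f).
  (* [weak_deriv] is the chosen function cut off to the slab, and the cutoff changes no pairing over
     the slab. *)
  have [lf lg hg] := @xgetPex _ (fun=> 0) [set g | is_weak_deriv (slab a b) v f g] (ex_intro _ g h).
  split => //; first exact: (locally_integrable_on_patch (measurable_slab a b) lg).
  move=> phi /hg ->; congr (- _); apply: eq_Rintegral => z zD.
  by rewrite /weak_deriv patchE zD.
by split=> //; exact: weak_deriv_unique h' h.
Qed.

(** The cutoff built into [weak_deriv] turns measurability on the slab into measurability on the
    whole space. *)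
Lemma weak_deriv_measurable (a b : R) (v : Rxt) (f : Rxt -> R) :
  is_weak_deriv (slab a b) v f (weak_deriv (slab a b) v f) ->
  measurable_fun setT (weak_deriv (slab a b) v f : Rx * measurableTypeR R -> R).
Proof.
move=> [_ [mg _] _].
have E : weak_deriv (slab a b) v f = weak_deriv (slab a b) v f \_ (slab a b).
  by apply/funext => z; rewrite /weak_deriv !patchE; case: ifPn.
rewrite E; exact: (measurable_restrictT _ (measurable_slab a b)).1 mg.
Qed.

Lemma continuous_pairl (V W : normedModType R) (t : W) : continuous (fun x : V => (x, t)).
Proof. by move=> x; apply: cvg_pair; [exact: cvg_id|exact: cvg_cst]. Qed.

Lemma test_fun_slice (a b t : R) (phi : Rxt -> R) : test_fun (slab a b) phi ->
  test_fun setT (fun x => phi (x, t)) /\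
  forall v x, 'D_v (fun x => phi (x, t)) x = 'D_(v, 0) phi (x, t).
Proof.
move=> tphi; have sp := test_fun_smooth tphi.
have HA (x v : Rx) (h : R) : (x + h *: v, t) = (x, t) + h *: (v, 0) :> Rxt.
  by rewrite -[RHS]/(x + h *: v, t + h *: 0) scaler0 addr0.
have cA : continuous (fun x : Rx => (x, t) : Rxt).
  exact: (@continuous_pairl Rx R t).
split.
  have [K [cK KD pK _]] := test_fun_supp tphi.
  apply: (@test_funI _ _ setT setT (fst @` K)) => //.
  - exact: openT.
  - by apply: continuous_compact => //; apply: continuous_subspaceT => z; exact: cvg_fst.
  - move=> x nx; apply/eqP; apply: contrapT => /negP /pK Kx; apply: nx.
    by exists (x, t).
  - by move=> k; apply: (@Cs_affine R Rx Rxt phi (fun x => (x, t)) (fun v => (v, 0)) setT k openT cA HA (sp k)).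
move=> v x.
by have [_] := @derivable_line R Rx Rxt phi (fun x => (x, t)) x v (v, 0) (HA x v) (@smooth_derivable R _ setT phi (x, t) (v, 0) sp I).
Qed.

(** The slices of a test function of the slab are test functions on space, so the identities of the
    slices can be integrated in time. The competitor, known slice by slice, gets its space-time
    derivatives in this way. *)
Lemma is_weak_deriv_of_slices (a b : R) (i : 'I_n.+1) (w g : Rxt -> R) :
  locally_integrable_on (slab a b) w -> locally_integrable_on (slab a b) g ->
  (forall t, a < t < b -> is_weak_partial i (slice w t) (slice g t)) ->
  is_weak_deriv (slab a b) (basis_vec i, 0) w g.
Proof.
move=> lw lg h; split=> // phi tphi.
have [_ i1 _ e1] := integrable_test_rVR lw tphi.
have [i2 _ e2 _] := integrable_test_rVR lg tphi.
rewrite e1 e2 Rintegral21_prod// [in RHS]Rintegral21_prod//=.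
rewrite -mulN1r -RintegralZl//; last exact: integrable_Rfubini2 i2.
have [K [_ KD pK dK]] := test_fun_supp tphi.
apply: eq_Rintegral => t _; have [tab|ntab] := boolP (a < t < b).
  have [_ _ ht] := h t tab; have [ts Ds] := test_fun_slice t tphi.
  rewrite mulN1r; apply: etrans (ht _ ts); apply: eq_Rintegral => x _.
  by rewrite Ds.
have z1 x : phi (x, t) = 0.
  by apply/eqP; apply: contraNT ntab => /pK /KD.
have z2 x : 'D_(basis_vec i, 0) phi (x, t) = 0.
  by apply/eqP; apply: contraNT ntab => /dK /KD.
under eq_Rintegral do rewrite z2 mulr0.
under [X in _ * X]eq_Rintegral do rewrite z1 mulr0.
by rewrite /Rintegral integral0 mulr0.
Qed.

End spacetime_test.

Section ae_integrable.
Context d (T : measurableType d) (R : realType) (mu : {measure set T -> \bar R}).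

Lemma integrable_ae_eq (D : set T) (f g : T -> R) : measurable D ->
  mu.-integrable D (EFin \o f) -> measurable_fun D g ->
  {ae mu, forall x, D x -> f x = g x} -> mu.-integrable D (EFin \o g).
Proof.
move=> mD /integrableP[mf foo] mg fg; apply/integrableP; split; first exact/measurable_EFinP.
rewrite -(@ae_eq_integral _ _ _ mu D (abse \o (EFin \o g)) (abse \o (EFin \o f)))//.
- exact: measurableT_comp.
- by apply: measurableT_comp => //; exact/measurable_EFinP.
- by apply: filterS fg => x h /h /= ->.
Qed.

Lemma integrable_addr (D : set T) (f g : T -> R) : measurable D ->
  mu.-integrable D (EFin \o f) -> mu.-integrable D (EFin \o g) ->
  mu.-integrable D (EFin \o (fun x => f x + g x)).
Proof. by move=> mD h1 h2; have := integrableD mD h1 h2; apply: eq_integrable. Qed.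

Lemma integrable_subr (D : set T) (f g : T -> R) : measurable D ->
  mu.-integrable D (EFin \o f) -> mu.-integrable D (EFin \o g) ->
  mu.-integrable D (EFin \o (fun x => f x - g x)).
Proof. by move=> mD h1 h2; have := integrableB mD h1 h2; apply: eq_integrable. Qed.

Lemma integrable_mulrl (D : set T) (c : R) (f : T -> R) : measurable D ->
  mu.-integrable D (EFin \o f) -> mu.-integrable D (EFin \o (fun x => c * f x)).
Proof. by move=> mD h1; have := integrableZl mD c h1; apply: eq_integrable. Qed.

End ae_integrable.

Section slices.
Context {R : realType} {n : nat}.
Local Notation lam := (@lebesgue_measure R).
Local Notation Rx := 'rV[R]_n.+1.
Local Notation Rxt := (Rx * R)%type.
Local Notation mu := (leb R n.+1 \x @lebesgue_measure R)%E.

(** Fubini for the pairing with a product of a function of [x] and a function of [t]. It carries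
    conditions on almost every slice to and from space-time identities. *)
Lemma slice_pairing (a b c d M1 M2 : R) (f : Rxt -> R) (psi : Rx -> R) (beta : R -> R)
    (K : set Rx) : a < c -> d < b -> locally_integrable_on (slab a b) f -> compact K ->
  measurable_fun setT psi -> (forall x, `|psi x| <= M1) -> (forall x, psi x != 0 -> K x) ->
  measurable_fun setT beta -> (forall t, `|beta t| <= M2) ->
  (forall t, beta t != 0 -> t \in `[c, d]) ->
  [/\ mu.-integrable setT (EFin \o (fun z => f z * (psi z.1 * beta z.2))),
    lam.-integrable setT (EFin \o (fun t : R => (\int[leb R n.+1]_x (f (x, t) * psi x)) * beta t)) &
    \int[lam]_t ((\int[leb R n.+1]_x (f (x, t) * psi x)) * beta t) =
    \int[mu]_z (f z * (psi z.1 * beta z.2))].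
Proof.
move=> ac db [mf lf] cK mpsi psiM psiK mbeta betaM betaK.
pose KK : set Rxt := K `*` `[c, d]%classic.
have cKK : compact KK by apply: compact_setX => //; exact: segment_compact.
have KKD : KK `<=` slab a b.
  move=> z [_ /=]; rewrite in_itv/= => /andP[h1 h2].
  by rewrite /slab/= (lt_le_trans ac h1) (le_lt_trans h2 db).
have mKK := compact_measurable_rVR cKK.
have mfst : measurable_fun setT (fun z : Rx * measurableTypeR R => psi z.1).
  exact: (measurable_funT_comp mpsi measurable_fst).
have msnd : measurable_fun setT (fun z : Rx * measurableTypeR R => beta z.2).
  exact: (measurable_funT_comp mbeta measurable_snd).
have i1 : mu.-integrable setT (EFin \o (fun z => f z * (psi z.1 * beta z.2))).
  apply: (@integrable_mul_supp R _ (Rx * measurableTypeR R)%type mu KK f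
    (fun z => psi z.1 * beta z.2) (M1 * M2) mKK _ _ _ (lf KK cKK KKD)).
  - exact: measurable_funM.
  - by move=> z; rewrite normrM; apply: ler_pM.
  - by move=> z; rewrite mulf_eq0 negb_or => /andP[/psiK h1 /betaK h2].
have E t : (leb R n.+1).-integrable setT (fun x => (f (x, t) * (psi x * beta t))%:E) ->
    \int[leb R n.+1]_x (f (x, t) * (psi x * beta t)) =
    (\int[leb R n.+1]_x (f (x, t) * psi x)) * beta t.
  move=> it; have [->|bt] := eqVneq (beta t) 0.
    rewrite mulr0 /Rintegral integral0_eq// => x _; by rewrite !mulr0.
  rewrite -RintegralZr//; first by apply: eq_Rintegral => x _; rewrite mulrA.
  have := integrableZl measurableT (beta t)^-1 it.
  by apply: eq_integrable => // x _ /=; rewrite -EFinM mulrA mulrC mulfK.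
have aeE : {ae lam, forall t : measurableTypeR R, \int[leb R n.+1]_x (f (x, t) * (psi x * beta t)) =
    (\int[leb R n.+1]_x (f (x, t) * psi x)) * beta t}.
  by apply: filterS (ae_integrable2 i1) => t it; exact: E.
have i2 := integrable_Rfubini2 i1.
(* [beta t] can be pulled out of the inner integral where the slice is integrable, that is, for
   almost every [t]. Measurability of the resulting function of [t] is thus shown separately, with
   [f] cut off to the compact set [KK]. *)
have m3 : measurable_fun setT (fun t : measurableTypeR R => (\int[leb R n.+1]_x (f (x, t) * psi x)) * beta t).
  have -> : (fun t : measurableTypeR R => (\int[leb R n.+1]_x (f (x, t) * psi x)) * beta t) =
     (fun t : measurableTypeR R => (\int[leb R n.+1]_x ((f \_ KK) (x, t) * psi x)) * beta t).
    apply/funext => t; have [->|/betaK bt] := eqVneq (beta t) 0; first by rewrite !mulr0.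
    congr (_ * _); apply: eq_Rintegral => x _.
    have [->|/psiK px] := eqVneq (psi x) 0; first by rewrite !mulr0.
    by rewrite patchE mem_set.
  apply: measurable_funM => //.
  have ifK := (@integrable_patch _ _ _ mu KK f mKK).1 (lf KK cKK KKD).
  have := @integrable_bounded_mul _ _ _ mu _ _ (fun z => psi z.1) M1 measurableT mfst (fun z _ => psiM z.1) ifK.
  by move=> /integrable_Rfubini2/measurable_fun_int.
split=> //.
  apply: (integrable_ae_eq measurableT i2 m3).
  by apply: filterS aeE => t + _.
rewrite Rintegral21_prod//; apply/esym/ae_eq_Rintegral => //.
- exact: measurable_fun_int i2.
- by apply: filterS aeE => t + _.
Qed.

Lemma integrable_slice_inner (a b c d M : R) (f : Rxt -> R) (psi : Rx -> R)
    (K : set Rx) : a < c -> d < b -> locally_integrable_on (slab a b) f -> compact K ->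
  measurable_fun setT psi -> (forall x, `|psi x| <= M) -> (forall x, psi x != 0 -> K x) ->
  lam.-integrable `[c, d] (EFin \o (fun t : R => \int[leb R n.+1]_x (f (x, t) * psi x))).
Proof.
move=> ac db lf cK mpsi psiM psiK.
have mi : measurable_fun setT (\1_(`[c, d]%classic) : measurableTypeR R -> R).
  exact: measurable_indic.
have i1 t : `|\1_(`[c, d]%classic) t| <= 1 :> R.
  by rewrite indicE; case: (_ \in _); rewrite ?normr1 ?normr0.
have i2 t : \1_(`[c, d]%classic) t != 0 :> R -> t \in `[c, d].
  by rewrite indicE; case: (boolP (_ \in _)); rewrite ?inE// eqxx.
have [_ + _] := slice_pairing ac db lf cK mpsi psiM psiK mi i1 i2.
move=> h; apply/(@integrable_mkcond _ (measurableTypeR R)); first exact: measurable_itv.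
apply: eq_integrable h => // t _ /=; rewrite patchE indicE.
by case: ifPn; rewrite ?mulr1 ?mulr0.
Qed.

(** For each bump in [x], testing with bumps in [t] gives the identity of the slices outside a null
    set of times; the bumps are countably many, so one null set suffices, and they determine [g'].
    That the slice has a weak derivative is a hypothesis here; it comes later from the trace
    condition. *)
Lemma weak_deriv_slice (a b : R) (i : 'I_n.+1) (u g : Rxt -> R) :
  is_weak_deriv (slab a b) (basis_vec i, 0) u g ->
  {ae lam, forall t : measurableTypeR R, a < (t : R) < b ->
    forall g', is_weak_partial i (slice u t) g' ->
      {ae leb R n.+1, forall x, g' x = g (x, t)}}.
Proof.
move=> [lu lg hug]; have [ab|ba] := ltP a b; last first.
  by apply: aeW => t /andP[h1 h2]; have := lt_trans h1 h2; rewrite ltNge ba.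
have pair0 (I : rV_index n.+1) : test_fun setT (@rV_bump R n.+1 I) ->
    {ae lam, forall t : measurableTypeR R, a < (t : R) < b ->
      \int[leb R n.+1]_x (u (x, t) * 'D_(basis_vec i) (rV_bump I) x) +
      \int[leb R n.+1]_x (g (x, t) * rV_bump I x) = 0}.
  move=> tI; have [K [cK _ pK dK]] := test_fun_supp tI.
  have sp := test_fun_smooth tI.
  have mI := @measurable_rV_bump R _ I.
  have mD := continuous_measurable_rV (smooth_test (v := basis_vec i) tI).
  have [M _ hM] := continuous_supp_bounded cK (smooth_test (v := basis_vec i) tI) (dK _).
  have := @separating_R R (inner_left a b) (inner_right a b) _
    (fun t : R => \int[leb R n.+1]_x (u (x, t) * 'D_(basis_vec i) (rV_bump I) x) +
      \int[leb R n.+1]_x (g (x, t) * rV_bump I x)).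
  move=> /(_ _ _ _)/wrap[].
  - by move=> N; have [] := inner_lt N ab.
  - move=> N; have [h1 h2 h3] := inner_lt N ab.
    have i1 := integrable_slice_inner h1 h3 lu cK mD hM (dK _).
    have i2 := integrable_slice_inner h1 h3 lg cK mI (@rV_bump_le1 R _ I) pK.
    by apply: integrable_addr => //; exact: measurable_itv.
  - move=> j [N supp]; have [h1 h2 h3] := inner_lt N ab.
    have suppj t : bumpI j t != 0 -> t \in `[inner_left a b N, inner_right a b N].
      by move=> /supp.
    have bj t : `|bumpI j t| <= 1 :> R by rewrite ger0_norm ?hat_ge0 ?hat_le1.
    have [j1 j2 j3] := slice_pairing h1 h3 lu cK mD hM (dK _) (measurable_hat _ _ _) bj suppj.
    have [k1 k2 k3] := slice_pairing h1 h3 lg cK mI (@rV_bump_le1 R _ I) pK (measurable_hat _ _ _) bj suppj.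
    under eq_Rintegral do rewrite mulrDl.
    rewrite RintegralD// j3 k3.
    have tphi : test_fun (slab a b) (fun z : Rxt => rV_bump I z.1 * bumpI j z.2).
      apply: (@test_fun_tensor R n _ _ _ K `[inner_left a b N, inner_right a b N]%classic) => //.
      + exact: smooth_hat.
      + exact: segment_compact.
      + move=> z [_ /=]; rewrite in_itv/= => /andP[q1 q2].
        by rewrite /slab/= (lt_le_trans h1 q1) (le_lt_trans q2 h3).
    have := hug _ tphi.
    have [_ _ _ ->] := integrable_test_rVR lu tphi.
    have [_ _ -> _] := integrable_test_rVR lg tphi.
    under eq_Rintegral do rewrite derive_tensor//.
    by move=> ->; rewrite addNr.
  apply: filterS => t ht tab; apply: ht.
  by have [N] := inner_exhaust tab; exists N.
have aeI : {ae lam, forall t : measurableTypeR R, forall N : nat,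
    (leb R n.+1).-integrable setT (fun x => ((g \_ (slab_box a b N)) (x, t))%:E)}.
  apply: ae_foralln => N.
  have mB := compact_measurable_rVR (@compact_slab_box R n a b N).
  have := (@integrable_patch _ _ _ mu _ g mB).1 (lg.2 _ (@compact_slab_box R n a b N) (@slab_box_sub R n a b N ab)).
  by move=> /ae_integrable2.
have aeP : {ae lam, forall t : measurableTypeR R, forall I : rV_index n.+1,
    test_fun setT (@rV_bump R n.+1 I) -> a < (t : R) < b ->
      \int[leb R n.+1]_x (u (x, t) * 'D_(basis_vec i) (rV_bump I) x) +
      \int[leb R n.+1]_x (g (x, t) * rV_bump I x) = 0}.
  apply: ae_countable => I; have [tI|ntI] := pselect (test_fun setT (@rV_bump R n.+1 I)).
    by apply: filterS (pair0 I tI) => t ht _.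
  by apply: aeW => t /ntI.
apply: filterS2 aeI aeP => t It Pt tab g' [lut lg' hg'].
have [N0 tN0] := inner_exhaust tab.
have igB N : (leb R n.+1).-integrable (rV_box N) (fun x => (g (x, t))%:E).
  pose M := maxn N N0.
  have mB := @measurable_rV_box R n.+1 N.
  apply: (@eq_integrable _ _ _ _ _ mB (fun x => ((g \_ (slab_box a b M)) (x, t))%:E)).
    move=> x; rewrite inE => xN; rewrite patchE mem_set//; split => /=.
      by apply: rV_box_nd xN; exact: leq_maxl.
    move: tN0; rewrite !in_itv/= => /andP[h2 h3].
    rewrite (le_trans (inner_left_nd ab (leq_maxr _ _)) h2).
    by rewrite (le_trans h3 (inner_right_nd ab (leq_maxr _ _))).
  exact: integrableS (It M).
have ig'B N : (leb R n.+1).-integrable (rV_box N) (EFin \o g').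
  by apply: lg'.2; exact: compact_rV_box.
have := @separating_rV R n.+1 (fun x => g' x - g (x, t)).
move=> /(_ _ _)/wrap[].
- move=> N; have := integrableB (@measurable_rV_box R n.+1 N) (ig'B N) (igB N).
  by apply: eq_integrable => //; exact: measurable_rV_box.
- move=> I [N supp]; have tI := test_fun_rV_bump supp.
  have mI := @measurable_rV_bump R _ I.
  have j1 := integrable_mul_supp (@measurable_rV_box R n.+1 N) mI (@rV_bump_le1 R _ I) supp (ig'B N).
  have j2 := @integrable_mul_supp R _ _ (leb R n.+1) _ (fun x => g (x, t)) _ _ (@measurable_rV_box R n.+1 N) mI (@rV_bump_le1 R _ I) supp (igB N).
  under eq_Rintegral do rewrite mulrBl.
  rewrite RintegralB//.
  have := hg' _ tI; have := Pt I tI tab; rewrite /slice => /eqP.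
  by rewrite addr_eq0 => /eqP -> /oppr_inj <-; rewrite subrr.
by apply: filterS => x hx; apply/eqP; rewrite -subr_eq0; apply/eqP/hx; exact: rV_box_exhaust.
Qed.

End slices.

(** * The lemma of du Bois-Reymond *)

Section du_bois_reymond.
Context {R : realType}.
Local Notation lam := (@lebesgue_measure R).

(** Integration starts at [-oo], which gives a primitive on the whole line; it vanishes beyond [d]
    because [zeta] has mean zero. *)
Lemma smooth_primitive (zeta : R -> R) (c d : R) : c <= d -> smooth setT zeta ->
  (forall t, zeta t != 0 -> t \in `[c, d]) -> \int[lam]_t zeta t = 0 ->
  let eta t := \int[lam]_(s in `]-oo, t]) zeta s in
  [/\ smooth setT eta, forall t, 'D_1 eta t = zeta t,
      forall t, eta t != 0 -> t \in `[c, d] &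
      forall t, t \in `[c, d] -> eta t = \int[lam]_(s in `]c, t[) zeta s].
Proof.
move=> cd sz zcd z0 eta.
have cz := smooth_continuous sz.
have mz : measurable_fun setT (zeta : measurableTypeR R -> R).
  exact: continuous_measurable_fun.
have [M _ zM] := continuous_supp_bounded (@segment_compact R c d) cz zcd.
have i1 : lam.-integrable `[c, d] (EFin \o cst (1 : R)).
  apply: measurable_bounded_integrable => //.
  - by rewrite /= lebesgue_measure_itv/=; case: ifP => //; rewrite -EFinD ltry.
  - by exists 1; split=> // x x1 y _ /=; rewrite normr1 ltW.
have iz : lam.-integrable setT (EFin \o zeta).
  have := @integrable_mul_supp R _ (measurableTypeR R) lam `[c, d]%classic (cst 1) zeta M (measurable_itv _) mz zM zcd i1.
  by apply: eq_integrable => // t _ /=; rewrite mul1r.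
have izI (i : interval R) : lam.-integrable [set` i] (EFin \o zeta).
  by apply: integrableS iz.
have De (t : R) : derivable eta t 1 /\ 'D_1 eta t = zeta t.
  have lt1 : t < t + 1 by rewrite ltrDl ltr01.
  have := @continuous_FTC1 R zeta (BInfty _ true) t (t + 1) _ (izI _) _ (cz t).
  by move=> /(_ lt1); rewrite ltNyr derive1E => /(_ isT).
have eout t : eta t != 0 -> t \in `[c, d].
  apply: contraNT; rewrite in_itv/= negb_and -!ltNge => /orP[tc|dt].
    apply/eqP; rewrite /eta /Rintegral integral0_eq// => s /=; rewrite in_itv/= => st.
    apply/congr1/eqP; apply: contraT => /zcd; rewrite in_itv/= => /andP[cs _].
    by have := lt_le_trans tc (le_trans cs st); rewrite ltxx.
  apply/eqP; rewrite -z0 /eta Rintegral_mkcond; apply: eq_Rintegral => s _.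
  rewrite patchE; case: ifPn => //; rewrite notin_setE /= in_itv/= => /negP; rewrite -ltNge => ts.
  apply/esym/eqP; apply: contraT => /zcd; rewrite in_itv/= => /andP[_ sd].
  by have := lt_le_trans (lt_trans dt ts) sd; rewrite ltxx.
split=> //.
- have ce : {in [set: R], continuous eta}.
    move=> x _; apply: differentiable_continuous; apply/derivable1_diffP.
    by have [] := De x.
  case=> [|k]; first by split.
  apply: Cs1D => //; first exact: openT.
    by move=> x _; have [] := De x.
  by apply: (Cs_ext openT _ (sz k)) => x _; have [_ ->] := De x.
- by move=> t; have [_ ->] := De t.
- move=> t; rewrite in_itv/= => /andP[ct td]; rewrite /eta.
  rewrite Rintegral_mkcond [RHS]Rintegral_mkcond.
  rewrite /Rintegral; congr fine; apply: ae_eq_integral => //.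
  + by apply/measurable_EFinP/(measurable_restrictT _ _).1 => //; exact: measurable_funTS.
  + by apply/measurable_EFinP/(measurable_restrictT _ _).1 => //; exact: measurable_funTS.
  apply: filterS2 (ae_neq c) (ae_neq t) => s sc st _ /=; congr EFin.
  rewrite !patchE; case: ifPn; rewrite ?inE ?notin_setE /= !in_itv/=.
    move=> sle; have slt : (s : R) < t by rewrite lt_neqAle st sle.
    case: ifPn => //; rewrite notin_setE /= in_itv/= slt andbT => /negP.
    rewrite -leNgt => scle; apply/eqP; apply: contraT => /zcd; rewrite in_itv/= => /andP[cs _].
    by have := le_anti (introT andP (conj scle cs)) => E; move: sc; rewrite E eqxx.
  move=> /negP; rewrite -ltNge => ts; case: ifPn => //; rewrite inE /= in_itv/= => /andP[_ /(lt_trans ts)].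
  by rewrite ltxx.
Qed.

(** With [P] the primitive of [W], integration by parts turns the hypothesis into the orthogonality
    of [F + P] to every admissible function of mean zero. Such a function is constant almost
    everywhere. *)
Lemma du_bois_reymond (c d : R) (F W : R -> R) : c < d ->
  lam.-integrable `[c, d] (EFin \o F) -> lam.-integrable `[c, d] (EFin \o W) ->
  (forall (eta : R -> R) (c' d' : R), c < c' -> d' < d -> smooth setT eta ->
    (forall t, eta t != 0 -> t \in `[c', d']) ->
    \int[lam]_t (F t * 'D_1 eta t) = \int[lam]_t (W t * eta t)) ->
  exists C, {ae lam, forall t : measurableTypeR R, (t : R) \in `[c, d] ->
    F t = C - \int[lam]_(s in `]c, (t : R)[) W s}.
Proof.
move=> cd intF intW hF.
have intWo : lam.-integrable `]c, d[ (EFin \o W).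
  apply: integrableS intW => //; exact: subset_itv_oo_cc.
pose P t := \int[lam]_(s in `]c, t[) W s.
pose E t := F t + P t.
have intP : lam.-integrable `[c, d] (EFin \o P).
  have cP : {within `[c, d], continuous (fun x => \int[lam]_(s in `[c, x]) W s)}.
    by apply: parameterized_integral_continuous => //; exact: ltW.
  have := continuous_compact_integrable (@segment_compact R c d) cP.
  apply: eq_integrable => // t; rewrite inE/= in_itv/= => /andP[ct td].
  congr EFin; rewrite /P.
  have iWt : lam.-integrable `[c, t] (EFin \o W).
    apply: integrableS intW => //= s; rewrite /= !in_itv/= => /andP[-> /le_trans]; exact.
  rewrite -Rintegral_itv_obnd_cbnd.
    rewrite -Rintegral_itv_bndo_bndc//.
    by apply: integrableS iWt => //= s; rewrite /= !in_itv/= => /andP[/ltW -> /ltW ->].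
  by apply: integrableS iWt => //= s; rewrite /= !in_itv/= => /andP[/ltW -> ->].
have intE : lam.-integrable `[c, d] (EFin \o E).
  by apply: integrable_addr => //; exact: measurable_itv.
have cd3 : 0 < (d - c) / 3 by rewrite divr_gt0// subr_gt0.
(* A fixed bump on the middle third of the interval; its multiples correct the mean of any other
   bump. *)
pose p0 := c + (d - c) / 3; pose q0 := d - (d - c) / 3.
have pq0 : [/\ c < p0, p0 < q0 & q0 < d].
  by rewrite /p0 /q0; split; lra.
have hat_itv k p q t : hat k p q t != 0 -> t \in `]p, q[ :> bool.
  by apply: contraNT => /hat_out ->.
have mhat k p q := @measurable_hat R k p q.
have hat1 k p q t : `|hat k p q t| <= 1 :> R by rewrite ger0_norm ?hat_ge0 ?hat_le1.
have i1 : lam.-integrable `[c, d] (EFin \o cst (1 : R)).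
  apply: measurable_bounded_integrable => //.
  - by rewrite /= lebesgue_measure_itv/=; case: ifP => //; rewrite -EFinD ltry.
  - by exists 1; split=> // x x1 y _ /=; rewrite normr1 ltW.
have itest (f : R -> R) k p q : c < p -> q < d -> lam.-integrable `[c, d] (EFin \o f) ->
    lam.-integrable setT (EFin \o (fun t : R => f t * hat k p q t)).
  move=> cp qd; apply: (@integrable_mul_supp R _ (measurableTypeR R) lam `[c, d]%classic f _ 1 (measurable_itv _) (mhat _ _ _) (hat1 _ _ _)).
  move=> t /hat_itv; rewrite /= !in_itv/= => /andP[pt tq].
  by rewrite (ltW (lt_trans cp pt)) (ltW (lt_trans tq qd)).
have ihat k p q : c < p -> q < d -> lam.-integrable setT (EFin \o hat k p q).
  move=> cp qd; have := itest (cst 1) k p q cp qd i1.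
  by apply: eq_integrable => // t _ /=; rewrite mul1r.
case: pq0 => cp0 p0q0 q0d.
pose b2 := hat 0 p0 q0; pose I2 := \int[lam]_t b2 t.
have I20 : I2 != 0.
  apply/eqP => I2E.
  have : {ae lam, forall t : measurableTypeR R, b2 t = 0}.
    have ib := ihat 0%N p0 q0 cp0 q0d.
    have e0 : (\int[lam]_t `|(b2 t)%:E| = 0)%E.
      have := I2E; rewrite /I2 /Rintegral => /eqP; rewrite fine_eq0; last exact: integrable_fin_num.
      move=> /eqP <-; apply: eq_integral => t _; by rewrite gee0_abs// lee_fin hat_ge0.
    have := (@ae_eq_integral_abs _ _ _ lam setT measurableT (EFin \o b2) (measurable_int _ ib)).1 e0.
    by apply: filterS => t /(_ I) /= [].
  move=> [N [mN N0 sub]].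
  have : (lam `]p0, q0[ <= lam N)%E.
    apply: le_measure; rewrite ?inE//.
    move=> t; rewrite /= in_itv/= => /andP[pt tq]; apply: sub => /=.
    apply/eqP; rewrite /b2 /hat mulf_eq0 negb_or /flat.
    by rewrite !mulr_gt0 ?subr_gt0// !expr0 !mul1r !gt_eqF ?expR_gt0.
  by rewrite [leRHS]N0 lebesgue_measure_itv/= lte_fin p0q0 -EFinB lee_fin subr_le0 leNgt p0q0.
pose C := (\int[lam]_t (E t * b2 t)) / I2.
exists C.
have iEC : lam.-integrable `[c, d] (EFin \o (fun t => E t - C)).
  have iC : lam.-integrable `[c, d] (EFin \o cst C).
    have := @integrable_mulrl _ (measurableTypeR R) R lam _ C (cst 1) (measurable_itv _) i1.
    by apply: eq_integrable => // t _ /=; rewrite mulr1.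
  exact: (@integrable_subr _ (measurableTypeR R) R lam _ E (cst C) (measurable_itv _) intE iC).
have := @ae0_of_bumps R c d (fun t => E t - C) cd iEC.
move=> /(_ _)/wrap[]; last first.
  by apply: filterS => t h /h; rewrite /E => /eqP; rewrite subr_eq0 => /eqP <-; rewrite /P addrK.
move=> k p q cp pq qd; pose b1 : R -> R := hat k (ratr p) (ratr q); pose I1 := \int[lam]_t b1 t.
(* The combination has mean zero, so that its primitive has compact support and can be used in
   [hF]. *)
pose zeta t := I2 * b1 t - I1 * b2 t.
have szeta : smooth setT zeta.
  move=> j; apply: (Cs_ext openT (f := fun t => I2 * b1 t + (- I1) * b2 t)).
    by move=> t _; rewrite /zeta mulNr.
  apply: CsD openT _ _; apply: CsM openT _ _; [exact: Cs_cst|exact: smooth_hat|exact: Cs_cst|exact: smooth_hat].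
pose c' := Num.min (ratr p) p0; pose d' := Num.max (ratr q) q0.
have cc' : c < c' by rewrite lt_min cp cp0.
have dd' : d' < d by rewrite gt_max qd q0d.
have zsupp t : zeta t != 0 -> t \in `[c', d'].
  apply: contraNT => tn; rewrite /zeta /b1 /b2 !hat_out ?mulr0 ?subrr//.
    apply: contra tn; rewrite !in_itv/= => /andP[/ltW h1 /ltW h2].
    by rewrite ge_min h1 orbT le_max h2 orbT.
  apply: contra tn; rewrite !in_itv/= => /andP[/ltW h1 /ltW h2].
  by rewrite ge_min h1 le_max h2.
have ib1 := ihat k (ratr p) (ratr q) cp qd.
have ib2 := ihat 0%N p0 q0 cp0 q0d.
have z0 : \int[lam]_t zeta t = 0.
  rewrite /zeta RintegralB//; [|exact: integrable_mulrl|exact: integrable_mulrl].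
  by rewrite RintegralZl// RintegralZl// -/I1 -/I2 mulrC subrr.
have c'd' : c' <= d'.
  by rewrite ge_min !le_max (ltW p0q0) !orbT.
have zsupp2 t : zeta t != 0 -> t \in `[c, d].
  move=> /zsupp; rewrite !in_itv/= => /andP[h1 h2].
  by rewrite (ltW (lt_le_trans cc' h1)) (ltW (le_lt_trans h2 dd')).
(* [smooth_primitive] is used twice: with [c'] and [d'] it puts the support inside the open
   interval, as [hF] requires; with [c] and [d] it writes [eta] as an integral starting at [c], as
   [ac_mul] requires. *)
have [_ De esupp _] := smooth_primitive c'd' szeta zsupp z0.
have [se _ _ eE0] := smooth_primitive (ltW cd) szeta zsupp2 z0.
set eta := (fun t => Rintegral _ _ _) in De esupp se eE0.
have eE t : t \in `[c, d] -> eta t = \int[lam]_(s in `]c, t[) zeta s := eE0 t.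
have hFe := hF eta c' d' cc' dd' se esupp.
have izeta : lam.-integrable setT (EFin \o zeta).
  by apply: integrable_subr => //; exact: integrable_mulrl.
have izo : lam.-integrable `]c, d[ (EFin \o zeta).
  exact: (@integrableS _ (measurableTypeR R) R lam setT `]c, d[%classic _ measurableT (measurable_itv _) _ izeta).
have [ip ep] := @ac_mul R c d 0 0 W zeta (ltW cd) intWo izo.
have eta_d : eta d = 0.
  by apply/eqP; apply: contraT => /esupp; rewrite in_itv/= => /andP[_ dd]; have := le_lt_trans dd dd'; rewrite ltxx.
rewrite mulr0 !add0r in ep.
have dcd : d \in `[c, d] by rewrite in_itv/= lexx (ltW cd).
rewrite -(eE _ dcd) eta_d mulr0 in ep.
have eoo : \int[lam]_(t in `]c, d[) (W t * eta t + P t * zeta t) = 0.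
  rewrite ep; apply: eq_Rintegral => t; rewrite inE/= in_itv/= => /andP[/ltW ct /ltW td].
  by rewrite !add0r eE// in_itv/= ct td.
have ece : continuous eta by exact: smooth_continuous.
have [M _ eM] := continuous_supp_bounded (@segment_compact R c' d') ece esupp.
have esupp2 t : eta t != 0 -> `[c, d]%classic t.
  move=> /esupp; rewrite /= !in_itv/= => /andP[h1 h2].
  by rewrite (ltW (lt_le_trans cc' h1)) (ltW (le_lt_trans h2 dd')).
have iWe : lam.-integrable setT (EFin \o (fun t => W t * eta t)).
  apply: (@integrable_mul_supp R _ (measurableTypeR R) lam `[c, d]%classic W eta M (measurable_itv _) _ eM esupp2 intW).
  exact: continuous_measurable_fun.
have [Mz _ zM] := continuous_supp_bounded (@segment_compact R c' d') (smooth_continuous szeta) zsupp.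
have izf (f : R -> R) : lam.-integrable `[c, d] (EFin \o f) ->
    lam.-integrable setT (EFin \o (fun t => f t * zeta t)).
  apply: (@integrable_mul_supp R _ (measurableTypeR R) lam `[c, d]%classic f zeta Mz (measurable_itv _) _ zM zsupp2).
  exact: continuous_measurable_fun (smooth_continuous szeta).
have Ez : \int[lam]_t (E t * zeta t) = 0.
  rewrite /E; under eq_Rintegral do rewrite mulrDl.
  rewrite RintegralD//; [|exact: izf|exact: izf].
  have -> : \int[lam]_t (F t * zeta t) = \int[lam]_t (F t * 'D_1 eta t).
    by apply: eq_Rintegral => t _; rewrite De.
  rewrite hFe -RintegralD//; last exact: izf.
  rewrite -[RHS]eoo [RHS]Rintegral_mkcond; apply: eq_Rintegral => t _.
  rewrite patchE; case: ifPn => //; rewrite notin_setE/= in_itv/= => /negP tn.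
  have -> : eta t = 0.
    apply/eqP; apply: contraNT tn => /esupp; rewrite in_itv/= => /andP[h1 h2].
    by rewrite (lt_le_trans cc' h1) (le_lt_trans h2 dd').
  have -> : zeta t = 0.
    apply/eqP; apply: contraNT tn => /zsupp; rewrite in_itv/= => /andP[h1 h2].
    by rewrite (lt_le_trans cc' h1) (le_lt_trans h2 dd').
  by rewrite !mulr0 addr0.
have iE1 := itest E k _ _ cp qd intE; have iE2 := itest E 0%N _ _ cp0 q0d intE.
have EI : I2 * \int[lam]_t (E t * b1 t) = I1 * \int[lam]_t (E t * b2 t).
  apply/eqP; rewrite -subr_eq0 -RintegralZl// -[X in _ - X]RintegralZl//.
  rewrite -RintegralB//; [|exact: integrable_mulrl|exact: integrable_mulrl].
  rewrite -[X in _ == X]Ez; apply/eqP; apply: eq_Rintegral => t _.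
  by rewrite /zeta; move: (E t) (b1 t) (b2 t) => e x1 x2; ring.
under eq_Rintegral do rewrite mulrBl.
rewrite RintegralB//; last exact: integrable_mulrl.
rewrite RintegralZl// -/I1 /C; apply: (mulfI I20); rewrite mulr0 mulrBr EI.
by rewrite mulrCA mulrAC -mulrA; field.
Qed.

End du_bois_reymond.

(** * Similarity coordinates *)

Lemma continuous_pairf (R : numFieldType) (T U V : normedModType R) (f : T -> U) (g : T -> V) :
  continuous f -> continuous g -> continuous (fun x => (f x, g x)).
Proof. by move=> cf cg x; apply: cvg_pair; [exact: cf|exact: cg]. Qed.

Section scaling.
Context {R : realType} {n : nat}.
Local Notation lam := (@lebesgue_measure R).
Local Notation Rx := 'rV[R]_n.+1.
Local Notation Rxt := (Rx * R)%type.
Local Notation mu := (leb R n.+1 \x @lebesgue_measure R)%E.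
Variable z0 : Rxt.
Local Notation x0 := z0.1.
Local Notation t0 := z0.2.

(* [unscale] maps (y, t) to (x, t); [past] and [jac] cut off the times t >= t0,
   where [rt] is 0. *)
Definition rt (t : R) : R := Num.sqrt (t0 - t).

Definition unscale (p : Rxt) : Rxt := (x0 + rt p.2 *: p.1, p.2).

Definition past (p : Rxt) : R := ((p.2 < t0)%R)%:R.

Definition jac (p : Rxt) : R := rt p.2 ^+ n.+1 * past p.

Lemma continuous_rt : continuous rt.
Proof.
move=> t; apply: continuous_comp; last exact: sqrt_continuous.
by apply: cvgB; [exact: cvg_cst|exact: cvg_id].
Qed.

Lemma rt_gt0 t : t < t0 -> 0 < rt t.
Proof. by move=> tt; rewrite sqrtr_gt0 subr_gt0. Qed.

Lemma rt_sqr t : t <= t0 -> rt t ^+ 2 = t0 - t.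
Proof. by move=> tt; rewrite sqr_sqrtr// subr_ge0. Qed.

Lemma measurable_rt : measurable_fun setT (rt : measurableTypeR R -> R).
Proof. exact: (continuous_measurable_fun continuous_rt). Qed.

Lemma continuous_unscale : continuous unscale.
Proof.
apply: (@continuous_pairf R Rxt Rx R (fun p => x0 + rt p.2 *: p.1) snd); last by move=> p; exact: cvg_snd.
move=> p; apply: cvgD; first exact: cvg_cst.
apply: cvgZ; last exact: cvg_fst.
by apply: (@continuous_comp _ _ _ snd rt); [exact: cvg_snd|exact: continuous_rt].
Qed.

Lemma measurable_unscale :
  measurable_fun setT (unscale : Rx * measurableTypeR R -> Rx * measurableTypeR R).
Proof.
apply: measurable_fun_pair; last exact: measurable_snd.
apply: measurable_fun_coord => i /=.
rewrite (_ : (fun x => _) = (fun p : Rx * measurableTypeR R => x0 ord0 i + rt p.2 * p.1 ord0 i)).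
  apply: measurable_funD => //; apply: measurable_funM.
    exact: (measurable_funT_comp measurable_rt measurable_snd).
  exact: (measurable_funT_comp (measurable_coord i) measurable_fst).
by apply/funext => p; rewrite !mxE.
Qed.

Lemma past_ge0 p : 0 <= past p. Proof. by rewrite ler0n. Qed.

Lemma jac_ge0 p : 0 <= jac p.
Proof. by rewrite mulr_ge0 ?past_ge0// exprn_ge0// sqrtr_ge0. Qed.

Lemma measurable_past : measurable_fun setT (past : Rx * measurableTypeR R -> R).
Proof.
have -> : past = \1_([set p : Rx * measurableTypeR R | (p.2 : R) < t0]).
  apply/funext => p; rewrite indicE /past; congr ((nat_of_bool _)%:R).
  by apply/idP/idP => [h|]; rewrite inE.
apply: measurable_indic.
apply: (@measurable_ltr _ _ (Rx * measurableTypeR R)%type snd (cst t0)); last exact: measurable_cst.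
exact: measurable_snd.
Qed.

Lemma measurable_jac : measurable_fun setT (jac : Rx * measurableTypeR R -> R).
Proof.
apply: measurable_funM measurable_past; apply: measurable_funX.
exact: (measurable_funT_comp measurable_rt measurable_snd).
Qed.

(** At a fixed time before [t0] the substitution is affine in space with factor [rt], whence the
    Jacobian [rt ^+ n.+1]; Tonelli collects the times, and both sides are 0 from [t0] on. *)
Lemma transfer_jac (f : Rxt -> R) : measurable_fun setT (f : Rx * measurableTypeR R -> R) ->
  (forall z, 0 <= f z) ->
  (\int[mu]_z (f z * past z)%:E = \int[mu]_p (f (unscale p) * jac p)%:E)%E.
Proof.
move=> mf f0.
have mfp : measurable_fun setT (fun z : Rx * measurableTypeR R => (f z * past z)%:E).
  by apply/measurable_EFinP; apply: measurable_funM => //; exact: measurable_past.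
have mfj : measurable_fun setT (fun z : Rx * measurableTypeR R => (f (unscale z) * jac z)%:E).
  apply/measurable_EFinP; apply: measurable_funM; last exact: measurable_jac.
  exact: (measurable_funT_comp mf measurable_unscale).
rewrite (fubini_tonelli2 _ mfp); last by move=> z; rewrite lee_fin mulr_ge0 ?past_ge0.
rewrite (fubini_tonelli2 _ mfj); last by move=> z; rewrite lee_fin mulr_ge0 ?jac_ge0.
apply: eq_integral => t _; rewrite /fubini_G /jac /past/=.
case: ltP => tt; last first.
  by rewrite !integral0_eq// => x _; rewrite !mulr0.
under eq_integral do rewrite mulr1.
rewrite (ge0_integral_leb_affine x0 (rt_gt0 tt)); first last.
- by move=> x; rewrite lee_fin.
- apply/measurable_EFinP; apply: (measurable_funT_comp mf); exact: (pair2_measurable t).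
rewrite -ge0_integralZl//.
- by apply: eq_integral => x _; rewrite mulr1 -EFinM mulrC.
- apply/measurable_EFinP.
  have m1 : measurable_fun setT (fun x : Rx => (x, t) : Rx * measurableTypeR R) by exact: (pair2_measurable t).
  exact: (measurable_funT_comp (measurable_funT_comp mf measurable_unscale) m1).
- by move=> x _; rewrite lee_fin.
- by rewrite lee_fin exprn_ge0// sqrtr_ge0.
Qed.

End scaling.

Section drift.
Context {R : realType} {n : nat}.
Local Notation Rx := 'rV[R]_n.+1.
Local Notation Rxt := (Rx * R)%type.
Variable z0 : Rxt.
Local Notation x0 := z0.1.
Local Notation t0 := z0.2.

(** Equal to 0 from [t0] on, where [rt] is 0. *)
Definition irt (t : R) : R := (rt z0 t)^-1.

Lemma irt_gt0 t : t < t0 -> 0 < irt t.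
Proof. by move=> tt; rewrite invr_gt0 rt_gt0. Qed.

Lemma irtK t : t < t0 -> irt t * rt z0 t = 1.
Proof. by move=> tt; rewrite mulVf// gt_eqF// rt_gt0. Qed.

Lemma derive_irt t : t < t0 -> derivable irt t 1 /\ 'D_1 irt t = irt t ^+ 3 / 2.
Proof.
move=> tt; have st : 0 < t0 - t by rewrite subr_gt0.
have dB : is_derive t (1 : R) (fun s : R => t0 - s) (- 1).
  by have := is_deriveB (is_derive_cst t0 t 1) (is_derive_id t 1); rewrite sub0r.
have [dS eS] : derivable (rt z0) t 1 /\ 'D_1 (rt z0) t = (2 * rt z0 t)^-1 * (-1).
  have dq := is_derive1_sqrt st.
  have [h1 h2] := @derivable_comp1 R R (@Num.sqrt R) (fun s => t0 - s) t 1 (@ex_derive _ _ _ _ _ _ _ dB) (@ex_derive _ _ _ _ _ _ _ dq).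
  split; first exact: h1.
  by rewrite /rt; move: h2; rewrite /comp /= => ->; rewrite (@derive_val _ _ _ _ _ _ _ dq) (@derive_val _ _ _ _ _ _ _ dB).
have r0 := rt_gt0 tt; have rn0 := lt0r_neq0 r0.
split; first exact: derivableV.
rewrite /irt deriveV// eS /GRing.scale/= /irt.
by field.
Qed.

(** The derivative is [irt ^+ 3 / 2], a polynomial in [irt], so the order of smoothness can be
    raised by induction. *)
Lemma smooth_irt : smooth [set t : R | t < t0] irt.
Proof.
have oU : open [set t : R | t < t0] by exact: open_lt.
have ci : {in [set t : R | t < t0], continuous irt}.
  move=> t; rewrite inE => /derive_irt[d _].
  by apply: differentiable_continuous; exact/derivable1_diffP.
elim=> [|k IH]; first by split.
apply: Cs1D => //; first by move=> t /derive_irt[].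
apply: (@Cs_ext R R _ k (fun t => irt t * (irt t * (irt t * 2^-1)))).
- exact: oU.
- by move=> t; rewrite inE => /derive_irt[_ ->]; rewrite !exprS expr0 mulr1 !mulrA.
- by do 3! (apply: (CsM oU) => //); exact: Cs_cst.
Qed.

Definition before : set Rxt := [set z | z.2 < t0].

Lemma open_before : open before.
Proof. by apply: (@open_comp _ _ snd [set t : R | t < t0]); [move=> z _; exact: cvg_snd|exact: open_lt]. Qed.

Definition sim (i : 'I_n.+1) (z : Rxt) : R := (z.1 ord0 i - x0 ord0 i) * irt z.2.

Lemma smooth_fst_coord (i : 'I_n.+1) (U : set Rxt) k : Cs U k (fun z => z.1 ord0 i - x0 ord0 i).
Proof.
apply: (@Cs_sub _ _ _ setT) => //; apply: (Cs_fst (f := fun x : Rx => x ord0 i - x0 ord0 i)).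
apply: (CsD openT); first exact: Cs_coord.
exact: Cs_cst.
Qed.

Lemma smooth_irt2 : smooth before (fun z => irt z.2).
Proof. by move=> k; apply: (@Cs_snd R n k [set t : R | t < t0]); [exact: open_lt|exact: smooth_irt]. Qed.

Lemma smooth_sim (i : 'I_n.+1) : smooth before (sim i).
Proof.
by move=> k; apply: (CsM open_before); [exact: smooth_fst_coord|exact: smooth_irt2].
Qed.

Lemma derive_coord_x (i : 'I_n.+1) (v : Rxt) (z : Rxt) :
  derivable (fun z : Rxt => z.1 ord0 i - x0 ord0 i) z v /\
  'D_v (fun z : Rxt => z.1 ord0 i - x0 ord0 i) z = v.1 ord0 i.
Proof.
have d1 : is_derive (z.1 ord0 i) (v.1 ord0 i) (fun r : R => r - x0 ord0 i) (v.1 ord0 i).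
  have := is_deriveB (is_derive_id (z.1 ord0 i) (v.1 ord0 i)) (is_derive_cst (x0 ord0 i) (z.1 ord0 i) (v.1 ord0 i)).
  by rewrite subr0.
have HA (h : R) : (z + h *: v).1 ord0 i = z.1 ord0 i + h *: v.1 ord0 i by rewrite /= !mxE.
have [h1 h2] := @derivable_line R Rxt R (fun r => r - x0 ord0 i) (fun z => z.1 ord0 i) z v (v.1 ord0 i) HA (@ex_derive _ _ _ _ _ _ _ d1).
split; first exact: h1.
by move: h2; rewrite /comp /= => ->; exact: (@derive_val _ _ _ _ _ _ _ d1).
Qed.

Lemma derive_time (f : R -> R) (v z : Rxt) : derivable f z.2 1 ->
  derivable (fun z : Rxt => f z.2) z v /\ 'D_v (fun z : Rxt => f z.2) z = v.2 * 'D_1 f z.2.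
Proof.
move=> /(derive1D v.2)[d1 <-].
exact: (@derivable_line R Rxt R f snd z v v.2 (fun h => erefl) d1).
Qed.

(** [(x - x0)_k / (2 (t0 - t))]: minus the k-th component of the velocity of the curves along which
    [(x - x0) / sqrt (t0 - t)] is constant. *)
Definition cdrift (k : 'I_n.+1) (z : Rxt) : R := (z.1 ord0 k - x0 ord0 k) * (irt z.2 ^+ 2 / 2).

(* The derivation along the similarity variable: functions of (x-x0)/sqrt(t0-t) are killed. *)
Definition drift (f : Rxt -> R) (z : Rxt) : R :=
  'D_(0, 1) f z - \sum_(k < n.+1) cdrift k z * 'D_(basis_vec k, 0) f z.

Lemma driftM (f g : Rxt -> R) z : (forall v, derivable f z v) -> (forall v, derivable g z v) ->
  drift (fun z => f z * g z) z = f z * drift g z + g z * drift f z.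
Proof.
move=> df dg; rewrite /drift.
under eq_bigr do rewrite [X in _ * X]deriveM//.
rewrite [X in X - _]deriveM// /GRing.scale/=.
under eq_bigr do rewrite mulrDr.
rewrite big_split/= !mulrBr !mulr_sumr.
have -> : \sum_i cdrift i z * (f z * 'D_(basis_vec i, 0) g z) =
  \sum_i f z * (cdrift i z * 'D_(basis_vec i, 0) g z).
  by apply: eq_bigr => i _; rewrite mulrCA.
have -> : \sum_i cdrift i z * (g z * 'D_(basis_vec i, 0) f z) =
  \sum_i g z * (cdrift i z * 'D_(basis_vec i, 0) f z).
  by apply: eq_bigr => i _; rewrite mulrCA.
by rewrite opprD addrACA.
Qed.

Lemma derive_sim (i : 'I_n.+1) v z : z.2 < t0 ->
  derivable (sim i) z v /\
  'D_v (sim i) z = (z.1 ord0 i - x0 ord0 i) * (v.2 * (irt z.2 ^+ 3 / 2)) + irt z.2 * v.1 ord0 i.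
Proof.
move=> zt; have [d1 e1] := derive_coord_x i v z.
have [di ei] := derive_irt zt; have [d2 e2] := derive_time v di.
split; first exact: (derivableM d1 d2).
by apply: etrans (deriveM d1 d2) _; rewrite e1 e2 ei.
Qed.

(** Only the i-th space derivative contributes, and [cdrift i] times [irt] equals the time
    derivative of [sim i]. *)
Lemma drift_sim (beta : R -> R) (i : 'I_n.+1) z : smooth setT beta -> z.2 < t0 ->
  drift (fun z => beta (sim i z)) z = 0.
Proof.
move=> sb zt; have db : derivable beta (sim i z) 1 by exact: (smooth_derivable sb).
have E v : 'D_v (fun z => beta (sim i z)) z = 'D_1 beta (sim i z) * 'D_v (sim i) z.
  have [ds _] := derive_sim i v zt.
  by have [_] := derivable_comp1 ds db.
rewrite /drift E; under eq_bigr do rewrite E.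
have [_ ->] := derive_sim i (0, 1) zt.
rewrite (bigD1 i)//= big1 => [|k ki].
  have [_ ->] := derive_sim i (basis_vec i, 0) zt.
  by rewrite /cdrift /basis_vec /= !mxE !eqxx /=; ring.
have [_ ->] := derive_sim i (basis_vec k, 0) zt.
by rewrite /basis_vec /= mxE eqxx eq_sym (negbTE ki) /= mul0r !mulr0 add0r !mulr0.
Qed.

Lemma drift_prod (I : Type) (r : seq I) (beta : I -> R -> R) (j : I -> 'I_n.+1) z :
  (forall i, smooth setT (beta i)) -> z.2 < t0 ->
  drift (fun z => \prod_(i <- r) beta i (sim (j i) z)) z = 0.
Proof.
move=> sb zt.
have S (r' : seq I) : smooth before (fun z => \prod_(i <- r') beta i (sim (j i) z)).
  move=> k; apply: Cs_prod open_before _ => i.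
  apply: (Cs_comp1 (W := setT) open_before _ (sb i k)) => //; exact: smooth_sim.
have S1 i : smooth before (fun z => beta i (sim (j i) z)).
  by move=> k; apply: (Cs_comp1 (W := setT) open_before _ (sb i k)) => //; exact: smooth_sim.
elim: r => [|i r IH].
  rewrite (_ : (fun z => _) = cst 1); last by apply/funext => y; rewrite big_nil.
  rewrite /drift derive_cst big1 ?subr0// => k _; by rewrite derive_cst mulr0.
rewrite (_ : (fun z => _) = (fun z => beta i (sim (j i) z) * \prod_(i <- r) beta i (sim (j i) z))); last first.
  by apply/funext => y; rewrite big_cons.
rewrite driftM ?IH ?drift_sim// ?mulr0 ?addr0//.
- by move=> v; exact: (smooth_derivable (S1 i)).
- by move=> v; exact: (smooth_derivable (S r)).
Qed.

End drift.

(** * Absolute continuity along similarity curves *)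

Section transport.
Context {R : realType} {n : nat}.
Local Notation lam := (@lebesgue_measure R).
Local Notation Rx := 'rV[R]_n.+1.
Local Notation Rxt := (Rx * R)%type.
Local Notation mu := (leb R n.+1 \x @lebesgue_measure R)%E.
Variable z0 : Rxt.
Local Notation x0 := z0.1.
Local Notation t0 := z0.2.

Lemma measurable_irt : measurable_fun setT (irt z0 : measurableTypeR R -> R).
Proof.
have -> : irt z0 = irt z0 \_ [set t : R | t < t0].
  apply/funext => t; rewrite patchE; case: ifPn => //; rewrite notin_setE/= => /negP.
  by rewrite -leNgt => tt; rewrite /irt /rt ler0_sqrtr ?invr0// subr_le0.
have mU : measurable ([set t : R | t < t0] : set (measurableTypeR R)).
  by apply: open_measurable; exact: open_lt.
apply: (measurable_restrictT _ mU).1; apply: open_continuous_measurable_fun.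
  exact: open_lt.
exact: (Cs_continuous (smooth_irt z0 0%N)).
Qed.

Lemma measurable_cdrift k : measurable_fun setT (cdrift z0 k : Rx * measurableTypeR R -> R).
Proof.
apply: measurable_funM.
  apply: measurable_funB => //; exact: (measurable_funT_comp (measurable_coord k) measurable_fst).
apply: measurable_funM => //; apply: measurable_funX.
exact: (measurable_funT_comp measurable_irt measurable_snd).
Qed.

Lemma smooth_cdrift k : smooth (before z0) (cdrift z0 k).
Proof.
move=> j; apply: (CsM (@open_before _ _ z0)); first exact: smooth_fst_coord.
apply: (CsM (@open_before _ _ z0)); last exact: Cs_cst.
apply: Cs_ext (@open_before _ _ z0) _ (CsM (@open_before _ _ z0) (smooth_irt2 z0 j) (smooth_irt2 z0 j)).
by move=> z _; rewrite expr2.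
Qed.

Lemma locally_integrable_on_mul (D U : set Rxt) (f h : Rxt -> R) :
  measurable (D : set (Rx * measurableTypeR R)) ->
  D `<=` U -> locally_integrable_on D f -> {in U, continuous h} ->
  measurable_fun setT (h : Rx * measurableTypeR R -> R) ->
  locally_integrable_on D (fun z => h z * f z).
Proof.
move=> mD DU [mf lf] ch mh; split.
  by apply: measurable_funM => //; exact: measurable_funTS.
move=> K cK KD; have mK := compact_measurable_rVR cK.
have : compact (h @` K).
  apply: continuous_compact => //; apply: continuous_in_subspaceT => z zK.
  by apply: ch; rewrite inE; apply/DU/KD/set_mem.
move=> /compact_bounded[M [Mr MM]].
have := @integrable_bounded_mul _ _ _ mu K f h (`|M| + 1) mK (measurable_funTS mh) _ (lf K cK KD).
move=> /(_ _)/wrap[].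
  by move=> z Kz; apply: (MM (`|M| + 1)); [rewrite (le_lt_trans (ler_norm _))// ltrDl|exists z].
by apply: eq_integrable => // z _ /=; rewrite mulrC.
Qed.

Lemma locally_integrable_onD (D : set Rxt) (f g : Rxt -> R) :
  locally_integrable_on D f -> locally_integrable_on D g ->
  locally_integrable_on D (fun x => f x + g x).
Proof.
move=> [mf lf] [mg lg]; split; first exact: measurable_funD.
move=> K cK KD; have mK := compact_measurable_rVR cK.
exact: integrable_addr mK (lf K cK KD) (lg K cK KD).
Qed.

Lemma locally_integrable_on_sum (D : set Rxt) (I : Type) (r : seq I) (f : I -> Rxt -> R) :
  measurable (D : set (Rx * measurableTypeR R)) ->
  (forall i, locally_integrable_on D (f i)) ->
  locally_integrable_on D (fun z => \sum_(i <- r) f i z).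
Proof.
move=> mD lf; elim: r => [|i r IH].
  under eq_fun do rewrite big_nil.
  split; first exact: measurable_cst.
  by move=> K _ _; exact: integrable0.
under eq_fun do rewrite big_cons.
exact: locally_integrable_onD.
Qed.

(** When [g] and [gt] are the space and time derivatives of [u], this is minus the derivative of [u]
    along the similarity curves. *)
Definition velocity (g : 'I_n.+1 -> Rxt -> R) (gt : Rxt -> R) (z : Rxt) : R :=
  \sum_(k < n.+1) cdrift z0 k z * g k z - gt z.

Lemma slab_before a : slab a t0 `<=` before z0.
Proof. by move=> z /andP[]. Qed.

Lemma locally_integrable_velocity a g gt :
  (forall k, locally_integrable_on (slab a t0) (g k)) ->
  locally_integrable_on (slab a t0) gt ->
  locally_integrable_on (slab a t0) (velocity g gt).
Proof.
move=> lg lgt; apply: locally_integrable_onB => //.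
apply: locally_integrable_on_sum; first exact: measurable_slab.
move=> k; apply: (locally_integrable_on_mul (measurable_slab _ _) (@slab_before a) (lg k)).
  exact: (Cs_continuous (smooth_cdrift k 0%N)).
exact: measurable_cdrift.
Qed.

Lemma integral_jac (f : Rxt -> R) : measurable_fun setT (f : Rx * measurableTypeR R -> R) ->
  (\int[mu]_z (f z * past z0 z)%:E = \int[mu]_p (f (unscale z0 p) * jac z0 p)%:E)%E.
Proof.
move=> mf; exact: (@integral_transfer _ _ _ _ R mu mu (unscale z0) (past z0) (jac z0)
  (past_ge0 z0) (jac_ge0 z0)
  (@transfer_jac R n z0) f mf).
Qed.

Lemma integrable_jac (f : Rxt -> R) : measurable_fun setT (f : Rx * measurableTypeR R -> R) ->
  mu.-integrable setT (fun z => (f z * past z0 z)%:E) <->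
  mu.-integrable setT (fun p => (f (unscale z0 p) * jac z0 p)%:E).
Proof.
move=> mf; exact: (@integrable_transfer _ _ _ _ R mu mu (unscale z0) (past z0) (jac z0)
  (measurable_unscale z0) (past_ge0 z0) (jac_ge0 z0) (measurable_past z0) (measurable_jac z0)
  (@transfer_jac R n z0) f mf).
Qed.

(** The change of variables gives integrability with the Jacobian as a factor; on a compact set
    before [t0] the inverse [irt ^+ n.+1] of the Jacobian is bounded. *)
Lemma locally_integrable_unscale a f : locally_integrable_on (slab a t0) f ->
  locally_integrable_on (slab a t0) (fun p => f (unscale z0 p)).
Proof.
move=> lf; have [mf lfK] := lf.
pose f0 := f \_ (slab a t0).
have mf0 : measurable_fun setT (f0 : Rx * measurableTypeR R -> R).
  exact: (measurable_restrictT _ (measurable_slab _ _)).1 mf.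
have E p : slab a t0 p -> f0 (unscale z0 p) = f (unscale z0 p).
  by move=> sp; rewrite /f0 patchE mem_set.
have m1 : measurable_fun setT ((fun p => f0 (unscale z0 p)) : Rx * measurableTypeR R -> R).
  exact: (measurable_funT_comp mf0 (measurable_unscale z0)).
split.
  apply: (eq_measurable_fun (fun p : Rx * measurableTypeR R => f0 (unscale z0 p))).
    by move=> p; rewrite inE => /E.
  exact: measurable_funTS m1.
move=> K cK KD; have mK := compact_measurable_rVR cK.
have cUK : compact (unscale z0 @` K).
  by apply: continuous_compact => //; apply: continuous_subspaceT; exact: continuous_unscale.
have UKD : unscale z0 @` K `<=` slab a t0 by move=> _ [p /KD Dp <-].
have mUK := compact_measurable_rVR cUK.
pose f1 := f \_ (unscale z0 @` K).
have if1 : mu.-integrable setT (EFin \o f1).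
  exact: (@integrable_patch _ _ _ mu _ f mUK).1 (lfK _ cUK UKD).
have mf1 := measurable_fun_int if1.
have i1 : mu.-integrable setT (fun z => (f1 z * past z0 z)%:E).
  apply: eq_integrable if1 => // z _ /=; congr EFin.
  rewrite /f1 patchE; case: ifPn; last by rewrite mul0r.
  by rewrite inE => /UKD/andP[_ zt]; rewrite /past zt mulr1.
have /(integrableS measurableT mK (@subsetT _ _)) i2 := (integrable_jac mf1).1 i1.
have : compact ((fun p : Rxt => irt z0 p.2 ^+ n.+1) @` K).
  apply: continuous_compact => //; apply: continuous_in_subspaceT => z zK.
  apply: (@continuous_comp _ _ _ (fun p : Rxt => irt z0 p.2) (fun r => r ^+ n.+1)); last exact: exprn_continuous.
  by apply: (Cs_continuous (smooth_irt2 z0 0%N)); rewrite inE; apply: (@slab_before a); apply/KD/set_mem.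
move=> /compact_bounded[M [Mr MM]].
have m3 : measurable_fun setT ((fun p => irt z0 p.2 ^+ n.+1) : Rx * measurableTypeR R -> R).
  by apply: measurable_funX; exact: (measurable_funT_comp measurable_irt measurable_snd).
have := @integrable_bounded_mul _ _ _ mu K (fun p => f1 (unscale z0 p) * jac z0 p) (fun p => irt z0 p.2 ^+ n.+1) (`|M| + 1) mK (measurable_funTS m3) _ i2.
move=> /(_ _)/wrap[].
  by move=> z Kz; apply: (MM (`|M| + 1)); [rewrite (le_lt_trans (ler_norm _))// ltrDl|exists z].
apply: eq_integrable => // p; rewrite inE => Kp /=; congr EFin.
have /andP[_ pt] := KD _ Kp.
rewrite /f1 patchE mem_set; last by exists p.
by rewrite /jac /past pt mulr1 -mulrA -exprMn [X in X ^+ _]mulrC irtK// expr1n mulr1.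
Qed.

End transport.

Lemma Rintegral_sum d (T : measurableType d) (R : realType) (mu : {measure set T -> \bar R})
    (I : Type) (r : seq I) (f : I -> T -> R) :
  (forall i, mu.-integrable setT (EFin \o f i)) ->
  mu.-integrable setT (EFin \o (fun x => \sum_(i <- r) f i x)) /\
  \int[mu]_x (\sum_(i <- r) f i x) = \sum_(i <- r) \int[mu]_x f i x.
Proof.
move=> fi; elim: r => [|i r [IH1 IH2]].
  have -> : (fun x => \sum_(i <- [::]) f i x) = cst 0 by apply/funext => x; rewrite big_nil.
  by split; [exact: integrable0|rewrite big_nil /Rintegral integral0].
have -> : (fun x => \sum_(j <- i :: r) f j x) = (fun x => f i x + \sum_(j <- r) f j x).
  by apply/funext => x; rewrite big_cons.
split; first exact: integrable_addr.
by rewrite RintegralD// big_cons IH2.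
Qed.

Section material_derivative.
Context {R : realType} {n : nat}.
Local Notation lam := (@lebesgue_measure R).
Local Notation Rx := 'rV[R]_n.+1.
Local Notation Rxt := (Rx * R)%type.
Local Notation mu := (leb R n.+1 \x @lebesgue_measure R)%E.
Variable z0 : Rxt.
Local Notation x0 := z0.1.
Local Notation t0 := z0.2.

Variables (a : R) (u : Rxt -> R) (g : 'I_n.+1 -> Rxt -> R) (gt : Rxt -> R).
Hypothesis at0 : a < t0.
Hypothesis wg : forall k, is_weak_deriv (slab a t0) (basis_vec k, 0) u (g k).
Hypothesis wgt : is_weak_deriv (slab a t0) (0, 1) u gt.

Local Notation V := (velocity z0 g gt).

Lemma sim_unscale i p : p.2 < t0 -> sim z0 i (unscale z0 p) = p.1 ord0 i.
Proof.
move=> pt; rewrite /sim /unscale /= !mxE addrAC subrr add0r.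
by rewrite mulrC mulrA irtK// mul1r.
Qed.

Definition sim_bump (I : rV_index n.+1) (z : Rxt) : R :=
  \prod_(i < n.+1) bumpI (I i) (sim z0 i z).

Lemma sim_bump_unscale I p : p.2 < t0 -> sim_bump I (unscale z0 p) = rV_bump I p.1.
Proof. by move=> pt; apply: eq_bigr => i _; rewrite sim_unscale. Qed.

Lemma drift_sim_bump I z : z.2 < t0 -> drift z0 (sim_bump I) z = 0.
Proof.
move=> zt; exact: (@drift_prod R n z0 _ (index_enum 'I_n.+1) (fun i => bumpI (I i)) id z (fun i => smooth_hat _ _ _) zt).
Qed.

Lemma smooth_sim_bump I : smooth (before z0) (sim_bump I).
Proof.
move=> k; apply: Cs_prod (@open_before _ _ z0) _ => i.
apply: (Cs_comp1 (W := setT) (@open_before _ _ z0) _ (smooth_hat _ _ _ k)) => //.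
exact: smooth_sim.
Qed.

(** The power of [irt] is the inverse Jacobian of [unscale]; after the change of variables only
    [eta] remains. *)
Definition ftime (eta : R -> R) (z : Rxt) : R := eta z.2 * irt z0 z.2 ^+ n.+1.

Lemma smooth_irtX j : smooth (before z0) (fun z => irt z0 z.2 ^+ j).
Proof.
move=> k; elim: j => [|j IH]; first exact: Cs_cst.
apply: (Cs_ext (f := fun z => irt z0 z.2 * irt z0 z.2 ^+ j)).
- exact: open_before.
- by move=> z _; rewrite exprS.
- apply: (CsM (@open_before _ _ z0)) => //; exact: smooth_irt2.
Qed.

Lemma smooth_ftime eta : smooth setT eta -> smooth (before z0) (ftime eta).
Proof.
move=> se k; apply: (CsM (@open_before _ _ z0)); last exact: smooth_irtX.
apply: (@Cs_sub _ _ _ [set z : Rxt | setT z.2]) => //.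
apply: Cs_snd; [exact: openT|exact: se].
Qed.

Lemma derive_irtX j t : t < t0 -> derivable (fun t => irt z0 t ^+ j) t 1 /\
  'D_1 (fun t => irt z0 t ^+ j) t = j%:R / 2 * irt z0 t ^+ j.+2.
Proof.
move=> tt; have [di ei] := derive_irt tt.
elim: j => [|j [dj ej]].
  rewrite mul0r mul0r (_ : (fun t => _) = cst 1); last by apply/funext => s; rewrite expr0.
  by split; [exact: derivable_cst|exact: derive_cst].
rewrite (_ : (fun t => _) = (fun t => irt z0 t * irt z0 t ^+ j)); last first.
  by apply/funext => s; rewrite exprS.
split; first exact: (derivableM di dj).
apply: etrans (deriveM di dj) _; rewrite ei ej /GRing.scale/=.
by rewrite -[in RHS]natr1 !exprS; set s := irt z0 t; set r := s ^+ j; ring.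
Qed.

Lemma derive_ftime eta z v : smooth setT eta -> z.2 < t0 ->
  'D_v (ftime eta) z = v.2 * ('D_1 eta z.2 * irt z0 z.2 ^+ n.+1
     + n.+1%:R / 2 * irt z0 z.2 ^+ 2 * (ftime eta z)).
Proof.
move=> se zt; have [dX eX] := derive_irtX n.+1 zt.
have de : derivable eta z.2 1 by exact: (smooth_derivable se).
have dM : derivable (fun t => eta t * irt z0 t ^+ n.+1) z.2 1 by exact: (derivableM de dX).
have [_ e1] := derive_time v dM.
apply: etrans e1 _; congr (_ * _).
apply: etrans (deriveM de dX) _.
rewrite eX /GRing.scale/= /ftime !exprS; set s := irt z0 z.2; set e := eta z.2; set d := 'D_1 eta z.2.
by set r := s ^+ n; ring.
Qed.

(** At time [t] the support in space is the box dilated by [rt t], and for times in [[c, d]] the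
    largest factor is [rt c]. *)
Lemma sim_bump_supp I N c d z : (forall x : Rx, rV_bump I x != 0 -> rV_box N x) ->
  d < t0 -> c <= z.2 <= d -> sim_bump I z != 0 ->
  ((fun y => x0 + rt z0 c *: y) @` (@rV_box R n.+1 N) `*` `[c, d]%classic) z.
Proof.
move=> supp dt0 /andP[cz zd] nz; have zt : z.2 < t0 by exact: le_lt_trans zd dt0.
have ct : c < t0 by exact: le_lt_trans cz zt.
split; last by rewrite /= in_itv/= cz zd.
pose y : Rx := irt z0 z.2 *: (z.1 - x0).
have Ez : z = unscale z0 (y, z.2).
  case: z zt {cz zd nz} @y => x t /= zt; rewrite /unscale /= scalerA mulrC irtK// scale1r.
  by rewrite addrC subrK.
have yb : rV_box N y.
  apply: supp; move: nz; rewrite {1}Ez sim_bump_unscale//.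
exists ((irt z0 c * rt z0 z.2) *: y); last first.
  by rewrite scalerA mulrA (mulrC (rt z0 c)) irtK// mul1r {2}Ez.
move=> i; rewrite mxE; move: (yb i); rewrite !in_itv/= -!ler_norml normrM => yi.
apply: le_trans yi; rewrite ler_piMl// ger0_norm; last first.
  by rewrite mulr_ge0 ?sqrtr_ge0// ltW// irt_gt0.
rewrite -(irtK ct) ler_pM2l ?irt_gt0// /rt ler_sqrt ?subr_ge0 ?lerD2l ?lerN2//.
exact: ltW.
Qed.

(** The weak time derivative is tested with [Phi], a bump in the similarity variable times
    [ftime eta], and the k-th space derivative with [cdrift k * Phi]. The difference of the
    identities is the weak form of the derivative along the curves, and it is then read in the
    coordinates [(y, t)]. *)
Lemma material_identity I N (eta : R -> R) c d : (forall x : Rx, rV_bump I x != 0 -> rV_box N x) ->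
  a < c -> d < t0 -> smooth setT eta -> (forall t, eta t != 0 -> t \in `[c, d]) ->
  \int[mu]_z (u (unscale z0 z) * (rV_bump I z.1 * 'D_1 eta z.2)) =
  \int[mu]_z (V (unscale z0 z) * (rV_bump I z.1 * eta z.2)).
Proof.
move=> supp ac dt0 se etaS.
pose K := (fun y : Rx => x0 + rt z0 c *: y) @` (@rV_box R n.+1 N) `*` `[c, d]%classic.
have cK : compact K.
  apply: compact_setX; last exact: segment_compact.
  apply: continuous_compact; last exact: compact_rV_box.
  apply: continuous_subspaceT; exact: continuous_affine.
have KD : K `<=` slab a t0.
  move=> z [_ /=]; rewrite in_itv/= => /andP[q1 q2].
  by rewrite /slab/= (lt_le_trans ac q1) (le_lt_trans q2 dt0).
have KU : K `<=` before z0 by move=> z /KD/andP[].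
have detaS t : 'D_1 eta t != 0 -> t \in `[c, d].
  apply: contraNT => nt; apply/eqP; apply: (@derive_out _ _ `[c, d]%classic eta).
  - by apply: compact_closed; [exact: norm_hausdorff|exact: segment_compact].
  - by move=> y /= /negP ny; apply/eqP; apply: contraNT ny => /etaS.
  - exact/negP.
pose P := sim_bump I; pose th := ftime eta.
pose Phi z := P z * th z.
have thout z : ~ (c <= z.2 <= d) -> th z = 0.
  move=> h; rewrite /th /ftime; have [->|/etaS] := eqVneq (eta z.2) 0; first by rewrite mul0r.
  by rewrite in_itv/= => /h.
have Phi0 z : ~ K z -> Phi z = 0.
  move=> nK; rewrite /Phi; have [zcd|/negP/thout->] := boolP (c <= z.2 <= d); last by rewrite mulr0.
  have [->|Pz] := eqVneq (P z) 0; first by rewrite mul0r.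
  by exfalso; apply: nK; exact: sim_bump_supp Pz.
have sPhi : smooth (before z0) Phi.
  by move=> k; apply: (CsM (@open_before _ _ z0)); [exact: smooth_sim_bump|exact: smooth_ftime].
have tPhi : test_fun (slab a t0) Phi.
  apply: test_funI (@open_before _ _ z0) cK KD KU Phi0 sPhi.
pose Phik k z := cdrift z0 k z * Phi z.
have tPhik k : test_fun (slab a t0) (Phik k).
  apply: test_funI (@open_before _ _ z0) cK KD KU _ _ => [z /Phi0 z1|j]; first by rewrite /Phik z1 mulr0.
  by apply: (CsM (@open_before _ _ z0)); [exact: smooth_cdrift|exact: sPhi].
pose L z := 'D_(0, 1) Phi z - \sum_k 'D_(basis_vec k, 0) (Phik k) z.
(* The drift kills the bump in the similarity variable. The divergence of [cdrift], which is
   [(n + 1) / (2 (t0 - t))], cancels the derivative of the inverse Jacobian in [ftime], so that only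
   the derivative of [eta] is left. *)
have LE z : L z = P z * ('D_1 eta z.2 * irt z0 z.2 ^+ n.+1).
  have [zt|zt] := ltP z.2 t0; last first.
    have nK : ~ K z by move=> /KU; rewrite /before/= ltNge zt.
    have clK : closed K by apply: compact_closed => //; exact: norm_hausdorff.
    have -> : 'D_1 eta z.2 = 0.
      apply/eqP; apply: contraT => /detaS; rewrite in_itv/= => /andP[_ /le_lt_trans /(_ dt0)].
      by rewrite ltNge zt.
    rewrite mul0r mulr0 /L (derive_out _ clK Phi0 nK) big1 ?subr0// => k _.
    by apply: (derive_out _ clK _ nK) => y /Phi0 y0; rewrite /Phik y0 mulr0.
  have dP v : derivable P z v by exact: (smooth_derivable (@smooth_sim_bump I) zt).
  have dth v : derivable th z v by exact: (smooth_derivable (smooth_ftime se) zt).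
  have dPhi v : derivable Phi z v by exact: (smooth_derivable sPhi zt).
  have dcd k v : derivable (cdrift z0 k) z v by exact: (smooth_derivable (@smooth_cdrift _ _ z0 k) zt).
  have Ecd k : 'D_(basis_vec k, 0) (cdrift z0 k) z = irt z0 z.2 ^+ 2 / 2.
    have [d1 e1] := @derive_coord_x R n z0 k (basis_vec k, 0) z.
    have [di _] := derive_irtX 2 zt.
    have di2 : derivable (fun t => irt z0 t ^+ 2 / 2) z.2 1.
      exact: (derivableM di (derivable_cst _ _ _)).
    have [d2 e2] := derive_time (basis_vec k, 0) di2.
    apply: etrans (deriveM d1 d2) _; rewrite e1 e2 /= mul0r scaler0 add0r.
    by rewrite /basis_vec mxE !eqxx /GRing.scale/= mulr1.
  have Dth k : 'D_(basis_vec k, 0) th z = 0 by rewrite /th derive_ftime//= mul0r.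
  rewrite /L; under eq_bigr do rewrite (deriveM (dcd _ _) (dPhi _)) Ecd (deriveM (dP _) (dth _)) Dth.
  rewrite (deriveM (dP _) (dth _)) derive_ftime// mul1r -/th.
  have := drift_sim_bump I zt; rewrite /drift -/P => /eqP; rewrite subr_eq0 => /eqP ->.
  rewrite big_split/= sumr_const card_ord.
  have -> : \sum_(k < n.+1) cdrift z0 k z *: (P z *: (0 : R) + th z *: 'D_(basis_vec k, 0) P z) =
    th z * \sum_(k < n.+1) cdrift z0 k z * 'D_(basis_vec k, 0) P z.
    by rewrite mulr_sumr; apply: eq_bigr => k _; rewrite /GRing.scale/= mulr0 add0r mulrCA.
  rewrite /GRing.scale/= -mulr_natr /Phi.
  by move: (\sum_k _) => S; ring.
have RE z : \sum_k g k z * Phik k z - gt z * Phi z = V z * Phi z.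
  by rewrite /velocity mulrBl mulr_suml; congr (_ - _); apply: eq_bigr => k _; rewrite /Phik mulrCA mulrA.
have [lu lgt hgt] := wgt.
have lg k : locally_integrable_on (slab a t0) (g k) by have [] := wg k.
have cL : continuous L.
  have c1 := @smooth_test R Rxt _ Phi (0, 1) tPhi.
  have c2 k := @smooth_test R Rxt _ (Phik k) (basis_vec k, 0) (tPhik k).
  have c3 : continuous (fun z => \sum_k 'D_(basis_vec k, 0) (Phik k) z).
    elim: (index_enum _) => [|k r IH].
      rewrite (_ : (fun z => _) = cst 0); first exact: cst_continuous.
      by apply/funext => z; rewrite big_nil.
    rewrite (_ : (fun z => _) = (fun z => 'D_(basis_vec k, 0) (Phik k) z + \sum_(k <- r) 'D_(basis_vec k, 0) (Phik k) z)).
      by move=> z; exact: (continuousD (c2 k z) (IH z)).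
    by apply/funext => z; rewrite big_cons.
  move=> z; exact: (continuousB (c1 z) (c3 z)).
have EQ : \int[mu]_z (u z * L z) = \int[mu]_z (V z * Phi z).
  have [_ iu _ eu] := integrable_test_rVR lu tPhi.
  have [igt _ egt _] := integrable_test_rVR lgt tPhi.
  have -> : \int[mu]_z (u z * L z) = \int[mu]_z (u z * 'D_(0, 1) Phi z) -
      \sum_k \int[mu]_z (u z * 'D_(basis_vec k, 0) (Phik k) z).
    have iuk k : mu.-integrable setT (EFin \o (fun z => u z * 'D_(basis_vec k, 0) (Phik k) z)).
      by have [_ + _ _] := integrable_test_rVR lu (tPhik k); exact.
    have [i1 <-] := Rintegral_sum (index_enum 'I_n.+1) iuk.
    rewrite -RintegralB//.
    by apply: eq_Rintegral => z _; rewrite /L mulrBr mulr_sumr.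
  rewrite -eu hgt// egt.
  have -> : \sum_k \int[mu]_z (u z * 'D_(basis_vec k, 0) (Phik k) z) =
     \sum_k - \int[mu]_z (g k z * Phik k z).
    apply: eq_bigr => k _.
    have [_ _ _ <-] := integrable_test_rVR lu (tPhik k).
    have [_ _ ->] := wg k; last exact: tPhik.
    by have [_ _ ->] := integrable_test_rVR (lg k) (tPhik k).
  rewrite sumrN opprK addrC.
  have igk k : mu.-integrable setT (EFin \o (fun z => g k z * Phik k z)).
    by have [] := integrable_test_rVR (lg k) (tPhik k).
  have [i1 <-] := Rintegral_sum (index_enum 'I_n.+1) igk.
  rewrite -RintegralB//.
  by apply: eq_Rintegral => z _; rewrite RE.
have mS : measurable (slab a t0 : set (Rx * measurableTypeR R)) by exact: measurable_slab.
have lV : locally_integrable_on (slab a t0) V by exact: locally_integrable_velocity.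
pose u0 := u \_ (slab a t0); pose V0 := V \_ (slab a t0).
have mu0 : measurable_fun setT (u0 : Rx * measurableTypeR R -> R) by exact: (measurable_restrictT _ mS).1 lu.1.
have mV0 : measurable_fun setT (V0 : Rx * measurableTypeR R -> R) by exact: (measurable_restrictT _ mS).1 lV.1.
(* Change of variables: the Jacobian cancels the power of [irt] carried by [B], and the bump becomes
   a function of [y] alone. Both sides of the identity are of this form. *)
have TR (f f0 B : Rxt -> R) (beta : R -> R) : f0 = f \_ (slab a t0) ->
    measurable_fun setT (f0 : Rx * measurableTypeR R -> R) -> continuous B ->
    (forall z, B z = P z * (beta z.2 * irt z0 z.2 ^+ n.+1)) -> (forall t, beta t != 0 -> t \in `[c, d]) ->
    \int[mu]_z (f z * B z) = \int[mu]_z (f (unscale z0 z) * (rV_bump I z.1 * beta z.2)).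
  move=> f0E mf0 cB BE bS.
  have inS t : beta t != 0 -> a < t < t0.
    by move=> /bS; rewrite in_itv/= => /andP[q1 q2]; rewrite (lt_le_trans ac q1) (le_lt_trans q2 dt0).
  have mB := continuous_measurable_rVR cB.
  have := @integral_jac R n z0 (fun z => f0 z * B z) (measurable_funM mf0 mB).
  rewrite /Rintegral => e; congr fine; transitivity (\int[mu]_z (f0 z * B z * past z0 z)%:E)%E.
    apply: eq_integral => z _; congr EFin; rewrite BE.
    have [->|/inS /[dup] h /andP[_ h2]] := eqVneq (beta z.2) 0; first by rewrite !(mul0r, mulr0).
    by rewrite /past h2 mulr1 f0E patchE mem_set.
  rewrite e; apply: eq_integral => p _; congr EFin; rewrite BE/=.
  have [->|/inS /[dup] h /andP[_ h2]] := eqVneq (beta p.2) 0; first by rewrite !(mul0r, mulr0).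
  rewrite /P sim_bump_unscale// /jac /past h2 mulr1 f0E patchE mem_set//.
  rewrite -!mulrA; congr (_ * (_ * _)).
  by rewrite -exprMn irtK// expr1n mulr1.
apply: etrans (esym (TR u u0 L ('D_1 eta) erefl mu0 cL LE detaS)) _; rewrite EQ.
have cPhi := smooth_continuous (test_fun_smooth tPhi).
exact: (TR V V0 Phi eta erefl mV0 cPhi (fun=> erefl) etaS).
Qed.

(** By du Bois-Reymond the pairing of the slices with each bump in [y] has the expected primitive
    form at almost every time. The bumps are countably many, so the good times can be chosen before
    the bump; at two good times the bumps then determine the difference of the slices. The
    exceptional set of [y] depends on the two times. *)
Lemma material_ac : exists2 A : set R,
  {ae lam, forall t : measurableTypeR R, a < (t : R) < t0 -> A t} &
  forall t1 t2, A t1 -> A t2 -> a < t1 -> t1 < t2 -> t2 < t0 ->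
    {ae leb R n.+1, forall y, u (unscale z0 (y, t2)) = u (unscale z0 (y, t1)) -
       \int[lam]_(s in `]t1, t2[) V (unscale z0 (y, s))}.
Proof.
have [lu lgt _] := wgt.
have lg k : locally_integrable_on (slab a t0) (g k) by have [] := wg k.
have lV := locally_integrable_velocity lg lgt.
pose U p := u (unscale z0 p); pose VU p := V (unscale z0 p).
have lU : locally_integrable_on (slab a t0) U by exact: locally_integrable_unscale.
have lVU : locally_integrable_on (slab a t0) VU by exact: locally_integrable_unscale.
pose F (I : rV_index n.+1) (t : R) := \int[leb R n.+1]_x (U (x, t) * rV_bump I x).
pose W (I : rV_index n.+1) (t : R) := \int[leb R n.+1]_x (VU (x, t) * rV_bump I x).
pose c := inner_left a t0; pose d := inner_right a t0.
pose supp (I : rV_index n.+1) := exists M, forall x : Rx, rV_bump I x != 0 -> rV_box M x.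
have intF I N f : supp I -> locally_integrable_on (slab a t0) f ->
    lam.-integrable `[c N, d N] (EFin \o (fun t : R => \int[leb R n.+1]_x (f (x, t) * rV_bump I x))).
  move=> [M sI] lf; have [h1 h2 h3] := inner_lt N at0.
  exact: (integrable_slice_inner h1 h3 lf (@compact_rV_box R _ M) (measurable_rV_bump _) (@rV_bump_le1 R _ I) sI).
have /choice[C hC] : forall q : rV_index n.+1 * nat, exists C, supp q.1 ->
    {ae lam, forall t : measurableTypeR R, (t : R) \in `[c q.2, d q.2] ->
      F q.1 t = C - \int[lam]_(s in `]c q.2, (t : R)[) W q.1 s}.
  move=> [I N] /=; have [sI|nsI] := pselect (supp I); last by exists 0.
  have [h1 h2 h3] := inner_lt N at0.
  have := @du_bois_reymond R (c N) (d N) (F I) (W I) h2 (intF I N U sI lU) (intF I N VU sI lVU).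
  move=> /(_ _)/wrap[]; last by move=> [C hC]; exists C.
  move=> eta c' d' cc' dd' se etaS.
  have [M sIM] := sI.
  have ac' : a < c' := lt_trans h1 cc'; have dt0 : d' < t0 := lt_trans dd' h3.
  have detaS t : 'D_1 eta t != 0 -> t \in `[c', d'].
    apply: contraNT => nt; apply/eqP; apply: (@derive_out _ _ `[c', d']%classic eta).
    - by apply: compact_closed; [exact: norm_hausdorff|exact: segment_compact].
    - by move=> y /= /negP ny; apply/eqP; apply: contraNT ny => /etaS.
    - exact/negP.
  have ce := smooth_continuous se; have cde := smooth_continuous (smooth_D (1 : R) se).
  have [M1 _ eM1] := continuous_supp_bounded (@segment_compact R c' d') ce etaS.
  have [M2 _ eM2] := continuous_supp_bounded (@segment_compact R c' d') cde detaS.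
  have [_ _ ->] := slice_pairing ac' dt0 lU (@compact_rV_box R _ M) (measurable_rV_bump _) (@rV_bump_le1 R _ I) sIM
    (continuous_measurable_fun cde) eM2 detaS.
  have [_ _ ->] := slice_pairing ac' dt0 lVU (@compact_rV_box R _ M) (measurable_rV_bump _) (@rV_bump_le1 R _ I) sIM
    (continuous_measurable_fun ce) eM1 etaS.
  exact: (material_identity sIM ac' dt0 se etaS).
(* Besides the formula for all pairings, a good slice must be integrable on boxes, in order that the
   bumps separate. *)
pose A (t : R) := (forall M, (leb R n.+1).-integrable (rV_box M) (fun x => (U (x, t))%:E)) /\
  (forall q : rV_index n.+1 * nat, supp q.1 -> t \in `[c q.2, d q.2] ->
      F q.1 t = C q - \int[lam]_(s in `]c q.2, t[) W q.1 s).
have boxU (f : Rxt -> R) : locally_integrable_on (slab a t0) f ->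
    {ae lam, forall t : measurableTypeR R, forall N : nat,
    (leb R n.+1).-integrable setT (fun x => ((f \_ (slab_box a t0 N)) (x, t))%:E)}.
  move=> lf; apply: ae_foralln => N.
  have mB := compact_measurable_rVR (@compact_slab_box R n a t0 N).
  have := (@integrable_patch _ _ _ mu _ f mB).1 (lf.2 _ (@compact_slab_box R n a t0 N) (@slab_box_sub R n a t0 N at0)).
  by move=> /ae_integrable2.
exists A.
  have : {ae lam, forall t : measurableTypeR R, forall q : rV_index n.+1 * nat, supp q.1 -> (t : R) \in `[c q.2, d q.2] ->
      F q.1 t = C q - \int[lam]_(s in `]c q.2, (t : R)[) W q.1 s}.
    apply: ae_countable => q; have [sq|nsq] := pselect (supp q.1); last by apply: aeW => t /nsq.
    by apply: filterS (hC q sq) => t ht _.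
  apply: filterS2 (boxU U lU) => t It ht tab; split=> // M.
  have [N0 tN0] := inner_exhaust tab.
  pose N := maxn M N0.
  have mB := @measurable_rV_box R n.+1 M.
  apply: (@eq_integrable _ _ _ _ _ mB (fun x => ((U \_ (slab_box a t0 N)) (x, t))%:E)).
    move=> x; rewrite inE => xN; rewrite patchE mem_set//; split => /=.
      by apply: rV_box_nd xN; exact: leq_maxl.
    move: tN0; rewrite !in_itv/= => /andP[h2 h3].
    rewrite (le_trans (inner_left_nd at0 (leq_maxr _ _)) h2).
    by rewrite (le_trans h3 (inner_right_nd at0 (leq_maxr _ _))).
  exact: integrableS (It N).
move=> t1 t2 [I1 E1] [I2 E2] at1 t12 t2t0.
have [N t1N t2N] : exists2 N, t1 \in `[c N, d N] & t2 \in `[c N, d N].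
  have [N1 k1] : exists N, t1 \in `[c N, d N] by apply: inner_exhaust; rewrite at1 (lt_trans t12 t2t0).
  have [N2 k2] : exists N, t2 \in `[c N, d N] by apply: inner_exhaust; rewrite t2t0 (lt_trans at1 t12).
  move: k1 k2; rewrite !in_itv/= => /andP[a1 a2] /andP[b1 b2].
  exists (maxn N1 N2); rewrite in_itv/=.
    by rewrite (le_trans (inner_left_nd at0 (leq_maxl _ _)) a1) (le_trans a2 (inner_right_nd at0 (leq_maxl _ _))).
  by rewrite (le_trans (inner_left_nd at0 (leq_maxr _ _)) b1) (le_trans b2 (inner_right_nd at0 (leq_maxr _ _))).
move: (t1N) (t2N); rewrite !in_itv/= => /andP[ct1 t1d] /andP[ct2 t2d].
pose Bx M : set Rxt := @rV_box R n.+1 M `*` `[t1, t2]%classic.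
have cB M : compact (Bx M) by apply: compact_setX; [exact: compact_rV_box|exact: segment_compact].
have BD M : Bx M `<=` slab a t0.
  move=> z [_ /=]; rewrite in_itv/= => /andP[q1 q2].
  by rewrite /slab/= (lt_le_trans at1 q1) (le_lt_trans q2 t2t0).
pose Bo M : set Rxt := @rV_box R n.+1 M `*` `]t1, t2[%classic.
have mBo M : measurable (Bo M : set (Rx * measurableTypeR R)).
  by apply: measurableX; [exact: measurable_rV_box|exact: measurable_itv].
pose VB M := VU \_ (Bo M).
have iVB M : mu.-integrable setT (EFin \o VB M).
  apply: (@integrable_patch _ _ _ mu _ VU (mBo M)).1.
  apply: integrableS (lVU.2 _ (cB M) (BD M)) => //; first exact: compact_measurable_rVR (cB M).
  by move=> z [z1 z2]; split=> //; exact: subset_itv_oo_cc z2.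
pose S (x : Rx) := \int[lam]_(s in `]t1, t2[) VU (x, s).
have SE M (x : Rx) : rV_box M x -> S x = \int[lam]_s VB M (x, s).
  move=> xM; rewrite /S Rintegral_mkcond; apply: eq_Rintegral => s _.
  rewrite /VB !patchE; congr (if _ then _ else _).
  apply/idP/idP; rewrite !inE /=; first by split.
  by case.
have iS M : (leb R n.+1).-integrable (rV_box M) (EFin \o S).
  have := integrableS measurableT (@measurable_rV_box R n.+1 M) (@subsetT _ _) (integrable_Rfubini1 (iVB M)).
  by apply: eq_integrable => [|x]; [exact: measurable_rV_box|rewrite inE => /SE /= ->].
have := @separating_rV R n.+1 (fun y => (U (y, t2) - U (y, t1)) + S y).
move=> /(_ _ _)/wrap[].
- move=> M; have mB := @measurable_rV_box R n.+1 M.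
  apply: integrable_addr => //; exact: (@integrable_subr _ _ _ _ _ (fun y => U (y, t2)) (fun y => U (y, t1)) mB (I2 M) (I1 M)).
- move=> I [M sI]; have mB := @measurable_rV_box R n.+1 M.
  have mI := @measurable_rV_bump R _ I.
  have j1 := @integrable_mul_supp R _ _ (leb R n.+1) _ (fun x => U (x, t1)) _ _ mB mI (@rV_bump_le1 R _ I) sI (I1 M).
  have j2 := @integrable_mul_supp R _ _ (leb R n.+1) _ (fun x => U (x, t2)) _ _ mB mI (@rV_bump_le1 R _ I) sI (I2 M).
  have j3 := @integrable_mul_supp R _ _ (leb R n.+1) _ S _ _ mB mI (@rV_bump_le1 R _ I) sI (iS M).
  under eq_Rintegral do rewrite mulrDl mulrBl.
  rewrite RintegralD//; last exact: (integrable_subr measurableT j2 j1).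
  rewrite RintegralB//.
  have sI' : supp I by exists M.
  have e1 := E1 (I, N) sI' t1N; have e2 := E2 (I, N) sI' t2N.
  rewrite -[X in X - _]/(F I t2) -[X in _ - X + _]/(F I t1) e1 e2.
  pose f z := VB M z * rV_bump I z.1.
  have i_f : mu.-integrable setT (EFin \o f).
    apply: (@integrable_bounded_mul _ _ _ mu _ (VB M) (fun z => rV_bump I z.1) 1 measurableT _ _ (iVB M)).
      exact: (measurable_funT_comp mI measurable_fst).
    by move=> z _; exact: rV_bump_le1.
  have -> : \int[leb R n.+1]_x (S x * rV_bump I x) = \int[mu]_z f z.
    rewrite Rintegral12_prod//; apply: ae_eq_Rintegral => //.
    - exact: measurable_fun_int j3.
    - exact: measurable_fun_int (integrable_Rfubini1 i_f).
    - apply: filterS (ae_integrable1 (iVB M)) => x ix _; rewrite /f /= RintegralZr//.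
      have [->|/sI xM] := eqVneq (rV_bump I x) 0; first by rewrite !mulr0.
      by rewrite (SE M).
  have -> : \int[mu]_z f z = \int[lam]_(s in `]t1, t2[) W I s.
    rewrite Rintegral21_prod// [RHS]Rintegral_mkcond; apply: eq_Rintegral => s _.
    rewrite patchE; case: ifPn => sI12; last first.
      rewrite /Rintegral integral0_eq// => x _.
      rewrite /f /VB patchE memNset ?mul0r//; apply: contraNnot sI12.
      by case=> _ /= ?; rewrite inE.
    apply: eq_Rintegral => x _; rewrite /f /VB/=.
    have [->|/sI xM] := eqVneq (rV_bump I x) 0; first by rewrite !mulr0.
    by rewrite patchE mem_set//; split => //=; move: sI12; rewrite inE.
  have iW : lam.-integrable `[c N, d N] (EFin \o W I) by exact: intF.
  have iW2 : lam.-integrable `]c N, t2[ (EFin \o W I).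
    apply: integrableS iW => //= s; rewrite /= !in_itv/= => /andP[/ltW -> /ltW h].
    exact: le_trans h t2d.
  have := @Rintegral_itvB R (W I) (BRight (c N)) (BLeft t2) t1 iW2 _ _.
  rewrite !bnd_simp => /(_ ct1 t12) <-.
  have -> : \int[lam]_(t in `]c N, t1]) W I t = \int[lam]_(t in `]c N, t1[) W I t.
    rewrite -Rintegral_itv_bndo_bndc//.
    apply: integrableS iW => //= s; rewrite /= !in_itv/= => /andP[/ltW -> /ltW h].
    exact: le_trans h t1d.
  by ring.
apply: filterS => y hy; have : U (y, t2) - U (y, t1) + S y = 0 by apply: hy; exact: rV_box_exhaust.
rewrite -/(U (y, t2)) -/(U (y, t1)) -/(VU _) => /eqP; rewrite addr_eq0 subr_eq => /eqP ->.
by rewrite addrC.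
Qed.

End material_derivative.

(** * The Gaussian weight *)

Section moments.
Context {R : realType}.
Local Notation lam := (@lebesgue_measure R).

Lemma integral_prod_coord n (k : R -> R) : measurable_fun setT (k : measurableTypeR R -> R) ->
  (forall s, 0 <= k s) -> lam.-integrable setT (EFin \o k) ->
  (leb R n).-integrable setT (fun x => (\prod_(i < n) k (x ord0 i))%:E).
Proof.
move=> mk k0 ik.
have mp n' : measurable_fun setT (fun x : 'rV[R]_n' => \prod_(i < n') k (x ord0 i)).
  by apply: measurable_prod => i _; exact: (measurable_funT_comp mk (measurable_coord i)).
have p0 n' (x : 'rV[R]_n') : 0 <= \prod_(i < n') k (x ord0 i) by apply: prodr_ge0.
elim: n => [|n IH].
  apply/integrableP; split; first by apply/measurable_EFinP; exact: mp.
  rewrite integral_dirac//; first by rewrite diracT mul1e ltry.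
  by apply: measurableT_comp => //; apply/measurable_EFinP; exact: mp.
apply/integrableP; split; first by apply/measurable_EFinP; exact: mp.
rewrite ge0_integral_rsnoc; first last.
- by move=> x; exact: abse_ge0.
- by apply: measurableT_comp => //; apply/measurable_EFinP; exact: mp.
have E (x : 'rV[R]_n) : (\int[lam]_s `|(\prod_(i < n.+1) k (rsnoc (x, s) ord0 i))%:E| =
    (\prod_(i < n) k (x ord0 i))%:E * \int[lam]_s (k s)%:E)%E.
  rewrite -ge0_integralZl//; first last.
  - by rewrite lee_fin p0.
  - by move=> s _; rewrite lee_fin.
  - exact/measurable_EFinP.
  apply: eq_integral => s _; rewrite gee0_abs ?lee_fin ?p0// -EFinM; congr EFin.
  rewrite big_ord_recr/=; congr (_ * _); last by rewrite mxE unlift_none.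
  apply: eq_bigr => j _.
  have -> : widen_ord (leqnSn n) j = lift ord_max j by apply: ord_inj; rewrite lift_max.
  by rewrite mxE liftK.
under eq_integral do rewrite E.
have fk : (\int[lam]_s (k s)%:E)%E \is a fin_num by exact: (integrable_fin_num _ ik).
rewrite ge0_integralZr//; first last.
- by apply: integral_ge0 => s _; rewrite lee_fin.
- by move=> x _; rewrite lee_fin.
- by apply/measurable_EFinP; exact: mp.
rewrite lte_mul_pinfty//.
- by apply: integral_ge0 => x _; rewrite lee_fin.
- exact: (integrable_fin_num _ IH).
- by rewrite ltey_eq fk.
Qed.

(** The function is [6 exp (- s^2 / 16)]. It dominates [(1 + s^2) exp (- s^2 / 4)], which is the
    factor of one coordinate in [gam_moment]: [1 + s^2 <= 6 (1 + 3 s^2 / 16)]. *)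
Lemma integrable_gauss4 : lam.-integrable setT (EFin \o (fun s : R => 6 * gauss_fun (4^-1 * s))).
Proof.
apply: (@integrable_mulrl _ (measurableTypeR R)) => //.
have mg : measurable_fun setT ((fun s : R => gauss_fun (4^-1 * s)) : measurableTypeR R -> R).
  by apply: measurableT_comp; [exact: measurable_gauss_fun|exact: measurable_funM].
apply/integrableP; split; first exact/measurable_EFinP.
have /integrableP[mG] := @integrableT_gauss R.
rewrite (@ge0_integral_affine R 0 4^-1)//; first last.
  by apply: measurableT_comp.
have -> : (\int[lam]_x `|(EFin \o gauss_fun) (0 + 4^-1 * x)%R| =
  \int[lam]_x `|(EFin \o (fun s : R => gauss_fun (4^-1 * s))) x|)%E.
  by apply: eq_integral => x _; rewrite /= add0r.
move=> h; rewrite ltey; apply/eqP => h2; move: h; rewrite h2 gt0_muley ?ltxx//.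
Qed.

End moments.

Section gaussian.
Context {R : realType} {n : nat}.
Local Notation lam := (@lebesgue_measure R).
Local Notation Rx := 'rV[R]_n.+1.
Local Notation Rxt := (Rx * R)%type.
Local Notation mu := (leb R n.+1 \x @lebesgue_measure R)%E.

Lemma sqnormE (v : Rx) : sqnorm v = \sum_i v ord0 i ^+ 2.
Proof. by apply: eq_bigr => i _; rewrite expr2. Qed.

Lemma sqnorm_ge0 (v : Rx) : 0 <= sqnorm v.
Proof. by rewrite sqnormE sumr_ge0// => i _; rewrite sqr_ge0. Qed.

Lemma sqnormZ c (v : Rx) : sqnorm (c *: v) = c ^+ 2 * sqnorm v.
Proof. by rewrite !sqnormE mulr_sumr; apply: eq_bigr => i _; rewrite mxE exprMn. Qed.

Lemma measurable_sqnorm : measurable_fun setT (@sqnorm R n.+1).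
Proof.
apply: measurable_sum => i; apply: measurable_funM; exact: measurable_coord.
Qed.

(** The Gaussian weight of the similarity coordinates, that is, the heat kernel one unit of time
    before its centre. *)
Definition gam (y : Rx) : R := heat_kernel y (-1).

Local Notation c0 := ((4 * pi : R) `^ (- (n.+1%:R / 2))).

Lemma c0_gt0 : 0 < c0.
Proof. by rewrite powR_gt0// mulr_gt0// pi_gt0. Qed.

Lemma gamE y : gam y = c0 * expR (- (sqnorm y / 4)).
Proof.
rewrite /gam /heat_kernel ltrN10; congr (_ `^ _ * expR _).
  by rewrite mulrN1 opprK.
by rewrite mulrN1 invrN mulrN.
Qed.

Lemma gam_gt0 y : 0 < gam y.
Proof. by rewrite gamE mulr_gt0 ?c0_gt0// expR_gt0. Qed.

Lemma gam_ge0 y : 0 <= gam y. Proof. exact/ltW/gam_gt0. Qed.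

Lemma measurable_gam : measurable_fun setT gam.
Proof.
rewrite (_ : gam = fun y => c0 * expR (- (sqnorm y / 4))); last exact/funext/gamE.
apply: measurable_funM => //; apply: measurableT_comp => //; apply: measurableT_comp => //.
by apply: measurable_funM => //; exact: measurable_sqnorm.
Qed.

(** As [1 + sum_i y_i^2 <= prod_i (1 + y_i^2)], the integrand is at most a product of functions of
    one coordinate. *)
Lemma gam_moment : (leb R n.+1).-integrable setT (fun y => ((1 + sqnorm y) * gam y)%:E).
Proof.
have mk : measurable_fun setT ((fun s : R => 6 * gauss_fun (4^-1 * s)) : measurableTypeR R -> R).
  apply: measurable_funM => //; apply: measurableT_comp; [exact: measurable_gauss_fun|exact: measurable_funM].
have k0 s : 0 <= 6 * gauss_fun (4^-1 * s) :> R by rewrite mulr_ge0// gauss_fun_ge0.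
have := integrableZl measurableT c0 (integral_prod_coord n.+1 mk k0 integrable_gauss4); apply: le_integrable => //.
  apply/measurable_EFinP; apply: measurable_funM; last exact: measurable_gam.
  by apply: measurable_funD => //; exact: measurable_sqnorm.
move=> y _ /=; rewrite lee_fin.
rewrite ger0_norm; last by rewrite mulr_ge0 ?gam_ge0// addr_ge0// sqnorm_ge0.
rewrite ger0_norm; last by rewrite mulr_ge0 ?(ltW c0_gt0)// prodr_ge0.
rewrite gamE mulrCA ler_pM2l ?c0_gt0//.
have -> : expR (- (sqnorm y / 4)) = \prod_(i < n.+1) expR (- (y ord0 i ^+ 2 / 4)).
  by rewrite sqnormE mulr_suml -sumrN expR_sum.
have h1 : 1 + sqnorm y <= \prod_(i < n.+1) (1 + y ord0 i ^+ 2).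
  rewrite sqnormE; suff [] : 0 <= \sum_i y ord0 i ^+ 2 /\
    1 + \sum_i y ord0 i ^+ 2 <= \prod_i (1 + y ord0 i ^+ 2) by [].
  elim/big_ind2 : _ => [|a b c d [a0 ab] [c0' cd]|i _]; first by rewrite addr0.
    split; first exact: addr_ge0.
    apply: le_trans (_ : (1 + a) * (1 + c) <= _).
      by rewrite mulrDl mul1r mulrDr mulr1 -addrA lerD2l [a + c]addrC lerD2l lerDl mulr_ge0.
    by apply: ler_pM => //; rewrite addr_ge0.
  by rewrite sqr_ge0.
apply: le_trans (ler_wpM2r _ h1) _; first by apply: prodr_ge0 => i _; exact: expR_ge0.
rewrite -big_split/=; apply: ler_prod => i _; set s := y ord0 i.
rewrite mulr_ge0 ?expR_ge0 ?addr_ge0 ?sqr_ge0//=.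
rewrite /gauss_fun.
have -> : - (s ^+ 2 / 4) = - (4^-1 * s) ^+ 2 + - (3 / 16 * s ^+ 2) by field.
rewrite expRD [X in _ * X]mulrC mulrA; apply: ler_wpM2r; first exact: expR_ge0.
rewrite expRN ler_pdivrMr ?expR_gt0//.
have := expR_ge1Dx (3 / 16 * s ^+ 2); have := sqr_ge0 s.
set e := expR _; set q := _ ^+ 2 => q0 he; lra.
Qed.

Variable z0 : Rxt.
Local Notation x0 := z0.1.
Local Notation t0 := z0.2.

Lemma heat_kernel_atE z : heat_kernel_at z0 z =
  c0 * irt z0 z.2 ^+ n.+1 * expR (- (sqnorm (z.1 - x0) * (irt z0 z.2 ^+ 2 / 4))) * past z0 z.
Proof.
rewrite /heat_kernel_at /heat_kernel subr_lt0 /past; case: ltP => zt; last by rewrite mulr0.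
have r0 := rt_gt0 zt; have i0 := irt_gt0 zt.
have e : z.2 - t0 = - rt z0 z.2 ^+ 2 by rewrite rt_sqr ?ltW// opprB.
rewrite mulr1 e; congr (_ * expR _); last first.
  by rewrite /irt; field; exact: lt0r_neq0.
have p4 : 0 <= 4 * pi :> R by rewrite mulr_ge0// pi_ge0.
rewrite (mulrN (4 * pi)) opprK (@powRM R (4 * pi) (rt z0 z.2 ^+ 2) _ p4 (sqr_ge0 _)); congr (_ * _).
rewrite -powR_mulrn ?ltW// -powRrM mulrN mulrC divfK// powR_invn ?ltW//.
by rewrite /irt exprVn.
Qed.

Lemma heat_kernel_at_ge0 z : 0 <= heat_kernel_at z0 z.
Proof.
rewrite heat_kernel_atE !mulr_ge0 ?past_ge0 ?expR_ge0 ?(ltW c0_gt0)//.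
by rewrite exprn_ge0// invr_ge0 sqrtr_ge0.
Qed.

Lemma heat_kernel_at_past z : heat_kernel_at z0 z = heat_kernel_at z0 z * past z0 z.
Proof. by rewrite heat_kernel_atE -!mulrA /past; case: (_ < _); rewrite ?mulr1 ?mulr0. Qed.

Lemma measurable_sqnorm_center :
  measurable_fun setT ((fun z => sqnorm (z.1 - x0)) : Rx * measurableTypeR R -> R).
Proof.
apply: (measurable_funT_comp measurable_sqnorm); apply: measurable_fun_coord => i.
under eq_fun do rewrite !mxE.
apply: measurable_funB => //; exact: (measurable_funT_comp (measurable_coord i) measurable_fst).
Qed.

Lemma measurable_irt2 j : measurable_fun setT ((fun z => irt z0 z.2 ^+ j) : Rx * measurableTypeR R -> R).
Proof.
by apply: measurable_funX; exact: (measurable_funT_comp (measurable_irt z0) measurable_snd).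
Qed.

Lemma measurable_heat_kernel_at :
  measurable_fun setT (heat_kernel_at z0 : Rx * measurableTypeR R -> R).
Proof.
rewrite (funext heat_kernel_atE).
apply: measurable_funM; last exact: measurable_past.
apply: measurable_funM; first by apply: measurable_funM => //; exact: measurable_irt2.
apply: measurableT_comp => //; apply: measurableT_comp => //.
apply: measurable_funM; first exact: measurable_sqnorm_center.
by apply: measurable_funM => //; exact: measurable_irt2.
Qed.

Lemma heat_kernel_unscale p : p.2 < t0 ->
  heat_kernel_at z0 (unscale z0 p) * rt z0 p.2 ^+ n.+1 = gam p.1.
Proof.
move=> pt; rewrite heat_kernel_atE gamE /past/= pt mulr1 addrAC subrr add0r sqnormZ.
have r0 := rt_gt0 pt.
have -> : rt z0 p.2 ^+ 2 * sqnorm p.1 * (irt z0 p.2 ^+ 2 / 4) = sqnorm p.1 / 4.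
  by rewrite /irt; field; exact: lt0r_neq0.
by rewrite mulrAC -[X in X * _]mulrA -exprMn irtK// expr1n mulr1.
Qed.

Definition gweight (p : Rxt) : R := gam p.1 * past z0 p.

Lemma gweight_ge0 p : 0 <= gweight p.
Proof. by rewrite mulr_ge0 ?gam_ge0 ?past_ge0. Qed.

Lemma measurable_gweight : measurable_fun setT (gweight : Rx * measurableTypeR R -> R).
Proof.
apply: measurable_funM; last exact: measurable_past.
exact: (measurable_funT_comp measurable_gam measurable_fst).
Qed.

Lemma transfer_heat0 (f : Rxt -> R) : measurable_fun setT (f : Rx * measurableTypeR R -> R) ->
  (forall z, 0 <= f z) ->
  (\int[mu]_z (f z * heat_kernel_at z0 z)%:E = \int[mu]_p (f (unscale z0 p) * gweight p)%:E)%E.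
Proof.
move=> mf f0; under eq_integral do rewrite heat_kernel_at_past mulrA.
rewrite transfer_jac//.
- apply: eq_integral => p _; congr EFin; rewrite /jac /gweight /past.
  case: ltP => pt; last by rewrite !mulr0.
  by rewrite !mulr1 -mulrA heat_kernel_unscale.
- by apply: measurable_funM => //; exact: measurable_heat_kernel_at.
- by move=> z; rewrite mulr_ge0// heat_kernel_at_ge0.
Qed.

Local Notation timeset J := [set z : Rxt | J z.2].

Lemma patch_mulr (D : set Rxt) (f g : Rxt -> R) :
  (fun z => (f z * g z)%:E) \_ D = (fun z => ((f \_ D) z * g z)%:E).
Proof. by apply/funext => z; rewrite !patchE; case: ifP; rewrite ?mul0r. Qed.

Lemma integral_heat (J : set R) (f : Rxt -> R) :
  measurable (timeset J : set (Rx * measurableTypeR R)) ->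
  measurable_fun (timeset J : set (Rx * measurableTypeR R)) f ->
  (\int[mu]_(z in timeset J) (f z * heat_kernel_at z0 z)%:E =
   \int[mu]_(p in timeset J) (f (unscale z0 p) * gweight p)%:E)%E.
Proof.
move=> mJ mf; rewrite integral_mkcond [RHS]integral_mkcond !patch_mulr.
exact: (@integral_transfer _ _ _ _ R mu mu (unscale z0) (heat_kernel_at z0) gweight
  heat_kernel_at_ge0 gweight_ge0 transfer_heat0 _ ((measurable_restrictT _ mJ).1 mf)).
Qed.

Lemma integrable_heat (J : set R) (f : Rxt -> R) :
  measurable (timeset J : set (Rx * measurableTypeR R)) ->
  measurable_fun (timeset J : set (Rx * measurableTypeR R)) f ->
  mu.-integrable (timeset J) (fun z => (f z * heat_kernel_at z0 z)%:E) <->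
  mu.-integrable (timeset J) (fun p => (f (unscale z0 p) * gweight p)%:E).
Proof.
move=> mJ mf; rewrite (integrable_mkcond _ mJ) [X in _ <-> X](integrable_mkcond _ mJ) !patch_mulr.
exact: (@integrable_transfer _ _ _ _ R mu mu (unscale z0) (heat_kernel_at z0) gweight
  (measurable_unscale z0) heat_kernel_at_ge0 gweight_ge0 measurable_heat_kernel_at measurable_gweight transfer_heat0 _ ((measurable_restrictT _ mJ).1 mf)).
Qed.

Lemma slice_heat t (f : Rx -> R) : t < t0 -> measurable_fun setT f -> (forall x, 0 <= f x) ->
  (\int[leb R n.+1]_x (f x * slice (heat_kernel_at z0) t x)%:E =
   \int[leb R n.+1]_y (f (x0 + rt z0 t *: y) * gam y)%:E)%E.
Proof.
move=> tt mf f0.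
have mG : measurable_fun setT (slice (heat_kernel_at z0) t).
  exact: (measurable_funT_comp measurable_heat_kernel_at (pair2_measurable t)).
have mfG : measurable_fun setT (fun x => f x * slice (heat_kernel_at z0) t x) by exact: measurable_funM.
rewrite (ge0_integral_leb_affine x0 (rt_gt0 tt)); first last.
- by move=> x; rewrite lee_fin mulr_ge0// heat_kernel_at_ge0.
- exact/measurable_EFinP.
rewrite -ge0_integralZl//; first last.
- by rewrite lee_fin exprn_ge0// sqrtr_ge0.
- by move=> x _; rewrite lee_fin mulr_ge0// heat_kernel_at_ge0.
- by apply/measurable_EFinP; exact: (measurable_funT_comp mfG (measurable_affine _ _)).
apply: eq_integral => y _; rewrite -EFinM; congr EFin.
by rewrite mulrCA -(@heat_kernel_unscale (y, t) tt); congr (_ * _); rewrite mulrC.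
Qed.

Lemma integrable_tensor_slab a b (k : Rx -> R) :
  (leb R n.+1).-integrable setT (EFin \o k) ->
  mu.-integrable (slab a b) (EFin \o (fun p => k p.1)).
Proof.
move=> ik.
have i1 : lam.-integrable `]a, b[ (EFin \o cst (1 : R)).
  apply: measurable_bounded_integrable => //.
  - by rewrite /= lebesgue_measure_itv/=; case: ifP => //; rewrite -EFinD ltry.
  - by exists 1; split=> // x x1 y _ /=; rewrite normr1 ltW.
have ii := (@integrable_patch _ (measurableTypeR R) R lam `]a, b[%classic (cst 1) (measurable_itv _)).1 i1.
have := integrableS measurableT (@measurable_slab R n a b) (@subsetT _ _) (integrable_tensor ik ii).
apply: eq_integrable; first exact: measurable_slab.
move=> p; rewrite inE => pab /=; rewrite patchE mem_set ?mulr1//.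
Qed.

Lemma integrable_slab_moment a b :
  mu.-integrable (slab a b) (EFin \o (fun p => (1 + sqnorm p.1) * gweight p)).
Proof.
have := @integrable_tensor_slab a b (fun y => (1 + sqnorm y) * gam y) gam_moment.
apply: le_integrable; first exact: measurable_slab.
  apply/measurable_EFinP/measurable_funTS/measurable_funM; last exact: measurable_gweight.
  by apply: measurable_funD => //; exact: (measurable_funT_comp measurable_sqnorm measurable_fst).
move=> p _ /=; rewrite lee_fin !ger0_norm ?mulr_ge0 ?gam_ge0 ?addr_ge0 ?sqnorm_ge0 ?gweight_ge0//.
rewrite ler_wpM2l ?addr_ge0 ?sqnorm_ge0// /gweight ler_piMr ?gam_ge0//.
by rewrite /past; case: (_ < _).
Qed.

Lemma integrable_slab_heat a b : mu.-integrable (slab a b) (EFin \o heat_kernel_at z0).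
Proof.
have mS := @measurable_slab R n a b.
have [_ h] := @integrable_heat [set t | a < t < b] (cst 1) mS (measurable_cst _).
apply: (@eq_integrable _ _ _ _ _ mS (fun z => (cst 1 z * heat_kernel_at z0 z)%:E)).
  by move=> p _ /=; rewrite mul1r.
apply: h; apply: le_integrable (integrable_slab_moment a b) => //.
  by apply/measurable_EFinP/measurable_funTS/measurable_funM => //; exact: measurable_gweight.
move=> p _ /=; rewrite lee_fin mul1r ger0_norm ?gweight_ge0// ger0_norm; last first.
  by rewrite mulr_ge0 ?gweight_ge0// addr_ge0 ?sqnorm_ge0.
by rewrite ler_peMl ?gweight_ge0// lerDl sqnorm_ge0.
Qed.

(** [|f| <= f^2 + 1], and on compact sets before [t0] the heat kernel is bounded below: its
    reciprocal [h] is continuous there. *)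
Lemma locally_integrable_of_heat a b (f : Rxt -> R) : b <= t0 ->
  measurable_fun (slab a b : set (Rx * measurableTypeR R)) f ->
  mu.-integrable (slab a b) (fun z => (f z ^+ 2 * heat_kernel_at z0 z)%:E) ->
  locally_integrable_on (slab a b) f.
Proof.
move=> bt0 mf if2; have mS := @measurable_slab R n a b.
have SU : slab a b `<=` before z0 by move=> z /andP[_ zb]; exact: lt_le_trans zb bt0.
have if3 := integrable_addr mS if2 (integrable_slab_heat a b).
have l1 : locally_integrable_on (slab a b) (fun z => f z ^+ 2 * heat_kernel_at z0 z + heat_kernel_at z0 z).
  split; last by move=> K cK KD; apply: integrableS if3 => //; exact: compact_measurable_rVR.
  apply: measurable_funD; last exact: measurable_funTS measurable_heat_kernel_at.
  apply: measurable_funM; first exact: measurable_funX.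
  exact: measurable_funTS measurable_heat_kernel_at.
pose h z := c0^-1 * (rt z0 z.2 ^+ n.+1 * expR (sqnorm (z.1 - x0) * (irt z0 z.2 ^+ 2 / 4))).
have hG z : before z0 z -> h z * heat_kernel_at z0 z = 1.
  move=> zt; rewrite heat_kernel_atE /past zt mulr1 /h expRN.
  have c1 := lt0r_neq0 c0_gt0; move: c1; set c := c0; move=> c1.
  have e1 := lt0r_neq0 (expR_gt0 (sqnorm (z.1 - x0) * (irt z0 z.2 ^+ 2 / 4))).
  move: e1; set e := expR _ => e1.
  rewrite /irt exprVn; field.
  by rewrite e1 c1 expf_neq0// gt_eqF// rt_gt0.
have mh : measurable_fun setT (h : Rx * measurableTypeR R -> R).
  apply: measurable_funM => //; apply: measurable_funM.
    by apply: measurable_funX; exact: (measurable_funT_comp (measurable_rt z0) measurable_snd).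
  apply: measurableT_comp => //; apply: measurable_funM; first exact: measurable_sqnorm_center.
  by apply: measurable_funM => //; exact: measurable_irt2.
have ch : {in before z0, continuous h}.
  have cq : {in before z0, continuous (fun z : Rxt => sqnorm (z.1 - x0) * (irt z0 z.2 ^+ 2 / 4))}.
    apply: (@Cs_continuous R Rxt (before z0) 0); apply: (CsM (@open_before _ _ z0)).
      apply: (Cs_ext (f := fun z : Rxt => \sum_(i <- index_enum 'I_n.+1) (z.1 ord0 i - x0 ord0 i) * (z.1 ord0 i - x0 ord0 i)) (@open_before _ _ z0)).
        by move=> z _; apply: eq_bigr => i _; rewrite !mxE.
      elim: (index_enum _) => [|i r IH].
        apply: (Cs_ext (f := cst 0) (@open_before _ _ z0)); last exact: Cs_cst.
        by move=> z _; rewrite big_nil.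
      apply: (Cs_ext (@open_before _ _ z0) _ (CsD (@open_before _ _ z0) (CsM (@open_before _ _ z0) (smooth_fst_coord _ i _ _) (smooth_fst_coord _ i _ _)) IH)).
      by move=> z _; rewrite big_cons.
    apply: (CsM (@open_before _ _ z0)); last exact: Cs_cst.
    exact: (@smooth_irtX R n z0 2 0%N).
  have c1 z : {for z, continuous (fun z : Rxt => rt z0 z.2 ^+ n.+1)}.
    apply: (@continuous_comp _ _ _ (fun z : Rxt => rt z0 z.2) (fun r => r ^+ n.+1)); last exact: exprn_continuous.
    by apply: (@continuous_comp _ _ _ snd (rt z0)); [exact: cvg_snd|exact: continuous_rt].
  move=> z zU; have c2 : {for z, continuous (fun z : Rxt => expR (sqnorm (z.1 - x0) * (irt z0 z.2 ^+ 2 / 4)))}.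
    by apply: continuous_comp; [exact: cq|exact: continuous_expR].
  exact: (@continuousM R Rxt (cst c0^-1) _ z (@cst_continuous _ _ _ z) (continuousM (c1 z) c2)).
have l2 := locally_integrable_on_mul mS SU l1 ch mh.
split=> // K cK KD; have mK := compact_measurable_rVR cK.
apply: le_integrable (l2.2 K cK KD) => //.
  by apply/measurable_EFinP; apply: measurable_funS mf.
move=> z Kz /=; rewrite lee_fin.
rewrite mulrDr mulrCA hG; last exact/SU/KD.
rewrite mulr1 [leRHS]ger0_norm ?addr_ge0 ?sqr_ge0//.
have := sqr_ge0 (`|f z| - 1); rewrite -[f z ^+ 2]real_normK ?num_real// => q0.
have n0 := normr_ge0 (f z); nra.
Qed.

End gaussian.

(** * Weighted Sobolev functions and traces *)

Lemma lt_pinfty_2D (R : realType) (x y : \bar R) :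
  (x < +oo -> y < +oo -> 2%:E * x + 2%:E * y < +oo)%E.
Proof. by move=> hx hy; apply: lte_add_pinfty; apply: lte_mul_pinfty. Qed.

Section weighted_sobolev.
Context {R : realType} {n : nat}.
Local Notation Rx := 'rV[R]_n.+1.
Implicit Types (f h : Rx -> R) (X Y : Rx -> Rx).

(** The vector field is a free argument: it stands for a chosen weak gradient, for an explicit field
    equal to it almost everywhere, or for a difference with the classical gradient of an
    approximation. *)
Definition energy (p f : Rx -> R) (X : Rx -> Rx) : \bar R :=
  (\int[leb R n.+1]_x ((f x ^+ 2 + sqnorm (X x)) * p x)%:E)%E.

Section weight.
Variable p : Rx -> R.
Hypotheses (p0 : forall x, 0 <= p x) (mp : measurable_fun setT p).

Lemma measurable_energy f X : measurable_fun setT f -> measurable_fun setT X ->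
  measurable_fun setT (fun x => ((f x ^+ 2 + sqnorm (X x)) * p x)%:E).
Proof.
move=> mf mX; apply/measurable_EFinP/measurable_funM => //.
apply: measurable_funD; first exact: measurable_funX.
exact: (measurable_funT_comp measurable_sqnorm mX).
Qed.

Lemma energy_integrand_ge0 f X x : (0 <= ((f x ^+ 2 + sqnorm (X x)) * p x)%:E)%E.
Proof. by rewrite lee_fin mulr_ge0// addr_ge0 ?sqr_ge0 ?sqnorm_ge0. Qed.

Lemma energy_ge0 f X : (0 <= energy p f X)%E.
Proof. by apply: integral_ge0 => x _; exact: energy_integrand_ge0. Qed.

Lemma energy_ae f X Y : measurable_fun setT f -> measurable_fun setT X -> measurable_fun setT Y ->
  {ae leb R n.+1, forall x, X x = Y x} -> energy p f X = energy p f Y.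
Proof.
move=> mf mX mY XY; apply: ae_eq_integral => //.
- exact: measurable_energy.
- exact: measurable_energy.
- by apply: filterS XY => x -> _.
Qed.

Lemma sqnormB_le (v w : Rx) : sqnorm (v - w) <= 2 * sqnorm v + 2 * sqnorm w.
Proof.
rewrite !sqnormE !mulr_sumr -big_split/=; apply: ler_sum => i _; rewrite !mxE.
have := sqr_ge0 (v ord0 i + w ord0 i); nra.
Qed.

Lemma energyB f h X Y : measurable_fun setT f -> measurable_fun setT h ->
  measurable_fun setT X -> measurable_fun setT Y ->
  (energy p (fun x => f x - h x)%R (fun x => X x - Y x)%R <= 2%:E * energy p f X + 2%:E * energy p h Y)%E.
Proof.
move=> mf mh mX mY.
rewrite /energy -!ge0_integralZl//; first last.
- by move=> x _; exact: energy_integrand_ge0.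
- exact: measurable_energy.
- by move=> x _; exact: energy_integrand_ge0.
- exact: measurable_energy.
rewrite -ge0_integralD//; first last.
- by apply: emeasurable_funM => //; exact: measurable_energy.
- by move=> x _; rewrite mule_ge0//; exact: energy_integrand_ge0.
- by apply: emeasurable_funM => //; exact: measurable_energy.
- by move=> x _; rewrite mule_ge0//; exact: energy_integrand_ge0.
apply: ge0_le_integral_nonmeas => x _.
  by rewrite lee_fin mulr_ge0// addr_ge0 ?sqr_ge0 ?sqnorm_ge0.
rewrite -!EFinM -EFinD lee_fin !mulrA -mulrDl ler_wpM2r//.
have := sqr_ge0 (f x + h x); have := sqnormB_le (X x) (Y x).
by move: (sqnorm _) (sqnorm _) (sqnorm _) => a b c; nra.
Qed.

Lemma weakly_differentiable_measurable f : weakly_differentiable f ->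
  measurable_fun setT f /\ measurable_fun setT (weak_grad f).
Proof.
move=> wf; split; first by have [[]] := wf ord0.
apply: measurable_fun_coord => i; under eq_fun do rewrite mxE.
by have [_ []] := wf i.
Qed.

Lemma test_grad (phi : Rx -> R) : test_fun setT phi ->
  measurable_fun setT phi /\ measurable_fun setT (grad phi).
Proof.
move=> tp; split.
  exact: continuous_measurable_rV (smooth_continuous (test_fun_smooth tp)).
apply: measurable_fun_coord => i; under eq_fun do rewrite mxE.
exact: continuous_measurable_rV (smooth_test (v := basis_vec i) tp).
Qed.

Lemma weak_gradB f h : weakly_differentiable f -> weakly_differentiable h ->
  weakly_differentiable (fun x => f x - h x) /\
  {ae leb R n.+1, forall x, weak_grad (fun x => f x - h x) x = weak_grad f x - weak_grad h x}.
Proof.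
move=> wf wh; have P i := weak_partialP (is_weak_partialB (wf i) (wh i)).
split; first by move=> i; have [] := P i.
have : {ae leb R n.+1, forall x, forall i : 'I_n.+1, weak_partial i (fun x => f x - h x) x =
   weak_partial i f x - weak_partial i h x}.
  by apply: ae_countable => i; have [] := P i.
by apply: filterS => x hx; apply/rowP => i; rewrite !mxE hx.
Qed.

Lemma W12E f : W12 p f <-> weakly_differentiable f /\ (energy p f (weak_grad f) < +oo)%E.
Proof. by []. Qed.

Lemma cvg_W12E phi f : cvg_W12 p phi f <->
  ((fun k => energy p (fun x => f x - phi k x)%R (fun x => weak_grad f x - grad (phi k) x)%R) @ \oo --> 0%E).
Proof. by []. Qed.

Lemma measurable_funB_rV X Y : measurable_fun setT X -> measurable_fun setT Y ->
  measurable_fun setT (fun x => X x - Y x).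
Proof.
move=> mX mY; apply: measurable_fun_coord => i; under eq_fun do rewrite !mxE.
apply: measurable_funB; first exact: (measurable_funT_comp (measurable_coord i) mX).
exact: (measurable_funT_comp (measurable_coord i) mY).
Qed.

Lemma test_funB (phi psi : Rx -> R) : test_fun setT phi -> test_fun setT psi ->
  test_fun setT (fun x => phi x - psi x).
Proof.
move=> t1 t2; have [K1 [cK1 _ pK1 _]] := test_fun_supp t1; have [K2 [cK2 _ pK2 _]] := test_fun_supp t2.
apply: (@test_funI _ _ setT setT (K1 `|` K2)) => //.
- exact: openT.
- exact: compactU.
- move=> x nK; have -> : phi x = 0.
    by apply/eqP; apply: contra_notT nK => /pK1; left.
  have -> : psi x = 0 by apply/eqP; apply: contra_notT nK => /pK2; right.
  by rewrite subr0.
- move=> k; apply: (Cs_ext openT (f := fun x => phi x + (-1) * psi x)).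
    by move=> x _; rewrite mulN1r.
  apply: (CsD openT); first exact: (test_fun_smooth t1).
  apply: (CsM openT); [exact: Cs_cst|exact: (test_fun_smooth t2)].
Qed.

Lemma gradB (phi psi : Rx -> R) x : test_fun setT phi -> test_fun setT psi ->
  grad (fun x => phi x - psi x) x = grad phi x - grad psi x.
Proof.
move=> t1 t2; apply/rowP => i; rewrite !mxE.
have d1 := smooth_derivable (v := basis_vec i) (test_fun_smooth t1) (I : setT x).
have d2 := smooth_derivable (v := basis_vec i) (test_fun_smooth t2) (I : setT x).
exact: deriveB d1 d2.
Qed.

Lemma W12_0B f h : W12_0 p f -> W12_0 p h -> W12_0 p (fun x => f x - h x).
Proof.
move=> [[wf ff] [phi tphi cphi]] [[wh fh] [psi tpsi cpsi]].
have [mf mgf] := weakly_differentiable_measurable wf.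
have [mh mgh] := weakly_differentiable_measurable wh.
have [wfh gfh] := weak_gradB wf wh.
have [mfh mgfh] := weakly_differentiable_measurable wfh.
have mB := measurable_funB_rV mgf mgh.
split.
  apply/W12E; split; first exact: wfh.
  rewrite (energy_ae mfh mgfh mB gfh).
  apply: le_lt_trans (energyB mf mh mgf mgh) _.
  exact: lt_pinfty_2D ff fh.
exists (fun k x => phi k x - psi k x); first by move=> k; exact: test_funB.
apply/cvg_W12E.
have c1 := cvgeZl (y := 2%:E) isT ((cvg_W12E phi f).1 cphi).
have c2 := cvgeZl (y := 2%:E) isT ((cvg_W12E psi h).1 cpsi).
rewrite mule0 in c1; rewrite mule0 in c2.
have dd : ((0 : \bar R) +? 0)%E by [].
have c3 := cvgeD dd c1 c2; rewrite add0e in c3.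
apply: (squeeze_cvge _ (@cvg_cst _ _ _ _ _) (c3 _)).
apply: nearW => k; rewrite energy_ge0/=.
have [mp1 mg1] := test_grad (tphi k); have [mp2 mg2] := test_grad (tpsi k).
have mX := measurable_funB_rV mgf mg1; have mY := measurable_funB_rV mgh mg2.
have m1 : measurable_fun setT (fun x => f x - phi k x) by exact: measurable_funB.
have m2 : measurable_fun setT (fun x => h x - psi k x) by exact: measurable_funB.
apply: le_trans (energyB m1 m2 mX mY).
rewrite (_ : (fun x => f x - h x - (phi k x - psi k x)) = (fun x => f x - phi k x - (h x - psi k x))); last first.
  by apply/funext => x; ring.
rewrite (@energy_ae _ _ (fun x => weak_grad f x - grad (phi k) x - (weak_grad h x - grad (psi k) x))%R)//.
- exact: measurable_funB.
- apply: measurable_funB_rV => //.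
  rewrite (_ : grad _ = fun x => grad (phi k) x - grad (psi k) x); first exact: measurable_funB_rV.
  by apply/funext => x; rewrite gradB.
- exact: measurable_funB_rV.
apply: filterS gfh => x ->; rewrite gradB//.
by apply/rowP => i; rewrite !mxE; ring.
Qed.

(** The approximations that define a trace are test functions converging in the weighted norm, so
    they also witness membership in the closure. *)
Lemma thin_trace_W12_0 f g : is_thin_trace p f g -> W12_0 p f.
Proof. by move=> [wf _ [phi [tphi cphi _]]]; split => //; exists phi. Qed.

End weight.

Section scale.
Variables (p q : Rx -> R) (a : Rx) (c d : R).
Hypotheses (p0 : forall x, 0 <= p x) (mp : measurable_fun setT p).
Hypotheses (q0 : forall x, 0 <= q x) (mq : measurable_fun setT q) (c0 : 0 < c).
Hypothesis pq : forall F : Rx -> R, measurable_fun setT F -> (forall x, 0 <= F x) ->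
  (\int[leb R n.+1]_x (F (a + c *: x) * q x)%:E = \int[leb R n.+1]_x (F x * p x)%:E)%E.

Definition scaled f (x : Rx) : R := d * f (a + c *: x).
Definition scaled_grad X (x : Rx) : Rx := (d * c) *: X (a + c *: x).

Lemma measurable_scaled f : measurable_fun setT f -> measurable_fun setT (scaled f).
Proof.
by move=> mf; apply: measurable_funM => //; exact: (measurable_funT_comp mf (measurable_affine _ _)).
Qed.

Lemma measurable_scaled_grad X : measurable_fun setT X -> measurable_fun setT (scaled_grad X).
Proof.
move=> mX; apply: measurable_fun_coord => i; under eq_fun do rewrite mxE.
apply: measurable_funM => //.
exact: (measurable_funT_comp (measurable_coord i) (measurable_funT_comp mX (measurable_affine _ _))).
Qed.

(** By the change of variables [pq] the left side is the integral of [d^2 f^2 + d^2 c^2 |X|^2], and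
    both factors are at most [d^2 (1 + c^2)]. For the heat kernel at two times [pq] holds without a
    Jacobian. *)
Lemma energy_scaled f X : measurable_fun setT f -> measurable_fun setT X ->
  (energy q (scaled f) (scaled_grad X) <= (d ^+ 2 * (1 + c ^+ 2))%:E * energy p f X)%E.
Proof.
move=> mf mX; have d1 : 0 <= d ^+ 2 * (1 + c ^+ 2) by rewrite mulr_ge0 ?sqr_ge0// addr_ge0// sqr_ge0.
have mF : measurable_fun setT (fun x => f x ^+ 2 + sqnorm (X x)).
  apply: measurable_funD; first exact: measurable_funX.
  exact: (measurable_funT_comp measurable_sqnorm mX).
rewrite /energy -(pq mF); last by move=> x; rewrite addr_ge0 ?sqr_ge0 ?sqnorm_ge0.
rewrite -ge0_integralZl//; first last.
- by move=> x _; rewrite lee_fin mulr_ge0// addr_ge0 ?sqr_ge0 ?sqnorm_ge0.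
- apply/measurable_EFinP/measurable_funM => //.
  exact: (measurable_funT_comp mF (measurable_affine _ _)).
apply: ge0_le_integral_nonmeas => x _; first exact: energy_integrand_ge0.
rewrite -EFinM lee_fin mulrA ler_wpM2r// /scaled /scaled_grad sqnormZ.
have := sqnorm_ge0 (X (a + c *: x)); have := sqr_ge0 (f (a + c *: x)).
rewrite !exprMn; move: (f _ ^+ 2) (sqnorm _) (sqr_ge0 d) (sqr_ge0 c) => u v.
move: (d ^+ 2) (c ^+ 2) => d2 c2 d20 c20 u0 v0.
have := mulr_ge0 d20 u0; have := mulr_ge0 d20 v0.
move=> h1 h2; have h3 := mulr_ge0 h2 c20.
have -> : d2 * (1 + c2) * (u + v) = d2 * u + d2 * c2 * v + (d2 * v + d2 * u * c2) by ring.
by rewrite lerDl addr_ge0.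
Qed.

Lemma weak_grad_scaled f : weakly_differentiable f -> weakly_differentiable (scaled f) /\
  {ae leb R n.+1, forall x, weak_grad (scaled f) x = scaled_grad (weak_grad f) x}.
Proof.
move=> wf; have P i := weak_partialP (is_weak_partial_affine a d c0 (wf i)).
split; first by move=> i; have [] := P i.
have : {ae leb R n.+1, forall x, forall i : 'I_n.+1, weak_partial i (scaled f) x =
   (d * c) * weak_partial i f (a + c *: x)}.
  by apply: ae_countable => i; have [] := P i.
by apply: filterS => x hx; apply/rowP => i; rewrite !mxE hx.
Qed.

Lemma test_fun_scaled phi : test_fun setT phi -> test_fun setT (scaled phi).
Proof.
move=> /(test_fun_affine a (lt0r_neq0 c0))[t1 _].
have [K [cK _ pK _]] := test_fun_supp t1.
apply: (@test_funI _ _ setT setT K) => //; first exact: openT.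
  move=> x nK; rewrite /scaled; have -> : phi (a + c *: x) = 0; last by rewrite mulr0.
  by apply/eqP; apply: contra_notT nK => /pK.
move=> k; apply: (CsM openT); [exact: Cs_cst|exact: (test_fun_smooth t1)].
Qed.

Lemma grad_scaled phi x : test_fun setT phi -> grad (scaled phi) x = scaled_grad (grad phi) x.
Proof.
move=> /(test_fun_affine a (lt0r_neq0 c0))[t1 D1].
apply/rowP => i; rewrite !mxE.
have d1 := smooth_derivable (v := basis_vec i) (test_fun_smooth t1) (I : setT x).
by rewrite [LHS](deriveZ _ d1) D1 /GRing.scale/= mulrA.
Qed.

Lemma W12_scaled f : W12 p f -> W12 q (scaled f).
Proof.
move=> /W12E[wf ff]; apply/W12E.
have [mf mgf] := weakly_differentiable_measurable wf.
have [ws gs] := weak_grad_scaled wf; split; first exact: ws.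
have [ms mgs] := weakly_differentiable_measurable ws.
rewrite (energy_ae mq ms mgs (measurable_scaled_grad mgf) gs).
apply: le_lt_trans (energy_scaled mf mgf) _; apply: lte_mul_pinfty => //.
by rewrite lee_fin mulr_ge0 ?sqr_ge0// addr_ge0// sqr_ge0.
Qed.

Lemma cvg_W12_scaled f phi : weakly_differentiable f -> (forall k, test_fun setT (phi k)) ->
  cvg_W12 p phi f -> cvg_W12 q (fun k => scaled (phi k)) (scaled f).
Proof.
move=> wf tphi /cvg_W12E cphi; apply/cvg_W12E.
have c1 := cvgeZl (y := (d ^+ 2 * (1 + c ^+ 2))%:E) isT cphi.
rewrite mule0 in c1.
apply: (squeeze_cvge _ (@cvg_cst _ _ _ _ _) c1).
apply: nearW => k; rewrite energy_ge0//=.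
have [mf mgf] := weakly_differentiable_measurable wf.
have [mp1 mg1] := test_grad (tphi k).
have m1 : measurable_fun setT (fun x => f x - phi k x) by exact: measurable_funB.
have m2 := measurable_funB_rV mgf mg1.
apply: le_trans (energy_scaled m1 m2).
have [ws gs] := weak_grad_scaled wf; have [ms mgs] := weakly_differentiable_measurable ws.
have -> : (fun x => scaled f x - scaled (phi k) x) = scaled (fun x => f x - phi k x).
  by apply/funext => x; rewrite /scaled mulrBr.
rewrite (@energy_ae q mq _ _ (scaled_grad (fun x => weak_grad f x - grad (phi k) x)))//.
- exact: measurable_scaled.
- apply: measurable_funB_rV => //.
  by have [] := test_grad (test_fun_scaled (tphi k)).
- exact: measurable_scaled_grad.
apply: filterS gs => x ->; rewrite grad_scaled//.
by rewrite /scaled_grad scalerBr.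
Qed.

(** The affine map preserves the thin space because the last coordinate of [a] is 0; there it
    carries [K] to a compact set and multiplies the squared distances by [d^2 / c^n]. *)
Lemma is_thin_trace_scaled f g : a ord0 ord_max = 0 -> is_thin_trace p f g ->
  is_thin_trace q (scaled f) (fun x' => d * g (\row_j a ord0 (lift ord_max j) + c *: x')).
Proof.
move=> a0 [wf mg [phi [tphi cphi tr]]].
set a' : 'rV[R]_n := \row_j _.
have mga : measurable_fun setT (fun x' : 'rV[R]_n => d * g (a' + c *: x')).
  by apply: measurable_funM => //; exact: (measurable_funT_comp mg (measurable_affine _ _)).
have aff (x' : 'rV[R]_n) : a + c *: rsnoc (x', 0) = rsnoc (a' + c *: x', 0).
  by rewrite -rsnoc_affine a0 mulr0 addr0.
split=> //; first exact: W12_scaled.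
exists (fun k => scaled (phi k)); split.
- by move=> k; exact: test_fun_scaled.
- by apply: cvg_W12_scaled => //; have /W12E[] := wf.
move=> K cK.
pose K2 : set 'rV[R]_n := (fun x' => a' + c *: x') @` K.
have cK2 : compact K2.
  by apply: continuous_compact => //; apply: continuous_subspaceT; exact: continuous_affine.
have c1 := cvgeZl (y := (d ^+ 2 / c ^+ n)%:E) isT (tr K2 cK2).
rewrite mule0 in c1.
apply: (squeeze_cvge _ (@cvg_cst _ _ _ _ _) c1).
apply: nearW => k; apply/andP; split; first by apply: integral_ge0 => x _; rewrite lee_fin sqr_ge0.
have mr : measurable_fun setT (fun x' : 'rV[R]_n => rsnoc (x', 0 : R)).
  apply: (measurable_funT_comp (@measurable_rsnoc R n)).
  by apply: measurable_fun_pair => //; exact: measurable_cst.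
have mphi : measurable_fun setT (fun x' : 'rV[R]_n => phi k (rsnoc (x', 0))).
  have [mp1 _] := test_grad (tphi k); exact: (measurable_funT_comp mp1 mr).
have mK2 := compact_measurable_rV cK2.
have mH : measurable_fun setT ((fun x' : 'rV[R]_n => ((phi k (rsnoc (x', 0)) - g x') ^+ 2)%:E) \_ K2).
  apply: (measurable_restrictT _ mK2).1; apply: measurable_funTS; apply/measurable_EFinP.
  by apply: measurable_funX; exact: measurable_funB.
rewrite [X in (_ <= _ * X)%E]integral_mkcond (ge0_integral_leb_affine a' c0 mH); last first.
  by move=> x; rewrite patchE; case: ifP => // _; rewrite lee_fin sqr_ge0.
rewrite muleA -EFinM divfK ?expf_neq0 ?lt0r_neq0//.
rewrite -ge0_integralZl//; first last.
- by rewrite lee_fin sqr_ge0.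
- by move=> x _; rewrite patchE; case: ifP => // _; rewrite lee_fin sqr_ge0.
- exact: (measurable_funT_comp mH (measurable_affine _ _)).
rewrite [leLHS]integral_mkcond; apply: ge0_le_integral_nonmeas => x _.
  by rewrite patchE; case: ifP => // _; rewrite lee_fin sqr_ge0.
rewrite patchE; case: ifPn => [xK|_]; last first.
  rewrite mule_ge0//; first by rewrite lee_fin sqr_ge0.
  by rewrite patchE; case: ifP => // _; rewrite lee_fin sqr_ge0.
rewrite patchE mem_set; last by exists x => //; rewrite inE in xK.
by rewrite -EFinM lee_fin /scaled aff -mulrBr exprMn.
Qed.

End scale.
End weighted_sobolev.

(** * The homogeneous competitor *)

Lemma ae_leb_affine (R : realType) n (a : 'rV[R]_n) (c : R) (P : 'rV[R]_n -> Prop) : 0 < c ->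
  {ae leb R n, forall x, P x} -> {ae leb R n, forall x, P (a + c *: x)}.
Proof.
move=> c0 [N [mN N0 sub]].
have mi : measurable_fun setT (fun x : 'rV[R]_n => (\1_N x : R)%:E).
  by apply/measurable_EFinP; exact: measurable_indic.
pose A x := a + c *: x.
have mAN : measurable (A @^-1` N).
  by rewrite -[X in measurable X]setTI; exact: measurable_affine.
exists (A @^-1` N); split=> //; last by move=> x; exact: sub.
have := @ge0_integral_leb_affine R n a c _ c0 mi _.
move=> /(_ _)/wrap[]; first by move=> x; rewrite lee_fin.
rewrite integral_indic// setIT [X in X = _]N0.
have -> : (\int[leb R n]_x (\1_N (a + c *: x) : R)%:E = \int[leb R n]_x (\1_(A @^-1` N) x : R)%:E)%E by [].
rewrite integral_indic// setIT => /esym/eqP; rewrite mule_eq0 => /orP[|/eqP//].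
by rewrite eqe expf_eq0 (gt_eqF c0) andbF.
Qed.

Section competitor.
Context {R : realType} {n : nat}.
Local Notation lam := (@lebesgue_measure R).
Local Notation Rx := 'rV[R]_n.+1.
Local Notation Rxt := (Rx * R)%type.
Local Notation mu := (leb R n.+1 \x @lebesgue_measure R)%E.

Lemma slab_tonelli (a b : R) (F : Rxt -> \bar R) :
  measurable_fun (slab a b : set (Rx * measurableTypeR R)) F ->
  (forall z, slab a b z -> (0 <= F z)%E) ->
  (\int[mu]_(z in slab a b) F z = \int[lam]_(t in `]a, b[) \int[leb R n.+1]_x F (x, t))%E.
Proof.
move=> mF F0; rewrite integral_mkcond fubini_tonelli2; first last.
- by move=> z; rewrite patchE; case: ifPn => //; rewrite inE => /F0.
- exact: (measurable_restrictT _ (@measurable_slab R n a b)).1 mF.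
rewrite [RHS]integral_mkcond; apply: eq_integral => t _; rewrite /fubini_G patchE.
case: ifPn => tab.
  apply: eq_integral => x _; rewrite patchE mem_set//.
  by move: tab; rewrite inE /= in_itv.
apply: integral0_eq => x _; rewrite patchE memNset//.
by move: tab; rewrite notin_setE /= in_itv.
Qed.

Variable z0 : Rxt.
Local Notation x0 := z0.1.
Local Notation t0 := z0.2.
Variables (tT kappa : R).
Hypothesis tTt0 : tT < t0.
Local Notation G := (heat_kernel_at z0).

(* With tau = t0 - t and T = t0 - tT the competitor is
   (tau / T)^(kappa / 2) f (x0 + sqrt (T / tau) (x - x0)). *)
Definition cfac (t : R) : R := ((t0 - t) / (t0 - tT)) `^ (kappa / 2).
Definition dil (t : R) : R := rt z0 tT * irt z0 t.
Definition ctr (t : R) : Rx := x0 - dil t *: x0.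
Definition competitor (f : Rx -> R) (z : Rxt) : R := cfac z.2 * f (ctr z.2 + dil z.2 *: z.1).
Definition competitor_grad (X : Rx -> Rx) (z : Rxt) : Rx :=
  (cfac z.2 * dil z.2) *: X (ctr z.2 + dil z.2 *: z.1).

Lemma dil_gt0 t : t < t0 -> 0 < dil t.
Proof. by move=> tt; rewrite mulr_gt0 ?rt_gt0 ?irt_gt0. Qed.

(** In the similarity variable the argument of [f] does not depend on [t]: this is the homogeneity
    of the competitor. *)
Lemma ctr_unscale t y : t < t0 -> ctr t + dil t *: (x0 + rt z0 t *: y) = x0 + rt z0 tT *: y.
Proof.
move=> tt; rewrite scalerDr addrA subrK scalerA; congr (_ + _ *: _).
by rewrite /dil -mulrA irtK// mulr1.
Qed.

Lemma heat_slice_dil t (F : Rx -> R) : t < t0 -> measurable_fun setT F -> (forall x, 0 <= F x) ->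
  (\int[leb R n.+1]_x (F (ctr t + dil t *: x) * slice G t x)%:E =
   \int[leb R n.+1]_x (F x * slice G tT x)%:E)%E.
Proof.
move=> tt mF F0.
have mFa : measurable_fun setT (fun x : Rx => F (ctr t + dil t *: x)).
  exact: (measurable_funT_comp mF (measurable_affine _ _)).
apply: etrans (slice_heat tt mFa (fun x => F0 _)) _.
apply: etrans _ (esym (slice_heat tTt0 mF F0)).
by apply: eq_integral => y _; rewrite ctr_unscale.
Qed.

Lemma measurable_cfac : measurable_fun setT (cfac : measurableTypeR R -> R).
Proof.
apply: (measurable_funT_comp (measurable_powR _)).
by apply: measurable_funM => //; exact: measurable_funB.
Qed.

Lemma measurable_dil : measurable_fun setT (dil : measurableTypeR R -> R).
Proof. by apply: measurable_funM => //; exact: measurable_irt. Qed.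

Lemma measurable_dilate : measurable_fun setT
  ((fun z => ctr z.2 + dil z.2 *: z.1) : Rx * measurableTypeR R -> Rx).
Proof.
have md := measurable_funT_comp measurable_dil (@measurable_snd _ _ Rx (measurableTypeR R)).
apply: measurable_fun_coord => i; under eq_fun do rewrite !mxE.
apply: measurable_funD; first by apply: measurable_funB => //; exact: measurable_funM.
apply: measurable_funM => //; exact: (measurable_funT_comp (measurable_coord i) measurable_fst).
Qed.

Lemma measurable_competitor f : measurable_fun setT f ->
  measurable_fun setT (competitor f : Rx * measurableTypeR R -> R).
Proof.
move=> mf; apply: measurable_funM; last exact: (measurable_funT_comp mf measurable_dilate).
exact: (measurable_funT_comp measurable_cfac measurable_snd).
Qed.

Lemma measurable_competitor_grad X i : measurable_fun setT X ->
  measurable_fun setT ((fun z => competitor_grad X z ord0 i) : Rx * measurableTypeR R -> R).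
Proof.
move=> mX; under eq_fun do rewrite mxE; apply: measurable_funM; last first.
  exact: (measurable_funT_comp (measurable_coord i) (measurable_funT_comp mX measurable_dilate)).
apply: measurable_funM; first exact: (measurable_funT_comp measurable_cfac measurable_snd).
exact: (measurable_funT_comp measurable_dil measurable_snd).
Qed.

Lemma heat_slice_ge0 t x : 0 <= slice G t x. Proof. exact: heat_kernel_at_ge0. Qed.

Lemma measurable_heat_slice t : measurable_fun setT (slice G t).
Proof. exact: (measurable_funT_comp (measurable_heat_kernel_at z0) (pair2_measurable t)). Qed.

Variables (b : R) (f : Rx -> R) (g : 'rV[R]_n -> R).
Hypotheses (bt0 : b < t0) (tTb : tT < b) (x0thin : x0 ord0 ord_max = 0) (kappa0 : 0 < kappa).
Hypothesis trf : is_thin_trace (slice G tT) f g.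
Hypothesis g0 : {ae leb R n, forall x', 0 <= g x'}.

Let W12f : W12 (slice G tT) f. Proof. by have [] := trf. Qed.

(** A bound of [cfac t ^+ 2 * (1 + dil t ^+ 2)] for times between [tT] and [b]. *)
Definition ebound : R := 1 + (t0 - tT) / (t0 - b).

Lemma cfac_le1 t : tT <= t <= t0 -> 0 <= cfac t <= 1.
Proof.
move=> /andP[t1 t2]; rewrite powR_ge0/=.
have q0 : 0 <= (t0 - t) / (t0 - tT) by rewrite divr_ge0 ?subr_ge0// ltW.
have q1 : (t0 - t) / (t0 - tT) <= 1 by rewrite ler_pdivrMr ?subr_gt0// mul1r lerD2l lerN2.
apply: le_trans (_ : 1 `^ (kappa / 2) <= _); last by rewrite powR1.
by apply: ge0_ler_powR => //; rewrite ?nnegrE// ltW// divr_gt0.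
Qed.

Lemma dil_sqr t : t < t0 -> dil t ^+ 2 = (t0 - tT) / (t0 - t).
Proof.
by move=> tt; rewrite /dil exprMn /irt exprVn !rt_sqr// ltW.
Qed.

Lemma energy_competitor t : tT < t < b ->
  (energy (slice G t) (slice (competitor f) t) (fun x => competitor_grad (weak_grad f) (x, t))
    <= ebound%:E * energy (slice G tT) f (weak_grad f))%E.
Proof.
move=> /andP[t1 tb]; have tt := lt_trans tb bt0.
have [wf _] := W12f; have [mf mgf] := weakly_differentiable_measurable wf.
have := energy_scaled (cfac t) (@heat_slice_ge0 t) (@measurable_heat_slice t)
  (fun F => @heat_slice_dil t F tt) mf mgf.
move=> h; apply: le_trans h _.
apply: lee_wpmul2r; first exact: (@energy_ge0 R n _ (@heat_slice_ge0 tT) f (weak_grad f)).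
have /andP[c0 c1] : 0 <= cfac t <= 1 by apply: cfac_le1; rewrite !ltW.
rewrite lee_fin /ebound dil_sqr//.
apply: le_trans (_ : 1 + (t0 - tT) / (t0 - t) <= _).
  rewrite ler_piMl ?exprn_ile1// addr_ge0// divr_ge0// subr_ge0 ltW//.
rewrite lerD2l ler_pM2l ?subr_gt0// lef_pV2 ?posrE ?subr_gt0//.
by rewrite lerD2l lerN2 ltW.
Qed.

Lemma competitor_energy_fin : (\int[mu]_(z in slab tT b)
  ((competitor f z ^+ 2 + sqnorm (competitor_grad (weak_grad f) z)) * G z)%:E < +oo)%E.
Proof.
have [wf ff] := W12f; have [mf mgf] := weakly_differentiable_measurable wf.
have mF : measurable_fun setT ((fun z => (competitor f z ^+ 2 + sqnorm (competitor_grad (weak_grad f) z)) * G z) : Rx * measurableTypeR R -> R).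
  apply: measurable_funM; last exact: measurable_heat_kernel_at.
  apply: measurable_funD; first by apply: measurable_funX; exact: measurable_competitor.
  apply: (measurable_funT_comp measurable_sqnorm); apply: measurable_fun_coord => i.
  exact: measurable_competitor_grad.
rewrite slab_tonelli; first last.
- by move=> z _; rewrite lee_fin mulr_ge0 ?heat_kernel_at_ge0// addr_ge0 ?sqr_ge0 ?sqnorm_ge0.
- by apply/measurable_EFinP; exact: measurable_funTS.
apply: (@le_lt_trans _ _ (\int[lam]_(t in `]tT, b[) (ebound%:E * energy (slice G tT) f (weak_grad f)))%E).
  apply: ge0_le_integral_nonmeas => t; rewrite /= in_itv/= => tb.
    by apply: integral_ge0 => x _; rewrite lee_fin mulr_ge0 ?heat_kernel_at_ge0// addr_ge0 ?sqr_ge0 ?sqnorm_ge0.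
  exact: energy_competitor.
have -> : (\int[lam]_(t in `]tT, b[) (ebound%:E * energy (slice G tT) f (weak_grad f)) =
    ebound%:E * energy (slice G tT) f (weak_grad f) * lam `]tT, b[)%E.
  exact: (@integral_cst _ (measurableTypeR R) R lam _ (measurable_itv _)).
have eb0 : (0 <= ebound%:E)%E.
  by rewrite lee_fin addr_ge0// divr_ge0 ?subr_ge0// ltW.
have e0 := @energy_ge0 R n _ (@heat_slice_ge0 tT) f (weak_grad f).
have m0 : (0 <= ebound%:E * energy (slice G tT) f (weak_grad f))%E by exact: mule_ge0.
apply: lte_mul_pinfty => //.
- by rewrite ge0_fin_numE//; apply: lte_mul_pinfty.
- by rewrite /= lebesgue_measure_itv/=; case: ifP => // _; rewrite -EFinD ltry.
Qed.

Lemma competitor_weak_grad t : t < t0 -> weakly_differentiable (slice (competitor f) t) /\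
  {ae leb R n.+1, forall x, weak_grad (slice (competitor f) t) x = competitor_grad (weak_grad f) (x, t)}.
Proof.
move=> tt; have [wf ff] := W12f.
exact: (weak_grad_scaled (ctr t) (cfac t) (dil_gt0 tt) wf).
Qed.

Lemma energy_competitor_weak t : t < t0 ->
  energy (slice G t) (slice (competitor f) t) (weak_grad (slice (competitor f) t)) =
  energy (slice G t) (slice (competitor f) t) (fun x => competitor_grad (weak_grad f) (x, t)).
Proof.
move=> tt; have [wf ff] := W12f; have [mf mgf] := weakly_differentiable_measurable wf.
have [wc gc] := competitor_weak_grad tt; have [mc mgc] := weakly_differentiable_measurable wc.
exact: (energy_ae (@measurable_heat_slice t) mc mgc (measurable_scaled_grad (ctr t) (dil t) (cfac t) mgf) gc).
Qed.

Lemma competitor_thin_trace t : t < t0 -> exists2 g', is_thin_trace (slice G t) (slice (competitor f) t) g' &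
  {ae leb R n, forall x', 0 <= g' x'}.
Proof.
move=> tt; pose a' : 'rV[R]_n := \row_j ctr t ord0 (lift ord_max j).
exists (fun x' => cfac t * g (a' + dil t *: x')).
  apply: (is_thin_trace_scaled (cfac t) (@heat_slice_ge0 t) (@measurable_heat_slice t) (dil_gt0 tt)
    (fun F => @heat_slice_dil t F tt) _ trf).
  by rewrite !mxE x0thin mulr0 subr0.
apply: filterS (ae_leb_affine a' (dil_gt0 tt) g0) => x' gx; apply: mulr_ge0 => //.
exact: powR_ge0.
Qed.

Lemma competitor_L2W12 : L2W12 z0 tT b (competitor f).
Proof.
have [wf ff] := W12f; have [mf mgf] := weakly_differentiable_measurable wf.
split.
- apply: measurable_funTS; exact: measurable_competitor.
- apply: aeW => t /andP[t1 tb].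
  by have [g' [+ _ _] _] := competitor_thin_trace (lt_trans tb bt0).
apply: le_lt_trans competitor_energy_fin.
rewrite slab_tonelli; first last.
- by move=> z _; rewrite lee_fin mulr_ge0 ?heat_kernel_at_ge0// addr_ge0 ?sqr_ge0 ?sqnorm_ge0.
- apply/measurable_EFinP; apply: measurable_funTS.
  apply: measurable_funM; last exact: measurable_heat_kernel_at.
  apply: measurable_funD; first by apply: measurable_funX; exact: measurable_competitor.
  apply: (measurable_funT_comp measurable_sqnorm); apply: measurable_fun_coord => i.
  exact: measurable_competitor_grad.
apply: ge0_le_integral_nonmeas => t; rewrite /= in_itv/= => /andP[t1 tb].
  by apply: integral_ge0 => x _; rewrite lee_fin mulr_ge0 ?heat_kernel_at_ge0// addr_ge0 ?sqr_ge0 ?sqnorm_ge0.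
by have := energy_competitor_weak (lt_trans tb bt0); rewrite /energy => ->.
Qed.

Lemma competitor_thin_ge0 : thin_ge0 z0 tT b (competitor f).
Proof. by apply: aeW => t /andP[_ tb]; exact: competitor_thin_trace (lt_trans tb bt0). Qed.

(** Each slice is an affine image of [f], whose weak derivatives are known, and the slices are
    assembled. Local integrability comes from the finite weighted energy. *)
Lemma competitor_weak_deriv i : is_weak_deriv (slab tT b) (basis_vec i, 0) (competitor f)
  (fun z => competitor_grad (weak_grad f) z ord0 i).
Proof.
have [wf ff] := W12f; have [mf mgf] := weakly_differentiable_measurable wf.
have mc := measurable_competitor mf; have mg i' := measurable_competitor_grad i' mgf.
have mS := @measurable_slab R n tT b.
have loc (h : Rxt -> R) : measurable_fun setT (h : Rx * measurableTypeR R -> R) ->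
    (forall z, h z ^+ 2 <= competitor f z ^+ 2 + sqnorm (competitor_grad (weak_grad f) z)) ->
    locally_integrable_on (slab tT b) h.
  move=> mh hb; apply: (locally_integrable_of_heat (ltW bt0)); first exact: measurable_funTS.
  apply/integrableP; split.
    apply/measurable_EFinP/measurable_funTS/measurable_funM; first exact: measurable_funX.
    exact: measurable_heat_kernel_at.
  apply: le_lt_trans competitor_energy_fin; apply: ge0_le_integral_nonmeas => z _ //.
  rewrite gee0_abs; last by rewrite lee_fin; apply: mulr_ge0; [exact: sqr_ge0|exact: heat_kernel_at_ge0].
  rewrite lee_fin.
  by rewrite ler_wpM2r ?heat_kernel_at_ge0.
apply: is_weak_deriv_of_slices.
- by apply: loc => // z; rewrite lerDl sqnorm_ge0.
- apply: loc => // z; rewrite sqnormE (bigD1 i)//= addrCA lerDl addr_ge0 ?sqr_ge0//.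
  by apply: sumr_ge0 => j _; rewrite sqr_ge0.
- move=> t /andP[_ tb]; have tt := lt_trans tb bt0.
  have := is_weak_partial_affine (ctr t) (cfac t) (dil_gt0 tt) (wf i).
  have -> : slice (fun z => competitor_grad (weak_grad f) z ord0 i) t =
    fun x => cfac t * dil t * weak_partial i f (ctr t + dil t *: x).
    by apply/funext => x; rewrite /slice !mxE.
  by [].
Qed.

Lemma competitor_nabla : {ae mu, forall z : Rx * measurableTypeR R, slab tT b z ->
  nabla (slab tT b) (competitor f) z = competitor_grad (weak_grad f) z}.
Proof.
have P i := (weak_derivP (competitor_weak_deriv i)).2.
have : {ae mu, forall z : Rx * measurableTypeR R, forall i : 'I_n.+1, slab tT b z ->
    weak_deriv (slab tT b) (basis_vec i, 0) (competitor f) z = competitor_grad (weak_grad f) z ord0 i}.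
  by apply: ae_countable => i; exact: P.
by apply: filterS => z hz sz; apply/rowP => i; rewrite mxE hz.
Qed.

End competitor.

(** * Almost every slice *)

Section product_ae.
Context d1 d2 (T1 : measurableType d1) (T2 : measurableType d2) (R : realType).
Variables (m1 : {sigma_finite_measure set T1 -> \bar R}) (m2 : {sigma_finite_measure set T2 -> \bar R}).

Lemma integral_indic0_ae d (T : measurableType d) (m : {measure set T -> \bar R}) (f : T -> \bar R) :
  measurable_fun setT f -> (forall x, (0 <= f x)%E) -> (\int[m]_x f x = 0)%E ->
  {ae m, forall x, f x = 0%E}.
Proof.
move=> mf f0 h.
have e0 : (\int[m]_x `|f x| = 0)%E by rewrite -[RHS]h; apply: eq_integral => x _; rewrite gee0_abs.
by have := (@ae_eq_integral_abs _ _ _ m setT measurableT f mf).1 e0; apply: filterS => x /(_ I).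
Qed.

Lemma ae_slice2 (P : T1 * T2 -> Prop) : {ae (m1 \x m2)%E, forall z, P z} ->
  {ae m2, forall y, {ae m1, forall x, P (x, y)}}.
Proof.
move=> [N [mN N0 sub]].
have mi : measurable_fun setT (fun z : T1 * T2 => (\1_N z : R)%:E).
  by apply/measurable_EFinP; exact: measurable_indic.
have i0 z : (0 <= (\1_N z : R)%:E)%E by rewrite lee_fin.
have : (\int[(m1 \x m2)%E]_z (\1_N z : R)%:E = 0)%E by rewrite integral_indic// setIT.
rewrite (fubini_tonelli2 _ mi)// => h.
have mG : measurable_fun setT (fubini_G m1 (fun z => (\1_N z : R)%:E)).
  exact: measurable_fun_fubini_tonelli_G.
have /= := integral_indic0_ae mG _ h; move=> /(_ _)/wrap[].
  by move=> y; apply: integral_ge0.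
apply: filterS => y hy.
have my : measurable_fun setT (fun x => (\1_N (x, y) : R)%:E) by exact: (measurable_funT_comp mi (pair2_measurable y)).
apply: filterS (integral_indic0_ae my _ hy) => // x /= [] /eqP.
by apply: contraPP => nP; rewrite indicE mem_set ?oner_eq0//; exact: sub.
Qed.

Lemma ae_slice1 (P : T1 * T2 -> Prop) : {ae (m1 \x m2)%E, forall z, P z} ->
  {ae m1, forall x, {ae m2, forall y, P (x, y)}}.
Proof.
move=> [N [mN N0 sub]].
have mi : measurable_fun setT (fun z : T1 * T2 => (\1_N z : R)%:E).
  by apply/measurable_EFinP; exact: measurable_indic.
have i0 z : (0 <= (\1_N z : R)%:E)%E by rewrite lee_fin.
have : (\int[(m1 \x m2)%E]_z (\1_N z : R)%:E = 0)%E by rewrite integral_indic// setIT.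
rewrite (fubini_tonelli1 _ mi)// => h.
have mG : measurable_fun setT (fubini_F m2 (fun z => (\1_N z : R)%:E)).
  exact: measurable_fun_fubini_tonelli_F.
have /= := integral_indic0_ae mG _ h; move=> /(_ _)/wrap[].
  by move=> y; apply: integral_ge0.
apply: filterS => x hx.
have my : measurable_fun setT (fun y => (\1_N (x, y) : R)%:E) by exact: (measurable_funT_comp mi (pair1_measurable x)).
apply: filterS (integral_indic0_ae my _ hx) => // y /= [] /eqP.
by apply: contraPP => nP; rewrite indicE mem_set ?oner_eq0//; exact: sub.
Qed.

(** Converse of [ae_slice2] for a measurable set, by Tonelli. Statements known on slices must
    therefore be put in a jointly measurable form first. *)
Lemma ae_of_slices2 (S : set (T1 * T2)) : measurable S ->
  {ae m2, forall y, {ae m1, forall x, S (x, y)}} -> {ae (m1 \x m2)%E, forall z, S z}.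
Proof.
move=> mS h; exists (~` S); split; [exact: measurableC| |by []].
have mSC : measurable (~` S) by exact: measurableC.
have mi : measurable_fun setT (fun z : T1 * T2 => (\1_(~` S) z : R)%:E).
  by apply/measurable_EFinP; exact: measurable_indic.
have i0 z : (0 <= (\1_(~` S) z : R)%:E)%E by rewrite lee_fin.
rewrite -[LHS](_ : (\int[(m1 \x m2)%E]_z (\1_(~` S) z : R)%:E)%E = _); last by rewrite integral_indic// setIT.
rewrite (fubini_tonelli2 _ mi)//.
rewrite -[RHS](integral0 m2 setT); apply: ae_eq_integral => //.
  exact: measurable_fun_fubini_tonelli_G.
apply: filterS h => y hy _ /=; rewrite /fubini_G -[RHS](integral0 m1 setT).
apply: ae_eq_integral => //; first exact: (measurable_funT_comp mi (pair2_measurable y)).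
by apply: filterS hy => x hx _ /=; rewrite indicE memNset//; exact.
Qed.

Lemma ae_fst (P : T1 -> Prop) : {ae m1, forall x, P x} -> {ae (m1 \x m2)%E, forall z, P z.1}.
Proof.
move=> [N [mN N0 sub]]; exists (N `*` setT); split; first exact: measurableX.
  by rewrite product_measure1E// [X in (X * _)%E]N0 mul0e.
by move=> z nP; split=> //; exact: sub.
Qed.

Lemma ae_snd (P : T2 -> Prop) : {ae m2, forall x, P x} -> {ae (m1 \x m2)%E, forall z, P z.2}.
Proof.
move=> [N [mN N0 sub]]; exists (setT `*` N); split; first exact: measurableX.
  by rewrite product_measure1E// [X in (_ * X)%E]N0 mule0.
by move=> z nP; split=> //; exact: sub.
Qed.

(** The integrals of the positive and negative parts are measurable by Tonelli, hence also the
    finite part of their difference, whether or not the sections are integrable. *)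
Lemma measurable_Rintegral_param (f : T1 * T2 -> R) : measurable_fun setT f ->
  measurable_fun setT (fun x => \int[m2]_y f (x, y)).
Proof.
move=> mf; apply: (measurable_funT_comp (fine_measurable measurableT)).
have mp : measurable_fun setT (fun z => maxe (f z)%:E 0).
  by apply: measurable_maxe => //; exact/measurable_EFinP.
have mn : measurable_fun setT (fun z => maxe (- (f z)%:E)%E 0).
  by apply: measurable_maxe => //; apply: measurableT_comp => //; exact/measurable_EFinP.
have F1 : measurable_fun setT (fubini_F m2 (fun z => maxe (f z)%:E 0)).
  by apply: measurable_fun_fubini_tonelli_F => // z; rewrite le_max lexx orbT.
have F2 : measurable_fun setT (fubini_F m2 (fun z => maxe (- (f z)%:E)%E 0)).
  by apply: measurable_fun_fubini_tonelli_F => // z; rewrite le_max lexx orbT.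
rewrite (_ : (fun x => _) = (fun x => \int[m2]_y maxe (f (x, y))%:E 0 - \int[m2]_y maxe (- (f (x, y))%:E) 0)%E).
  by apply: emeasurable_funB; [exact: F1|exact: F2].
apply/funext => x; rewrite integralE; congr (_ - _)%E.
  by apply: eq_integral => y _; rewrite funeposE.
by apply: eq_integral => y _; rewrite funenegE.
Qed.

End product_ae.

Section misc_integrable.
Context d (T : measurableType d) (R : realType) (m : {measure set T -> \bar R}).

(** Truncating [B] at height [|M|] turns the bound almost everywhere into a bound everywhere. *)
Lemma integrable_ae_bounded_mul (D : set T) (h B : T -> R) (M : R) : measurable D ->
  measurable_fun D B -> {ae m, forall x, D x -> `|B x| <= M} ->
  m.-integrable D (EFin \o h) -> m.-integrable D (EFin \o (fun x => h x * B x)).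
Proof.
move=> mD mB BM ih.
pose B' x := Num.max (- `|M|) (Num.min (B x) `|M|).
have mB' : measurable_fun D B'.
  by apply: measurable_maxr => //; apply: measurable_minr.
have B'M x : D x -> `|B' x| <= `|M|.
  move=> _; rewrite ler_norml /B' le_max lexx /= ge_max ge_min lexx orbT andbT.
  by apply: le_trans (normr_ge0 M); rewrite oppr_le0.
have i1 := integrable_bounded_mul mD mB' B'M ih.
apply: integrable_ae_eq mD i1 _ _.
  by apply: measurable_funM => //; apply/measurable_EFinP; exact: measurable_int ih.
apply: filterS BM => x BMx Dx; congr (_ * _).
have {}BMx := le_trans (BMx Dx) (ler_norm M).
move: BMx; rewrite ler_norml /B' => /andP[h1 h2].
by rewrite min_l// max_r.
Qed.

End misc_integrable.

Section primitive_limit.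
Context {R : realType}.
Local Notation lam := (@lebesgue_measure R).

(** The integral depends continuously on its upper end point, so bounds for end points close to [b]
    pass to the limit. *)
Lemma Rintegral_itv_limit (a b C : R) (q : R -> R) : a < b ->
  lam.-integrable `]a, b[ (EFin \o q) ->
  (forall e, 0 < e -> exists2 b0, a <= b0 < b & forall b', b0 < b' < b ->
     \int[lam]_(t in `]a, b'[) q t <= C + e) ->
  \int[lam]_(t in `]a, b[) q t <= C.
Proof.
move=> ab iq h.
pose q0 := q \_ `]a, b[.
have iq0 : lam.-integrable setT (EFin \o q0).
  exact: (@integrable_patch _ (measurableTypeR R) R lam `]a, b[%classic q (measurable_itv _)).1.
have iq1 : lam.-integrable `[a, b] (EFin \o q0).
  exact: (@integrableS _ (measurableTypeR R) R lam setT `[a, b]%classic _ measurableT (measurable_itv _) (@subsetT _ _) iq0).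
have E b' : b' <= b -> a < b' -> \int[lam]_(t in `]a, b'[) q t = \int[lam]_(t in `[a, b']) q0 t.
  move=> b'b ab'; have i2 : lam.-integrable `[a, b'] (EFin \o q0).
    apply: integrableS iq1 => //= s; rewrite /= !in_itv/= => /andP[-> h2].
    exact: le_trans h2 b'b.
  rewrite -(@Rintegral_itv_obnd_cbnd R a (BRight b')); last first.
    by apply: integrableS i2 => //= s; rewrite /= !in_itv/= => /andP[/ltW -> ->].
  rewrite -(@Rintegral_itv_bndo_bndc R (BRight a) b'); last first.
    by apply: integrableS i2 => //= s; rewrite /= !in_itv/= => /andP[/ltW -> /ltW ->].
  apply: eq_Rintegral => t; rewrite inE /= in_itv/= => /andP[at_ tb'].
  by rewrite /q0 patchE mem_set//= in_itv/= at_ (lt_le_trans tb' b'b).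
have c := @parameterized_integral_cvg_at_left R a b q0 ab iq1.
rewrite E//; apply/ler_addgt0Pr => e e0; have [b0 /andP[ab0 b0b] hb0] := h e e0.
apply: (ler_cvg_to c (@cvg_cst _ _ _ _ _)); near=> b'.
have b0b' : b0 < b' by near: b'; apply: nbhs_left_gt.
have b'b : b' < b by near: b'; apply: nbhs_left_lt.
rewrite /parameterized_integral -(E _ (ltW b'b) (le_lt_trans ab0 b0b')).
by apply: hb0; rewrite b0b' b'b.
Unshelve. all: by end_near. Qed.

End primitive_limit.

Section scaled_solution.
Context {R : realType} {n : nat}.
Local Notation lam := (@lebesgue_measure R).
Local Notation Rx := 'rV[R]_n.+1.
Local Notation Rxt := (Rx * R)%type.
Local Notation mu := (leb R n.+1 \x @lebesgue_measure R)%E.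
Variables (z0 : Rxt) (u : Rxt -> R).
Local Notation x0 := z0.1.
Local Notation t0 := z0.2.
Local Notation D := (slab (-1) t0).
Local Notation G := (heat_kernel_at z0).

(** The indicator of a null set has integral zero after the change of variables, and the Jacobian is
    positive before [t0]. *)
Lemma ae_unscale (P : Rxt -> Prop) : {ae mu, forall z : Rx * measurableTypeR R, P z} ->
  {ae mu, forall p : Rx * measurableTypeR R, (p.2 : R) < t0 -> P (unscale z0 p)}.
Proof.
move=> [N [mN N0 sub]].
have mi : measurable_fun setT (\1_N : Rx * measurableTypeR R -> R) by exact: measurable_indic.
have i0 (z : Rxt) : 0 <= \1_N z :> R by [].
have := @transfer_jac R n z0 _ mi i0.
have -> : (\int[mu]_z ((\1_N z : R) * past z0 z)%:E = 0)%E.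
  apply/eqP; rewrite eq_le; apply/andP; split; last first.
    by apply: integral_ge0 => z _; rewrite lee_fin mulr_ge0// past_ge0.
  have <- : (\int[mu]_z (\1_N z : R)%:E = 0)%E by rewrite integral_indic// setIT.
  apply: ge0_le_integral_nonmeas => z _; rewrite lee_fin ?mulr_ge0 ?past_ge0//.
  by rewrite ler_piMr// /past; case: (_ < _).
move=> /esym h.
have mj : measurable_fun setT (fun p : Rx * measurableTypeR R => ((\1_N (unscale z0 p) : R) * jac z0 p)%:E).
  apply/measurable_EFinP/measurable_funM; last exact: measurable_jac.
  exact: (measurable_funT_comp mi (measurable_unscale z0)).
apply: filterS (integral_indic0_ae mj _ h) => [|p]; last first.
  by rewrite lee_fin mulr_ge0 ?jac_ge0.
move=> p /= [] /eqP hp pt; apply: contrapT => nP; move: hp.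
rewrite indicE mem_set ?mul1r; last exact: sub.
by rewrite /jac /past pt mulr1 expf_eq0 gt_eqF ?andbF// rt_gt0.
Qed.

Hypothesis t01 : -1 < t0.
Hypothesis t0le : t0 <= 0.
Hypothesis x0thin : x0 ord0 ord_max = 0.
Hypothesis wu : W11_differentiable D u.
Local Notation Nu := (nabla D u).
Local Notation ut := (partial_t D u).
Variable M : R.
Hypothesis Mu : {ae mu, forall z : Rx * measurableTypeR R, D z -> `|u z| <= M}.
Hypothesis Eu : (\int[mu]_(z in D)
  ((u z ^+ 2 + (t0 - z.2) * (sqnorm (Nu z) + ut z ^+ 2)) * G z)%:E < +oo)%E.
Hypothesis Tu : thin_ge0 z0 (-1) t0 u.

Let mD : measurable (D : set (Rx * measurableTypeR R)). Proof. exact: measurable_slab. Qed.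

Let mu_ : measurable_fun (D : set (Rx * measurableTypeR R)) u.
Proof. by have [[]] := wu.2. Qed.

(* u, sqrt (t0 - t) grad u and sqrt (t0 - t) u_t in similarity coordinates. [u]
   is cut off since nothing is known on its measurability outside of [D]. *)
Definition uv (p : Rxt) : R := (u \_ D) (unscale z0 p).
Definition gs (p : Rxt) : Rx := rt z0 p.2 *: Nu (unscale z0 p).
Definition st (p : Rxt) : R := rt z0 p.2 * ut (unscale z0 p).
(** [(x - x0) . grad u + 2 (t - t0) u_t] in similarity coordinates: minus the drift factor of the
    almost minimality, and [2 (t0 - t)] times [velocity]. *)
Definition Zu (p : Rxt) : R := dotv p.1 (gs p) - 2 * rt z0 p.2 * st p.

Lemma uvE p : D p -> uv p = u (unscale z0 p).
Proof. by move=> Dp; rewrite /uv patchE mem_set. Qed.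

Lemma measurable_uv : measurable_fun setT (uv : Rx * measurableTypeR R -> R).
Proof.
exact: (measurable_funT_comp ((measurable_restrictT _ mD).1 mu_) (measurable_unscale z0)).
Qed.

Lemma measurable_nabla_coord i : measurable_fun setT ((fun z => Nu z ord0 i) : Rx * measurableTypeR R -> R).
Proof. by under eq_fun do rewrite mxE; apply: weak_deriv_measurable; exact: wu.1. Qed.

Lemma measurable_ut : measurable_fun setT (ut : Rx * measurableTypeR R -> R).
Proof. apply: weak_deriv_measurable; exact: wu.2. Qed.

Let mrt2 : measurable_fun setT ((fun p => rt z0 p.2) : Rx * measurableTypeR R -> R).
Proof. exact: (measurable_funT_comp (measurable_rt z0) measurable_snd). Qed.

Lemma measurable_gs_coord i : measurable_fun setT ((fun p => gs p ord0 i) : Rx * measurableTypeR R -> R).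
Proof.
under eq_fun do rewrite mxE; apply: measurable_funM => //.
exact: (measurable_funT_comp (measurable_nabla_coord i) (measurable_unscale z0)).
Qed.

Lemma measurable_gs2 : measurable_fun setT ((fun p => sqnorm (gs p)) : Rx * measurableTypeR R -> R).
Proof.
apply: (measurable_funT_comp measurable_sqnorm); apply: measurable_fun_coord => i.
exact: measurable_gs_coord.
Qed.

Lemma measurable_st : measurable_fun setT (st : Rx * measurableTypeR R -> R).
Proof. apply: measurable_funM => //; exact: (measurable_funT_comp measurable_ut (measurable_unscale z0)). Qed.

Lemma measurable_Zu : measurable_fun setT (Zu : Rx * measurableTypeR R -> R).
Proof.
apply: measurable_funB.
  apply: measurable_sum => i; apply: measurable_funM; last exact: measurable_gs_coord.
  exact: (measurable_funT_comp (measurable_coord i) measurable_fst).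
by apply: measurable_funM; [exact: measurable_funM|exact: measurable_st].
Qed.

Lemma velocity_unscale p : (p.2 : R) < t0 ->
  velocity z0 (fun k => weak_deriv D (basis_vec k, 0) u) ut (unscale z0 p) =
  Zu p * (irt z0 p.2 ^+ 2 / 2).
Proof.
move=> pt; rewrite /velocity /Zu mulrBl /dotv mulr_suml; congr (_ - _).
  apply: eq_bigr => k _; rewrite /cdrift /= !mxE [x0 ord0 k + _]addrC addrK.
  by rewrite /nabla; ring.
rewrite /st; have r0 := rt_gt0 pt; rewrite /irt; field; exact: lt0r_neq0.
Qed.

Lemma ae_uv_le : {ae mu, forall p : Rx * measurableTypeR R, D p -> `|uv p| <= M}.
Proof.
apply: filterS (ae_unscale Mu) => p hp Dp; rewrite uvE//; apply: hp => //.
by case/andP: Dp.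
Qed.

Lemma integrable_scaled_energy : mu.-integrable D
  (EFin \o (fun p => (uv p ^+ 2 + (sqnorm (gs p) + st p ^+ 2)) * gweight z0 p)).
Proof.
have mF : measurable_fun (D : set (Rx * measurableTypeR R))
    (fun z => u z ^+ 2 + (t0 - z.2) * (sqnorm (Nu z) + ut z ^+ 2)).
  apply: measurable_funD; first exact: measurable_funX.
  apply: measurable_funTS; apply: measurable_funM.
    by apply: measurable_funB => //; exact: measurable_snd.
  apply: measurable_funD; last by apply: measurable_funX; exact: measurable_ut.
  apply: (measurable_funT_comp measurable_sqnorm); apply: measurable_fun_coord => i.
  exact: measurable_nabla_coord.
have F0 z : D z -> 0 <= (u z ^+ 2 + (t0 - z.2) * (sqnorm (Nu z) + ut z ^+ 2)) * G z.
  case/andP => _ zt; apply: mulr_ge0; last exact: heat_kernel_at_ge0.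
  apply: addr_ge0; first exact: sqr_ge0.
  apply: mulr_ge0; first by rewrite subr_ge0 ltW.
  by rewrite addr_ge0 ?sqnorm_ge0 ?sqr_ge0.
have iF : mu.-integrable D (fun z => ((u z ^+ 2 + (t0 - z.2) * (sqnorm (Nu z) + ut z ^+ 2)) * G z)%:E).
  apply/integrableP; split.
    apply/measurable_EFinP/measurable_funM => //.
    exact: measurable_funTS (measurable_heat_kernel_at z0).
  apply: le_lt_trans Eu; apply: ge0_le_integral_nonmeas => z Dz; first exact: abse_ge0.
  by rewrite gee0_abs// lee_fin; exact: F0.
have := (@integrable_heat R n z0 [set t | -1 < t < t0] _ mD mF).1 iF.
apply: eq_integrable => // p; rewrite inE => Dp; congr EFin; congr (_ * _).
rewrite /= uvE// /gs sqnormZ /st exprMn rt_sqr; last by case/andP: Dp => _ /ltW.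
by rewrite mulrDr.
Qed.

Lemma integrable_energy_le (a b : R) (h : Rxt -> R) : -1 <= a -> b <= t0 ->
  measurable_fun setT (h : Rx * measurableTypeR R -> R) ->
  (forall p, slab a b p -> `|h p| <= (1 + sqnorm p.1) + (uv p ^+ 2 + (sqnorm (gs p) + st p ^+ 2))) ->
  mu.-integrable (slab a b) (EFin \o (fun p => h p * gweight z0 p)).
Proof.
move=> a1 bt0 mh hb; have mS := @measurable_slab R n a b.
have sub : slab a b `<=` (D : set Rxt).
  by move=> p /andP[p1 p2]; rewrite /slab/= (le_lt_trans a1 p1) (lt_le_trans p2 bt0).
have i1 := integrableS mD mS sub integrable_scaled_energy.
have i2 := integrable_addr mS (integrable_slab_moment z0 a b) i1.
apply: le_integrable i2 => //.
  by apply/measurable_EFinP/measurable_funTS/measurable_funM => //; exact: measurable_gweight.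
move=> p /hb hp; have g0 := gweight_ge0 z0 p; rewrite /comp lee_fin -mulrDl.
by rewrite [leLHS]normrM [leRHS]normrM (ger0_norm g0) ler_wpM2r//; apply: le_trans hp _; exact: ler_norm.
Qed.

(** Young's inequality, with [rt <= 1] because [-1 < t < t0 <= 0]. The terms in [y] have a finite
    Gaussian moment, so [Zu] is integrable for the weight. *)
Lemma Zu_le p : D p -> `|Zu p| <= (1 + sqnorm p.1) + (uv p ^+ 2 + (sqnorm (gs p) + st p ^+ 2)).
Proof.
move=> /andP[p1 p2].
have h1 : `|dotv p.1 (gs p)| <= (sqnorm p.1 + sqnorm (gs p)) / 2.
  rewrite !sqnormE -big_split/= mulr_suml; apply: le_trans (ler_norm_sum _ _ _) _.
  apply: ler_sum => i _; rewrite normrM.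
  rewrite -[p.1 ord0 i ^+ 2]real_normK ?num_real// -[gs p ord0 i ^+ 2]real_normK ?num_real//.
  have := sqr_ge0 (`|p.1 ord0 i| - `|gs p ord0 i|); nra.
have h2 : `|2 * rt z0 p.2 * st p| <= 1 + st p ^+ 2.
  have r1 : rt z0 p.2 ^+ 2 <= 1 by rewrite (rt_sqr (ltW p2)) lerBlDr; apply: le_trans t0le _; rewrite -lerBlDl sub0r ltW.
  have r0 : 0 <= rt z0 p.2 by exact: sqrtr_ge0.
  rewrite ler_norml; have := sqr_ge0 (rt z0 p.2 - st p); have := sqr_ge0 (rt z0 p.2 + st p).
  by move=> h3 h4; apply/andP; split; nra.
have h3 := ler_normB (dotv p.1 (gs p)) (2 * rt z0 p.2 * st p).
have := sqnorm_ge0 p.1; have := sqnorm_ge0 (gs p); have := sqr_ge0 (uv p).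
by rewrite /Zu => q1 q2 q3; lra.
Qed.

(** What a slice must satisfy in order that its homogeneous extension can be compared with [u]. *)
Definition good (A : set R) (t : R) : Prop := [/\ A t,
  exists2 g, is_thin_trace (slice G t) (slice u t) g & {ae leb R n, forall x', 0 <= g x'},
  {ae leb R n.+1, forall x, weak_grad (slice u t) x = Nu (x, t)} &
  {ae leb R n.+1, forall x, `|u (x, t)| <= M}].

(** The trace condition supplies the weak derivatives of the slices, and [weak_deriv_slice]
    identifies them with the slices of the space-time derivatives. *)
Lemma ae_good (A : set R) : {ae lam, forall t : measurableTypeR R, -1 < (t : R) < t0 -> A t} ->
  {ae lam, forall t : measurableTypeR R, -1 < (t : R) < t0 -> good A t}.
Proof.
move=> aA.
have aM : {ae lam, forall t : measurableTypeR R, {ae leb R n.+1, forall x, D (x, t) -> `|u (x, t)| <= M}}.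
  exact: (@ae_slice2 _ _ _ _ R (leb R n.+1) lam _ Mu).
have aw : {ae lam, forall t : measurableTypeR R, forall i : 'I_n.+1, -1 < (t : R) < t0 ->
    forall g', is_weak_partial i (slice u t) g' ->
      {ae leb R n.+1, forall x, g' x = weak_deriv D (basis_vec i, 0) u (x, t)}}.
  by apply: ae_countable => i; exact: weak_deriv_slice (wu.1 i).
have aT : {ae lam, forall t : measurableTypeR R, -1 < (t : R) < t0 ->
  exists2 g, is_thin_trace (slice G t) (slice u t) g & {ae leb R n, forall x', 0 <= g x'}} := Tu.
apply: filterS2 (ae_and aA aT) (ae_and aM aw) => t [hA hT] [tM tw] tab.
have At := hA tab; have [g tg g0] := hT tab.
have tt : t < t0 by case/andP: tab.
split=> //; first by exists g.
  have [[wt _] _ _] := tg.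
  have : {ae leb R n.+1, forall x, forall i : 'I_n.+1, weak_partial i (slice u t) x =
     weak_deriv D (basis_vec i, 0) u (x, t)}.
    by apply: ae_countable => i; exact: (tw i tab _ (wt i)).
  by apply: filterS => x hx; apply/rowP => i; rewrite !mxE hx.
by apply: filterS tM => x; exact.
Qed.

End scaled_solution.

(** * The energy inequality *)

Lemma Rintegral_ae_ge0 d (T : measurableType d) (R : realType) (mu : {measure set T -> \bar R})
    (D : set T) (f : T -> R) : measurable D -> measurable_fun D f ->
  {ae mu, forall t, D t -> 0 <= f t} -> 0 <= \int[mu]_(t in D) f t.
Proof.
move=> mD mf f0.
have -> : \int[mu]_(t in D) f t = \int[mu]_(t in D) Num.max (f t) 0.
  apply: ae_eq_Rintegral => //; first exact: measurable_maxr.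
  by apply: filterS f0 => t h Dt; rewrite max_l// h.
by apply: Rintegral_ge0 => t _; rewrite le_max lexx orbT.
Qed.

(** * Explicit functions of time *)

Section C1_functions.
Context {R : realType}.
Local Notation lam := (@lebesgue_measure R).
Variable t0 : R.

(** The explicit factors of W and of the competitor belong to this class; [C1_before_ac] writes them
    as primitives, which is the form that [ac_mul] accepts. *)
Definition C1_before (f f' : R -> R) : Prop :=
  forall t, t < t0 -> is_derive t (1 : R) f (f' t) /\ {for t, continuous f'}.

Lemma C1_before_continuous f f' t : C1_before f f' -> t < t0 -> {for t, continuous f}.
Proof.
move=> cf /cf [df _]; apply: differentiable_continuous; apply/derivable1_diffP.
exact: (@ex_derive _ _ _ _ _ _ _ df).
Qed.

Lemma C1_before_eq f f' g' : f' =1 g' -> C1_before f f' -> C1_before f g'.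
Proof. by move=> /funext ->. Qed.

Lemma C1_before_cst c : C1_before (cst c) (cst 0).
Proof. by move=> t _; split; [exact: is_derive_cst|exact: cst_continuous]. Qed.

Lemma C1_beforeD f f' g g' : C1_before f f' -> C1_before g g' -> C1_before (f \+ g) (f' \+ g').
Proof.
move=> cf cg t tt; have [df cf'] := cf t tt; have [dg cg'] := cg t tt.
by split; [exact: is_deriveD|exact: continuousD].
Qed.

Lemma C1_beforeM f f' g g' : C1_before f f' -> C1_before g g' ->
  C1_before (fun t => f t * g t) (fun t => f' t * g t + f t * g' t).
Proof.
move=> cf cg t tt; have [df cf'] := cf t tt; have [dg cg'] := cg t tt; split.
  have h := is_deriveM df dg; apply: is_derive_eq h _.
  by rewrite /GRing.scale/= addrC [g t * _]mulrC.
apply: continuousD; apply: (@continuousM R R) => //.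
  exact: C1_before_continuous cg tt.
exact: C1_before_continuous cf tt.
Qed.

Lemma C1_beforeZ c f f' : C1_before f f' -> C1_before (fun t => c * f t) (fun t => c * f' t).
Proof.
move=> cf; apply: C1_before_eq (C1_beforeM (C1_before_cst c) cf) => t /=.
by rewrite mul0r add0r.
Qed.

Lemma C1_before_expR f f' : C1_before f f' ->
  C1_before (fun t => expR (f t)) (fun t => f' t * expR (f t)).
Proof.
move=> cf t tt; have [df cf'] := cf t tt; split.
  by rewrite mulrC; exact: (is_derive1_comp (is_derive_expR (f t)) df).
apply: (@continuousM R R) => //.
apply: (@continuous_comp _ _ _ f expR); first exact: C1_before_continuous cf tt.
exact: continuous_expR.
Qed.

Definition half_log (t : R) : R := ln (t0 - t) / 2.

Lemma C1_half_log : C1_before half_log (fun t => - (2 * (t0 - t))^-1).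
Proof.
move=> t tt; have t1 : 0 < t0 - t by rewrite subr_gt0.
split.
  have dB : is_derive t (1 : R) (fun s : R => t0 - s) (0 - 1).
    exact: (is_deriveB (is_derive_cst t0 t 1) (is_derive_id t (1 : R))).
  have dl := @is_derive1_comp R (@ln R) (fun s => t0 - s) t _ _ (is_derive1_ln t1) dB.
  have := is_deriveM dl (is_derive_cst (2^-1 : R) t (1 : R)).
  move=> h; apply: is_derive_eq h _.
  by rewrite /GRing.scale/= mulr0 add0r; field; rewrite gt_eqF.
apply: (@continuousN R R); apply: (@continuousV R R (fun t => 2 * (t0 - t))).
  by rewrite gt_eqF// mulr_gt0.
apply: (@continuousM R R (cst 2)); first exact: cst_continuous.
by apply: continuousB; [exact: cst_continuous|exact: cvg_id].
Qed.

Lemma C1_before_ac a b f f' : a < b -> b < t0 -> C1_before f f' ->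
  lam.-integrable `]a, b[ (EFin \o f') /\
  forall t, t \in `[a, b] -> f t = f a + \int[lam]_(s in `]a, t[) f' s.
Proof.
move=> ab bt cf.
have cw t : t <= b -> {within `[a, t], continuous f'}.
  move=> tb; apply: continuous_in_subspaceT => s; rewrite inE /= in_itv/= => /andP[_ st].
  by have [] := cf s (le_lt_trans (le_trans st tb) bt).
have ii t : t <= b -> lam.-integrable `[a, t] (EFin \o f').
  by move=> tb; apply: continuous_compact_integrable; [exact: segment_compact|exact: cw].
split; first by apply: integrableS (ii b (lexx _)) => //; exact: subset_itv_oo_cc.
move=> t; rewrite in_itv/= => /andP[]; rewrite le_eqVlt => /predU1P[<-|at_] tb.
  by rewrite set_itvoo0 Rintegral_set0 addr0.
have F := @continuous_FTC2 R f' f a t at_ (cw t tb).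
rewrite (@Rintegral_itv_bndo_bndc R (BRight a) t); last first.
  by apply: integrableS (ii t tb) => //; exact: subset_itv_oo_cc.
rewrite (@Rintegral_itv_obnd_cbnd R a (BRight t)); last first.
  by apply: integrableS (ii t tb) => //; exact: subset_itv_oc_cc.
rewrite /Rintegral F/=; first by rewrite addrCA subrr addr0.
- split.
  + move=> s; rewrite in_itv/= => /andP[_ st].
    by have [df _] := cf s (lt_trans (lt_le_trans st tb) bt); exact: (@ex_derive _ _ _ _ _ _ _ df).
  + apply: cvg_at_right_filter; exact: C1_before_continuous cf (lt_trans ab bt).
  + apply: cvg_at_left_filter; exact: C1_before_continuous cf (le_lt_trans tb bt).
- move=> s; rewrite in_itv/= => /andP[_ st].
  have [df _] := cf s (lt_trans (lt_le_trans st tb) bt).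
  by rewrite derive1E (@derive_val _ _ _ _ _ _ _ df).
Qed.

(** The power [r^c] of [r = sqrt (t0 - t)], written as an exponential so that its derivative is
    visibly a multiple of itself and powers compare through their exponents. *)
Definition time_pow (c t : R) : R := expR (c * half_log t).
Local Notation dlog t := (- (2 * (t0 - t))^-1).

Lemma C1_time_pow c : C1_before (time_pow c) (fun t => c * dlog t * time_pow c t).
Proof. exact: C1_before_expR (C1_beforeZ c C1_half_log). Qed.

Lemma time_powE c t : t < t0 -> time_pow c t = Num.sqrt (t0 - t) `^ c.
Proof.
move=> tt; have t1 : 0 < t0 - t by rewrite subr_gt0.
rewrite /time_pow /half_log -powR12_sqrt ?(ltW t1)// -powRrM /powR (gt_eqF t1).
by congr expR; ring.
Qed.

End C1_functions.

Section energy_1d.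
Context {R : realType}.
Local Notation lam := (@lebesgue_measure R).
Variables (t0 tT b kappa : R).
Hypotheses (tTb : tT < b) (bt0 : b < t0).

Let tTt0 : tT < t0. Proof. exact: lt_trans tTb bt0. Qed.

(** The factor [cfac] of the competitor is the case [a = kappa / 2], and its square the case
    [a = kappa]. *)
Definition decay (a t : R) : R := ((t0 - t) / (t0 - tT)) `^ a.

Lemma decay_tT a : decay a tT = 1.
Proof. by rewrite /decay divff ?powR1// gt_eqF// subr_gt0. Qed.

Definition decay' a t : R := - (a / (t0 - t)) * decay a t.

Lemma C1_decay a : C1_before t0 (decay a) (decay' a).
Proof.
move=> t tt; have t1 : 0 < t0 - t by rewrite subr_gt0.
have t2 : 0 < t0 - tT by rewrite subr_gt0.
have q0 : 0 < (t0 - t) / (t0 - tT) by rewrite divr_gt0.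
have dB : is_derive t (1 : R) (fun s : R => (t0 - s) / (t0 - tT)) (- (t0 - tT)^-1).
  have h := is_deriveB (is_derive_cst t0 t 1) (is_derive_id t (1 : R)).
  have := is_deriveM h (is_derive_cst (t0 - tT)^-1 t (1 : R)).
  by move=> h2; apply: is_derive_eq h2 _; rewrite /GRing.scale/= mulr0 add0r sub0r mulrN1.
have d : is_derive t (1 : R) (decay a) (decay' a t).
  have h := @is_derive1_comp R (fun x => x `^ a) (fun s => (t0 - s) / (t0 - tT)) t _ _
    (is_derive1_powR a q0) dB.
  apply: is_derive_eq h _; rewrite /decay' /decay powRB; last by rewrite (gt_eqF q0) implybT.
  rewrite powRr1 ?ltW//; set P := _ `^ a; field.
  by rewrite !gt_eqF.
split=> //; apply: (@continuousM R R (fun t => - (a / (t0 - t))) (decay a)); last first.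
  apply: differentiable_continuous; apply/derivable1_diffP.
  exact: (@ex_derive _ _ _ _ _ _ _ d).
apply: continuousN; apply: (@continuousM R R (cst a)); first exact: cst_continuous.
apply: (@continuousV R R (fun t => t0 - t)); first by rewrite gt_eqF.
by apply: continuousB; [exact: cst_continuous|exact: cvg_id].
Qed.

Lemma integrable_decay' a : lam.-integrable `]tT, b[ (EFin \o decay' a).
Proof. exact: (C1_before_ac tTb bt0 (C1_decay a)).1. Qed.

Lemma decayE a t : t \in `[tT, b] -> decay a t = 1 + \int[lam]_(s in `]tT, t[) decay' a s.
Proof. by move=> tI; rewrite ((C1_before_ac tTb bt0 (C1_decay a)).2 t tI) decay_tT. Qed.

Lemma time_to_t0E t : t \in `[tT, b] -> t0 - t = (t0 - tT) + \int[lam]_(s in `]tT, t[) (-1).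
Proof.
rewrite in_itv/= => /andP[Tt tb]; rewrite Rintegral_cst//= lebesgue_measure_itv/= lte_fin.
case: ltP => Tt'; first by rewrite -EFinD /= mulN1r opprB addrA subrK.
by have -> : t = tT; [apply/eqP; rewrite eq_le Tt' Tt|rewrite mulr0 addr0].
Qed.

(** The integrand is the derivative of [(t0 - s) * e s ^+ 2], because
    [e' = - V + kappa w / (2 (t0 - s))] along the curve. This quantity vanishes at [tT], where
    [v = w = c], and is nonnegative at [b]. *)
Lemma energy_1d (V v w e : R -> R) (c : R) :
  (forall s, w s = decay (kappa / 2) s * c) -> (forall s, e s = v s - w s) ->
  lam.-integrable `]tT, b[ (EFin \o V) -> measurable_fun setT (v : measurableTypeR R -> R) ->
  {ae lam, forall s : measurableTypeR R, (s : R) \in `]tT, b[ ->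
     v s = c - \int[lam]_(r in `]tT, (s : R)[) V r} ->
  0 <= \int[lam]_(s in `]tT, b[) (- (2 * (t0 - s) * V s * e s) - e s ^+ 2 + kappa * (w s * e s)).
Proof.
move=> wE eE0 iV mv vE.
pose k2 := kappa / 2.
have id' : lam.-integrable `]tT, b[ (EFin \o decay' k2).
  exact: integrable_decay'.
pose f1 s := (-1) * V s + (- c) * decay' k2 s.
have if1 : lam.-integrable `]tT, b[ (EFin \o f1).
  apply: integrable_addr; first exact: measurable_itv.
    exact: (@integrable_mulrl _ (measurableTypeR R) R lam _ (-1) V (measurable_itv _) iV).
  exact: (@integrable_mulrl _ (measurableTypeR R) R lam _ (- c) (decay' k2) (measurable_itv _) id').
pose E t := 0 + \int[lam]_(s in `]tT, t[) f1 s.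
have sub t : t <= b -> `]tT, t[%classic `<=` (`]tT, b[%classic : set R).
  by move=> tb s; rewrite /= !in_itv/= => /andP[-> /lt_le_trans]; exact.
pose h s := f1 s * E s + E s * f1 s.
have E2 t : t \in `[tT, b] -> lam.-integrable `]tT, t[ (EFin \o h) /\ E t * E t = 0 + \int[lam]_(s in `]tT, t[) h s.
  rewrite in_itv/= => /andP[Tt tb].
  have it : lam.-integrable `]tT, t[ (EFin \o f1) by apply: integrableS if1 => //; exact: sub.
  have [q1 q2] := @ac_mul R tT t 0 0 f1 f1 Tt it it.
  by split; [exact: q1|rewrite /E q2 mulr0].
have bb : b \in `[tT, b] by rewrite in_itv/= lexx ltW.
have i1 : lam.-integrable `]tT, b[ (EFin \o cst (-1 : R)).
  apply: measurable_bounded_integrable => //.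
  - by rewrite /= lebesgue_measure_itv/=; case: ifP => //; rewrite -EFinD ltry.
  - by exists 1; split=> // x x1 y _ /=; rewrite normrN1 ltW.
(* Product rule for [t0 - s], with derivative -1, and for [E^2], with derivative [h]. *)
have [q1 q2] := @ac_mul R tT b (t0 - tT) 0 (cst (-1)) h (ltW tTb) i1 (E2 b bb).1.
have Q0 : 0 <= \int[lam]_(s in `]tT, b[) ((-1) * (E s * E s) + (t0 - s) * h s).
  have -> : \int[lam]_(s in `]tT, b[) ((-1) * (E s * E s) + (t0 - s) * h s) = (t0 - b) * (E b * E b).
    rewrite (E2 b bb).2 time_to_t0E// q2 mulr0 add0r; apply: eq_Rintegral => s.
    rewrite inE /= in_itv/= => /andP[/ltW Ts /ltW sb].
    have sI : s \in `[tT, b] by rewrite in_itv/= Ts sb.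
    by rewrite (E2 s sI).2 time_to_t0E.
  by apply: mulr_ge0; [rewrite subr_ge0 ltW|rewrite -expr2 sqr_ge0].
have eE : {ae lam, forall s : measurableTypeR R, `]tT, b[%classic (s : R) -> e s = E s}.
  apply: filterS vE => s hs sI; have {}hs := hs sI.
  move: sI; rewrite /= in_itv/= => /andP[Ts sb].
  have sI : (s : R) \in `[tT, b] by rewrite in_itv/= !ltW.
  have iVs : lam.-integrable `]tT, (s : R)[ (EFin \o V) by apply: integrableS iV => //; exact/sub/ltW.
  have ids : lam.-integrable `]tT, (s : R)[ (EFin \o decay' k2) by apply: integrableS id' => //; exact/sub/ltW.
  rewrite eE0 wE hs decayE// /E /f1 add0r.
  have -> : \int[lam]_(r in `]tT, (s : R)[) ((-1) * V r + (- c) * decay' k2 r) =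
    (-1) * (\int[lam]_(r in `]tT, (s : R)[) V r) + (- c) * (\int[lam]_(r in `]tT, (s : R)[) decay' k2 r).
    rewrite RintegralD//.
    + by rewrite !RintegralZl.
    + exact: (@integrable_mulrl _ (measurableTypeR R) R lam _ (-1) V (measurable_itv _) iVs).
    + exact: (@integrable_mulrl _ (measurableTypeR R) R lam _ (- c) (decay' k2) (measurable_itv _) ids).
  rewrite -/k2.
  by move: (\int[lam]_(r in _) _) (\int[lam]_(r in _) _) => A B; ring.
have iQ : lam.-integrable `]tT, b[ (EFin \o (fun s => (-1) * (E s * E s) + (t0 - s) * h s)).
  apply: eq_integrable q1 => // s; rewrite inE /= in_itv/= => /andP[/ltW Ts /ltW sb].
  have sI : s \in `[tT, b] by rewrite in_itv/= Ts sb.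
  by rewrite (E2 s sI).2 (time_to_t0E sI).
apply: le_trans Q0 _; rewrite le_eqVlt; apply/orP; left; apply/eqP.
have mI : measurable (`]tT, b[%classic : set (measurableTypeR R)) by exact: measurable_itv.
have md : measurable_fun setT (decay k2 : measurableTypeR R -> R).
  apply: (measurable_funT_comp (measurable_powR _)).
  by apply: measurable_funM => //; exact: measurable_funB.
have mw : measurable_fun setT (w : measurableTypeR R -> R).
  by rewrite (funext wE); exact: measurable_funM.
have me : measurable_fun setT (e : measurableTypeR R -> R).
  by rewrite (funext eE0); exact: measurable_funB.
have mV : measurable_fun (`]tT, b[%classic : set (measurableTypeR R)) V.
  exact: (@measurable_fun_int _ (measurableTypeR R) R lam).
apply: (@ae_eq_Rintegral _ (measurableTypeR R) R lam) => //.
- exact: (@measurable_fun_int _ (measurableTypeR R) R lam).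
- have mt : measurable_fun (`]tT, b[%classic : set (measurableTypeR R)) (fun s : measurableTypeR R => 2 * (t0 - s)).
    by apply: measurable_funM => //; exact: measurable_funB.
  have meD := measurable_funTS me (D := `]tT, b[%classic).
  apply: measurable_funD.
    apply: measurable_funB; last exact: measurable_funX.
    apply: measurableT_comp => //; apply: measurable_funM => //; exact: measurable_funM.
  by apply: measurable_funM => //; apply: measurable_funM => //; exact: measurable_funTS.
apply: filterS eE => s hs sI; rewrite /h /f1 -(hs sI).
move: sI; rewrite /= in_itv/= => /andP[Ts sb].
have tn : t0 - s != 0 by rewrite gt_eqF// subr_gt0 (lt_trans sb).
have kE : kappa = 2 * k2 by rewrite /k2 mulrC divfK.
rewrite /decay' wE -/k2 kE.
by move: (decay _ s) (e s) (V s) => d' e' v'; field.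
Qed.

End energy_1d.

Section energy.
Context {R : realType} {n : nat}.
Local Notation lam := (@lebesgue_measure R).
Local Notation Rx := 'rV[R]_n.+1.
Local Notation Rxt := (Rx * R)%type.
Local Notation mu := (leb R n.+1 \x @lebesgue_measure R)%E.
Variables (z0 : Rxt) (u : Rxt -> R).
Local Notation x0 := z0.1.
Local Notation t0 := z0.2.
Local Notation D := (slab (-1) t0).
Local Notation G := (heat_kernel_at z0).
Local Notation Nu := (nabla D u).
Local Notation ut := (partial_t D u).
Hypothesis t0le : t0 <= 0.
Hypothesis wu : W11_differentiable D u.
Variable M : R.
Hypothesis Mu : {ae mu, forall z : Rx * measurableTypeR R, D z -> `|u z| <= M}.
Hypothesis Eu : (\int[mu]_(z in D)
  ((u z ^+ 2 + (t0 - z.2) * (sqnorm (Nu z) + ut z ^+ 2)) * G z)%:E < +oo)%E.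
Variable A : set R.
Hypothesis aA : {ae lam, forall t : measurableTypeR R, -1 < (t : R) < t0 -> A t}.
Hypothesis acA : forall t1 t2, A t1 -> A t2 -> -1 < t1 -> t1 < t2 -> t2 < t0 ->
  {ae leb R n.+1, forall y, u (unscale z0 (y, t2)) = u (unscale z0 (y, t1)) -
     \int[lam]_(s in `]t1, t2[)
       velocity z0 (fun k => weak_deriv D (basis_vec k, 0) u) ut (unscale z0 (y, s))}.
Variables (tT kappa : R).
Hypotheses (tT1 : -1 < tT) (tTt0 : tT < t0) (kappa0 : 0 < kappa).
Hypothesis good_tT : good z0 u M A tT.

Local Notation f := (slice u tT).
Local Notation rT := (rt z0 tT).
Local Notation v := (uv z0 u).
Local Notation Z := (Zu z0 u).
Local Notation gw := (gweight z0).

(** [wv], [ev] and [gwv] are, in similarity coordinates, the competitor, the difference of [u] and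
    the competitor, and [t0 - t] times the squared gradient of the competitor. *)
Definition wv (p : Rxt) : R := cfac z0 tT kappa p.2 * f (x0 + rT *: p.1).
Definition ev (p : Rxt) : R := v p - wv p.
Definition gwv (p : Rxt) : R :=
  (cfac z0 tT kappa p.2 * rT) ^+ 2 * sqnorm (weak_grad f (x0 + rT *: p.1)).

Let W12f : W12 (slice G tT) f. Proof. by case: good_tT => _ [g [wf _ _] _] _ _. Qed.
Let mf : measurable_fun setT f.
Proof. by have [wf _] := W12f; have [] := weakly_differentiable_measurable wf. Qed.
Let mgf : measurable_fun setT (weak_grad f).
Proof. by have [wf _] := W12f; have [] := weakly_differentiable_measurable wf. Qed.

Let mcf : measurable_fun setT ((fun p => cfac z0 tT kappa p.2) : Rx * measurableTypeR R -> R).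
Proof. exact: (measurable_funT_comp (measurable_cfac z0 tT kappa) measurable_snd). Qed.

Let mfst_aff : measurable_fun setT ((fun p => x0 + rT *: p.1) : Rx * measurableTypeR R -> Rx).
Proof. exact: (measurable_funT_comp (measurable_affine x0 rT) measurable_fst). Qed.

Lemma measurable_wv : measurable_fun setT (wv : Rx * measurableTypeR R -> R).
Proof. by apply: measurable_funM => //; exact: (measurable_funT_comp mf mfst_aff). Qed.

Lemma measurable_ev : measurable_fun setT (ev : Rx * measurableTypeR R -> R).
Proof. by apply: measurable_funB; [exact: measurable_uv|exact: measurable_wv]. Qed.

Lemma measurable_gwv : measurable_fun setT (gwv : Rx * measurableTypeR R -> R).
Proof.
apply: measurable_funM; first by apply: measurable_funX; exact: measurable_funM.
exact: (measurable_funT_comp measurable_sqnorm (measurable_funT_comp mgf mfst_aff)).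
Qed.

Let Sub b : b <= t0 -> slab tT b `<=` (D : set Rxt).
Proof. by move=> bt p /andP[p1 p2]; rewrite /slab/= (lt_trans tT1 p1) (lt_le_trans p2 bt). Qed.

Lemma wv_unscale p : (p.2 : R) < t0 -> wv p = competitor z0 tT kappa f (unscale z0 p).
Proof. by move=> pt; rewrite /wv /competitor /unscale /= ctr_unscale. Qed.

Lemma gwv_unscale p : (p.2 : R) < t0 ->
  gwv p = (t0 - p.2) * sqnorm (competitor_grad z0 tT kappa (weak_grad f) (unscale z0 p)).
Proof.
move=> pt; rewrite /gwv /competitor_grad /unscale /= ctr_unscale// sqnormZ mulrA.
congr (_ * _); rewrite -(rt_sqr (ltW pt)) -exprMn; congr (_ ^+ 2).
rewrite /dil mulrCA; congr (_ * _).
by rewrite mulrCA [rt z0 p.2 * _]mulrC irtK ?mulr1.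
Qed.

Lemma ae_wv_le : {ae mu, forall p : Rx * measurableTypeR R, slab tT t0 p -> `|wv p| <= M}.
Proof.
have [_ _ _ fM] := good_tT.
have := ae_fst lam (ae_leb_affine x0 (rt_gt0 tTt0) fM).
apply: filterS => p hp /andP[p1 p2].
have /andP[c0 c1] : 0 <= cfac z0 tT kappa p.2 <= 1 by apply: cfac_le1 => //; rewrite !ltW.
rewrite /wv normrM (ger0_norm c0); apply: le_trans hp; rewrite ler_piMl//.
Qed.

Lemma ae_ev_le : {ae mu, forall p : Rx * measurableTypeR R, slab tT t0 p -> `|ev p| <= M + M}.
Proof.
apply: filterS2 ae_wv_le (ae_uv_le Mu) => p h1 h2 sp.
apply: le_trans (ler_normB _ _) _; apply: lerD; last exact: h1.
by apply: h2; exact: (Sub (lexx _)).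
Qed.

Let mS b : measurable (slab tT b : set (Rx * measurableTypeR R)). Proof. exact: measurable_slab. Qed.

Lemma integrable_gweight : mu.-integrable (slab tT t0) (EFin \o gw).
Proof.
have := @integrable_energy_le R n z0 u wu Eu tT t0 (cst 1) (ltW tT1) (lexx _) (measurable_cst _).
move=> /(_ _)/wrap[].
  move=> p _; rewrite normr1; apply: le_trans (_ : 1 + sqnorm p.1 <= _); first by rewrite lerDl sqnorm_ge0.
  by rewrite lerDl !addr_ge0 ?sqr_ge0 ?sqnorm_ge0.
by apply: eq_integrable => // p _; rewrite /comp mul1r.
Qed.

Lemma integrable_bounded_gw (h : Rxt -> R) C : measurable_fun setT (h : Rx * measurableTypeR R -> R) ->
  {ae mu, forall p : Rx * measurableTypeR R, slab tT t0 p -> `|h p| <= C} ->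
  mu.-integrable (slab tT t0) (EFin \o (fun p => h p * gw p)).
Proof.
move=> mh hC; have := integrable_ae_bounded_mul (@mS t0) (measurable_funTS mh) hC integrable_gweight.
by apply: eq_integrable => // p _; rewrite /comp mulrC.
Qed.

Lemma integrable_v2 : mu.-integrable (slab tT t0) (EFin \o (fun p => v p ^+ 2 * gw p)).
Proof.
apply: (integrable_energy_le wu Eu (ltW tT1) (lexx _)).
  by apply: measurable_funX; exact: measurable_uv.
move=> p _; rewrite ger0_norm ?sqr_ge0//.
have := sqnorm_ge0 p.1; have := sqnorm_ge0 (gs z0 u p); have := sqr_ge0 (st z0 u p).
by move: (v p ^+ 2) => q; lra.
Qed.

Lemma integrable_gs2 : mu.-integrable (slab tT t0) (EFin \o (fun p => sqnorm (gs z0 u p) * gw p)).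
Proof.
apply: (integrable_energy_le wu Eu (ltW tT1) (lexx _)); first exact: measurable_gs2.
move=> p _; rewrite ger0_norm ?sqnorm_ge0//.
have := sqnorm_ge0 p.1; have := sqr_ge0 (v p); have := sqr_ge0 (st z0 u p).
by lra.
Qed.

Lemma integrable_w2 : mu.-integrable (slab tT t0) (EFin \o (fun p => wv p ^+ 2 * gw p)).
Proof.
apply: (@integrable_bounded_gw _ (M ^+ 2)); first by apply: measurable_funX; exact: measurable_wv.
by apply: filterS ae_wv_le => p hp /hp; rewrite normrX => h; rewrite lerXn2r ?nnegrE// (le_trans _ h).
Qed.

Lemma integrable_e2 : mu.-integrable (slab tT t0) (EFin \o (fun p => ev p ^+ 2 * gw p)).
Proof.
apply: (@integrable_bounded_gw _ ((M + M) ^+ 2)); first by apply: measurable_funX; exact: measurable_ev.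
by apply: filterS ae_ev_le => p hp /hp; rewrite normrX => h; rewrite lerXn2r ?nnegrE// (le_trans _ h).
Qed.

Lemma integrable_we : mu.-integrable (slab tT t0) (EFin \o (fun p => wv p * ev p * gw p)).
Proof.
apply: (@integrable_bounded_gw _ (M * (M + M))).
  by apply: measurable_funM; [exact: measurable_wv|exact: measurable_ev].
apply: filterS2 ae_wv_le ae_ev_le => p h1 h2 sp; rewrite normrM.
by apply: ler_pM => //; [exact: h1|exact: h2].
Qed.

Lemma integrable_Zgw : mu.-integrable (slab tT t0) (EFin \o (fun p => Z p * gw p)).
Proof.
apply: (integrable_energy_le wu Eu (ltW tT1) (lexx _)); first exact: measurable_Zu.
by move=> p sp; apply: Zu_le => //; exact: (Sub (lexx _)).
Qed.

(** [Z] is integrable for the weight and [ev] is bounded almost everywhere; the supremum bound on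
    [u] enters here. *)
Lemma integrable_Ze : mu.-integrable (slab tT t0) (EFin \o (fun p => Z p * ev p * gw p)).
Proof.
have := integrable_ae_bounded_mul (@mS t0) (measurable_funTS measurable_ev) ae_ev_le integrable_Zgw.
by apply: eq_integrable => // p _; rewrite /comp mulrAC.
Qed.

Definition vel (p : Rxt) : R := Z p * (irt z0 p.2 ^+ 2 / 2).

Lemma measurable_vel : measurable_fun setT (vel : Rx * measurableTypeR R -> R).
Proof.
apply: measurable_funM; first exact: measurable_Zu.
by apply: measurable_funM => //; exact: measurable_irt2.
Qed.

(* The right-hand side of [acA]: jointly measurable, so that equality with [uv] on
   almost every slice gives equality almost everywhere. *)
Definition path (p : Rxt) : R := f (x0 + rT *: p.1) - \int[lam]_(s in `]tT, p.2[) vel (p.1, s).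

Lemma measurable_path : measurable_fun setT (path : Rx * measurableTypeR R -> R).
Proof.
apply: measurable_funB; first exact: (measurable_funT_comp mf mfst_aff).
pose B : set ((Rx * measurableTypeR R) * measurableTypeR R) :=
  [set q | tT < (q.2 : R)] `&` [set q | (q.2 : R) < q.1.2].
have mB : measurable B.
  apply: measurableI.
    by apply: (@measurable_ltr _ _ _ (cst tT) snd); [exact: measurable_cst|exact: measurable_snd].
  apply: (@measurable_ltr _ _ _ snd (fun q => q.1.2)); first exact: measurable_snd.
  exact: (measurable_funT_comp measurable_snd measurable_fst).
pose h (q : (Rx * measurableTypeR R) * measurableTypeR R) := vel (q.1.1, q.2) * \1_B q.
have mh : measurable_fun setT h.
  apply: measurable_funM; last exact: measurable_indic.
  apply: (measurable_funT_comp measurable_vel); apply: measurable_fun_pair; last exact: measurable_snd.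
  exact: (measurable_funT_comp measurable_fst measurable_fst).
rewrite (_ : (fun p => _) = (fun p => \int[lam]_s h (p, s))).
  exact: (@measurable_Rintegral_param _ _ _ _ R lam h mh).
apply/funext => p; rewrite Rintegral_mkcond; apply: eq_Rintegral => s _.
rewrite /h patchE indicE; case: ifPn => [|sI].
  by rewrite inE /= in_itv/= => /andP[h1 h2]; rewrite mem_set ?mulr1.
rewrite memNset ?mulr0// => -[/= h1 h2]; move: sI.
by rewrite notin_setE /= in_itv/= h1 h2.
Qed.

Lemma ae_path : {ae mu, forall p : Rx * measurableTypeR R, slab tT t0 p -> v p = path p}.
Proof.
have mE : measurable [set p : Rx * measurableTypeR R | slab tT t0 p -> v p = path p].
  rewrite (_ : [set p | _] = ~` slab tT t0 `|` (fun p => v p - path p) @^-1` [set 0]).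
    apply: measurableU; first exact: measurableC.
    rewrite -[X in measurable X]setTI.
    have md : measurable_fun setT ((fun p => v p - path p) : Rx * measurableTypeR R -> R).
      by apply: measurable_funB; [exact: measurable_uv|exact: measurable_path].
    by apply: md => //; exact: measurable_set1.
  apply/seteqP; split=> p /=.
    have [sp h|nsp _] := pselect (slab tT t0 p); last by left.
    by right; rewrite h// subrr.
  by case=> [nsp /nsp|/eqP]//; rewrite subr_eq0 => /eqP.
apply: (ae_of_slices2 mE); apply: filterS aA => t hA.
have [tT_t|nt] := pselect (tT < (t : R) < t0); last first.
  by apply: aeW => x /= /nt.
have /andP[Tt tt] := tT_t; have t1 := lt_trans tT1 Tt.
have [AT _ _ _] := good_tT.
have At : A t by apply: hA; rewrite t1 tt.
apply: filterS (acA AT At tT1 Tt tt) => y hy _ /=.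
rewrite uvE; last by rewrite /slab/= t1 tt.
rewrite hy /path /slice /unscale/=; congr (_ - _); apply: eq_Rintegral => s.
rewrite inE /= in_itv/= => /andP[_ st].
by rewrite -[RHS](@velocity_unscale R n z0 u (y, s) (lt_trans st tt)).
Qed.

(** [energy_1d] holds on almost every curve, by [ae_path], and is integrated in [y] against the
    Gaussian; [Z] is [2 (t0 - t)] times [vel]. *)
Lemma energy_ineq b : tT < b -> b < t0 ->
  0 <= \int[mu]_(p in slab tT b) ((- (Z p * ev p) - ev p ^+ 2 + kappa * (wv p * ev p)) * gw p).
Proof.
move=> Tb bt0.
pose Q p := - (Z p * ev p) - ev p ^+ 2 + kappa * (wv p * ev p).
have subb : slab tT b `<=` (slab tT t0 : set Rxt).
  by move=> p /andP[p1 p2]; rewrite /slab/= p1 (lt_trans p2 bt0).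
have iQ : mu.-integrable (slab tT b) (EFin \o (fun p => Q p * gw p)).
  apply: (integrableS (@mS t0) (@mS b) subb).
  have i1 := integrable_mulrl (-1) (@mS t0) integrable_Ze.
  have i2 := integrable_mulrl (-1) (@mS t0) integrable_e2.
  have i3 := integrable_mulrl kappa (@mS t0) integrable_we.
  have := integrable_addr (@mS t0) (integrable_addr (@mS t0) i1 i2) i3.
  by apply: eq_integrable => // p _; rewrite /comp /Q; congr EFin; ring.
have iQp := (@integrable_patch _ _ _ mu _ _ (@mS b)).1 iQ.
rewrite Rintegral_mkcond Rintegral12_prod//.
have iQ1 := integrable_Rfubini1 iQp.
have mQ1 := measurable_fun_int iQ1.
set F := fun y => _ in mQ1 *.
suff aF : {ae leb R n.+1, forall y, 0 <= F y}.
  by apply: Rintegral_ae_ge0 mQ1 _ => //; apply: filterS aF => y hy _.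
have iV : mu.-integrable (slab tT b) (EFin \o (fun p => vel p * gw p)).
  have iZ := integrableS (@mS t0) (@mS b) subb integrable_Zgw.
  have mi : measurable_fun (slab tT b : set (Rx * measurableTypeR R)) (fun p => irt z0 p.2 ^+ 2 / 2).
    by apply: measurable_funTS; apply: measurable_funM => //; exact: measurable_irt2.
  (* Until time [b] the factor between [vel] and [Z] is bounded, so [vel] is integrable on almost
     every curve; the bound is lost as [b] tends to [t0]. *)
  have hi (p : Rxt) : slab tT b p -> `|irt z0 p.2 ^+ 2 / 2| <= (t0 - b)^-1.
    move=> /andP[_ pb]; have pt := lt_trans pb bt0.
    rewrite ger0_norm; last by rewrite divr_ge0// sqr_ge0.
    rewrite /irt exprVn (rt_sqr (ltW pt)).
    apply: le_trans (_ : (t0 - p.2)^-1 <= _).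
      by rewrite ler_pdivrMr// ler_peMr ?invr_ge0 ?subr_ge0 ?ltW// ltr1n.
    by rewrite lef_pV2 ?posrE ?subr_gt0// lerD2l lerN2 ltW.
  have := integrable_bounded_mul (@mS b) mi hi iZ.
  by apply: eq_integrable => // p _; rewrite /comp /vel mulrAC.
have iVp := (@integrable_patch _ _ _ mu _ _ (@mS b)).1 iV.
have aP := ae_slice1 ae_path.
apply: filterS2 (ae_and (ae_integrable1 iVp) (ae_integrable1 iQp)) aP => y [iVy iQy] hy.
have g0 := @gam_gt0 R n y; have gn := lt0r_neq0 g0.
have mI : measurable (`]tT, b[%classic : set (measurableTypeR R)) by exact: measurable_itv.
have E (h : Rxt -> R) s : ((fun p => h p * gw p) \_ (slab tT b)) (y, s) =
    ((fun s => h (y, s) * gam y) \_ `]tT, b[) s.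
  rewrite !patchE; have -> : ((y, s) \in (slab tT b : set Rxt)) = (s \in `]tT, b[%classic).
    by apply/idP/idP => /set_mem h'; apply/mem_set; move: h'; rewrite /slab/= in_itv.
  case: ifPn => //; rewrite inE/= in_itv/= => /andP[_ sb].
  by rewrite /gweight /past/= (lt_trans sb bt0) mulr1.
have iH (h : Rxt -> R) : lam.-integrable setT (fun s => (((fun p => h p * gw p) \_ (slab tT b)) (y, s))%:E) ->
    lam.-integrable `]tT, b[ (EFin \o (fun s : R => h (y, s) * gam y)).
  move=> ih; apply: (@integrable_patch _ (measurableTypeR R) R lam `]tT, b[%classic (fun s => h (y, s) * gam y) mI).2.
  by apply: eq_integrable ih => // s _; rewrite /comp E.
have iH2 (h : Rxt -> R) : lam.-integrable `]tT, b[ (EFin \o (fun s : R => h (y, s) * gam y)) ->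
    lam.-integrable `]tT, b[ (EFin \o (fun s : R => h (y, s))).
  move=> /(@integrable_mulrl _ (measurableTypeR R) R lam _ (gam y)^-1 _ mI).
  by apply: eq_integrable => // s _; rewrite /comp mulrC mulfK.
have iVy' := iH2 vel (iH vel iVy); have iQy' := iH2 Q (iH Q iQy).
have FE : F y = (\int[lam]_(s in `]tT, b[) Q (y, s)) * gam y.
  rewrite /F -RintegralZr// [RHS]Rintegral_mkcond; apply: eq_Rintegral => s _.
  exact: (E Q s).
rewrite FE; apply: mulr_ge0; last exact: ltW.
have := @energy_1d R t0 tT b kappa Tb bt0 (fun s => vel (y, s)) (fun s => v (y, s)) (fun s => wv (y, s))
  (fun s => ev (y, s)) (f (x0 + rT *: y)) (fun s => erefl) (fun s => erefl) iVy'.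
move=> /(_ _ _)/wrap[].
- have mv : measurable_fun setT (v : Rx * measurableTypeR R -> R) by exact: measurable_uv.
  have m1 : measurable_fun setT ((fun s => (y, s)) : measurableTypeR R -> Rx * measurableTypeR R).
    exact: pair1_measurable.
  exact: (measurable_funT_comp mv m1).
- apply: filterS hy => s hs; rewrite in_itv/= => /andP[s1 s2].
  by apply: hs; rewrite /slab/= s1 (lt_trans s2 bt0).
move=> h; apply: le_trans h _; rewrite le_eqVlt; apply/orP; left; apply/eqP.
apply: eq_Rintegral => s; rewrite inE /= in_itv/= => /andP[_ sb].
have st := lt_trans sb bt0; have r0 := rt_gt0 st.
rewrite /Q /vel -(rt_sqr (ltW st)) /irt; congr (- _ - _ + _).
by field; exact: lt0r_neq0.
Qed.

End energy.

(** * Comparison with the competitor *)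

(** Adding [+oo] to [g] on the exceptional null set makes the inequality hold everywhere and leaves
    the integral of [g] unchanged. *)
Lemma ae_le_integral_nonmeas d (T : measurableType d) (R : realType)
    (mu : {measure set T -> \bar R}) (D : set T) (f g : T -> \bar R) :
  measurable D -> measurable_fun D g ->
  (forall x, D x -> 0 <= f x)%E -> (forall x, D x -> 0 <= g x)%E ->
  {ae mu, forall x, D x -> (f x <= g x)%E} ->
  (\int[mu]_(x in D) f x <= \int[mu]_(x in D) g x)%E.
Proof.
move=> mD mg f0 g0 [N [mN N0 sub]].
pose h x := ((g x + ((cst +oo) \_ N) x))%E.
have i0 x : (0 <= ((cst (+oo%E : \bar R)) \_ N) x)%E by rewrite patchE; case: ifPn => _; rewrite ?leey.
have mi : measurable_fun D ((cst (+oo%E : \bar R)) \_ N).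
  by apply: measurable_funTS; exact: (measurable_restrictT _ mN).1 (measurable_cst _).
have <- : (\int[mu]_(x in D) h x = \int[mu]_(x in D) g x)%E.
  apply: ge0_ae_eq_integral => //.
  - exact: emeasurable_funD.
  - by move=> x Dx; rewrite adde_ge0// g0.
  - exists N; split=> // x /= hx; apply: contrapT => nN; apply: hx => _.
    by rewrite /h patchE memNset// adde0.
apply: ge0_le_integral_nonmeas => // x Dx; rewrite /h patchE.
case: ifPn => [_|]; first by rewrite addeC addye ?leey// gt_eqF// (lt_le_trans _ (g0 _ Dx)).
rewrite notin_setE => nN; rewrite adde0; apply: contrapT => fg; apply: nN; apply: sub => /=.
by move=> h'; apply: fg; exact: h'.
Qed.

Section admissible.
Context {R : realType} {n : nat}.
Local Notation lam := (@lebesgue_measure R).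
Local Notation Rx := 'rV[R]_n.+1.
Local Notation Rxt := (Rx * R)%type.
Local Notation mu := (leb R n.+1 \x @lebesgue_measure R)%E.
Variables (z0 : Rxt) (u : Rxt -> R).
Local Notation x0 := z0.1.
Local Notation t0 := z0.2.
Local Notation D := (slab (-1) t0).
Local Notation G := (heat_kernel_at z0).
Local Notation Nu := (nabla D u).
Local Notation ut := (partial_t D u).
Hypothesis t0le : t0 <= 0.
Hypothesis x0thin : x0 ord0 ord_max = 0.
Hypothesis wu : W11_differentiable D u.
Variable M : R.
Hypothesis Mu : {ae mu, forall z : Rx * measurableTypeR R, D z -> `|u z| <= M}.
Hypothesis Eu : (\int[mu]_(z in D)
  ((u z ^+ 2 + (t0 - z.2) * (sqnorm (Nu z) + ut z ^+ 2)) * G z)%:E < +oo)%E.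
Hypothesis Tu : thin_ge0 z0 (-1) t0 u.
Variables (tT kappa b : R).
Hypotheses (tT1 : -1 < tT) (tTb : tT < b) (bt0 : b < t0) (kappa0 : 0 < kappa).
Variables (f : Rx -> R) (g : 'rV[R]_n -> R).
Hypothesis trf : is_thin_trace (slice G tT) f g.
Hypothesis g0 : {ae leb R n, forall x', 0 <= g x'}.

Local Notation w := (competitor z0 tT kappa f).
Local Notation cg := (competitor_grad z0 tT kappa (weak_grad f)).
Local Notation S := (slab tT b).

Let tTt0 := lt_trans tTb bt0.
Let mS : measurable (S : set (Rx * measurableTypeR R)). Proof. exact: measurable_slab. Qed.
Let mD : measurable (D : set (Rx * measurableTypeR R)). Proof. exact: measurable_slab. Qed.
Let SD : S `<=` (D : set Rxt).
Proof. by move=> p /andP[p1 p2]; rewrite /slab/= (lt_trans tT1 p1) (lt_trans p2 bt0). Qed.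

Let W12f : W12 (slice G tT) f. Proof. by case: trf. Qed.
Let mf : measurable_fun setT f.
Proof. by have [wf _] := W12f; have [] := weakly_differentiable_measurable wf. Qed.
Let mgf : measurable_fun setT (weak_grad f).
Proof. by have [wf _] := W12f; have [] := weakly_differentiable_measurable wf. Qed.
Let mw : measurable_fun setT (w : Rx * measurableTypeR R -> R).
Proof. exact: measurable_competitor. Qed.
Let mcg : measurable_fun setT (cg : Rx * measurableTypeR R -> Rx).
Proof. by apply: measurable_fun_coord => i; exact: measurable_competitor_grad. Qed.
Let mNu : measurable_fun setT (Nu : Rx * measurableTypeR R -> Rx).
Proof. by apply: measurable_fun_coord => i; exact: measurable_nabla_coord. Qed.
Let muS : measurable_fun (S : set (Rx * measurableTypeR R)) u.
Proof. by apply: measurable_funS mD SD _; case: wu => _ [[]]. Qed.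

Let Fen (h : Rxt -> R) (X : Rxt -> Rx) (z : Rxt) : \bar R :=
  ((h z ^+ 2 + sqnorm (X z)) * G z)%:E.
Let Fen0 h X z : (0 <= Fen h X z)%E.
Proof. by rewrite lee_fin mulr_ge0 ?heat_kernel_at_ge0// addr_ge0 ?sqr_ge0 ?sqnorm_ge0. Qed.

Let mFen h X : measurable_fun (S : set (Rx * measurableTypeR R)) h ->
  measurable_fun setT (X : Rx * measurableTypeR R -> Rx) ->
  measurable_fun (S : set (Rx * measurableTypeR R)) (Fen h X).
Proof.
move=> mh mX; apply/measurable_EFinP; apply: measurable_funM.
  apply: measurable_funD; first exact: measurable_funX.
  by apply: measurable_funTS; exact: (measurable_funT_comp measurable_sqnorm mX).
by apply: measurable_funTS; exact: measurable_heat_kernel_at.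
Qed.

(** Until time [b] the factor [t0 - t] in the norm is at least [t0 - b]; the constant [C] satisfies
    both [1 <= C] and [1 <= C * (t0 - t)]. *)
Lemma solution_energy_fin : (\int[mu]_(z in S) Fen u Nu z < +oo)%E.
Proof.
pose C : R := 1 + (t0 - b)^-1.
have tb : 0 < t0 - b by rewrite subr_gt0.
have C0 : 0 <= C by rewrite addr_ge0// invr_ge0 ltW.
pose F z : R := (u z ^+ 2 + (t0 - z.2) * (sqnorm (Nu z) + ut z ^+ 2)) * G z.
have F0 z : D z -> (0 <= (F z)%:E)%E.
  case/andP => _ zt; rewrite lee_fin; apply: mulr_ge0; last exact: heat_kernel_at_ge0.
  apply: addr_ge0; first exact: sqr_ge0.
  apply: mulr_ge0; first by rewrite subr_ge0 ltW.
  by rewrite addr_ge0 ?sqnorm_ge0 ?sqr_ge0.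
have mF : measurable_fun (D : set (Rx * measurableTypeR R)) (fun z => (F z)%:E).
  apply/measurable_EFinP; apply: measurable_funM; last first.
    by apply: measurable_funTS; exact: measurable_heat_kernel_at.
  apply: measurable_funD; first by apply: measurable_funX; case: wu => _ [[]].
  apply: measurable_funTS; apply: measurable_funM.
    by apply: measurable_funB => //; exact: measurable_snd.
  apply: measurable_funD; last by apply: measurable_funX; exact: measurable_ut.
  exact: (measurable_funT_comp measurable_sqnorm mNu).
apply: (@le_lt_trans _ _ (\int[mu]_(z in D) (C%:E * (F z)%:E))%E); last first.
  by rewrite ge0_integralZl_EFin//; apply: lte_mul_pinfty.
apply: le_trans (_ : (\int[mu]_(z in S) (C%:E * (F z)%:E) <= _)%E); last first.
  apply: ge0_subset_integral => //; first exact: measurable_funeM.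
  by move=> z /F0 h; rewrite mule_ge0.
apply: ge0_le_integral_nonmeas => z Sz; first exact: Fen0.
rewrite -EFinM lee_fin /F mulrA; apply: ler_wpM2r; first exact: heat_kernel_at_ge0.
have /andP[_ zb] := Sz; have zt : t0 - b <= t0 - z.2 by rewrite lerD2l lerN2 ltW.
have h1 : 1 <= C * (t0 - z.2).
  rewrite /C mulrDl mul1r; apply: le_trans (_ : (t0 - b)^-1 * (t0 - b) <= _); first by rewrite mulVf ?gt_eqF.
  apply: le_trans (_ : (t0 - b)^-1 * (t0 - z.2) <= _); first by rewrite ler_wpM2l// invr_ge0 ltW.
  by rewrite lerDr; exact: le_trans (ltW tb) zt.
rewrite mulrDr; apply: lerD.
  by rewrite ler_peMl ?sqr_ge0// /C lerDl invr_ge0 ltW.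
rewrite mulrA; apply: le_trans (_ : sqnorm (Nu z) + ut z ^+ 2 <= _); first by rewrite lerDl sqr_ge0.
by rewrite ler_peMl// addr_ge0 ?sqnorm_ge0 ?sqr_ge0.
Qed.

(** The slices of [u] and of the competitor have traces for the same weight, so both lie in [W12_0].
    The energy of the difference is at most twice the sum of the two energies, which are finite up
    to time [b]. *)
Lemma difference_admissible : L2W12_0 z0 tT b (u \- w).
Proof.
have hg : {ae lam, forall t : measurableTypeR R, tT < (t : R) < b ->
   good z0 u M setT t}.
  have := @ae_good R n z0 u wu M Mu Tu setT (aeW _ (fun _ _ => I)).
  by apply: filterS => t ht /andP[t1 t2]; apply: ht; rewrite (lt_trans tT1 t1) (lt_trans t2 bt0).
have h0 t : tT < t < b -> good z0 u M setT t ->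
    W12_0 (slice G t) (slice (u \- w) t).
  move=> /andP[_ tb] [_ [gu tu _] _ _].
  have [g' tw _] := competitor_thin_trace kappa tTt0 x0thin trf g0 (lt_trans tb bt0).
  exact: (W12_0B (@heat_slice_ge0 R n z0 t) (measurable_heat_slice z0 t) (thin_trace_W12_0 tu) (thin_trace_W12_0 tw)).
split; last by apply: filterS hg => t ht tb; exact: h0 (ht tb).
split.
- by apply: measurable_funB => //; exact: measurable_funTS.
- by apply: filterS hg => t ht tb; have [] := h0 _ tb (ht tb).
(* The gradients of the slices are chosen slice by slice, without control in [t]. [U] is formed with
   the fields [Nu] and [cg] instead, which are jointly measurable and agree with them almost
   everywhere on almost every slice. *)
pose U h X (t : R) := (\int[leb R n.+1]_x (Fen h X \_ S) (x, t))%E.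
have U0 h X t : (0 <= U h X t)%E.
  by apply: integral_ge0 => x _; rewrite patchE; case: ifPn.
have mP h X : measurable_fun (S : set (Rx * measurableTypeR R)) h ->
    measurable_fun setT (X : Rx * measurableTypeR R -> Rx) ->
    measurable_fun setT (Fen h X \_ S : Rx * measurableTypeR R -> \bar R).
  by move=> mh mX; exact: (measurable_restrictT _ mS).1 (mFen mh mX).
have p0 h X (z : Rx * measurableTypeR R) : (0 <= (Fen h X \_ S) z)%E by rewrite patchE; case: ifPn.
have mU h X : measurable_fun (S : set (Rx * measurableTypeR R)) h ->
    measurable_fun setT (X : Rx * measurableTypeR R -> Rx) ->
    measurable_fun setT (U h X : measurableTypeR R -> \bar R).
  by move=> mh mX; exact: (@measurable_fun_fubini_tonelli_G _ _ _ (measurableTypeR R) R (leb R n.+1) (Fen h X \_ S) (mP _ _ mh mX) (p0 _ _)).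
have fU h X : measurable_fun (S : set (Rx * measurableTypeR R)) h ->
    measurable_fun setT (X : Rx * measurableTypeR R -> Rx) ->
    (\int[mu]_(z in S) Fen h X z < +oo)%E -> (\int[lam]_(t in `]tT, b[) U h X t < +oo)%E.
  move=> mh mX; apply: le_lt_trans; rewrite [leRHS]integral_mkcond.
  rewrite (@fubini_tonelli2 _ _ _ (measurableTypeR R) R (leb R n.+1) lam (Fen h X \_ S) (mP _ _ mh mX) (p0 _ _)).
  apply: ge0_subset_integral => //; first exact: mU.
have UE h X t : tT < t < b -> U h X t = energy (slice G t) (slice h t) (fun x => X (x, t)).
  by move=> tb; apply: eq_integral => x _; rewrite patchE mem_set.
have mwS := measurable_funTS mw : measurable_fun (S : set (Rx * measurableTypeR R)) w.
apply: (@le_lt_trans _ _ (\int[lam]_(t in `]tT, b[) (2%:E * U u Nu t + 2%:E * U w cg t))%E).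
  apply: ae_le_integral_nonmeas => //.
  - by apply: measurable_funTS; apply: emeasurable_funD; apply: measurable_funeM; exact: mU.
  - by move=> t _; apply: integral_ge0 => x _; rewrite lee_fin mulr_ge0 ?heat_slice_ge0// addr_ge0 ?sqr_ge0 ?sqnorm_ge0.
  - by move=> t _; rewrite adde_ge0// mule_ge0// U0.
  - apply: filterS hg => t ht; rewrite /= in_itv/= => tb.
    have /andP[_ tb'] := tb; have tt := lt_trans tb' bt0.
    have [_ [gu [[wfu _] _ _] _] gN _] := ht tb.
    have [g' [[wfw _] _ _] _] := competitor_thin_trace kappa tTt0 x0thin trf g0 tt.
    have [mu1 mu2] := weakly_differentiable_measurable wfu.
    have [mw1 mw2] := weakly_differentiable_measurable wfw.
    have [wfd dE] := weak_gradB wfu wfw.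
    have [md1 md2] := weakly_differentiable_measurable wfd.
    have mNt : measurable_fun setT (fun x => Nu (x, t)).
      by apply: (measurable_funT_comp mNu); exact: pair2_measurable.
    rewrite !UE// -(energy_ae (measurable_heat_slice z0 t) mu1 mu2 mNt gN).
    rewrite -(energy_competitor_weak kappa tTt0 trf tt).
    apply: le_trans (energyB (@heat_slice_ge0 R n z0 t) (measurable_heat_slice z0 t) mu1 mw1 mu2 mw2).
    rewrite -(energy_ae (measurable_heat_slice z0 t) md1 md2 _ dE)//.
    exact: measurable_funB_rV.
rewrite ge0_integralD//=; first last.
- by apply: measurable_funTS; apply: measurable_funeM; exact: mU.
- by move=> t _; rewrite mule_ge0.
- by apply: measurable_funTS; apply: measurable_funeM; exact: mU.
- by move=> t _; rewrite mule_ge0.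
rewrite !ge0_integralZl_EFin//; try by apply: measurable_funTS; exact: mU.
apply: lte_add_pinfty; apply: lte_mul_pinfty => //; apply: fU => //.
  exact: solution_energy_fin.
exact: competitor_energy_fin bt0 kappa0 trf.
Qed.

End admissible.

(** * The time integral of the homogeneous factor *)

Section decay_integral.
Context {R : realType}.
Local Notation lam := (@lebesgue_measure R).

Lemma decayS (t0 tT a t : R) : t < t0 -> tT < t0 ->
  decay t0 tT (a + 1) t = (t0 - t) / (t0 - tT) * decay t0 tT a t.
Proof.
move=> tt Tt; have q0 : 0 < (t0 - t) / (t0 - tT) by rewrite divr_gt0 ?subr_gt0.
rewrite /decay powRD; last by rewrite (gt_eqF q0) implybT.
by rewrite powRr1 ?(ltW q0)// mulrC.
Qed.

Lemma decay_bounds (t0 tT a t : R) : 0 < a -> tT <= t -> t < t0 -> 0 <= decay t0 tT a t <= 1.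
Proof.
move=> a0 Tt tt; rewrite powR_ge0 /=.
have q0 : 0 < (t0 - t) / (t0 - tT) by rewrite divr_gt0 ?subr_gt0// (le_lt_trans Tt).
have q1 : (t0 - t) / (t0 - tT) <= 1.
  by rewrite ler_pdivrMr ?mul1r ?subr_gt0 ?(le_lt_trans Tt)// lerD2l lerN2.
have := @ge0_ler_powR R a (ltW a0) ((t0 - t) / (t0 - tT)) 1.
by rewrite !nnegrE (ltW q0) ler01 powR1 => /(_ isT isT q1).
Qed.

Lemma measurable_decay (t0 tT a : R) : measurable_fun setT (decay t0 tT a : measurableTypeR R -> R).
Proof.
apply: (measurable_funT_comp (@measurable_powR R a)).
by apply: measurable_funM => //; exact: measurable_funB.
Qed.

Lemma integrable_decay (t0 tT a : R) : tT < t0 -> 0 < a ->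
  lam.-integrable `]tT, t0[ (EFin \o decay t0 tT a).
Proof.
move=> Tt a0; apply: (@measurable_bounded_integrable _ (measurableTypeR R) R lam) => //.
- by rewrite /= lebesgue_measure_itv/= lte_fin Tt -EFinD ltry.
- by apply: measurable_funTS; exact: measurable_decay.
- exists 1; split=> // x x1 t; rewrite /= in_itv/= => /andP[t1 t2].
  have /andP[d0 d1] := decay_bounds a0 (ltW t1) t2.
  by rewrite ger0_norm// (le_trans d1)// ltW.
Qed.

Lemma decay_integral_part (t0 tT a b : R) : tT < b -> b < t0 -> 0 < a ->
  \int[lam]_(t in `]tT, b[) decay t0 tT a t = (t0 - tT) / (a + 1) * (1 - decay t0 tT (a + 1) b).
Proof.
move=> Tb bt a0; have Tt := lt_trans Tb bt.
have T0 : 0 < t0 - tT by rewrite subr_gt0.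
have a1 : 0 < a + 1 by rewrite addr_gt0.
rewrite (@decayE R t0 tT b Tb bt (a + 1) b); last by rewrite in_itv/= lexx ltW.
rewrite opprD addrA subrr sub0r mulrN -mulNr.
have -> : \int[lam]_(s in `]tT, b[) decay' t0 tT (a + 1) s =
    \int[lam]_(s in `]tT, b[) (- ((a + 1) / (t0 - tT)) * decay t0 tT a s).
  apply: eq_Rintegral => s; rewrite inE/= in_itv/= => /andP[_ sb].
  have st := lt_trans sb bt.
  rewrite /decay' decayS//; field.
  by rewrite !gt_eqF// subr_gt0.
rewrite RintegralZl//; last first.
  apply: integrableS (integrable_decay Tt a0) => //= s; rewrite /= !in_itv/= => /andP[-> sb].
  exact: lt_trans sb bt.
by rewrite mulrA mulrNN mulrA divfK ?gt_eqF// divff ?gt_eqF// mul1r.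
Qed.

(** The antiderivative is known up to every [b < t0]; [decay (a + 1) b] tends to 0 as [b] tends to
    [t0], and the limit is taken once for each inequality. *)
Lemma decay_integral (t0 tT a : R) : tT < t0 -> 0 < a ->
  \int[lam]_(t in `]tT, t0[) decay t0 tT a t = (t0 - tT) / (a + 1).
Proof.
move=> Tt a0; have a1 : 0 < a + 1 by rewrite addr_gt0.
have T0 : 0 < t0 - tT by rewrite subr_gt0.
apply/eqP; rewrite eq_le; apply/andP; split.
  apply: Rintegral_itv_limit => // [|e e0]; first exact: integrable_decay.
  exists tT => [|b /andP[Tb bt]]; first by rewrite lexx.
  rewrite decay_integral_part//; have /andP[d0 _] := decay_bounds a1 (ltW Tb) bt.
  apply: le_trans (_ : (t0 - tT) / (a + 1) <= _); last by rewrite lerDl ltW.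
  by rewrite ler_piMr ?divr_ge0 ?(ltW T0) ?(ltW a1)// lerBlDr lerDl.
rewrite -lerN2; have <- : \int[lam]_(t in `]tT, t0[) (- 1 * decay t0 tT a t) =
    - \int[lam]_(t in `]tT, t0[) decay t0 tT a t.
  by rewrite RintegralZl ?mulN1r//; exact: integrable_decay.
apply: Rintegral_itv_limit => // [|e e0].
  by apply: integrable_mulrl => //; exact: integrable_decay.
(* Beyond [t0 - e] the remaining term is at most [t0 - b], hence at most [e]. *)
exists (Num.max tT (t0 - e)) => [|b].
  by rewrite le_max lexx /= gt_max Tt gtrBl.
rewrite gt_max => /andP[/andP[Tb eb] bt].
rewrite RintegralZl//; last first.
  apply: integrableS (integrable_decay Tt a0) => //= s; rewrite /= !in_itv/= => /andP[-> sb].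
  exact: lt_trans sb bt.
rewrite decay_integral_part// mulN1r mulrBr mulr1 opprB addrC lerD2l decayS//.
have /andP[d0 d1] := decay_bounds a0 (ltW Tb) bt.
rewrite mulrA [_ / _ * (_ / _)]mulrC mulrA divfK ?gt_eqF//.
have h1 : 0 <= (t0 - b) / (a + 1) by rewrite divr_ge0 ?(ltW a1)// subr_ge0 ltW.
apply: le_trans (_ : (t0 - b) / (a + 1) <= _); first by rewrite ler_piMr.
rewrite ler_pdivrMr//; apply: le_trans (_ : e <= _); first by rewrite lerBlDr -lerBlDl ltW.
by rewrite ler_peMr ?(ltW e0)// lerDr ltW.
Qed.

End decay_integral.

Section slab_integrals.
Context {R : realType} {n : nat}.
Local Notation lam := (@lebesgue_measure R).
Local Notation Rx := 'rV[R]_n.+1.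
Local Notation Rxt := (Rx * R)%type.
Local Notation mu := (leb R n.+1 \x @lebesgue_measure R)%E.

Lemma slab_fubini (a b : R) (F : Rxt -> R) : mu.-integrable (slab a b) (EFin \o F) ->
  lam.-integrable `]a, b[ (EFin \o (fun t : R => \int[leb R n.+1]_y F (y, t))) /\
  \int[mu]_(p in slab a b) F p = \int[lam]_(t in `]a, b[) \int[leb R n.+1]_y F (y, t).
Proof.
move=> iF; have mS : measurable (slab a b : set (Rx * measurableTypeR R)) by exact: measurable_slab.
have mI : measurable (`]a, b[%classic : set (measurableTypeR R)) by exact: measurable_itv.
have iP := (@integrable_patch _ _ _ mu _ _ mS).1 iF.
have i2 := integrable_Rfubini2 iP.
have E (t : R) : \int[leb R n.+1]_y (F \_ (slab a b)) (y, t) =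
    ((fun t : R => \int[leb R n.+1]_y F (y, t)) \_ `]a, b[) t.
  rewrite [RHS]patchE; case: ifPn => tab.
    apply: eq_Rintegral => y _; rewrite patchE mem_set//.
    by move: tab; rewrite inE /= in_itv.
  rewrite /Rintegral integral0_eq// => y _; rewrite patchE memNset//.
  by move: tab; rewrite notin_setE /= in_itv.
split.
  apply: (@integrable_patch _ (measurableTypeR R) R lam `]a, b[%classic _ mI).2.
  by apply: eq_integrable i2 => // t _; rewrite /comp E.
rewrite Rintegral_mkcond (Rintegral21_prod iP) [RHS]Rintegral_mkcond.
by apply: eq_Rintegral => t _; exact: E.
Qed.

Lemma slab_limit (a b C : R) (F : Rxt -> R) : a < b -> mu.-integrable (slab a b) (EFin \o F) ->
  (forall b', a < b' -> b' < b -> \int[mu]_(p in slab a b') F p <= C) ->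
  \int[mu]_(p in slab a b) F p <= C.
Proof.
move=> ab iF h; have [i1 ->] := slab_fubini iF.
apply: Rintegral_itv_limit => // e e0; exists a => [|b' /andP[ab' b'b]]; first by rewrite lexx.
apply: le_trans (_ : C <= _); last by rewrite lerDl ltW.
have sub : slab a b' `<=` (slab a b : set Rxt).
  by move=> p /andP[p1 p2]; rewrite /slab/= p1 (lt_trans p2 b'b).
have [_ <-] := slab_fubini (integrableS (@measurable_slab R n a b) (@measurable_slab R n a b') sub iF).
exact: h.
Qed.

Lemma Rintegral_slab_heat (z0 : Rxt) (a b : R) (h : Rxt -> R) :
  measurable_fun (slab a b : set (Rx * measurableTypeR R)) h ->
  \int[mu]_(z in slab a b) (h z * heat_kernel_at z0 z) =
  \int[mu]_(p in slab a b) (h (unscale z0 p) * gweight z0 p).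
Proof.
move=> mh; rewrite /Rintegral; congr fine.
exact: (@integral_heat R n z0 [set t | a < t < b] h (@measurable_slab R n a b) mh).
Qed.

Lemma Rintegral_slab_tensor (a b : R) (c : R -> R) (k : Rx -> R) :
  mu.-integrable (slab a b) (EFin \o (fun p => c p.2 * k p.1)) ->
  lam.-integrable `]a, b[ (EFin \o c) -> (leb R n.+1).-integrable setT (EFin \o k) ->
  \int[mu]_(p in slab a b) (c p.2 * k p.1) =
  (\int[lam]_(t in `]a, b[) c t) * \int[leb R n.+1]_y k y.
Proof.
move=> ick ic ik; have [_ ->] := slab_fubini ick; rewrite -RintegralZr//.
by apply: eq_Rintegral => t _ /=; rewrite RintegralZl.
Qed.

Lemma slab_gweight (z0 : Rxt) (a : R) (h : Rxt -> R) :
  mu.-integrable (slab a z0.2) (EFin \o (fun p => h p * gweight z0 p)) ->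
  lam.-integrable `]a, z0.2[ (EFin \o (fun t : R => \int[leb R n.+1]_y (h (y, t) * gam y))) /\
  \int[mu]_(p in slab a z0.2) (h p * gweight z0 p) =
  \int[lam]_(t in `]a, z0.2[) \int[leb R n.+1]_y (h (y, t) * gam y).
Proof.
move=> ih; have [i1 e1] := slab_fubini ih.
have E t : t \in `]a, z0.2[%classic -> \int[leb R n.+1]_y (h (y, t) * gweight z0 (y, t)) =
    \int[leb R n.+1]_y (h (y, t) * gam y).
  rewrite inE/= in_itv/= => /andP[_ tt]; apply: eq_Rintegral => y _.
  by rewrite /gweight /past tt mulr1.
split; last by rewrite e1; apply: eq_Rintegral => t; exact: E.
by apply: eq_integrable i1 => // t tI; rewrite /comp E.
Qed.

End slab_integrals.

Section comparison.
Context {R : realType} {n : nat}.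
Local Notation lam := (@lebesgue_measure R).
Local Notation Rx := 'rV[R]_n.+1.
Local Notation Rxt := (Rx * R)%type.
Local Notation mu := (leb R n.+1 \x @lebesgue_measure R)%E.
Variables (z0 : Rxt) (u : Rxt -> R).
Local Notation x0 := z0.1.
Local Notation t0 := z0.2.
Local Notation D := (slab (-1) t0).
Local Notation G := (heat_kernel_at z0).
Local Notation Nu := (nabla D u).
Local Notation ut := (partial_t D u).
Hypothesis t0le : t0 <= 0.
Hypothesis x0thin : x0 ord0 ord_max = 0.
Hypothesis wu : W11_differentiable D u.
Variable M : R.
Hypothesis Mu : {ae mu, forall z : Rx * measurableTypeR R, D z -> `|u z| <= M}.
Hypothesis Eu : (\int[mu]_(z in D)
  ((u z ^+ 2 + (t0 - z.2) * (sqnorm (Nu z) + ut z ^+ 2)) * G z)%:E < +oo)%E.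
Hypothesis Tu : thin_ge0 z0 (-1) t0 u.
Variable A : set R.
Hypothesis aA : {ae lam, forall t : measurableTypeR R, -1 < (t : R) < t0 -> A t}.
Hypothesis acA : forall t1 t2, A t1 -> A t2 -> -1 < t1 -> t1 < t2 -> t2 < t0 ->
  {ae leb R n.+1, forall y, u (unscale z0 (y, t2)) = u (unscale z0 (y, t1)) -
     \int[lam]_(s in `]t1, t2[)
       velocity z0 (fun k => weak_deriv D (basis_vec k, 0) u) ut (unscale z0 (y, s))}.
Variable alpha : R.
Hypothesis signorini : weighted_almost_signorini alpha z0 u.
Variables (tT kappa : R).
Hypotheses (tT1 : -1 < tT) (tTt0 : tT < t0) (kappa0 : 0 < kappa).
Hypothesis good_tT : good z0 u M A tT.

Local Notation f := (slice u tT).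
Local Notation r := (rt z0 tT).
Local Notation v := (uv z0 u).
Local Notation Z := (Zu z0 u).
Local Notation gw := (gweight z0).
Local Notation e := (ev z0 u tT kappa).
Local Notation w := (wv z0 u tT kappa).
Local Notation gradw := (gwv z0 u tT kappa).
Local Notation F2 := (fine (normF z0 u) ^+ 2 * expR (- r^-1)).

Let W12f : W12 (slice G tT) f. Proof. by case: good_tT => _ [g [wf _ _] _] _ _. Qed.
Let mf : measurable_fun setT f.
Proof. by have [wf _] := W12f; have [] := weakly_differentiable_measurable wf. Qed.
Let mgf : measurable_fun setT (weak_grad f).
Proof. by have [wf _] := W12f; have [] := weakly_differentiable_measurable wf. Qed.
Let mNu : measurable_fun setT (Nu : Rx * measurableTypeR R -> Rx).
Proof. by apply: measurable_fun_coord => i; exact: measurable_nabla_coord. Qed.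
Let mS a b : measurable (slab a b : set (Rx * measurableTypeR R)). Proof. exact: measurable_slab. Qed.
Let mD : measurable (D : set (Rx * measurableTypeR R)). Proof. exact: measurable_slab. Qed.

Let k1 (y : Rx) : R := sqnorm (weak_grad f (x0 + r *: y)) * gam y.
Let k0 (y : Rx) : R := f (x0 + r *: y) ^+ 2 * gam y.

Let r0 : 0 < r. Proof. exact: rt_gt0. Qed.

Let ik0 : (leb R n.+1).-integrable setT (EFin \o k0) /\
  (leb R n.+1).-integrable setT (EFin \o k1).
Proof.
have [wf ff] := W12f.
pose h y : R := (f (x0 + r *: y) ^+ 2 + sqnorm (weak_grad f (x0 + r *: y))) * gam y.
have ma := measurable_affine x0 r.
have m0 : measurable_fun setT k0.
  apply: measurable_funM; last exact: measurable_gam.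
  by apply: measurable_funX; exact: (measurable_funT_comp mf ma).
have m1 : measurable_fun setT k1.
  apply: measurable_funM; last exact: measurable_gam.
  exact: (measurable_funT_comp measurable_sqnorm (measurable_funT_comp mgf ma)).
have g0 y : 0 <= gam y :> R by exact: gam_ge0.
have p0 y : 0 <= k0 y by rewrite mulr_ge0 ?sqr_ge0.
have p1 y : 0 <= k1 y by rewrite mulr_ge0 ?sqnorm_ge0.
have ih : (leb R n.+1).-integrable setT (EFin \o (fun y => k0 y + k1 y)).
  apply/integrableP; split; first by apply/measurable_EFinP; exact: measurable_funD.
  apply: le_lt_trans ff; rewrite (slice_heat (f := fun x => f x ^+ 2 + sqnorm (weak_grad f x)) tTt0); first last.
  - by move=> x; rewrite addr_ge0 ?sqr_ge0 ?sqnorm_ge0.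
  - apply: measurable_funD; first exact: measurable_funX.
    exact: (measurable_funT_comp measurable_sqnorm mgf).
  apply: ge0_le_integral_nonmeas => y _; first exact: abse_ge0.
  by rewrite /= lee_fin ger0_norm ?addr_ge0// /k0 /k1 mulrDl.
split; apply: le_integrable ih => //.
- exact/measurable_EFinP.
- by move=> y _; rewrite /= lee_fin !ger0_norm ?addr_ge0// lerDl.
- exact/measurable_EFinP.
- by move=> y _; rewrite /= lee_fin !ger0_norm ?addr_ge0// lerDr.
Qed.

Let cfac2 t : cfac z0 tT kappa t ^+ 2 = decay t0 tT kappa t.
Proof.
rewrite /cfac /decay -powR_mulrn ?powR_ge0// -powRrM; congr (_ `^ _).
by rewrite divfK.
Qed.

Let gwE b p : b <= t0 -> slab tT b p -> gw p = gam p.1.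
Proof.
by move=> bt /andP[_ pb]; rewrite /gweight /past (lt_le_trans pb bt) mulr1.
Qed.

Let itens k : (leb R n.+1).-integrable setT (EFin \o k) ->
  mu.-integrable (slab tT t0) (EFin \o (fun p => decay t0 tT kappa p.2 * k p.1)).
Proof.
move=> ik; have i1 := integrable_tensor_slab tT t0 ik.
have md : measurable_fun (slab tT t0 : set (Rx * measurableTypeR R)) (fun p => decay t0 tT kappa p.2).
  by apply: measurable_funTS; exact: (measurable_funT_comp (measurable_decay t0 tT kappa) measurable_snd).
have bd (p : Rx * measurableTypeR R) : slab tT t0 p -> `|decay t0 tT kappa p.2| <= 1.
  move=> /andP[/ltW p1 p2]; have /andP[d0 d1] := decay_bounds kappa0 p1 p2.
  by rewrite ger0_norm.
have := integrable_bounded_mul (mS tT t0) md bd i1.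
by apply: eq_integrable => // p _; rewrite /comp mulrC.
Qed.

Let gradwE p : slab tT t0 p -> gradw p * gw p = r ^+ 2 * (decay t0 tT kappa p.2 * k1 p.1).
Proof. by move=> sp; rewrite (gwE (lexx _) sp) /gwv exprMn cfac2 /k1; ring. Qed.

Let w2E p : slab tT t0 p -> w p ^+ 2 * gw p = decay t0 tT kappa p.2 * k0 p.1.
Proof. by move=> sp; rewrite (gwE (lexx _) sp) /wv exprMn cfac2 /k0; ring. Qed.

Lemma integrable_gradw : mu.-integrable (slab tT t0) (EFin \o (fun p => gradw p * gw p)).
Proof.
have := integrable_mulrl (r ^+ 2) (mS tT t0) (itens ik0.2).
by apply: eq_integrable => // p; rewrite inE /comp => sp; rewrite gradwE.
Qed.

(** The almost minimality between the radii [rt tT] and [rt b], with the homogeneous competitor,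
    written in similarity coordinates. *)
Lemma comparison_ineq b : tT < b -> b < t0 ->
  \int[mu]_(p in slab tT b) (((1 - r `^ alpha) * sqnorm (gs z0 u p) - Z p * e p) * gw p) <=
  (1 + r `^ alpha) * \int[mu]_(p in slab tT b) (gradw p * gw p) +
  r `^ alpha * \int[mu]_(p in slab tT b) (e p ^+ 2 * gw p) + F2.
Proof.
move=> Tb bt0.
have [_ [g trf g0] _ _] := good_tT.
pose rho := rt z0 b; pose c := competitor z0 tT kappa f.
have rE : t0 - r ^+ 2 = tT by rewrite (rt_sqr (ltW tTt0)); ring.
have rhoE : t0 - rho ^+ 2 = b by rewrite (rt_sqr (ltW bt0)); ring.
have rho0 : 0 <= rho by exact: sqrtr_ge0.
have rhor : rho < r by rewrite /rho /rt ltr_sqrt ?subr_gt0// ltrD2l ltrN2.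
have r1 : r < 1.
  by rewrite -[ltRHS]sqrtr1 /rt ltr_sqrt// ltrBlDr; apply: le_lt_trans t0le _; rewrite -ltrBlDl sub0r.
have mc : measurable_fun setT (c : Rx * measurableTypeR R -> R) by exact: measurable_competitor.
have muD : measurable_fun (D : set (Rx * measurableTypeR R)) u by case: wu => _ [[]].
have SD : slab tT b `<=` (D : set Rxt).
  by move=> p /andP[p1 p2]; rewrite /slab/= (lt_trans tT1 p1) (lt_trans p2 bt0).
have [_ _ _ sig] := signorini.
have tr1 : -1 < t0 - r ^+ 2 by rewrite rE.
have {}sig := sig rho r rho0 rhor r1 tr1 c; cbv zeta in sig; rewrite rE rhoE in sig.
have {sig} := sig (competitor_L2W12 tTt0 bt0 x0thin kappa0 trf g0)
  (competitor_thin_ge0 kappa tTt0 bt0 x0thin trf g0)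
  (difference_admissible x0thin wu Mu Eu Tu tT1 Tb bt0 kappa0 trf g0).
set B := strip r t0 `\` strip rho t0.
have BE : B = [set z : Rx * measurableTypeR R | tT < z.2] `&` [set z : Rx * measurableTypeR R | z.2 <= b].
  apply/seteqP; split=> z; rewrite /B /strip /= rE rhoE.
    move=> [/andP[-> zt]]; rewrite zt andbT => /negP; rewrite -leNgt.
    by [].
  by move=> [-> zb]; rewrite (le_trans zb (ltW bt0)); split=> //; rewrite andbT; apply/negP; rewrite -leNgt.
have mB : measurable (B : set (Rx * measurableTypeR R)).
  rewrite BE; apply: measurableI.
    by apply: (@measurable_ltr _ _ _ (cst tT) snd); [exact: measurable_cst|exact: measurable_snd].
  rewrite (_ : [set z | _] = ~` [set z | b < z.2]); last first.
    by apply/seteqP; split=> z /=; rewrite leNgt => /negP.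
  apply: measurableC; apply: (@measurable_ltr _ _ _ (cst b) snd); first exact: measurable_cst.
  exact: measurable_snd.
have BD : B `<=` (D : set Rxt).
  by move=> z; rewrite BE => -[/= z1 z2]; rewrite /slab/= (lt_trans tT1 z1) (le_lt_trans z2 bt0).
(* [B] is the half-open range of times []tT, b]]; it differs from the slab by the single time [b],
   which is null. *)
have conv (h : Rxt -> R) : measurable_fun (D : set (Rx * measurableTypeR R)) h ->
    \int[mu]_(z in B) (h z * G z) = \int[mu]_(p in slab tT b) (h (unscale z0 p) * gw p).
  move=> mh; have mhS := measurable_funS mD SD mh; rewrite -(Rintegral_slab_heat z0 mhS).
  have mhG : measurable_fun (D : set (Rx * measurableTypeR R)) (fun z => h z * G z).
    by apply: measurable_funM => //; apply: measurable_funTS; exact: measurable_heat_kernel_at.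
  rewrite Rintegral_mkcond [RHS]Rintegral_mkcond; apply: ae_eq_Rintegral => //.
  - exact: (measurable_restrictT _ mB).1 (measurable_funS mD BD mhG).
  - exact: (measurable_restrictT _ (mS tT b)).1 (measurable_funS mD SD mhG).
  apply: filterS (ae_snd (leb R n.+1) (ae_neq b)) => z zb _; rewrite !patchE.
  have -> // : (z \in B) = (z \in (slab tT b : set Rxt)).
  rewrite BE; apply/idP/idP => /set_mem hz; apply/mem_set.
    by case: hz => /= z1 z2; rewrite /slab/= z1 lt_neqAle zb.
  by case/andP: hz => z1 /ltW z2.
have mNu2 : measurable_fun setT ((fun z => sqnorm (Nu z)) : Rx * measurableTypeR R -> R).
  exact: (measurable_funT_comp measurable_sqnorm mNu).
have mtau : measurable_fun setT ((fun z => t0 - z.2) : Rx * measurableTypeR R -> R).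
  by apply: measurable_funB => //; exact: measurable_snd.
have muc : measurable_fun (D : set (Rx * measurableTypeR R)) (fun z => u z - c z).
  by apply: measurable_funB => //; exact: measurable_funTS.
pose Dc := nabla (slab tT b) c.
have mDc : measurable_fun setT (Dc : Rx * measurableTypeR R -> Rx).
  apply: measurable_fun_coord => i; under eq_fun do rewrite mxE.
  apply: weak_deriv_measurable.
  exact: (weak_derivP (competitor_weak_deriv tTt0 bt0 kappa0 trf i)).1.
rewrite (conv (fun z => (1 - r `^ alpha) * (t0 - z.2) * sqnorm (Nu z)
   + (- dotv (z.1 - x0) (Nu z) - 2 * (z.2 - t0) * ut z) * (u z - c z))); last first.
  apply: measurable_funD.
    by apply: measurable_funTS; apply: measurable_funM => //; exact: measurable_funM.
  apply: measurable_funM => //; apply: measurable_funTS; apply: measurable_funB.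
    apply: measurableT_comp => //; apply: measurable_sum => i; apply: measurable_funM.
      under eq_fun do rewrite !mxE; apply: measurable_funB => //.
      exact: (measurable_funT_comp (measurable_coord i) measurable_fst).
    exact: measurable_nabla_coord.
  apply: measurable_funM; last exact: measurable_ut.
  by apply: measurable_funM => //; apply: measurable_funB => //; exact: measurable_snd.
rewrite (conv (fun z => (t0 - z.2) * sqnorm (Dc z))); last first.
  by apply: measurable_funTS; apply: measurable_funM => //; exact: (measurable_funT_comp measurable_sqnorm mDc).
rewrite (conv (fun z => (u z - c z) ^+ 2)); last exact: measurable_funX.
have eE p : slab tT b p -> u (unscale z0 p) - c (unscale z0 p) = e p.
  move=> sp; rewrite /ev uvE; last exact: SD.
  by rewrite wv_unscale//; case/andP: sp => _ pb; exact: lt_trans pb bt0.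
have -> : \int[mu]_(p in slab tT b) ((t0 - (unscale z0 p).2) * sqnorm (Dc (unscale z0 p)) * gw p) =
    \int[mu]_(p in slab tT b) (gradw p * gw p).
  apply: ae_eq_Rintegral => //.
  - apply: measurable_funTS; apply: measurable_funM; last exact: measurable_gweight.
    apply: measurable_funM => //.
    exact: (measurable_funT_comp measurable_sqnorm (measurable_funT_comp mDc (measurable_unscale z0))).
  - apply: measurable_funTS; apply: measurable_funM; last exact: measurable_gweight.
    exact: (measurable_gwv kappa good_tT).
  apply: filterS (ae_unscale z0 (competitor_nabla tTt0 bt0 kappa0 trf)) => p hp sp.
  have pt : (p.2 : R) < t0 by case/andP: sp => _ pb; exact: lt_trans pb bt0.
  by rewrite (gwv_unscale u tT kappa pt) /Dc /c (hp pt sp).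
set I1 := \int[mu]_(p in _) _; set I2 := \int[mu]_(p in _) ((_ - _) ^+ 2 * _) => h.
have -> : \int[mu]_(p in slab tT b) (e p ^+ 2 * gw p) = I2.
  by apply: eq_Rintegral => p; rewrite inE => /eE ->.
apply: le_trans h; rewrite le_eqVlt; apply/orP; left; apply/eqP.
apply: eq_Rintegral => p; rewrite inE => sp; rewrite eE//; congr (_ * _).
have pt : (p.2 : R) < t0 by case/andP: sp => _ pb; exact: lt_trans pb bt0.
rewrite /Zu /gs /st sqnormZ (rt_sqr (ltW pt)) /=.
have -> : dotv (x0 + rt z0 p.2 *: p.1 - x0) (Nu (unscale z0 p)) = dotv p.1 (rt z0 p.2 *: Nu (unscale z0 p)).
  by apply: eq_bigr => i _; rewrite !mxE; ring.
have -> : p.2 - t0 = - rt z0 p.2 ^+ 2 by rewrite (rt_sqr (ltW pt)) opprB.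
by rewrite /unscale; ring.
Qed.

(** [t0 - t] times the Gaussian energy of the slice, so that twice its time integral is the energy
    term of W. *)
Definition dirichlet (t : R) : R := \int[leb R n.+1]_y (sqnorm (gs z0 u (y, t)) * gam y).
Definition height (t : R) : R := \int[leb R n.+1]_y (v (y, t) ^+ 2 * gam y).

Let T := t0 - tT.
Let DI := 2 * \int[lam]_(t in `]tT, t0[) dirichlet t.
Let HI := \int[lam]_(t in `]tT, t0[) height t.
Let E b := \int[mu]_(p in slab tT b) (e p ^+ 2 * gw p).

Let dropgw (h : Rxt -> R) : mu.-integrable (slab tT t0) (EFin \o (fun p => h p * gw p)) ->
  \int[mu]_(p in slab tT t0) (h p * gw p) =
  \int[lam]_(t in `]tT, t0[) \int[leb R n.+1]_y (h (y, t) * gam y).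
Proof.
by move=> ih; exact: (slab_gweight ih).2.
Qed.

(** On a good slice the weak gradient of the slice is the slice of the gradient of [u]; so the
    integrals produced by the competitor are the energy and the height of [u] at time [tT]. *)
Let KE : r ^+ 2 * \int[leb R n.+1]_y k1 y = dirichlet tT /\ \int[leb R n.+1]_y k0 y = height tT.
Proof.
have [_ _ gN _] := good_tT.
have h1 := ae_leb_affine x0 r0 gN.
have ma := measurable_affine x0 r.
split.
  rewrite -(RintegralZl _ measurableT ik0.2); apply: ae_eq_Rintegral => //.
  - apply: measurable_funM => //; apply: measurable_funM; last exact: measurable_gam.
    exact: (measurable_funT_comp measurable_sqnorm (measurable_funT_comp mgf ma)).
  - apply: measurable_funM; last exact: measurable_gam.
    have m1 : measurable_fun setT ((fun y => (y, tT)) : Rx -> Rx * measurableTypeR R) by exact: pair2_measurable.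
    have m2 : measurable_fun setT ((fun p => sqnorm (gs z0 u p)) : Rx * measurableTypeR R -> R).
      exact: measurable_gs2.
    exact: (measurable_funT_comp m2 m1).
  - by apply: filterS h1 => y hy _; rewrite /k1 hy /gs sqnormZ /unscale /=; ring.
apply: eq_Rintegral => y _; rewrite /k0 uvE//.
by rewrite /slab/= tT1.
Qed.

(* [d] is the weighted squared L^2 distance of [u] to the competitor *)
Lemma comparison_key :
  exists d : R, [/\ 0 <= d,
    (1 - r `^ alpha) * DI - kappa * HI + (kappa + 2 - 2 * r `^ alpha) * d
      + kappa * (T / (kappa + 1) * height tT)
    <= (1 + r `^ alpha) * (T / (kappa + 1)) * (2 * dirichlet tT) + 2 * F2 &
    forall theta, 0 < theta -> (1 - theta) * HI - d / theta <= T / (kappa + 1) * height tT].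
Proof.
have TtoE b : b <= t0 -> slab tT b `<=` (slab tT t0 : set Rxt).
  by move=> bt p /andP[p1 p2]; rewrite /slab/= p1 (lt_le_trans p2 bt).
have ie2 := integrable_e2 wu Mu Eu tT1 tTt0 kappa0 good_tT.
have iwe := integrable_we wu Mu Eu tT1 tTt0 kappa0 good_tT.
have iZe := integrable_Ze t0le wu Mu Eu tT1 tTt0 kappa0 good_tT.
have iv2 := integrable_v2 wu Eu tT1.
have ig2 := integrable_gs2 wu Eu tT1.
have iw2 := integrable_w2 wu Eu tT1 tTt0 kappa0 good_tT.
have igw := integrable_gradw.
have HV : \int[mu]_(p in slab tT t0) (v p ^+ 2 * gw p) = HI by exact: dropgw.
have HD : 2 * \int[mu]_(p in slab tT t0) (sqnorm (gs z0 u p) * gw p) = DI by rewrite dropgw.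
have [KD KH] := KE.
have id := integrable_decay tTt0 kappa0.
(* By homogeneity the integrand is a power of [t0 - t] times a function of [y], and the time
   integral of the power is [T / (kappa + 1)]. The gradient below behaves in the same way. *)
have HW : \int[mu]_(p in slab tT t0) (w p ^+ 2 * gw p) = T / (kappa + 1) * height tT.
  rewrite -KH -(decay_integral tTt0 kappa0) -(Rintegral_slab_tensor (itens ik0.1) id ik0.1).
  by apply: eq_Rintegral => p; rewrite inE; exact: w2E.
have HG : \int[mu]_(p in slab tT t0) (gradw p * gw p) = T / (kappa + 1) * dirichlet tT.
  rewrite -KD mulrCA -(decay_integral tTt0 kappa0) -(Rintegral_slab_tensor (itens ik0.2) id ik0.2).
  rewrite -(RintegralZl _ (mS tT t0) (itens ik0.2)).
  by apply: eq_Rintegral => p; rewrite inE; exact: gradwE.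
have S1 b : b <= t0 -> forall h : Rxt -> R, mu.-integrable (slab tT t0) (EFin \o h) ->
    mu.-integrable (slab tT b) (EFin \o h).
  by move=> bt h; apply: integrableS => //; exact: TtoE.
pose q := r `^ alpha.
(* The combination left when [energy_ineq] is added to [comparison_ineq]: the terms [Z * e] cancel.
   It is integrable up to [t0], which permits the limit in [b]. *)
pose X p := (1 - q) * (sqnorm (gs z0 u p) * gw p) + ((1 - q) * (e p ^+ 2 * gw p) +
   ((- kappa) * (w p * e p * gw p) + (- (1 + q)) * (gradw p * gw p))).
have lin b : b <= t0 -> mu.-integrable (slab tT b) (EFin \o X) /\
   \int[mu]_(p in slab tT b) X p =
   (1 - q) * \int[mu]_(p in slab tT b) (sqnorm (gs z0 u p) * gw p) +
   ((1 - q) * E b + ((- kappa) * \int[mu]_(p in slab tT b) (w p * e p * gw p) +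
   (- (1 + q)) * \int[mu]_(p in slab tT b) (gradw p * gw p))).
  move=> bt; have mb := mS tT b.
  have j1 := S1 b bt _ ig2; have j2 := S1 b bt _ ie2; have j3 := S1 b bt _ iwe; have j4 := S1 b bt _ igw.
  have l1 := integrable_mulrl (1 - q) mb j1; have l2 := integrable_mulrl (1 - q) mb j2.
  have l3 := integrable_mulrl (- kappa) mb j3; have l4 := integrable_mulrl (- (1 + q)) mb j4.
  have l34 := integrable_addr mb l3 l4; have l234 := integrable_addr mb l2 l34.
  split; first exact: (integrable_addr mb l1 l234).
  rewrite /X (RintegralD mb l1 l234) (RintegralD mb l2 l34) (RintegralD mb l3 l4).
  by rewrite (RintegralZl _ mb j1) (RintegralZl _ mb j2) (RintegralZl _ mb j3) (RintegralZl _ mb j4).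
have XF : \int[mu]_(p in slab tT t0) X p <= F2.
  apply: (slab_limit tTt0 (lin _ (lexx _)).1) => b Tb bt.
  rewrite (lin b (ltW bt)).2.
  have mb := mS tT b.
  have j1 := S1 b (ltW bt) _ ig2; have j2 := S1 b (ltW bt) _ ie2; have j3 := S1 b (ltW bt) _ iwe.
  have j5 := S1 b (ltW bt) _ iZe.
  have := comparison_ineq Tb bt.
  have := energy_ineq t0le wu Mu Eu aA acA tT1 tTt0 kappa0 good_tT Tb bt.
  have -> : \int[mu]_(p in slab tT b) ((- (Z p * e p) - e p ^+ 2 + kappa * (w p * e p)) * gw p) =
     -1 * \int[mu]_(p in slab tT b) (Z p * e p * gw p) + (-1 * E b +
       kappa * \int[mu]_(p in slab tT b) (w p * e p * gw p)).
    have l1 := integrable_mulrl (-1) mb j5; have l2 := integrable_mulrl (-1) mb j2.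
    have l3 := integrable_mulrl kappa mb j3; have l23 := integrable_addr mb l2 l3.
    rewrite -(RintegralZl _ mb j5) -(RintegralZl _ mb j2) -(RintegralZl _ mb j3).
    rewrite -(RintegralD mb l2 l3) -(RintegralD mb l1 l23).
    by apply: eq_Rintegral => p _; ring.
  have -> : \int[mu]_(p in slab tT b) (((1 - q) * sqnorm (gs z0 u p) - Z p * e p) * gw p) =
     (1 - q) * \int[mu]_(p in slab tT b) (sqnorm (gs z0 u p) * gw p) +
     -1 * \int[mu]_(p in slab tT b) (Z p * e p * gw p).
    have l1 := integrable_mulrl (-1) mb j5; have l2 := integrable_mulrl (1 - q) mb j1.
    rewrite -(RintegralZl _ mb j5) -(RintegralZl _ mb j1) -(RintegralD mb l2 l1).
    by apply: eq_Rintegral => p _; ring.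
  rewrite -/q -/(E b).
  set a1 := \int[mu]_(p in _) (sqnorm _ * _); set a2 := \int[mu]_(p in _) (Z p * _ * _).
  set a3 := \int[mu]_(p in _) (w p * _ * _); set a4 := \int[mu]_(p in _) (gradw p * _).
  by move=> h1 h2; lra.
(* Polarization: [2 w e = v^2 - w^2 - e^2], because [v = w + e]. It turns the mixed term into
   heights and the distance. *)
have WE : \int[mu]_(p in slab tT t0) (w p * e p * gw p) =
    2^-1 * (HI - T / (kappa + 1) * height tT - E t0).
  have mt := mS tT t0.
  rewrite -HV -HW /E; rewrite -(RintegralB mt iv2 iw2).
    have lb' : mu.-integrable (slab tT t0) (EFin \o (fun p => v p ^+ 2 * gw p - w p ^+ 2 * gw p)).
    exact: (integrable_subr mt iv2 iw2).
  rewrite -(RintegralB mt lb' ie2).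
  have lc : mu.-integrable (slab tT t0) (EFin \o (fun p => v p ^+ 2 * gw p - w p ^+ 2 * gw p - e p ^+ 2 * gw p)).
    exact: (integrable_subr mt lb' ie2).
  rewrite -(RintegralZl _ mt lc); apply: eq_Rintegral => p _.
  by rewrite /ev; field.
exists (E t0); split.
- by apply: Rintegral_ge0 => p _; rewrite mulr_ge0 ?sqr_ge0 ?gweight_ge0.
- move: XF; rewrite (lin _ (lexx _)).2 WE HG -HD -/q.
  set a1 := \int[mu]_(p in _) (sqnorm _ * _).
  set Tk := T / (kappa + 1); rewrite -HV.
  set a2 := \int[mu]_(p in _) (v p ^+ 2 * _).
  move: (E t0) (height tT) (dirichlet tT) F2 => d h D0 F h1.
  by nra.
move=> theta th0; have mt := mS tT t0.
have l1 := integrable_mulrl (1 - theta) mt iv2; have l2 := integrable_mulrl (- theta^-1) mt ie2.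
have -> : (1 - theta) * HI - E t0 / theta =
   \int[mu]_(p in slab tT t0) ((1 - theta) * (v p ^+ 2 * gw p) + (- theta^-1) * (e p ^+ 2 * gw p)).
  by rewrite (RintegralD mt l1 l2) (RintegralZl _ mt iv2) (RintegralZl _ mt ie2) HV mulNr [theta^-1 * _]mulrC.
rewrite -HW; apply: le_Rintegral => //; first exact: (integrable_addr mt l1 l2).
move=> p _; rewrite [X in X + _ <= _]mulrA [X in _ + X <= _]mulrA -mulrDl; apply: ler_wpM2r; first exact: gweight_ge0.
have -> : w p = v p - e p by rewrite /ev opprB addrC subrK.
move: (v p) (e p) => V0 e0.
(* Young's inequality with weight [theta] for the cross term of [(v - e)^2]. *)
have := sqr_ge0 (theta * V0 - e0) => h.
have h' : 0 <= theta^-1 * (theta * V0 - e0) ^+ 2 by rewrite mulr_ge0// invr_ge0 ltW.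
have E1 : theta^-1 * (theta * V0 - e0) ^+ 2 = theta * V0 ^+ 2 - 2 * V0 * e0 + theta^-1 * e0 ^+ 2.
  by field; rewrite gt_eqF.
rewrite E1 in h'; have := sqr_ge0 e0; nra.
Qed.

End comparison.

(** * Monotonicity *)

(* For x = r^alpha, y = r^eps, z = r^-delta, ri = r^-1 and D4 = 4 r^2 times the
   energy on the slice, the conclusion is the derivative of W up to a positive
   factor. *)
Lemma monotone_algebra (R : realFieldType)
    (kappa0 kappa eps delta theta x y z ri I H d M E D4 : R) :
  0 < kappa -> kappa < kappa0 -> 0 < eps -> eps < 1 -> delta < 2 ->
  0 <= x -> x <= y -> x <= 1 -> 1 <= z -> 2 + 6 * (kappa0 + 1) <= ri ->
  theta = eps / (4 * (kappa0 + 1)) -> 128 * (kappa0 + 1) / eps * y <= theta / 2 ->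
  0 <= I -> 0 <= H -> 0 <= d -> 0 <= E ->
  (1 - x) * I - kappa * H + (kappa + 2 - 2 * x) * d + kappa * M
    <= (1 + x) * (D4 / (2 * (kappa + 1))) + 2 * E ->
  (1 - theta) * H - d / theta <= M ->
  0 <= (8 * (kappa + 1) * x - 2 * (kappa + 1)) * I + D4
    - kappa * ((8 * (kappa + 1) * x - 2 * (kappa + 1)) * (1 - 128 * (kappa0 + 1) / eps * y)
                - 128 * (kappa0 + 1) * y) * H
    - 2 * kappa * (kappa + 1) * (1 - 128 * (kappa0 + 1) / eps * y) * M
    + (8 * (kappa + 1) * x - 2 * (kappa + 1) + ri - delta) * (E * z).
Proof.
move=> k0 kk e0 e1 d2 x0 xy x1 z1 hri thE hb I0 H0 d0 E0 key hM.
have l0 : 0 < kappa + 1 by lra.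
have K0 : 0 < kappa0 + 1 by lra.
have th0 : 0 < theta by rewrite thE divr_gt0// mulr_gt0.
set b := 128 * (kappa0 + 1) / eps in hb *.
set l := kappa + 1 in l0 key *.
have y0 : 0 <= y := le_trans x0 xy.
have b128 : 128 * (kappa0 + 1) <= b by rewrite /b ler_pdivlMr// ler_piMr ?(ltW e1)// mulr_ge0// ltW.
have by0 : 0 <= b * y by rewrite mulr_ge0// (le_trans _ b128)// mulr_ge0// ltW.
have x10 : 0 < 1 + x by lra.
set s := x / (1 + x).
have sE : s * (1 + x) = x by rewrite divfK// gt_eqF.
have s0 : 0 <= s by rewrite divr_ge0// ltW.
have sx : s <= x by rewrite ler_pdivrMr// ler_peMr// lerDl.
have s12 : s <= 2^-1 by rewrite ler_pdivrMr//; lra.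
(* Up to the factor [2 l kappa], the coefficient of [M] that remains once [D4] is replaced by its
   lower bound. It must be nonnegative in order that the lower bound of [M] can be used. *)
pose c := b * y - s.
have c0 : 0 <= c.
  have h1 : 128 * (kappa0 + 1) * y <= b * y by rewrite ler_wpM2r.
  have h2 : y <= 128 * (kappa0 + 1) * y by rewrite ler_peMl//; lra.
  rewrite /c; lra.
have cb : c <= b * y by rewrite /c lerBlDr lerDl.
(* The choice of [theta] makes [b * theta = 32]. *)
have cth : c * theta <= 32 * y.
  have -> : 32 * y = b * y * theta by rewrite thE /b; field; rewrite !gt_eqF.
  by rewrite ler_wpM2r// ltW.
have cth2 : c / theta <= 2^-1.
  by rewrite ler_pdivrMr// [leRHS]mulrC; exact: le_trans cb _.
(* [1 / (1 + x) = 1 - s] *)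
have h1 : (1 - 2 * s) * I - kappa * (1 - s) * H + (1 - s) * (kappa + 2 - 2 * x) * d
    + kappa * (1 - s) * M - 2 * (1 - s) * E <= D4 / (2 * l).
  have i1 : (1 - s) * (1 + x) = 1 by rewrite mulrBl sE; ring.
  have i2 : (1 - s) * (1 - x) = 1 - 2 * s by rewrite /s; field; rewrite gt_eqF.
  have s1 : 0 <= 1 - s by lra.
  have := ler_wpM2l s1 key.
  have -> : (1 - s) * ((1 + x) * (D4 / (2 * l)) + 2 * E) = D4 / (2 * l) + 2 * (1 - s) * E.
    rewrite mulrDr; congr (_ + _); last by ring.
    by move: (D4 / _) => Q; rewrite mulrA i1 mul1r.
  have -> : (1 - s) * ((1 - x) * I - kappa * H + (kappa + 2 - 2 * x) * d + kappa * M) =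
      (1 - s) * (1 - x) * I - kappa * (1 - s) * H + (1 - s) * (kappa + 2 - 2 * x) * d + kappa * (1 - s) * M.
    by ring.
  by rewrite i2 => h; rewrite lerBlDr.
have h2 : 2 * l * ((1 - 2 * s) * I - kappa * (1 - s) * H + (1 - s) * (kappa + 2 - 2 * x) * d
    + kappa * (1 - s) * M - 2 * (1 - s) * E) <= D4.
  have -> : D4 = 2 * l * (D4 / (2 * l)) by field; rewrite gt_eqF.
  by rewrite ler_wpM2l// mulr_ge0// ltW.
apply: le_trans (_ : 4 * l * (2 * x - s) * I
  + kappa * (- 2 * l * c - 8 * l * x * (1 - b * y) + 128 * (kappa0 + 1) * y) * H
  + 2 * l * (1 - s) * (kappa + 2 - 2 * x) * d + 2 * l * kappa * c * M
  - 4 * l * (1 - s) * E + (8 * l * x - 2 * l + ri - delta) * (E * z) <= _); last first.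
  rewrite -subr_ge0 in h2; rewrite -subr_ge0; rewrite /c.
  by apply: le_trans h2 _; rewrite le_eqVlt; apply/orP; left; apply/eqP; ring.
have g1 : 0 <= 4 * l * (2 * x - s) * I by rewrite mulr_ge0// mulr_ge0 ?mulr_ge0 ?(ltW l0)//; lra.
have lc : 0 <= 2 * l * kappa * c by rewrite !mulr_ge0// ltW.
have g2 : 2 * l * kappa * c * ((1 - theta) * H - d / theta) <= 2 * l * kappa * c * M by rewrite ler_wpM2l.
(* The derivative of [b r^eps] contributes [128 (kappa0 + 1) y] to the height. Of the 128, the
   exponential factor costs at most 8, as [g4] shows, and the loss [theta * H] at most 64. *)
have g3 : 0 <= kappa * (120 * (kappa0 + 1) * y - 2 * l * (c * theta)) * H.
  rewrite mulr_ge0// mulr_ge0 ?(ltW k0)//.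
  have : 2 * l * (c * theta) <= 2 * l * (32 * y) by rewrite ler_wpM2l// mulr_ge0// ltW.
  have : l * y <= (kappa0 + 1) * y by rewrite ler_wpM2r// /l; lra.
  have : 0 <= (kappa0 + 1) * y by rewrite mulr_ge0// ltW.
  lra.
have g4 : kappa * (120 * (kappa0 + 1) * y) * H <=
    kappa * (- 8 * l * x * (1 - b * y) + 128 * (kappa0 + 1) * y) * H.
  rewrite ler_wpM2r// ler_wpM2l ?(ltW k0)//.
  have : l * x * (1 - b * y) <= l * x.
    by rewrite ler_piMr ?mulr_ge0 ?(ltW l0)//; lra.
  have : l * x <= (kappa0 + 1) * y.
    by apply: ler_pM => //; rewrite ?(ltW l0)// /l; lra.
  lra.
(* The distance term of the key inequality has coefficient at least [l kappa] here, which covers the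
   loss [d / theta] since [c / theta <= 1 / 2]. *)
have g5 : 0 <= (2 * l * (1 - s) * (kappa + 2 - 2 * x) - 2 * l * kappa * (c / theta)) * d.
  rewrite mulr_ge0//.
  have : l * kappa * (c / theta) <= l * kappa * 2^-1 by rewrite ler_wpM2l// mulr_ge0// ltW.
  have : l * 2^-1 * kappa <= l * (1 - s) * (kappa + 2 - 2 * x).
    apply: ler_pM => //; rewrite ?mulr_ge0 ?(ltW l0) ?(ltW k0) ?invr_ge0//; last by lra.
    by rewrite ler_wpM2l ?(ltW l0)//; lra.
  lra.
have g6 : 0 <= - 4 * l * (1 - s) * E + (8 * l * x - 2 * l + ri - delta) * (E * z).
  have Ez : E <= E * z by rewrite ler_peMr.
  have Ez0 : 0 <= E * z by exact: le_trans E0 Ez.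
  (* [ri] comes from differentiating [exp (- 1 / r)]. Its threshold covers [delta < 2], the [2 l]
     from the power of [r] and the [4 l] from the error of the almost minimality. *)
  have q1 : 4 * l <= 8 * l * x - 2 * l + ri - delta.
    have : l <= kappa0 + 1 by rewrite /l lerD2r ltW.
    have : 0 <= l * x by rewrite mulr_ge0// ltW.
    lra.
  have q2 : 4 * l * E <= (8 * l * x - 2 * l + ri - delta) * (E * z).
    by apply: ler_pM => //; rewrite mulr_ge0// ltW.
  have : 0 <= l * s * E by rewrite mulr_ge0// mulr_ge0// ltW.
  lra.
have E1 : 2 * l * kappa * c * ((1 - theta) * H - d / theta) =
  2 * l * kappa * c * H - 2 * l * kappa * (c * theta) * H - 2 * l * kappa * (c / theta) * d by ring.
rewrite E1 in g2.
move: g1 g2 g3 g4 g5 g6; move: (c / theta) (c * theta) => ct1 ct2; lra.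
Qed.

Lemma Rintegral_ae_le0 d (T : measurableType d) (R : realType) (mu : {measure set T -> \bar R})
    (D : set T) (f : T -> R) : measurable D -> mu.-integrable D (EFin \o f) ->
  {ae mu, forall t, D t -> f t <= 0} -> \int[mu]_(t in D) f t <= 0.
Proof.
move=> mD intf f0; have iN := integrable_mulrl (-1) mD intf.
rewrite -oppr_ge0 -mulN1r -(RintegralZl (-1) mD intf).
apply: Rintegral_ae_ge0 (measurable_fun_int iN) _ => //.
by apply: filterS f0 => t h Dt; rewrite mulN1r oppr_ge0 h.
Qed.

Section monotone.
Context {R : realType}.
Local Notation lam := (@lebesgue_measure R).
Variables (t0 kappa0 kappa alpha eps delta F2 : R) (Dt ht : R -> R).
Hypotheses (kappa_gt0 : 0 < kappa) (kappaK : kappa < kappa0) (eps0 : 0 < eps)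
  (epsalpha : eps <= alpha) (alpha1 : alpha < 1) (delta0 : 0 < delta) (delta2 : delta < 2)
  (F20 : 0 <= F2).
Local Notation y := (time_pow t0).
Local Notation dlog t := (- (2 * (t0 - t))^-1).
Local Notation a := (8 * (kappa + 1) / alpha).
Local Notation b := (128 * (kappa0 + 1) / eps).

Let P t := expR (a * y alpha t) * y (- (2 * kappa + 2)) t.
Let Q t := kappa * (P t * (1 - b * y eps t)).
Let K t := P t * (F2 * (expR (- 1 * y (-1) t) * y (- delta) t)).

(** W as a function of [t = t0 - r^2], with [y c t] standing for [r^c]; the orientation is reversed,
    so it has to be nonincreasing. [P], [Q] and [K] are the coefficients of the energy and of the
    height and the explicit error term. *)
Definition weiss_time (t : R) : R :=
  P t * (2 * \int[lam]_(s in `]t, t0[) Dt s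
         - kappa * (1 - b * y eps t) * \int[lam]_(s in `]t, t0[) ht s
         + F2 * (expR (- 1 * y (-1) t) * y (- delta) t)).

(** Derivatives in [t]. The common factor [dlog] is the derivative of [ln r], and the cofactors come
    from differentiating in [ln r]; for instance [a r^alpha] gives [8 (kappa + 1) r^alpha]. *)
Let P' t := P t * dlog t * (8 * (kappa + 1) * y alpha t - 2 * (kappa + 1)).
Let Q' t := P t * dlog t * (kappa * ((8 * (kappa + 1) * y alpha t - 2 * (kappa + 1)) * (1 - b * y eps t)
   - 128 * (kappa0 + 1) * y eps t)).
Let K' t := P t * dlog t * ((8 * (kappa + 1) * y alpha t - 2 * (kappa + 1) + y (-1) t - delta) *
   (F2 * expR (- 1 * y (-1) t) * y (- delta) t)).

Let alpha0 : 0 < alpha. Proof. exact: lt_le_trans eps0 epsalpha. Qed.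

Let CP : C1_before t0 P P'.
Proof.
apply: C1_before_eq (C1_beforeM (C1_before_expR (C1_beforeZ a (C1_time_pow alpha)))
  (C1_time_pow (- (2 * kappa + 2)))) => t.
rewrite /P' /P; move: (dlog t) (expR (a * y alpha t)) (y (- (2 * kappa + 2)) t) (y alpha t) => L X Y2 Y1.
by field; rewrite gt_eqF.
Qed.

Let CQ : C1_before t0 Q Q'.
Proof.
have h := C1_beforeD (C1_before_cst (t0 := t0) 1) (C1_beforeZ (- b) (C1_time_pow eps)).
have := C1_beforeZ kappa (C1_beforeM CP h).
have -> : (fun t => kappa * (P t * (cst 1 t + - b * y eps t))) = Q.
  by apply/funext => t; rewrite /Q /= mulNr.
apply: C1_before_eq => t; rewrite /Q' /P' /=; move: (dlog t) (P t) => L p.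
by field; rewrite gt_eqF.
Qed.

Let CK : C1_before t0 K K'.
Proof.
have h := C1_beforeM (C1_before_expR (C1_beforeZ (-1) (C1_time_pow (t0 := t0) (-1)))) (C1_time_pow (- delta)).
apply: C1_before_eq (C1_beforeM CP (C1_beforeZ F2 h)) => t.
rewrite /K' /P' /=; move: (dlog t) (P t) => L p.
by ring.
Qed.

Variables (t1 t2 theta : R).
Hypotheses (t12 : t1 < t2) (t20 : t2 < t0).
Hypotheses (iD : lam.-integrable `]t1, t0[ (EFin \o Dt)) (ih : lam.-integrable `]t1, t0[ (EFin \o ht)).
Hypotheses (D0 : forall t, 0 <= Dt t) (h0 : forall t, 0 <= ht t).
Hypothesis (thetaE : theta = eps / (4 * (kappa0 + 1))).
Hypothesis small : forall t, t1 < t -> t < t2 ->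
  [/\ t0 - t <= 1, 2 + 6 * (kappa0 + 1) <= y (-1) t & b * y eps t <= theta / 2].
Hypothesis key : {ae lam, forall t : measurableTypeR R, t1 < (t : R) -> (t : R) < t2 ->
  exists d : R, [/\ 0 <= d,
    (1 - y alpha t) * (2 * \int[lam]_(s in `](t : R), t0[) Dt s)
      - kappa * \int[lam]_(s in `](t : R), t0[) ht s + (kappa + 2 - 2 * y alpha t) * d
      + kappa * ((t0 - t) / (kappa + 1) * ht t)
    <= (1 + y alpha t) * ((t0 - t) / (kappa + 1)) * (2 * Dt t) + 2 * (F2 * expR (- 1 * y (-1) t)) &
    forall theta, 0 < theta -> (1 - theta) * \int[lam]_(s in `](t : R), t0[) ht s - d / theta
      <= (t0 - t) / (kappa + 1) * ht t]}.

Let tailE (f : R -> R) : lam.-integrable `]t1, t0[ (EFin \o f) -> forall t, t \in `[t1, t2] ->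
  \int[lam]_(s in `]t, t0[) f s = \int[lam]_(s in `]t1, t0[) f s + \int[lam]_(s in `]t1, t[) (-1 * f s).
Proof.
move=> intf t; rewrite in_itv/= => /andP[t1t tt2]; have tt := le_lt_trans tt2 t20.
have i1 : lam.-integrable `]t1, t[ (EFin \o f).
  by apply: integrableS intf => // s; rewrite /= !in_itv/= => /andP[-> /lt_trans]; exact.
rewrite RintegralZl// mulN1r (@Rintegral_itv_bndo_bndc R (BRight t1) t)//.
by rewrite (@Rintegral_itvB R f (BRight t1) (BLeft t0) t)// bnd_simp.
Qed.

(** The product rule in integrated form writes the difference of the two values as the integral of
    [S]. The sign of [S] is known for almost every time, from [monotone_algebra] applied to the key
    inequality. *)
Lemma weiss_time_le : weiss_time t2 <= weiss_time t1.
Proof.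
have alg (p q k a1 a2 a3 : R) : 2 * a1 + (-1 * a2 + a3) <= 0 ->
    2 * (p + a1) - (q + a2) + (k + a3) <= 2 * p - q + k by lra.
have iN (f : R -> R) c : lam.-integrable `]t1, t0[ (EFin \o f) ->
    lam.-integrable `]t1, t2[ (EFin \o (fun s : R => c * f s)).
  move=> intf; apply: integrable_mulrl; first exact: measurable_itv.
  by apply: integrableS intf => // s; rewrite /= !in_itv/= => /andP[-> /lt_trans]; exact.
pose I1 := \int[lam]_(s in `]t1, t0[) Dt s; pose H1 := \int[lam]_(s in `]t1, t0[) ht s.
have [iP PE] := C1_before_ac t12 t20 CP.
have [iQ QE] := C1_before_ac t12 t20 CQ.
have [iK KE] := C1_before_ac t12 t20 CK.
have l12 := ltW t12.
have [j1 e1] := @ac_mul R t1 t2 (P t1) I1 P' (fun s => -1 * Dt s) l12 iP (iN Dt (-1) iD).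
have [j2 e2] := @ac_mul R t1 t2 (Q t1) H1 Q' (fun s => -1 * ht s) l12 iQ (iN ht (-1) ih).
pose If t := \int[lam]_(s in `]t, t0[) Dt s; pose Hf t := \int[lam]_(s in `]t, t0[) ht s.
have Icc t : t1 < t < t2 -> t \in `[t1, t2] by rewrite in_itv/= => /andP[/ltW -> /ltW ->].
have m12 : measurable (`]t1, t2[%classic : set (measurableTypeR R)) by exact: measurable_itv.
pose G1 t := P' t * If t + P t * (-1 * Dt t).
pose G2 t := Q' t * Hf t + Q t * (-1 * ht t).
have j1' : lam.-integrable `]t1, t2[ (EFin \o G1).
  apply: eq_integrable j1 => // t; rewrite inE/= in_itv/= => /Icc tI.
  by rewrite /G1 /If (tailE iD tI) (PE t tI).
have j2' : lam.-integrable `]t1, t2[ (EFin \o G2).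
  apply: eq_integrable j2 => // t; rewrite inE/= in_itv/= => /Icc tI.
  by rewrite /G2 /Hf (tailE ih tI) (QE t tI).
have t2I : t2 \in `[t1, t2] by rewrite in_itv/= lexx l12.
have t1I : t1 \in `[t1, t2] by rewrite in_itv/= lexx l12.
have E1 : P t2 * If t2 = P t1 * I1 + \int[lam]_(t in `]t1, t2[) G1 t.
  rewrite /If (tailE iD t2I) (PE t2 t2I) e1; congr (_ + _); apply: eq_Rintegral => t.
  by rewrite inE/= in_itv/= => /Icc tI; rewrite /G1 /If (tailE iD tI) (PE t tI).
have E2 : Q t2 * Hf t2 = Q t1 * H1 + \int[lam]_(t in `]t1, t2[) G2 t.
  rewrite /Hf (tailE ih t2I) (QE t2 t2I) e2; congr (_ + _); apply: eq_Rintegral => t.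
  by rewrite inE/= in_itv/= => /Icc tI; rewrite /G2 /Hf (tailE ih tI) (QE t tI).
have WE t : weiss_time t = 2 * (P t * If t) - Q t * Hf t + K t.
  by rewrite /weiss_time /Q /K -/(If t) -/(Hf t); ring.
pose S t := 2 * G1 t + (-1 * G2 t + K' t).
have k1 := @integrable_mulrl _ (measurableTypeR R) R lam _ 2 G1 m12 j1'.
have k2 := @integrable_mulrl _ (measurableTypeR R) R lam _ (-1) G2 m12 j2'.
have k3 := @integrable_addr _ (measurableTypeR R) R lam _ _ K' m12 k2 iK.
have iS := @integrable_addr _ (measurableTypeR R) R lam _ _ _ m12 k1 k3.
have SE : \int[lam]_(t in `]t1, t2[) S t = 2 * \int[lam]_(t in `]t1, t2[) G1 t +
    (-1 * \int[lam]_(t in `]t1, t2[) G2 t + \int[lam]_(t in `]t1, t2[) K' t).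
  rewrite /S (@RintegralD _ (measurableTypeR R) R lam _ _ _ m12 k1 k3).
  rewrite (@RintegralD _ (measurableTypeR R) R lam _ _ _ m12 k2 iK).
  by rewrite (@RintegralZl _ (measurableTypeR R) R lam _ _ 2 m12 j1') (@RintegralZl _ (measurableTypeR R) R lam _ _ (-1) m12 j2').
suff S0 : \int[lam]_(t in `]t1, t2[) S t <= 0.
  rewrite !WE E1 E2 (KE t2 t2I) -/(If t1) -/(Hf t1) /If /Hf.
  by apply: alg; rewrite -SE.
apply: Rintegral_ae_le0 => //; apply: filterS key => t hk; rewrite /= in_itv/= => /andP[Tt tt].
have [d [d0 key1 key2]] := hk Tt tt.
have [tau1 hri hb] := small Tt tt.
have t0t : 0 < t0 - t by rewrite subr_gt0 (lt_trans tt).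
have hl : half_log t0 t <= 0 by rewrite /half_log pmulr_lle0// ln_le0.
have y0 c : 0 <= y c t by exact: expR_ge0.
have yle c c' : c <= c' -> y c' t <= y c t.
  by move=> cc; rewrite ler_expR ler_wnM2r.
have y01 : y 0 t = 1 by rewrite /time_pow mul0r expR0.
have I0 : 0 <= If t by exact: Rintegral_ge0.
have H0 : 0 <= Hf t by exact: Rintegral_ge0.
have k10 : 0 < kappa + 1 by rewrite addr_gt0.
have th0 : 0 < theta.
  rewrite thetaE divr_gt0// mulr_gt0// addr_gt0//; exact: lt_trans kappaK.
have E0 : 0 <= F2 * expR (- 1 * y (-1) t) by rewrite mulr_ge0// expR_ge0.
have I20 : 0 <= 2 * If t by rewrite mulr_ge0.
have ax : y alpha t <= 1 by rewrite -y01; apply: yle; exact: ltW.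
have zx : 1 <= y (- delta) t by rewrite -y01; apply: yle; rewrite oppr_le0 ltW.
have key1' : (1 - y alpha t) * (2 * If t) - kappa * Hf t + (kappa + 2 - 2 * y alpha t) * d
      + kappa * ((t0 - t) / (kappa + 1) * ht t)
    <= (1 + y alpha t) * (4 * (t0 - t) * Dt t / (2 * (kappa + 1))) + 2 * (F2 * expR (- 1 * y (-1) t)).
  apply: le_trans key1 _; rewrite lerD2r le_eqVlt; apply/orP; left; apply/eqP.
  by field; rewrite gt_eqF.
have := monotone_algebra kappa_gt0 kappaK eps0 (le_lt_trans epsalpha alpha1) delta2 (y0 alpha)
  (yle _ _ epsalpha) ax zx hri thetaE hb I20 H0 d0 E0 key1' (key2 theta th0).
set B := (X in 0 <= X) => hB.
(* The minus sign is that of [dlog]: as [t] increases, [r] decreases. *)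
have -> : S t = - ((2 * (t0 - t))^-1 * P t * B).
  by rewrite /S /G1 /G2 /P' /Q' /K' /B /Q; field; rewrite !gt_eqF// mulr_gt0.
rewrite oppr_le0; apply: mulr_ge0 => //; apply: mulr_ge0; first by rewrite invr_ge0 mulr_ge0// ltW.
by rewrite mulr_ge0// expR_ge0.
Qed.

End monotone.

(** * The functional in the time variable *)

Section weiss_functional.
Context {R : realType} {n : nat}.
Local Notation lam := (@lebesgue_measure R).
Local Notation Rx := 'rV[R]_n.+1.
Local Notation Rxt := (Rx * R)%type.
Local Notation mu := (leb R n.+1 \x @lebesgue_measure R)%E.
Variables (z0 : Rxt) (u : Rxt -> R).
Local Notation t0 := z0.2.
Local Notation D := (slab (-1) t0).
Local Notation G := (heat_kernel_at z0).
Local Notation Nu := (nabla D u).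
Local Notation ut := (partial_t D u).

Lemma normF_fin : (normF z0 u < +oo)%E ->
  (\int[mu]_(z in D) ((u z ^+ 2 + (t0 - z.2) * (sqnorm (Nu z) + ut z ^+ 2)) * G z)%:E < +oo)%E /\
  exists M, {ae mu, forall z : Rx * measurableTypeR R, D z -> `|u z| <= M}.
Proof.
rewrite /normF; cbv zeta.
set X := (\int[mu]_(z in D) _)%E; set Y := (\int[mu]_(z in _ `&` _) _)%E.
set N := ('N[_]_+oo[_])%E => fin.
have Y0 := poweR_ge0 Y 2^-1; have X0 := poweR_ge0 X 2^-1.
have N0 : (0 <= N)%E by exact: Lnorm_ge0.
have fX : (X `^ 2^-1 < +oo)%E.
  by apply: le_lt_trans fin; rewrite -addeA leeDl// adde_ge0.
have fN : (N < +oo)%E by apply: le_lt_trans fin; rewrite leeDr// adde_ge0.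
split; first by apply: lty_poweRy fX; rewrite invr_eq0 pnatr_eq0.
move: fN; rewrite /N unlock /=; case: ifPn => [_ h|].
  have [M hM] := @ess_sup_inf.ess_supr_bounded _ _ R mu (fun z => `|(u \_ D) z|) h.
  by exists M; apply: filterS hM => z + Dz; rewrite patchE mem_set.
(* On a space of measure zero the supremum norm is 0 by convention; every property then holds almost
   everywhere. *)
rewrite -leNgt => m0 _; exists 0; exists setT; split=> //.
by apply/eqP; rewrite eq_le m0 measure_ge0.
Qed.

Hypothesis t0le : t0 <= 0.
Hypothesis wu : W11_differentiable D u.
Hypothesis Eu : (\int[mu]_(z in D)
  ((u z ^+ 2 + (t0 - z.2) * (sqnorm (Nu z) + ut z ^+ 2)) * G z)%:E < +oo)%E.

Lemma integrable_dirichlet a : -1 < a -> lam.-integrable `]a, t0[ (EFin \o dirichlet z0 u).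
Proof. by move=> a1; exact: (slab_gweight (integrable_gs2 wu Eu a1)).1. Qed.

Lemma integrable_height a : -1 < a -> lam.-integrable `]a, t0[ (EFin \o height z0 u).
Proof. by move=> a1; exact: (slab_gweight (integrable_v2 wu Eu a1)).1. Qed.

Lemma weissE (kappa0 kappa alpha eps delta r : R) : 0 < r -> -1 < t0 - r ^+ 2 ->
  weiss kappa0 kappa alpha eps delta r u z0 =
  weiss_time t0 kappa0 kappa alpha eps delta (fine (normF z0 u) ^+ 2)
    (dirichlet z0 u) (height z0 u) (t0 - r ^+ 2).
Proof.
move=> r0 t1; set t := t0 - r ^+ 2.
have tt : t < t0 by rewrite ltrBlDr ltrDl exprn_gt0.
have yE c : time_pow t0 c t = r `^ c.
  by rewrite time_powE// /t opprB addrC subrK sqrtr_sqr ger0_norm// ltW.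
rewrite /weiss /weiss_time !yE powR_inv1 ?(ltW r0)// mulN1r -powRN; congr (_ * _).
rewrite [in RHS]mulrA; congr (_ + _).
set c := 1 - _.
have mS : measurable (slab t t0 : set (Rx * measurableTypeR R)) by exact: measurable_slab.
have i1 := integrable_gs2 wu Eu t1; have i2 := integrable_v2 wu Eu t1.
have l1 := integrable_mulrl 2 mS i1; have l2 := integrable_mulrl (- (kappa * c)) mS i2.
have -> : 2 * \int[lam]_(s in `]t, t0[) dirichlet z0 u s - kappa * c * \int[lam]_(s in `]t, t0[) height z0 u s =
    \int[mu]_(p in slab t t0) (2 * (sqnorm (gs z0 u p) * gweight z0 p) +
      - (kappa * c) * (uv z0 u p ^+ 2 * gweight z0 p)).
  rewrite (RintegralD mS l1 l2) (RintegralZl _ mS i1) (RintegralZl _ mS i2).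
  by rewrite (slab_gweight i1).2 (slab_gweight i2).2 mulNr.
have sub : slab t t0 `<=` (D : set Rxt).
  by move=> p /andP[p1 p2]; rewrite /slab/= (lt_trans t1 p1) p2.
have mh : measurable_fun (slab t t0 : set (Rx * measurableTypeR R))
    (fun z => 2 * (t0 - z.2) * sqnorm (Nu z) - kappa * c * u z ^+ 2).
  apply: measurable_funB.
    apply: measurable_funTS; apply: measurable_funM.
      by apply: measurable_funM => //; apply: measurable_funB => //; exact: measurable_snd.
    apply: (measurable_funT_comp measurable_sqnorm); apply: measurable_fun_coord => i.
    exact: measurable_nabla_coord.
  apply: measurable_funM => //; apply: measurable_funX.
  apply: (measurable_funS _ sub); first exact: measurable_slab.
  by case: wu => _ [[]].
transitivity (\int[mu]_(z in slab t t0) ((2 * (t0 - z.2) * sqnorm (Nu z) - kappa * c * u z ^+ 2) * G z)).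
  rewrite Rintegral_mkcond [RHS]Rintegral_mkcond; apply: eq_Rintegral => z _; rewrite !patchE.
  (* The strip contains the time [t0] and the slab does not; there the heat kernel is 0 by
     convention. *)
  have [zt|zt] := eqVneq z.2 t0; last first.
    have -> // : (z \in (strip r t0 : set Rxt)) = (z \in (slab t t0 : set Rxt)).
    apply/idP/idP => /set_mem /andP[z1 z2]; apply/mem_set; rewrite /strip /slab/= z1/= ?(ltW z2)//.
    by rewrite lt_neqAle zt.
  have -> : G z = 0 by rewrite /heat_kernel_at /heat_kernel /= zt subrr ltxx.
  by rewrite !mulr0; case: ifP; case: ifP.
rewrite (Rintegral_slab_heat z0 mh); apply: eq_Rintegral => p; rewrite inE => sp.
have pt : (p.2 : R) < t0 by case/andP: sp.
rewrite uvE; last exact: sub.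
rewrite /gs sqnormZ (rt_sqr (ltW pt)) /unscale /=; ring.
Qed.

End weiss_functional.

(* The dimension of space is n + 1. *)
Theorem theorem1 (R : realType) (kappa0 eps : R) (hkappa0 : 2 < kappa0)
    (heps : 0 < eps) :
  exists2 r0 : R, 0 < r0 &
  forall (n : nat) (hn : (2 <= n.+1)%N) (delta alpha : R)
    (u : 'rV[R]_n.+1 * R -> R) (z0 : 'rV[R]_n.+1 * R),
  0 < delta -> delta < 2 -> eps <= alpha -> alpha < 1 ->
  thin_values_trace z0 u ->
  free_boundary u z0 -> (cylinder (1 / 2) 0 `&` thin_space) z0 ->
  weighted_almost_signorini alpha z0 u ->
  forall kappa : R, 0 < kappa -> kappa < kappa0 ->
  forall r s : R, 0 < r -> r <= s -> s < r0 ->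
    weiss kappa0 kappa alpha eps delta r u z0
    <= weiss kappa0 kappa alpha eps delta s u z0.
Proof.
have K0 : 0 < kappa0 + 1 by rewrite addr_gt0// (lt_trans _ hkappa0).
pose theta : R := eps / (4 * (kappa0 + 1)).
pose b : R := 128 * (kappa0 + 1) / eps.
have th0 : 0 < theta by rewrite divr_gt0// mulr_gt0.
have b0 : 0 < b by rewrite divr_gt0// mulr_gt0.
pose q : R := theta / 2 / b; have q0 : 0 < q by rewrite divr_gt0// divr_gt0.
have k0 : 0 < 2 + 6 * (kappa0 + 1) by rewrite addr_gt0// mulr_gt0.
(* The bound 1/2 keeps the strips after time -1, since [t0 > -1/4]. The second bound makes [1 / r]
   at least [2 + 6 (kappa0 + 1)], and the third is [b r^eps <= theta / 2]. None of them involves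
   [kappa], [alpha], [delta] or the dimension. *)
exists (Num.min (1 / 2) (Num.min (2 + 6 * (kappa0 + 1))^-1 (q `^ eps^-1))).
  by rewrite !lt_min divr_gt0//= invr_gt0 k0 powR_gt0.
move=> n _ delta alpha u z0 d0 d2 ea a1 _ _ [[_ /andP[t0gt t0le]] x0thin] sig kappa kp kK r s r0 rs.
rewrite !lt_min => /and3P[s12 sK sq].
move: rs; rewrite le_eqVlt => /predU1P[->//|rs].
have s0 := lt_trans r0 rs.
have x0 : z0.1 ord0 ord_max = 0 := x0thin.
have t0le' : z0.2 <= 0 := t0le.
have t0gt' : - 4^-1 < z0.2.
  by apply: le_lt_trans t0gt; rewrite /= sub0r lerN2; lra.
have t01 : -1 < z0.2 by apply: lt_trans t0gt'; lra.
have r2s2 : r ^+ 2 < s ^+ 2 by rewrite ltr_pXn2r// nnegrE ltW.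
have s4 : s ^+ 2 < 4^-1.
  have : s ^+ 2 < (1 / 2) ^+ 2 by rewrite ltr_pXn2r// nnegrE ?ltW.
  by move=> h; apply: lt_le_trans h _; rewrite expr2; lra.
have ts : -1 < z0.2 - s ^+ 2 by lra.
have tr : -1 < z0.2 - r ^+ 2 by lra.
have [_ [wu nF] Tu _] := sig.
have [Eu [M Mu]] := normF_fin nF.
have [A aA acA] := material_ac t01 wu.1 wu.2.
have good := ae_good wu Mu Tu aA.
rewrite !weissE//.
have t20 : z0.2 - r ^+ 2 < z0.2 by rewrite ltrBlDr ltrDl exprn_gt0.
have t12 : z0.2 - s ^+ 2 < z0.2 - r ^+ 2 by rewrite ltrD2l ltrN2.
have rtE t : z0.2 - s ^+ 2 < t -> t < z0.2 -> 0 < rt z0 t < s.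
  move=> st tt; rewrite rt_gt0//= -[ltRHS]ger0_norm ?(ltW s0)// -sqrtr_sqr /rt ltr_sqrt ?exprn_gt0//.
  by rewrite ltrBlDr -ltrBlDl.
apply: (@weiss_time_le R z0.2 kappa0 kappa alpha eps delta (fine (normF z0 u) ^+ 2)
  (dirichlet z0 u) (height z0 u) kp kK heps ea a1 d0 d2 (sqr_ge0 _) _ _ theta t12 t20) => //.
- exact: integrable_dirichlet.
- exact: integrable_height.
- move=> t; apply: Rintegral_ge0 => y _; rewrite mulr_ge0 ?sqnorm_ge0//; exact: gam_ge0.
- move=> t; apply: Rintegral_ge0 => y _; rewrite mulr_ge0 ?sqr_ge0//; exact: gam_ge0.
- move=> t st tt'; have tt := lt_trans tt' t20.
  have /andP[rho0 rhos] := rtE t st tt.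
  have tp : 0 < z0.2 - t by rewrite subr_gt0.
  rewrite !time_powE// -/(rt z0 t) powR_inv1 ?(ltW rho0)//; split.
  + rewrite lerBlDr; apply: le_trans t0le' _; rewrite -lerBlDl sub0r.
    exact: ltW (lt_trans ts st).
  + rewrite -[leLHS]invrK lef_pV2 ?posrE ?invr_gt0//.
    exact: ltW (lt_trans rhos sK).
  + rewrite mulrC -ler_pdivlMr// -/b -/q.
    have -> : q = (q `^ eps^-1) `^ eps by rewrite -powRrM mulVf ?gt_eqF// powRr1// ltW.
    by apply: ge0_ler_powR; rewrite ?nnegrE ?powR_ge0 ?(ltW heps) ?(ltW rho0)// (ltW (lt_trans rhos sq)).
- apply: filterS good => t gt st tt'; have tt := lt_trans tt' t20.
  have /andP[rho0 rhos] := rtE t st tt; have t1 := lt_trans ts st.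
  have gt' : Defs.slab (-1) z0.2 ((0 : 'rV[R]_n.+1), (t : R)) by rewrite /slab/= t1 tt.
  have := comparison_key t0le' x0 wu Mu Eu Tu aA acA sig t1 tt kp (gt gt').
  by rewrite !time_powE// -/(rt z0 t) powR_inv1 ?(ltW rho0)// mulN1r.
Qed.
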